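(* Let $\mathbb{k}$ be a field and let $R$ be a commutative $\mathbb{k}$-algebra essentially of finite type over $\mathbb{k}$. Assume that $R$ has no embedded associated primes, and let $R_{\rm red} = R/\sqrt{0}$. Then there exist a set of Noetherian operators $\delta_1,\ldots,\delta_m \in \mathrm{Diff}_{R/\mathbb{k}}(R, R_{\rm red})$ for $R$ and an integer $c \ge 0$ such that $$ \overline{I^{n+c}} :_{R_{\rm red}} \{\delta_1,\ldots,\delta_m\} \;\subseteq\; J^n $$ for any ideal $J$ in $R$ with image $I$ in $R_{\rm red}$ and any integer $n \ge 0$, where $\overline{I^{n+c}}$ denotes the integral closure of the ideal $I^{n+c}$ in $R_{\rm red}$ (the operators $\delta_i$ and the constant $c$ are independent of $J$ and $n$).
   Context: Differential operators: for a $\mathbb{k}$-algebra $R$ and $R$-modules $M,N$, define inductively $\mathrm{Diff}^0_{R/\mathbb{k}}(M,N) = \mathrm{Hom}_R(M,N)$ and, for $n\ge 1$, $\mathrm{Diff}^n_{R/\mathbb{k}}(M,N) = \{\delta \in \mathrm{Hom}_{\mathbb{k}}(M,N) \mid [\delta,f] \in \mathrm{Diff}^{n-1}_{R/\mathbb{k}}(M,N) \text{ for all } f\in R\}$, where $[\delta,f](m) = \delta(fm) - f\delta(m)$. Set $\mathrm{Diff}_{R/\mathbb{k}}(M,N) = \bigcup_{n\ge 0}\mathrm{Diff}^n_{R/\mathbb{k}}(M,N)$. A finite set $\delta_1,\ldots,\delta_m \in \mathrm{Diff}_{R/\mathbb{k}}(R,R_{\rm red})$ is a set of Noetherian operators for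 $R$ if $\{f\in R \mid \delta_i(f)=0 \text{ for all } 1\le i\le m\} = (0)$. For an ideal $I\subset R_{\rm red}$ and $\delta_1,\ldots,\delta_m \in \mathrm{Diff}_{R/\mathbb{k}}(R,R_{\rm red})$, set $I :_{R_{\rm red}} \{\delta_1,\ldots,\delta_m\} = \{f\in R \mid \delta_i(f)\in I \text{ for all } 1\le i\le m\}$ (a subset of $R$). *)

(* Defs.v *)
From HB Require Import structures.
From mathcomp Require Import all_boot all_algebra.
From mathcomp Require Import boolp classical_sets.

Set Implicit Arguments.
Unset Strict Implicit.
Unset Printing Implicit Defensive.

Import GRing.Theory.
Local Open Scope ring_scope.
Local Open Scope classical_set_scope.
Local Open Scope quotient_scope.

(* Rings are [comPzRingType]s, so that the zero ring is allowed. As MathComp's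
   algebra structures are non-trivial, a commutative k-algebra is a
   [comPzRingType] R with its structure morphism [{rmorphism k -> R}]. *)

Section Ideals.
Variable R : comPzRingType.

Definition is_ideal (I : set R) : Prop :=
  [/\ I 0, (forall x y, I x -> I y -> I (x + y))
     & (forall a x, I x -> I (a * x))].

Definition is_prime_ideal (P : set R) : Prop :=
  [/\ is_ideal P, ~ P 1 & (forall x y, P (x * y) -> P x \/ P y)].

Definition ideal_mul (I J : set R) : set R :=
  [set x | exists s : seq (R * R),
     (forall p, p \in s -> I p.1 /\ J p.2) /\ x = \sum_(p <- s) p.1 * p.2].

Fixpoint ideal_pow (I : set R) (n : nat) : set R :=
  if n is n'.+1 then ideal_mul I (ideal_pow I n') else setT.

Definition integral_closure (I : set R) : set R :=
  [set x | exists (m : nat) (a : nat -> R),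
     [/\ (0 < m)%N, (forall i, (1 <= i <= m)%N -> ideal_pow I i (a i))
        & x ^+ m + \sum_(1 <= i < m.+1) a i * x ^+ (m - i) = 0]].

Definition annihilator (x : R) : set R := [set a | a * x = 0].

Definition associated_prime (P : set R) : Prop :=
  is_prime_ideal P /\ exists x : R, P = annihilator x.

Definition embedded_prime (P : set R) : Prop :=
  associated_prime P /\ exists Q, associated_prime Q /\ Q `<` P.

Definition no_embedded_primes : Prop := forall P, ~ embedded_prime P.

End Ideals.

Section EssentiallyFiniteType.

Definition subalgebra (k : fieldType) (A : comPzRingType)
    (algA : {rmorphism k -> A}) (S : set A) : Prop :=
  [/\ (forall c, S (algA c)), (forall x y, S x -> S y -> S (x + y))
     & (forall x y, S x -> S y -> S (x * y))].

Definition finite_type (k : fieldType) (A : comPzRingType)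
    (algA : {rmorphism k -> A}) : Prop :=
  exists gens : seq A, forall S : set A, subalgebra algA S ->
    (forall x, x \in gens -> S x) -> S = setT.

Definition mul_closed (A : comPzRingType) (W : set A) : Prop :=
  W 1 /\ forall x y, W x -> W y -> W (x * y).

(* f exhibits B as the localization of A at the multiplicative set W. *)
Definition is_localization (A B : comPzRingType) (W : set A)
    (f : {rmorphism A -> B}) : Prop :=
  [/\ (forall w, W w -> exists u, u * f w = 1),
      (forall b, exists a w, W w /\ b * f w = f a)
    & (forall a, f a = 0 -> exists w, W w /\ w * a = 0)].

Definition ess_finite_type (k : fieldType) (R : comPzRingType)
    (alg : {rmorphism k -> R}) : Prop :=
  exists (A : comPzRingType) (algA : {rmorphism k -> A})
         (f : {rmorphism A -> R}) (W : set A),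
    [/\ finite_type algA, (forall c, f (algA c) = alg c),
        mul_closed W & is_localization W f].

End EssentiallyFiniteType.

Section Nilradical.
Variable R : comPzRingType.

(* A boolean predicate, as required by the quotient construction. *)
Definition nilradical : pred R := fun x => `[< exists n : nat, x ^+ n = 0 >].

Lemma nilradicalP x : reflect (exists n : nat, x ^+ n = 0) (x \in nilradical).
Proof. exact: asboolP. Qed.

Lemma nilradicalM a x : x \in nilradical -> a * x \in nilradical.
Proof.
move=> /nilradicalP[n xn0]; apply/nilradicalP; exists n.
by rewrite exprMn xn0 mulr0.
Qed.

Fact nilradical_zmod_closed : zmod_closed nilradical.
Proof.
split=> [|x y /nilradicalP[n xn0] /(nilradicalM (-1))].
  by apply/nilradicalP; exists 1%N.
rewrite mulN1r => /nilradicalP[m ym0]; apply/nilradicalP; exists (n + m)%N.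
rewrite exprDn big1 // => i _; have [le_im|lt_mi] := leqP i m.
  by rewrite -addnBA // exprD xn0 !mul0r mul0rn.
by rewrite -(subnK (ltnW lt_mi)) [_ ^+ (_ + m)]exprD ym0 !mulr0 mul0rn.
Qed.

HB.instance Definition _ := GRing.isZmodClosed.Build R nilradical
  nilradical_zmod_closed.

Definition nilradical_zmod : zmodClosed R := GRing.ZmodClosed.clone R nilradical _.

(* The library puts a ring structure on quotients by proper ideals only, hence
   the ring structure below on the additive quotient. *)
Definition Rred : Type := Quotient.quot nilradical_zmod.

HB.instance Definition _ := GRing.Zmodule.on Rred.

Definition red (x : R) : Rred := \pi_(Quotient.quot nilradical_zmod) x.

Lemma redP x y : reflect (red x = red y) (x - y \in nilradical).
Proof. by rewrite Quotient.idealrBE; exact: eqP. Qed.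

Lemma red_surj (u : Rred) : exists x, red x = u.
Proof. by exists (repr u); exact: reprK. Qed.

Fact red_is_zmod_morphism : zmod_morphism red.
Proof. exact: pi_is_zmod_morphism. Qed.

HB.instance Definition _ := GRing.isZmodMorphism.Build R Rred red
  red_is_zmod_morphism.

Definition red_mul (u v : Rred) : Rred := red (repr u * repr v).

Lemma red_mulE x y : red_mul (red x) (red y) = red (x * y).
Proof.
apply/redP; set x' := repr _; set y' := repr _.
have nx : x' - x \in nilradical by apply/redP; exact: reprK.
have ny : y' - y \in nilradical by apply/redP; exact: reprK.
have -> : x' * y' - x * y = y' * (x' - x) + x * (y' - y).
  by rewrite !mulrBr ![y' * _]mulrC addrA subrK.
by apply: rpredD; apply: nilradicalM.
Qed.

Fact red_mulA : associative red_mul.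
Proof.
move=> u v w; have [[[x <-] [y <-]] [z <-]] := (red_surj u, red_surj v, red_surj w).
by rewrite !red_mulE mulrA.
Qed.

Fact red_mulC : commutative red_mul.
Proof. by move=> u v; rewrite /red_mul mulrC. Qed.

Fact red_mul1 : left_id (red 1) red_mul.
Proof. by move=> u; have [x <-] := red_surj u; rewrite red_mulE mul1r. Qed.

Fact red_mulDl : left_distributive red_mul +%R.
Proof.
move=> u v w; have [[[x <-] [y <-]] [z <-]] := (red_surj u, red_surj v, red_surj w).
by rewrite -raddfD !red_mulE mulrDl raddfD.
Qed.

HB.instance Definition _ := GRing.Zmodule_isComPzRing.Build Rred
  red_mulA red_mulC red_mul1 red_mulDl.

Fact red_is_monoid_morphism : monoid_morphism red.
Proof. by split=> // x y; rewrite -red_mulE. Qed.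

HB.instance Definition _ := GRing.isMonoidMorphism.Build R Rred red
  red_is_monoid_morphism.

Definition red_scale (a : R) (u : Rred) : Rred := red a * u.

Fact red_scaleA a b u : red_scale a (red_scale b u) = red_scale (a * b) u.
Proof. by rewrite /red_scale rmorphM mulrA. Qed.

Fact red_scale1 : left_id 1 red_scale.
Proof. by move=> u; rewrite /red_scale rmorph1 mul1r. Qed.

Fact red_scaleDr : right_distributive red_scale +%R.
Proof. by move=> a u v; rewrite /red_scale mulrDr. Qed.

Fact red_scaleDl u : {morph red_scale^~ u : a b / a + b}.
Proof. by move=> a b; rewrite /red_scale rmorphD mulrDl. Qed.

HB.instance Definition _ := GRing.Zmodule_isLmodule.Build R Rred
  red_scaleA red_scale1 red_scaleDr red_scaleDl.

End Nilradical.

Section DifferentialOperators.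
Variables (k : fieldType) (R : comPzRingType) (alg : {rmorphism k -> R}).
Variables M N : lmodType R.

(* R-modules are k-vector spaces by restriction of scalars along [alg]. *)
Definition k_linear (d : M -> N) : Prop :=
  forall (c : k) (x y : M), d (alg c *: x + y) = alg c *: d x + d y.

Definition commutator (d : M -> N) (f : R) : M -> N :=
  fun m => d (f *: m) - f *: d m.

Fixpoint Diff_order (n : nat) (d : M -> N) : Prop :=
  if n is n'.+1 then
    k_linear d /\ forall f : R, Diff_order n' (commutator d f)
  else linear d.

Definition Diff : set (M -> N) := [set d | exists n : nat, Diff_order n d].

End DifferentialOperators.

Section NoetherianOperators.
Variables (k : fieldType) (R : comPzRingType) (alg : {rmorphism k -> R}).

(* [R^o] is R as a module over itself. *)
Definition noetherian_operators (m : nat) (d : 'I_m -> R^o -> Rred R) : Prop :=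
  (forall i, Diff alg (d i)) /\
  [set f : R | forall i, d i f = 0] = [set 0].

Definition colon_ops (I : set (Rred R)) (m : nat) (d : 'I_m -> R^o -> Rred R) :
    set R :=
  [set f : R | forall i, I (d i f)].

End NoetherianOperators.

(* Main.v *)
(* For an associated (hence minimal) prime P of R, the ring R_P is Artinian local with residue
   field Frac(R/P). For a power q of the characteristic (q = 1 in characteristic 0) the q-th powers
   of R/P lie, after inverting elements, in the image of a tower E of separable monic extensions of
   a polynomial ring, and Hensel's lemma lifts E -> Frac(R/P) to E -> R_P. The coordinates of R in
   the finite E-module generated by R in R_P are differential operators R -> R/P, because x^q minus
   the lift of its residue is nilpotent in R_P for every x in R. By Lipman-Sathaye, the Jacobian
   multiplier of E satisfies a uniform Briancon-Skoda property; it shows that if all coordinates of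
   f lie in the integral closure of the (n+c)-th power of the image of J, then B f lies in J^n for a
   fixed B outside P. The multipliers B at the finitely many associated primes combine to a
   nonzerodivisor, which is cancelled by a uniform Artin-Rees argument. *)

Require Import Defs.
From HB Require Import structures.
From mathcomp Require Import all_boot all_algebra.
From mathcomp Require Import ring zify.
From mathcomp Require Import mpoly.
From mathcomp Require Import boolp classical_sets.
From mathcomp Require functions.

Set Implicit Arguments.
Unset Strict Implicit.
Unset Printing Implicit Defensive.

Import GRing.Theory.
Local Open Scope ring_scope.
Local Open Scope classical_set_scope.

(** * Ideals and their powers *)

(** The constants may depend on neither J nor n, and this shapes the proof. For the Briancon-Skoda
    property uniformity comes from the extended Rees algebra R[tau, J/tau]: up to integral
    dependence J may be replaced by as many elements as there are free variables, tau included, and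
    each of them adds a relation with derivative tau. The trace argument needs finiteness over a
    polynomial ring, which holds only after a generic linear change of the free variables, and this
    change alters the Jacobian. The determinant is therefore kept polynomial in the change and
    specialised to the trivial change by interpolation. Interpolation needs an infinite field; the
    Artin-Rees argument needs a tower with q = 1, hence a perfect one. The operators, however, must
    be linear over [k] and take values in the reduction of [R]. So they are built over [k] itself,
    with q > 1 allowed, while the two statements about ideals are proved after base change and
    brought back by a linear retraction. *)

Section SetIdeals.
Variable R : comPzRingType.
Implicit Types (I J K N : set R) (x y a b : R).

Lemma ideal0 I : is_ideal I -> I 0. Proof. by case. Qed.
Lemma idealD I x y : is_ideal I -> I x -> I y -> I (x + y).
Proof. by case=> _ h _; apply: h. Qed.
Lemma idealM I a x : is_ideal I -> I x -> I (a * x).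
Proof. by case=> _ _; apply. Qed.
Lemma idealMl I a x : is_ideal I -> I x -> I (x * a).
Proof. by move=> hI Ix; rewrite mulrC; apply: idealM. Qed.
Lemma idealN I x : is_ideal I -> I x -> I (- x).
Proof. by move=> hI Ix; rewrite -mulN1r; apply: idealM. Qed.
Lemma idealB I x y : is_ideal I -> I x -> I y -> I (x - y).
Proof. by move=> hI Ix Iy; apply: idealD => //; apply: idealN. Qed.
Lemma ideal_sum I (T : Type) (r : seq T) (P : pred T) (F : T -> R) :
  is_ideal I -> (forall i, P i -> I (F i)) -> I (\sum_(i <- r | P i) F i).
Proof.
move=> hI h; apply: big_ind => //; first exact: ideal0.
by move=> x y; apply: idealD.
Qed.

Lemma ideal_setT : is_ideal [set: R]. Proof. by split. Qed.
Lemma ideal_set0 : is_ideal [set (0 : R)].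
Proof. by split=> // [x y -> ->|a x ->]; rewrite ?addr0 ?mulr0. Qed.

Lemma mem_mul I J x y : I x -> J y -> ideal_mul I J (x * y).
Proof.
move=> Ix Jy; exists [:: (x, y)]; split; last by rewrite big_seq1.
by move=> p; rewrite inE => /eqP ->.
Qed.

Lemma mul_ind I J K : K 0 -> (forall u v, K u -> K v -> K (u + v)) ->
  (forall u v, I u -> J v -> K (u * v)) -> forall x, ideal_mul I J x -> K x.
Proof.
move=> K0 KD KM x [s [hs ->]]; rewrite big_seq; apply: big_ind => //.
by move=> p /hs[]; apply: KM.
Qed.

Lemma mul0 I J : ideal_mul I J 0.
Proof. by exists [::]; split=> //; rewrite big_nil. Qed.
Lemma mulD I J x y : ideal_mul I J x -> ideal_mul I J y -> ideal_mul I J (x + y).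
Proof.
move=> [s [hs ->]] [t [ht ->]]; exists (s ++ t); split; last by rewrite big_cat.
by move=> p; rewrite mem_cat => /orP[/hs|/ht].
Qed.

Lemma ideal_mul_ideal I J : is_ideal J -> is_ideal (ideal_mul I J).
Proof.
move=> hJ; split; [exact: mul0|exact: mulD|].
move=> a; apply: mul_ind => [|u v|u v Iu Jv]; first by rewrite mulr0; apply: mul0.
  by rewrite mulrDr; apply: mulD.
by rewrite mulrCA; apply: mem_mul => //; apply: idealM.
Qed.

Lemma mul_sub I J I' J' : I `<=` I' -> J `<=` J' ->
  ideal_mul I J `<=` ideal_mul I' J'.
Proof.
move=> h1 h2; apply: mul_ind; [exact: mul0|exact: mulD|].
by move=> u v /h1 ? /h2; apply: mem_mul.
Qed.

Lemma mul_subr I J : is_ideal J -> ideal_mul I J `<=` J.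
Proof.
move=> hJ; apply: mul_ind; [exact: ideal0|by move=> *; apply: idealD|].
by move=> *; apply: idealM.
Qed.
Lemma mul_subl I J : is_ideal I -> ideal_mul I J `<=` I.
Proof.
move=> hJ; apply: mul_ind; [exact: ideal0|by move=> *; apply: idealD|].
by move=> *; apply: idealMl.
Qed.

Lemma pow_ideal I n : is_ideal (ideal_pow I n).
Proof. by elim: n => [|n IH]; [exact: ideal_setT|exact: ideal_mul_ideal]. Qed.

Lemma pow0r I n : ideal_pow I n 0. Proof. by apply: ideal0; apply: pow_ideal. Qed.
Lemma powDr I n x y : ideal_pow I n x -> ideal_pow I n y -> ideal_pow I n (x + y).
Proof. by move=> *; apply: idealD => //; apply: pow_ideal. Qed.

(** A power is defined by nested sums of products. This principle flattens them: a property stable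
    under sums has to be checked only on a ring element times a product of n members of [I]. *)
Lemma pow_ind I n K : K 0 -> (forall u v, K u -> K v -> K (u + v)) ->
  (forall a (s : seq R), size s = n -> (forall y, y \in s -> I y) ->
     K (a * \prod_(y <- s) y)) ->
  forall x, ideal_pow I n x -> K x.
Proof.
move=> K0 KD; elim: n K K0 KD => [|n IH] K K0 KD h /=.
  by move=> x _; have := h x [::] erefl; rewrite big_nil mulr1; apply.
apply: mul_ind => // u v Iu; move: v; apply: (IH (fun v => K (u * v))).
- by rewrite mulr0.
- by move=> v w; rewrite mulrDr; apply: KD.
move=> a s ss hs; have := h a (u :: s); rewrite big_cons /= ss mulrCA.
by apply=> // y; rewrite inE => /orP[/eqP ->|/hs].
Qed.

Lemma mem_pow I (s : seq R) a : (forall y, y \in s -> I y) ->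
  ideal_pow I (size s) (a * \prod_(y <- s) y).
Proof.
elim: s => //= y s IH h; rewrite big_cons mulrCA; apply: mem_mul.
  by apply: h; rewrite mem_head.
by apply: IH => z zs; apply: h; rewrite inE zs orbT.
Qed.

Lemma powD I m n x y : ideal_pow I m x -> ideal_pow I n y ->
  ideal_pow I (m + n) (x * y).
Proof.
move=> hx; move: y; apply: pow_ind => [|u v|b t st ht].
- by rewrite mulr0; apply: pow0r.
- by rewrite mulrDr; apply: powDr.
move: x hx; apply: pow_ind => [|u v|a s ss hs].
- by rewrite mul0r; apply: pow0r.
- by rewrite mulrDl; apply: powDr.
rewrite mulrACA -big_cat -ss -st -size_cat; apply: mem_pow => z.
by rewrite mem_cat => /orP[/hs|/ht].
Qed.

Lemma powE I m n x : ideal_pow I m x -> ideal_pow I (m * n) (x ^+ n).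
Proof.
move=> hx; elim: n => [|n IH]; first by rewrite muln0.
by rewrite exprS mulnS; apply: powD.
Qed.

Lemma pow1 I x : I x -> ideal_pow I 1 x.
Proof. by move=> Ix; rewrite -[x]mulr1; apply: mem_mul. Qed.

Lemma pow1E I x : is_ideal I -> ideal_pow I 1 x -> I x.
Proof. by move=> hI; apply: mul_subl. Qed.

Lemma powS I n : ideal_pow I n.+1 `<=` ideal_pow I n.
Proof. by apply: mul_subr; apply: pow_ideal. Qed.

Lemma pow_le I m n : (m <= n)%N -> ideal_pow I n `<=` ideal_pow I m.
Proof.
move=> /subnK <-; elim: (n - m)%N => [|d IH] x //.
by rewrite addSn => /powS/IH.
Qed.

Lemma pow_sub I J n : I `<=` J -> ideal_pow I n `<=` ideal_pow J n.
Proof. by move=> h; elim: n => //= n IH; apply: mul_sub. Qed.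

Lemma powM I m n x : ideal_pow (ideal_pow I m) n x -> ideal_pow I (m * n) x.
Proof.
elim: n x => [|n IH] /=; first by rewrite muln0.
apply: mul_ind.
- exact: pow0r.
- exact: powDr.
by move=> u v hu /IH; rewrite mulnS; apply: powD.
Qed.

(** Coefficients are functions on [nat], read below the size only, so that families can be shifted
    and extended without casts. *)
Definition span (s : seq R) : set R :=
  [set x | exists c : nat -> R, x = \sum_(i < size s) c i * s`_i].

Lemma span_ideal s : is_ideal (span s).
Proof.
split.
- by exists (fun=> 0); rewrite big1 // => i _; rewrite mul0r.
- move=> x y [c ->] [d ->]; exists (fun i => c i + d i).
  by rewrite -big_split; apply: eq_bigr => i _; rewrite mulrDl.
- move=> a x [c ->]; exists (fun i => a * c i).
  by rewrite mulr_sumr; apply: eq_bigr => i _; rewrite mulrA.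
Qed.

Lemma mem_span s x : x \in s -> span s x.
Proof.
move=> xs; exists (fun i => (i == index x s)%:R).
have hi : (index x s < size s)%N by rewrite index_mem.
rewrite (bigD1 (Ordinal hi)) //= eqxx mul1r nth_index // big1 ?addr0 // => i.
by rewrite -val_eqE /= => /negPf ->; rewrite mul0r.
Qed.

Lemma span_sub s I : is_ideal I -> (forall x, x \in s -> I x) -> span s `<=` I.
Proof.
move=> hI h x [c ->]; apply: ideal_sum => // i _.
by apply: idealM => //; apply/h/mem_nth.
Qed.

Lemma subset_eq I J : I `<=` J -> J `<=` I -> I = J.
Proof. by move=> h1 h2; rewrite eqEsubset. Qed.

End SetIdeals.

Lemma image_pow (R S : comPzRingType) (f : {rmorphism R -> S}) (I : set R) n :
  forall x, ideal_pow I n x -> ideal_pow (f @` I) n (f x).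
Proof.
elim: n => //= n IH; apply: mul_ind => [|u v|u v Iu Jv].
- by rewrite rmorph0; apply: mul0.
- by rewrite rmorphD; apply: mulD.
by rewrite rmorphM; apply: mem_mul; [exists u|exact: IH].
Qed.

Lemma morph_pow (R S : comPzRingType) (f : {rmorphism R -> S}) (I : set R)
    (J : set S) n :
  (forall x, I x -> J (f x)) ->
  forall x, ideal_pow I n x -> ideal_pow J n (f x).
Proof.
move=> h x /(@image_pow _ _ f); apply: pow_sub => y [z Iz <-]; exact: h.
Qed.

Lemma lift_pow (R S : comPzRingType) (f : {rmorphism R -> S}) (I : set R)
    (J : set S) n :
  (forall y, exists x, f x = y) -> (forall y, J y -> exists2 x, I x & f x = y) ->
  forall y, ideal_pow J n y -> exists2 x, ideal_pow I n x & f x = y.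
Proof.
move=> sf h; elim: n => [|n IH] /=; first by move=> y; have [x <-] := sf y; exists x.
apply: mul_ind => [|u v [x hx <-] [z hz <-]|u v /h[x Ix <-] /IH[z hz <-]].
- by exists 0; [exact: mul0|rewrite rmorph0].
- by exists (x + z); [exact: mulD|rewrite rmorphD].
- by exists (x * z); [exact: mem_mul|rewrite rmorphM].
Qed.

Lemma preim_ideal (R S : comPzRingType) (f : {rmorphism R -> S}) (I : set S) :
  is_ideal I -> is_ideal (f @^-1` I).
Proof.
move=> hI; split=> /= [|x y|a x]; rewrite /preimage /= ?rmorph0 ?rmorphD ?rmorphM.
- exact: ideal0.
- exact: idealD.
- exact: idealM.
Qed.

(** * Quotients and localizations *)

Local Open Scope quotient_scope.

Section QuotientRing.
Variables (R : comNzRingType) (I : set R) (hI : is_ideal I) (hI1 : ~ I 1).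

(** The proofs are arguments so that the instance of a proper ideal can be declared for this
    predicate. *)
Definition ideal_pred of is_ideal I & ~ I 1 : pred R := fun x => `[< I x >].

Fact ideal_predP : idealr_closed (ideal_pred hI hI1).
Proof.
split; first by apply/asboolP; apply: ideal0.
  by apply/asboolP.
move=> a u v /asboolP Iu /asboolP Iv; apply/asboolP.
by apply: idealD => //; apply: idealM.
Qed.

HB.instance Definition _ := isIdealr.Build R (ideal_pred hI hI1) ideal_predP.

Definition ideal_idealr : idealr R := Idealr.clone R (ideal_pred hI hI1) _.

Lemma quot_ex : exists (Q : comNzRingType) (p : {rmorphism R -> Q}),
  (forall q, exists r, p r = q) /\ (forall r, p r = 0 <-> I r).
Proof.
exists (Quotient.quot ideal_idealr).
exists (\pi_(Quotient.quot ideal_idealr)).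
split=> [q|r]; first by exists (repr q); exact: reprK.
have -> : (\pi_(Quotient.quot ideal_idealr) r = 0) <->
    (r - 0 \in (ideal_idealr : pred R)).
  rewrite Quotient.idealrBE; split=> [|/eqP] h.
    by apply/eqP; rewrite h rmorph0.
  by rewrite h rmorph0.
rewrite subr0; split=> [/asboolP //|h]; exact/asboolP.
Qed.
End QuotientRing.

Lemma factor_surj (R Q B : comPzRingType) (p : {rmorphism R -> Q})
    (f : {rmorphism R -> B}) :
  (forall q, exists r, p r = q) -> (forall r, p r = 0 -> f r = 0) ->
  exists g : {rmorphism Q -> B}, forall r, g (p r) = f r.
Proof.
move=> sp kp; have [s hs] := choice sp.
have gE r : f (s (p r)) = f r.
  by apply/eqP; rewrite -subr_eq0 -rmorphB kp // rmorphB /= hs subrr.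
pose g q := f (s q).
have gB : zmod_morphism g.
  by move=> x y; rewrite -[x]hs -[y]hs -rmorphB /g !gE rmorphB.
have gM : monoid_morphism g.
  split; first by rewrite /g -(rmorph1 p) gE rmorph1.
  by move=> x y; rewrite -[x]hs -[y]hs -rmorphM /g !gE rmorphM.
pose G : {rmorphism Q -> B} := HB.pack g
  (GRing.isZmodMorphism.Build _ _ g gB) (GRing.isMonoidMorphism.Build _ _ g gM).
by exists G => r; exact: gE.
Qed.

Section Localization.
Variables (A : comNzRingType) (W : set A).
Hypotheses (hW : mul_closed W) (hW0 : ~ W 0).

(** Fractions are represented by all pairs of elements of [A]: a second component outside [W] is
    read as the denominator 1, which avoids a subtype of pairs. *)
Definition loc_den (x : A * A) : A := if `[< W x.2 >] then x.2 else 1.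
Lemma loc_denW x : W (loc_den x).
Proof. by rewrite /loc_den; case: asboolP => // _; case: hW. Qed.
Lemma loc_denE a w : W w -> loc_den (a, w) = w.
Proof. by rewrite /loc_den => h; rewrite asboolT. Qed.

Definition loc_eq (x y : A * A) : bool :=
  `[< exists2 w, W w & w * (x.1 * loc_den y - y.1 * loc_den x) = 0 >].

Lemma loc_eq_equiv : equiv_class_of loc_eq.
Proof.
split=> [x|x y|y x z].
- by apply/asboolP; exists 1; [case: hW|rewrite subrr mulr0].
- by apply/asboolP/asboolP => -[w Ww h]; exists w => //;
    apply/eqP; rewrite -oppr_eq0 -mulrN opprB h.
- move=> /asboolP[w Ww h] /asboolP[v Wv k]; apply/asboolP.
  exists (w * v * loc_den y); first by case: hW => _ M; apply: (M); [exact: M|exact: loc_denW].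
  transitivity (v * loc_den z * (w * (x.1 * loc_den y - y.1 * loc_den x))
    + w * loc_den x * (v * (y.1 * loc_den z - z.1 * loc_den y))); first by ring.
  by rewrite h k !mulr0 addr0.
Qed.

Canonical loc_equivR := EquivRelPack loc_eq_equiv.
Definition Loc of mul_closed W & ~ W 0 := {eq_quot loc_eq}.
Notation L := (Loc hW hW0).
HB.instance Definition _ := Choice.on L.
HB.instance Definition _ := EqQuotient.on L.

Definition lfrac (a w : A) : L := \pi_L (a, w).

Lemma lfracP a w b v : W w -> W v ->
  lfrac a w = lfrac b v <-> exists2 u, W u & u * (a * v - b * w) = 0.
Proof.
move=> Ww Wv; split=> [/eqP|[u Wu h]].
  by rewrite /lfrac eqmodE => /asboolP[u Wu]; rewrite !loc_denE //=; exists u.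
apply/eqP; rewrite /lfrac eqmodE; apply/asboolP; exists u => //=.
by rewrite !loc_denE.
Qed.

Lemma lfracW (x : L) : exists a w, W w /\ x = lfrac a w.
Proof.
exists (repr x).1, (loc_den (repr x)); split; first exact: loc_denW.
apply/eqP; rewrite -[x in x == _]reprK /lfrac eqmodE; apply/asboolP.
exists 1; first by case: hW.
by rewrite /= loc_denE ?subrr ?mulr0 //; exact: loc_denW.
Qed.

Let num (x : L) := (repr x).1.
Let den (x : L) := loc_den (repr x).
Let denW x : W (den x). Proof. exact: loc_denW. Qed.
Let numdenE x : x = lfrac (num x) (den x).
Proof.
apply/eqP; rewrite -[x in x == _]reprK /lfrac eqmodE; apply/asboolP.
by exists 1; [case: hW|rewrite /= loc_denE ?subrr ?mulr0 //; exact: denW].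
Qed.
Let WM u v : W u -> W v -> W (u * v). Proof. by case: hW => _; apply. Qed.
Let W1 : W 1. Proof. by case: hW. Qed.

Hint Resolve WM denW W1 : core.

Let fr_in a w b v u : W w -> W v -> W u -> u * (a * v - b * w) = 0 ->
  lfrac a w = lfrac b v.
Proof. by move=> Ww Wv Wu h; apply: (lfracP _ _ Ww Wv).2; exists u. Qed.

Definition loc_add (x y : L) := lfrac (num x * den y + num y * den x) (den x * den y).
Definition loc_opp (x : L) := lfrac (- num x) (den x).
Definition loc_mul (x y : L) := lfrac (num x * num y) (den x * den y).

Lemma loc_addE a w b v : W w -> W v ->
  loc_add (lfrac a w) (lfrac b v) = lfrac (a * v + b * w) (w * v).
Proof.
move=> Ww Wv; rewrite /loc_add.
have [u Wu hu] := (lfracP _ _ Ww (denW _)).1 (numdenE (lfrac a w)).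
have [t Wt ht] := (lfracP _ _ Wv (denW _)).1 (numdenE (lfrac b v)).
set n1 := num _ in hu *; set d1 := den _ in hu *.
set n2 := num _ in ht *; set d2 := den _ in ht *.
have [Wd1 Wd2] : W d1 /\ W d2 by split; exact: denW.
apply: (@fr_in _ _ _ _ (u * t)); do ?exact: WM.
transitivity (- (t * d2 * v) * (u * (a * d1 - n1 * w)) - (u * d1 * w) * (t * (b * d2 - n2 * v))); first by ring.
by rewrite hu ht !mulr0 subr0.
Qed.

Lemma loc_mulE a w b v : W w -> W v ->
  loc_mul (lfrac a w) (lfrac b v) = lfrac (a * b) (w * v).
Proof.
move=> Ww Wv; rewrite /loc_mul.
have [u Wu hu] := (lfracP _ _ Ww (denW _)).1 (numdenE (lfrac a w)).
have [t Wt ht] := (lfracP _ _ Wv (denW _)).1 (numdenE (lfrac b v)).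
set n1 := num _ in hu *; set d1 := den _ in hu *.
set n2 := num _ in ht *; set d2 := den _ in ht *.
have [Wd1 Wd2] : W d1 /\ W d2 by split; exact: denW.
apply: (@fr_in _ _ _ _ (u * t)); do ?exact: WM.
transitivity (- (t * b * d2) * (u * (a * d1 - n1 * w)) - (u * n1 * w) * (t * (b * d2 - n2 * v))); first by ring.
by rewrite hu ht !mulr0 subr0.
Qed.

Lemma loc_oppE a w : W w -> loc_opp (lfrac a w) = lfrac (- a) w.
Proof.
move=> Ww; rewrite /loc_opp.
have [u Wu hu] := (lfracP _ _ Ww (denW _)).1 (numdenE (lfrac a w)).
apply: (@fr_in _ _ _ _ u) => //.
by move: hu; rewrite !mulNr opprK addrC => ->.
Qed.

Let fr_eq a w b v : W w -> W v -> a * v = b * w -> lfrac a w = lfrac b v.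
Proof. by move=> Ww Wv h; apply: (@fr_in _ _ _ _ 1) => //; rewrite h subrr mulr0. Qed.

Ltac fr x := have [? [? [? ->]]] := lfracW x.

Fact loc_addA : associative loc_add.
Proof.
move=> x y z; fr x; fr y; fr z; rewrite !loc_addE //; try exact: WM.
by apply: fr_eq; [do ?apply: WM|do ?apply: WM|ring].
Qed.
Fact loc_addC : commutative loc_add.
Proof.
move=> x y; fr x; fr y; rewrite !loc_addE //.
by apply: fr_eq; [do ?apply: WM|do ?apply: WM|ring].
Qed.
Fact loc_add0 : left_id (lfrac 0 1) loc_add.
Proof.
move=> x; fr x; rewrite !loc_addE //.
by apply: fr_eq; [do ?apply: WM|do ?apply: WM|ring].
Qed.
Fact loc_addN : left_inverse (lfrac 0 1) loc_opp loc_add.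
Proof.
move=> x; fr x; rewrite loc_oppE // !loc_addE //.
by apply: fr_eq; [do ?apply: WM|done|ring].
Qed.
HB.instance Definition _ := GRing.isZmodule.Build L loc_addA loc_addC loc_add0 loc_addN.
Fact loc_mulA : associative loc_mul.
Proof.
move=> x y z; fr x; fr y; fr z; rewrite !loc_mulE //; try exact: WM.
by apply: fr_eq; [do ?apply: WM|do ?apply: WM|ring].
Qed.
Fact loc_mulC : commutative loc_mul.
Proof.
move=> x y; fr x; fr y; rewrite !loc_mulE //.
by apply: fr_eq; [do ?apply: WM|do ?apply: WM|ring].
Qed.
Fact loc_mul1 : left_id (lfrac 1 1) loc_mul.
Proof.
move=> x; fr x; rewrite !loc_mulE //.
by apply: fr_eq; [do ?apply: WM|done|ring].
Qed.
Fact loc_mulDl : left_distributive loc_mul loc_add.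
Proof.
move=> x y z; fr x; fr y; fr z.
rewrite !(loc_mulE, loc_addE) //; try exact: WM.
by apply: fr_eq; [do ?apply: WM|do ?apply: WM|ring].
Qed.
Fact loc_1n0 : (lfrac 1 1 : L) != 0.
Proof.
apply/eqP => /(lfracP _ _ W1 W1)[u Wu]; rewrite !mulr1 subr0 mulr1 => u0.
by apply: hW0; rewrite -u0.
Qed.
HB.instance Definition _ := GRing.Zmodule_isComNzRing.Build L
  loc_mulA loc_mulC loc_mul1 loc_mulDl loc_1n0.

Definition to_loc (a : A) : L := lfrac a 1.
Fact to_loc_zmod : zmod_morphism to_loc.
Proof.
move=> x y; rewrite /to_loc; change (lfrac (x - y) 1 = loc_add (lfrac x 1) (loc_opp (lfrac y 1))).
by rewrite loc_oppE // loc_addE //; apply: fr_eq; [|exact: WM|ring].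
Qed.
Fact to_loc_mon : monoid_morphism to_loc.
Proof.
split=> // x y; change (lfrac (x * y) 1 = loc_mul (lfrac x 1) (lfrac y 1)).
by rewrite loc_mulE // mulr1.
Qed.
HB.instance Definition _ := GRing.isZmodMorphism.Build A L to_loc to_loc_zmod.
HB.instance Definition _ := GRing.isMonoidMorphism.Build A L to_loc to_loc_mon.

Lemma loc_ex : exists (B : comNzRingType) (f : {rmorphism A -> B}),
  is_localization W f.
Proof.
exists L, to_loc; split=> [w Ww|b|a].
- exists (lfrac 1 w); change (loc_mul (lfrac 1 w) (lfrac w 1) = lfrac 1 1).
  by rewrite loc_mulE //; apply: fr_eq; [exact: WM| |ring].
- have [a [w [Ww ->]]] := lfracW b; exists a, w; split=> //.
  change (loc_mul (lfrac a w) (lfrac w 1) = lfrac a 1).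
  by rewrite loc_mulE //; apply: fr_eq; [exact: WM| |ring].
- move=> /(lfracP _ _ W1 W1)[u Wu]; rewrite mul0r subr0 mulr1; by exists u.
Qed.

End Localization.

(** * Noetherian rings *)

Definition noetherian (R : comPzRingType) :=
  forall I : set R, is_ideal I -> exists s : seq R, I = span s.

Section NoetherianRings.
Variable R : comPzRingType.

Lemma seq_max_index (T : eqType) (s : seq T) (P : nat -> T -> Prop) :
  (forall x, x \in s -> exists n, P n x) ->
  (forall m n x, (m <= n)%N -> P m x -> P n x) ->
  exists n, forall x, x \in s -> P n x.
Proof.
move=> h mono; elim: s h => [|y s IH] h; first by exists 0%N.
have [n hn] := IH (fun x xs => h x (@mem_behead _ (y :: s) _ xs)).
have [m hm] := h y (mem_head _ _); exists (maxn m n) => x.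
rewrite inE => /orP[/eqP ->|/hn h']; first by apply: (mono m) => //; apply: leq_maxl.
by apply: (mono n) => //; apply: leq_maxr.
Qed.

(** A counterexample would start, by dependent choice, a strictly increasing chain of ideals; the
    union of the chain is finitely generated, so the chain is constant from some index on. *)
Lemma noeth_ind (P : set R -> Prop) : noetherian R ->
  (forall I, is_ideal I ->
     (forall J, is_ideal J -> I `<=` J -> I <> J -> P J) -> P I) ->
  forall I, is_ideal I -> P I.
Proof.
move=> nR step I0 hI0; apply: contrapT => nP0.
pose bad := {I : set R | is_ideal I /\ ~ P I}.
have nxt : forall I : bad, exists J : bad, sval I `<=` sval J /\ sval I <> sval J.
  move=> [I [hI nP]]; apply: contrapT => hn; apply: (nP); apply: step => // J hJ IJ nIJ.
  by apply: contrapT => nPJ; apply: hn; exists (exist _ J (conj hJ nPJ)).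
have [f hf] := choice nxt.
pose c n := iter n f (exist _ I0 (conj hI0 nP0) : bad).
have cS n : sval (c n) `<=` sval (c n.+1) by exact: (hf (c n)).1.
have cle m n : (m <= n)%N -> sval (c m) `<=` sval (c n).
  move=> /subnK <-; elim: (n - m)%N => [|d IH] x //.
  by rewrite addSn => /IH; apply: cS.
pose U := [set x | exists n, sval (c n) x].
have hU : is_ideal U.
  split=> [|x y [m hx] [n hy]|a x [n hx]].
  - by exists 0%N; apply: ideal0; exact: (svalP (c 0%N)).1.
  - exists (maxn m n); apply: idealD; first exact: (svalP (c _)).1.
      by apply: cle hx; apply: leq_maxl.
    by apply: cle hy; apply: leq_maxr.
  - by exists n; apply: idealM => //; exact: (svalP (c _)).1.
have [s sE] := nR U hU.
have [|m n x mn|n hn] := @seq_max_index R s (fun n x => sval (c n) x).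
- by move=> x /mem_span; rewrite -sE.
- exact: cle.
have Un : U `<=` sval (c n).
  by rewrite sE; apply: span_sub => //; exact: (svalP (c n)).1.
apply: (hf (c n)).2; apply: subset_eq; first exact: cS.
by move=> x hx; apply: Un; exists n.+1.
Qed.

End NoetherianRings.

Lemma noeth_surj (R S : comPzRingType) (f : {rmorphism R -> S}) :
  (forall y, exists x, f x = y) -> noetherian R -> noetherian S.
Proof.
move=> sf nR I hI; have [s sE] := nR _ (preim_ideal f hI).
exists (map f s); apply: subset_eq; last first.
  apply: span_sub => // _ /mapP[x xs ->].
  by have : (f @^-1` I) x by rewrite sE; apply: mem_span.
move=> y Iy; have [x xE] := sf y.
have : (f @^-1` I) x by rewrite /preimage /= xE.
rewrite sE => -[c hx]; exists (fun i => f (c i)).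
rewrite -xE hx rmorph_sum size_map; apply: eq_bigr => i _.
by rewrite rmorphM (nth_map 0).
Qed.

Lemma noeth_field (k : fieldType) : noetherian k.
Proof.
move=> I hI; case: (pselect (exists2 x, I x & x != 0)) => [[x Ix x0]|h].
  exists [:: x]; apply: subset_eq => [y _|y [c ->]].
    by exists (fun=> y / x); rewrite big_ord1 /= divfK.
  by rewrite big_ord1; apply: idealM.
exists [::]; apply: subset_eq => [y Iy|y [c ->]]; last by rewrite big_ord0; apply: ideal0.
exists (fun=> 0); rewrite big_ord0; apply: contrapT => /eqP y0.
by apply: h; exists y.
Qed.

(** Hilbert's basis theorem. The ideals [L n] of n-th coefficients of members of I of degree at most
    n increase and become constant at some [N]; polynomials realising generators of [L i] for i up
    to [N] generate I, since they allow the top term to be cancelled. *)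
Lemma noeth_poly (R : comNzRingType) : noetherian R -> noetherian {poly R}.
Proof.
move=> nR I hI.
pose L n := [set c : R | exists2 p, I p & (size p <= n.+1)%N /\ p`_n = c].
have hL n : is_ideal (L n).
  split=> [|x y [p Ip [sp <-]] [q Iq [sq <-]]|a x [p Ip [sp <-]]].
  - by exists 0; [exact: ideal0|rewrite size_poly0 coef0].
  - exists (p + q); first exact: idealD.
    by rewrite coefD (leq_trans (size_polyD _ _)) // geq_max sp sq.
  - exists (a%:P * p); first exact: idealM.
    by rewrite coefCM mul_polyC (leq_trans (size_scale_leq _ _)).
have LS m n : (m <= n)%N -> L m `<=` L n.
  move=> mn x [p Ip [sp <-]]; exists ('X^(n - m) * p); first exact: idealM.
  split; last by rewrite coefXnM ltnNge leq_subr /= subKn.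
  apply: leq_trans (size_polyMleq _ _) _; rewrite size_polyXn /=.
  by rewrite (leq_trans (leq_add (leqnn _) sp)) // addnS subnK.
have /choice[t ht] : forall n, exists t : seq {poly R},
    (forall p, p \in t -> I p /\ (size p <= n.+1)%N) /\
    L n = span [seq p`_n | p : {poly R} <- t].
  move=> n; have [s sE] := nR _ (hL n).
  have /choice[g hg] : forall c, exists p : {poly R}, L n c -> I p /\ (size p <= n.+1)%N /\ p`_n = c.
    move=> c; case: (pselect (L n c)) => [[p Ip hp]|nc]; last by exists 0.
    by exists p.
  exists (map g s).
  have hs c : c \in s -> L n c by rewrite sE; apply: mem_span.
  split=> [_ /mapP[c /hs/hg[h1 [h2 _]] ->] //|].
  rewrite -map_comp sE; congr span; rewrite -[LHS]map_id; apply/eq_in_map => c.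
  by move=> /hs/hg[_ [_]].
pose U := [set c | exists n, L n c].
have hU : is_ideal U.
  split=> [|x y [m hx] [n hy]|a x [n hx]].
  - by exists 0%N; apply: ideal0.
  - exists (maxn m n); apply: idealD => //.
      by apply: LS hx; apply: leq_maxl.
    by apply: LS hy; apply: leq_maxr.
  - by exists n; apply: idealM.
have [s sE] := nR U hU.
have [|m n x mn|N hN] := @seq_max_index R s L.
- by move=> x /mem_span; rewrite -sE.
- exact: LS.
have LN n : L n `<=` L N.
  move=> x hx; have : U x by exists n.
  by rewrite sE; apply: span_sub.
pose G := flatten [seq t i | i <- iota 0 N.+1].
have GI p : p \in G -> I p.
  by move=> /flatten_mapP[i _ /(ht i).1[]].
have Gt i p : (i <= N)%N -> p \in t i -> p \in G.
  by move=> iN pt; apply/flatten_mapP; exists i => //; rewrite mem_iota.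
exists G; apply: subset_eq; last exact: span_sub.
suff main n (p : {poly R}) : (size p <= n)%N -> I p -> span G p by move=> p; apply: main.
elim: n p => [|n IH] p sp Ip.
  by move: sp; rewrite leqn0 size_poly_eq0 => /eqP ->; apply: ideal0; apply: span_ideal.
have [q Gq [sq qn]] : exists2 q : {poly R}, span G q & (size q <= n.+1)%N /\ q`_n = p`_n.
  have Lp : L n p`_n by exists p.
  pose m := minn n N.
  have : L m p`_n by rewrite /m /minn; case: ifP => _ //; exact: LN Lp.
  have mN : (m <= N)%N by exact: geq_minr.
  have mn : (m <= n)%N by exact: geq_minl.
  rewrite (ht m).2 => -[c ->]; rewrite size_map.
  exists ('X^(n - m) * \sum_(i < size (t m)) (c i)%:P * (t m)`_i).
    apply: idealM; first exact: span_ideal.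
    apply: ideal_sum; first exact: span_ideal.
    move=> i _; apply: idealM; first exact: span_ideal.
    by apply: mem_span; apply: Gt mN _; apply: mem_nth.
  split; last first.
    rewrite coefXnM ltnNge leq_subr /= subKn // coef_sum; apply: eq_bigr => i _.
    by rewrite coefCM (nth_map 0).
  apply: leq_trans (size_polyMleq _ _) _; rewrite size_polyXn /=.
  set S := \sum_(_ < _) _; suff sS : (size S <= m.+1)%N.
    by rewrite (leq_trans (leq_add (leqnn _) sS)) // addnS subnK.
  apply: leq_trans (size_sum _ _ _) _; apply/bigmax_leqP => i _.
  rewrite mul_polyC (leq_trans (size_scale_leq _ _)) //.
  exact: ((ht m).1 _ (mem_nth 0 (ltn_ord i))).2.
rewrite -[p](subrK q); apply: idealD => //; first exact: span_ideal.
have Iq : I q by exact: (span_sub hI GI).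
apply: IH; last exact: idealB.
apply/leq_sizeP => j; rewrite leq_eqVlt => /orP[/eqP <-|nj].
  by rewrite coefB qn subrr.
by rewrite coefB !nth_default ?subr0 //; [exact: leq_trans sq _|exact: leq_trans sp _].
Qed.

(** * Dedekind-Mertens and the determinant trick *)

Section DedekindMertens.
Variable R : comNzRingType.
Implicit Types (p q : {poly R}) (M : set R) (s : seq nat).

(** Additive subgroups rather than ideals: over a fraction field the relevant sets are stable only
    under the smaller ring. *)
Definition add_closed M := M 0 /\ forall x y, M x -> M y -> M (x - y).

Let closedD M x y : add_closed M -> M x -> M y -> M (x + y).
Proof.
move=> [M0 MB] Mx My; have -> : x + y = x - (0 - y) by rewrite sub0r opprK.
by apply: (MB) => //; apply: MB.
Qed.

Local Notation pp p s := (\prod_(i <- s) p`_i).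

(* Dedekind-Mertens: content(p)^(deg q + 1) content(q) is contained in
   content(p)^(deg q) content(pq), as additive groups. *)
Lemma dedekind_mertens n p q M : (size q <= n.+1)%N -> add_closed M ->
  (forall s k, size s = n -> M (pp p s * (p * q)`_k)) ->
  forall s j, size s = n.+1 -> M (pp p s * q`_j).
Proof.
elim: n p q M => [|n IHn] p q M.
  move=> /size1_polyC -> hM h [|i []] //= j _; rewrite big_seq1.
  have := h [::] i erefl; rewrite big_nil mul1r mulrC mul_polyC coefZ mulrC coefC.
  by case: eqP => // _ _; rewrite mulr0; case: hM.
have [m] := ubnP (size p); elim: m p q M => // m IHm p q M; rewrite ltnS.
move=> sp sq hM h; have [M0 MB] := hM.
pose a := p`_m.-1; pose b := q`_n.+1.
pose q' := q - b *: 'X^(n.+1); pose p' := p - a *: 'X^(m.-1).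
case: m => [|m] in IHm sp a p' *.
  move: sp; rewrite leqn0 size_poly_eq0 => /eqP -> [|i s] j //= _.
  by rewrite big_cons coef0 !mul0r.
rewrite /= in a p' *.
have hab : (p * q)`_(m + n.+1) = a * b.
  rewrite coefM (bigD1 (inord m)) //= inordK ?ltnS ?leq_addr // addKn big1 ?addr0 //.
  move=> i; rewrite -val_eqE /= inordK ?ltnS ?leq_addr // => im.
  case: (ltngtP i m) im => // im _; last by rewrite (nth_default _ (leq_trans sp im)) mul0r.
  rewrite [q`__]nth_default ?mulr0 //; apply: leq_trans sq _.
  by move: im; clear; lia.
have sq' : (size q' <= n.+1)%N.
  apply/leq_sizeP => j; rewrite leq_eqVlt => /orP[/eqP <-|nj].
    by rewrite coefB coefZ coefXn eqxx mulr1 subrr.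
  by rewrite coefB coefZ coefXn gtn_eqF // mulr0 subr0 nth_default // (leq_trans sq).
have sp' : (size p' < m.+1)%N.
  rewrite ltnS; apply/leq_sizeP => j; rewrite leq_eqVlt => /orP[/eqP <-|nj].
    by rewrite coefB coefZ coefXn eqxx mulr1 subrr.
  by rewrite coefB coefZ coefXn gtn_eqF // mulr0 subr0 nth_default // (leq_trans sp).
have qE j : q`_j = q'`_j + b * (j == n.+1)%:R.
  by rewrite coefB coefZ coefXn subrK.
have pq' k : (p * q')`_k = (p * q)`_k - b * (if (k < n.+1)%N then 0 else p`_(k - n.+1)).
  by rewrite /q' mulrBr coefB -scalerAr coefZ coefMXn.
have p'q k : (p' * q)`_k = (p * q)`_k - a * (if (k < m)%N then 0 else q`_(k - m)).
  by rewrite /p' mulrBl coefB -scalerAl coefZ coefXnM.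
have shift c : add_closed [set x | M (c * x)].
  by split=> [|x y hx hy] /=; rewrite ?mulr0 // mulrBr; apply: MB.
(* After multiplication by [a] the top term of q contributes [a * b], which is itself a coefficient
   of [p * q]; so the induction on n applies to [q'] and to the set of x with [M (a * x)]. *)
have A1 s j : size s = n.+1 -> M (a * (pp p s * q'`_j)).
  move=> ss; apply: (IHn p q' [set x | M (a * x)]) => // t k st /=.
  rewrite pq' mulrBr mulrBr; apply: MB.
    rewrite mulrA; have := h (m :: t) k; rewrite big_cons /= st; exact.
  case: ifP => _; rewrite ?mulr0 //.
  have := h (k - n.+1 :: t)%N (m + n.+1)%N; rewrite hab big_cons /= st => /(_ erefl).
  by congr M; ring.
(* A product in which the top index m occurs contains the factor [a]; for the other products [p] may
   be replaced by the shorter [p']. *)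
have B s : size s = n.+2 -> M (pp p s * b).
  move=> ss; have [ms|ms] := boolP (m \in s).
    rewrite (perm_big _ (perm_to_rem ms)) big_cons /=.
    have := h (rem m s) (m + n.+1)%N; rewrite size_rem // ss hab => /(_ erefl).
    by congr M; rewrite -/a; ring.
  have ppE t : m \notin t -> pp p t = pp p' t.
    move=> mt; apply: eq_big_seq => i it; rewrite coefB coefZ coefXn.
    by case: eqP it mt => [->->//|]; rewrite mulr0 subr0.
  rewrite ppE //; apply: (IHm p' q M) => // t k st.
  have [mt|mt] := boolP (m \in t).
    rewrite (perm_big _ (perm_to_rem mt)) big_cons /=.
    by rewrite coefB coefZ coefXn eqxx mulr1 subrr !mul0r.
  rewrite -ppE // p'q mulrBr; apply: MB; first exact: h.
  case: ifP => _; rewrite ?mulr0 // qE.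
  have -> : pp p t * (a * (q'`_(k - m) + b * (k - m == n.+1)%N%:R)) =
     a * (pp p t * q'`_(k - m)) + pp p t * (a * b) * (k - m == n.+1)%N%:R by ring.
  apply: closedD => //; first exact: A1.
  by case: eqP => _; rewrite ?mulr1 ?mulr0 // -hab; apply: h.
move=> [|i s] j //= [ss]; rewrite qE mulrDr; apply: closedD => //; last first.
  case: eqP => _; rewrite ?mulr1 ?mulr0 ?mulr0 //; apply: B; by rewrite /= ss.
rewrite big_cons -mulrA.
apply: (IHn p q' [set x | M (p`_i * x)]) => // t k st /=.
rewrite pq' mulrBr mulrBr; apply: MB.
  by rewrite mulrA; have := h (i :: t) k; rewrite big_cons /= st; exact.
case: ifP => _; rewrite ?mulr0 //.
have := B (k - n.+1 :: i :: t)%N; rewrite !big_cons /= st => /(_ erefl).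
by congr M; ring.
Qed.

End DedekindMertens.

(** Cayley-Hamilton: the adjugate of [x%:M - A] shows that the value of the characteristic
    polynomial kills every [y i]. Its coefficient of degree i is a sum of products with at least r -
    i factors among the entries of A, which gives the grading needed for integral dependence on
    [N]. *)
Lemma det_trick (R : comNzRingType) (V : comNzRingType) (f : {rmorphism R -> V})
    (N : set R) r (A : 'M[R]_r) (y : 'I_r -> V) (x : R) : is_ideal N ->
  (forall i j, N (A i j)) ->
  (forall i, f x * y i = \sum_j f (A i j) * y j) ->
  exists2 p : {poly R}, p \is monic /\ size p = r.+1 &
    (forall i, (i <= r)%N -> ideal_pow N (r - i) p`_i) /\
    forall i, f p.[x] * y i = 0.
Proof.
move=> hN hA h; exists (char_poly A).
  by rewrite char_poly_monic size_char_poly.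
split=> [i ir|i].
  rewrite /char_poly /determinant coef_sum; apply: ideal_sum; first exact: pow_ideal.
  move=> s _; rewrite -(rmorph_sign (@polyC R)) coefCM; apply: idealM; first exact: pow_ideal.
  suff H (t : seq 'I_r) (g : 'I_r -> 'I_r) k : (k <= size t)%N ->
      ideal_pow N (size t - k) (\prod_(j <- t) char_poly_mx A j (g j))`_k.
    have := H (index_enum 'I_r) (perm.fun_of_perm s) i.
    have -> : size (index_enum 'I_r) = r by rewrite -[RHS](size_enum_ord r) enumT [index_enum _]unlock.
    exact.
  elim: t k => [//|j t IH] k /=.
  move=> kt; rewrite big_cons coefM; apply: ideal_sum; first exact: pow_ideal.
  move=> l _; rewrite /char_poly_mx !mxE coefB coefMn coefX coefC.
  case: l => -[|[|l]] lk /=.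
  - rewrite mul0rn sub0r subn0 mulNr; apply: idealN; first exact: pow_ideal.
    move: kt; rewrite leq_eqVlt => /orP[/eqP ->|]; first by rewrite subnn.
    rewrite ltnS => kt; rewrite subSn //= ; apply: mem_mul; [exact: hA|exact: IH].
  - rewrite subr0 -[_ * _]/(_ * _); apply: idealM; first exact: pow_ideal.
    rewrite ltnS in lk; rewrite -(prednK lk) subSS subn1 /=.
    by apply: IH; rewrite -ltnS (prednK lk).
  - by rewrite mul0rn subr0 mul0r; apply: pow0r.
have detE : (char_poly A).[x] = \det (x%:M - A).
  rewrite /char_poly -horner_evalE -det_map_mx; congr (\det _).
  by apply/matrixP=> a b; rewrite !mxE /= /horner_eval hornerD hornerN hornerMn hornerX hornerC.
rewrite detE; pose Y := \col_j y j; pose B := map_mx f (x%:M - A).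
have BY : B *m Y = 0.
  apply/colP=> a; rewrite !mxE.
  have -> : \sum_j B a j * Y j 0 = f x * y a - \sum_j f (A a j) * y j.
    rewrite (bigD1 a) //= [in RHS](bigD1 a) //= !mxE eqxx mulr1n rmorphB mulrBl.
    rewrite opprD addrA; congr (_ + _); rewrite -sumrN; apply: eq_bigr => j ja.
    by rewrite !mxE eq_sym (negPf ja) mulr0n sub0r rmorphN mulNr.
  by rewrite h subrr.
have : (\det B *: Y) i 0 = 0.
  by rewrite -mul_scalar_mx -mul_adj_mx -mulmxA BY mulmx0 mxE.
by rewrite /B det_map_mx !mxE.
Qed.

(** * Completely integrally closed domains *)

Lemma mpoly_hom_ext n (R : comNzRingType) (B : comNzRingType)
    (f g : {rmorphism {mpoly R[n]} -> B}) :
  (forall c, f c%:MP = g c%:MP) -> (forall i, f 'X_i = g 'X_i) -> f =1 g.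
Proof.
move=> hC hX p; rewrite [p]mpolyE !rmorph_sum; apply: eq_bigr => m _.
rewrite -mul_mpolyC !rmorphM hC mpolyXE_id !rmorph_prod; congr (_ * _).
by apply: eq_bigr => i _; rewrite !rmorphXn hX.
Qed.

(** Complete integral closedness, written without fractions: if the powers of a / b have the common
    denominator d, then a / b lies in [E]. It passes to polynomial rings by leading coefficients,
    and bounded denominators of powers are what Dedekind-Mertens delivers. *)
Definition cic (E : idomainType) := forall a b d : E, b != 0 -> d != 0 ->
  (forall n, exists e, d * a ^+ n = e * b ^+ n) -> exists e, a = e * b.

Local Notation "x %:F" := (tofrac x) .

Lemma fraction_num (E : idomainType) (x : {fraction E}) :
  exists a b : E, b != 0 /\ x * b%:F = a%:F.
Proof.
elim/quotW: x => x; exists (frac x).1, (frac x).2.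
split; first exact: denom_ratioP.
unlock tofrac; rewrite -[LHS]FracField.pi_mul; apply/eqmodP.
rewrite /= FracField.equivfE /FracField.mulf !numden_Ratio ?oner_neq0 ?mulr1 //.
  by rewrite mulrC.
all: exact: denom_ratioP.
Qed.

Lemma cic_frac (E : idomainType) (x : {fraction E}) (d : E) : cic E -> d != 0 ->
  (forall n, exists e, d%:F * x ^+ n = e%:F) -> exists e, x = e%:F.
Proof.
move=> hE d0 h; have [a [b [b0 xb]]] := fraction_num x.
have b0F : b%:F != 0 by rewrite tofrac_eq0.
have [|e ae] := hE a b d b0 d0.
  move=> n; have [e he] := h n; exists e; apply/eqP; rewrite -tofrac_eq; apply/eqP.
  by rewrite !rmorphM !rmorphXn /= -xb exprMn mulrA he.
by exists e; apply: (mulIf b0F); rewrite xb ae rmorphM.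
Qed.

Lemma cic_transfer (A B : idomainType) (u : {rmorphism A -> B})
    (v : {rmorphism B -> A}) : cancel u v -> cic B -> cic A.
Proof.
move=> uv hB a b d b0 d0 h.
have u0 x : x != 0 -> u x != 0.
  by apply: contra_neq => ux; rewrite -[x]uv ux rmorph0.
have [|e he] := hB (u a) (u b) (u d) (u0 _ b0) (u0 _ d0).
  by move=> n; have [e he] := h n; exists (u e); rewrite -!rmorphXn -!rmorphM he.
by exists (v e); rewrite -[a]uv he rmorphM uv.
Qed.

Lemma cic_field (k : fieldType) : cic k.
Proof. by move=> a b d b0 _ _; exists (a / b); rewrite divfK. Qed.

(** Over the fraction field, cancel the gcd of a and b: all powers of the reduced denominator divide
    d, so it is constant and a / b is a polynomial [u]. The powers of its leading coefficient have a
    common denominator, so this coefficient lies in [E]; subtract the leading term and induct on the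
    degree. *)
Lemma cic_poly (E : idomainType) : cic E -> cic {poly E}.
Proof.
move=> hE a b d b0 d0 h.
pose F := {fraction E}; pose m : {rmorphism {poly E} -> {poly F}} := map_poly (@tofrac E).
have tfI : injective (@tofrac E) by move=> x y /eqP; rewrite tofrac_eq => /eqP.
have minj : injective m by apply: map_inj_poly => //; rewrite rmorph0.
have m0 x : x != 0 -> m x != 0.
  by apply: contra_neq => mx; apply: minj; rewrite mx rmorph0.
have [u hu] : exists u, m a = u * m b.
  pose g := gcdp (m a) (m b); have g0 : g != 0 by rewrite gcdp_eq0 negb_and (m0 _ b0) orbT.
  have ga : m a %/ g * g = m a by rewrite divpK // dvdp_gcdl.
  have gb : m b %/ g * g = m b by rewrite divpK // dvdp_gcdr.
  set a' := m a %/ g in ga; set b' := m b %/ g in gb.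
  have cop : coprimep a' b' by rewrite coprimep_div_gcd // (m0 _ b0) orbT.
  have dvd n : b' ^+ n %| m d.
    have [e he] := h n.
    have : b' ^+ n %| m d * a' ^+ n.
      rewrite -(@dvdp_mul2r _ (g ^+ n)) ?expf_neq0 // -mulrA -!exprMn ga gb.
      by rewrite -!rmorphXn -rmorphM he rmorphM dvdp_mull.
    by rewrite Gauss_dvdpl // coprimep_expl // coprimep_expr // coprimep_sym.
  have b'0 : b' != 0 by apply: contra_neq (m0 _ b0) => b'0; rewrite -gb b'0 mul0r.
  have sb' : size b' = 1%N.
    have h1 := dvdp_leq (m0 _ d0) (dvd (size (m d))).
    have h3 : (0 < size (b' ^+ size (m d)))%N by rewrite size_poly_gt0 expf_neq0.
    have : ((size b').-1 * size (m d) < size (m d))%N by rewrite -size_exp prednK.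
    rewrite [RHS]/= => h4; rewrite polySpred //.
    by case: (size b').-1 h4 => // s; rewrite ltnNge /= leq_pmull.
  have /size_poly1P[c c0 b'E] : size b' == 1%N by rewrite sb'.
  exists (c^-1%:P * a'); rewrite -gb b'E mulrACA -polyCM mulVf // mul1r ga //.
have du n : exists e, m d * u ^+ n = m e.
  have [e he] := h n; exists e.
  apply: (mulIf (expf_neq0 n (m0 _ b0))).
  by rewrite -mulrA -exprMn -hu -!rmorphXn -!rmorphM he.
suff [e ue] : exists e, u = m e.
  by exists e; apply: minj; rewrite hu ue rmorphM.
have [N] := ubnP (size u); elim: N u du {hu} => // N IH u du; rewrite ltnS => sN.
have [->|u0] := eqVneq u 0; first by exists 0; rewrite rmorph0.
have [||c hc] := @cic_frac E (lead_coef u) (lead_coef d) hE.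
- by rewrite lead_coef_eq0.
- move=> n; have [e he] := du n; exists (lead_coef e).
  have := congr1 lead_coef he; rewrite lead_coefM lead_coef_exp /m /=.
  by rewrite !lead_coef_map_inj // rmorph0.
pose w := c *: 'X^((size u).-1) : {poly E}.
have mw : m w = lead_coef u *: 'X^((size u).-1) by rewrite /m /= map_polyZ map_polyXn hc.
have [||e he] := IH (u - m w).
- move=> n; rewrite exprBn mulr_sumr.
  suff [E0 hE0] : exists e0 : nat -> {poly E}, forall i, m d * u ^+ i = m (e0 i).
    exists (\sum_(i < n.+1) (E0 (n - i)%N * (-1) ^+ i * w ^+ i) *+ 'C(n, i)).
    rewrite rmorph_sum; apply: eq_bigr => i _.
    rewrite rmorphMn !rmorphM !rmorphXn -hE0 rmorphN1.
    by rewrite -mulrnAr; ring.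
  by have /choice[f hf] := du; exists f.
- apply: leq_trans _ sN; rewrite [size u in leqRHS]polySpred // ltnS; apply/leq_sizeP => j.
  rewrite mw coefB coefZ coefXn leq_eqVlt => /orP[/eqP <-|nj].
    by rewrite eqxx mulr1 subrr.
  by rewrite gtn_eqF // mulr0 subr0 nth_default // [size u]polySpred.
by exists (e + w); rewrite rmorphD -he subrK.
Qed.

Lemma cic_mpoly (k : fieldType) n : cic {mpoly k[n]}.
Proof.
elim: n => [|n IH].
  apply: (@cic_transfer _ k (mcoeff 0%MM) (@mpolyC 0 k)); last exact: cic_field.
  exact: mpolyKC.
pose X (i : 'I_n.+1) : {poly {mpoly k[n]}} :=
  if unlift ord_max i is Some j then ('X_j)%:P else 'X.
pose u : {rmorphism {mpoly k[n.+1]} -> {poly {mpoly k[n]}}} :=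
  mmap (@polyC {mpoly k[n]} \o @mpolyC n k) X.
pose v : {rmorphism {poly {mpoly k[n]}} -> {mpoly k[n.+1]}} :=
  horner_eval 'X_ord_max \o map_poly (@mwiden n k).
apply: (@cic_transfer _ _ u v); last exact: cic_poly.
pose id' : {rmorphism {mpoly k[n.+1]} -> {mpoly k[n.+1]}} := idfun.
pose vu : {rmorphism {mpoly k[n.+1]} -> {mpoly k[n.+1]}} := v \o u.
apply: (@mpoly_hom_ext _ _ _ vu id') => [c|i].
  by rewrite /= mmapC /= /horner_eval map_polyC hornerC /= mwidenC.
rewrite /= mmapX mmap1U /X; case: unliftP => [j ->|->].
  rewrite /= /horner_eval map_polyC hornerC /= mwidenX mnmwiden1; congr 'X__.
  by apply: val_inj; rewrite /= /bump leqNgt ltn_ord.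
by rewrite /horner_eval map_polyX hornerX.
Qed.

Local Notation "x %:F" := (tofrac x).

(** * Integrality of traces over a completely integrally closed domain *)

Section IntegralTrace.
Variable E : idomainType.
Hypothesis hE : cic E.
Local Notation F := {fraction E}.
Local Notation tf := (@tofrac E).

Lemma common_den (s : seq F) : exists2 d : E, d != 0 &
  forall x, x \in s -> exists e, d%:F * x = e%:F.
Proof.
elim: s => [|x s [d d0 IH]]; first by exists 1; rewrite ?oner_neq0.
have [a [b [b0 xb]]] := fraction_num x.
exists (d * b); first by rewrite mulf_neq0.
move=> y; rewrite inE => /orP[/eqP ->|/IH[e he]].
  by exists (d * a); rewrite !rmorphM /= -xb; ring.
by exists (b * e); rewrite !rmorphM /= -he; ring.
Qed.

Lemma gauss_monic (g h : {poly F}) (f : {poly E}) :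
  h \is monic -> g * h = map_poly tf f ->
  forall i, exists e, g`_i = e%:F.
Proof.
move=> hm gh; pose n := (size h).-1.
have [d d0 hd] := common_den g.
have hdi i : exists e, d%:F * g`_i = e%:F.
  have [ig|ig] := ltnP i (size g); first by apply: hd; apply: mem_nth.
  by exists 0; rewrite nth_default // mulr0 rmorph0.
have hdp (s : seq nat) : exists e, d%:F ^+ size s * \prod_(i <- s) g`_i = e%:F.
  elim: s => [|i s [e he]]; first by exists 1; rewrite big_nil expr0 mul1r rmorph1.
  have [e' he'] := hdi i; exists (e' * e).
  by rewrite big_cons exprS mulrACA he he' -rmorphM.
pose M := [set x : F | exists e, d%:F ^+ n * x = e%:F].
have hM : add_closed M.
  split=> [|x y [e he] [e' he']]; first by exists 0; rewrite mulr0 rmorph0.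
  by exists (e - e'); rewrite mulrBr he he' rmorphB.
have hMz z : add_closed [set x | M (z * x)].
  split=> [|x y hx hy] /=; first by rewrite mulr0; apply: (hM.1).
  by rewrite mulrBr; apply: (hM.2).
have key m (s : seq nat) : size s = (n + m)%N -> M (\prod_(i <- s) g`_i).
  elim: m s => [|m IH] s.
    by rewrite addn0 => ss; have [e he] := hdp s; exists e; rewrite -he ss.
  move=> ss; rewrite -(cat_take_drop m s) big_cat /=.
  have std : size (drop m s) = n.+1 by rewrite size_drop ss addnS subSn ?leq_addl // addnK.
  have stt : size (take m s) = m by rewrite size_takel // ss addnS leqW // leq_addl.
  pose z := \prod_(i <- take m s) g`_i.
  have := @dedekind_mertens F n g h [set x | M (z * x)] _ (hMz z) _ (drop m s) n std.
  rewrite /= (_ : h`_n = 1) ?mulr1; last by have := monicP hm.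
  apply; first by rewrite /n prednK // size_poly_gt0 monic_neq0.
  move=> t k st /=; rewrite gh coef_map /= mulrA -big_cat.
  have [|e he] := IH (take m s ++ t); first by rewrite size_cat stt st addnC.
  by exists (e * f`_k); rewrite mulrA he rmorphM.
move=> i; apply: (@cic_frac E _ (d ^+ n) hE); first by rewrite expf_neq0.
move=> m; have [e he] := key m (nseq (n + m) i) (size_nseq _ _).
have [mn|mn] := leqP m n.
  have [e' he'] := hdi i; exists (d ^+ (n - m) * e' ^+ m).
  rewrite rmorphM !rmorphXn /= -he' exprMn mulrA -exprD subnK //.
have [e1 he1] := key (m - n)%N (nseq m i) (etrans (size_nseq _ _) (esym (subnKC (ltnW mn)))).
by exists e1; rewrite -he1 rmorphXn /= big_nseq -Monoid.iteropE.
Qed.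

(** Since f(X) = 0, the scalar matrix f(T) is divisible by T - X. Taking determinants, the
    characteristic polynomial of X divides a power of f with monic cofactor, and [gauss_monic] puts
    its coefficients, the trace among them, into [E]. *)
Lemma trace_integral r (X : 'M[F]_r) (f : {poly E}) : f \is monic ->
  \sum_(i < size f) (f`_i)%:F *: X ^+ i = 0 -> exists e, \tr X = e%:F.
Proof.
move=> fm fX; case: r X fX => [|r] X fX.
  by exists 0; rewrite /mxtrace big_ord0 rmorph0.
pose T : 'M[{poly F}]_r.+1 := 'X%:M; pose Xc := map_mx (@polyC F) X.
have comTX : GRing.comm T Xc by rewrite /GRing.comm -!mulmxE mul_scalar_mx mul_mx_scalar.
pose Q := \sum_(i < size f) (f`_i)%:F%:P *:
   \sum_(j < i) T ^+ (i.-1 - j) * Xc ^+ j.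
have fTQ : (map_poly tf f)%:M = (T - Xc) * Q.
  rewrite mulr_sumr; have -> : ((map_poly tf f)%:M : 'M_r.+1) =
      \sum_(i < size f) (f`_i)%:F%:P *: T ^+ i.
    rewrite -[f in LHS]coefK poly_def rmorph_sum raddf_sum; apply: eq_bigr => i _.
    rewrite /= map_polyZ map_polyXn -mul_polyC scalar_mxM -mul_scalar_mx.
    by rewrite -rmorphXn.
  have -> : \sum_(i < size f) (f`_i)%:F%:P *: T ^+ i =
      \sum_(i < size f) (f`_i)%:F%:P *: (T ^+ i - Xc ^+ i).
    have h0 : \sum_(i < size f) (f`_i)%:F%:P *: Xc ^+ i = 0.
      transitivity (map_mx (@polyC F) (\sum_(i < size f) (f`_i)%:F *: X ^+ i)); last by rewrite fX map_mx0.
      by rewrite rmorph_sum; apply: eq_bigr => i _; rewrite /= map_mxZ rmorphXn.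
    by rewrite -[LHS]subr0 -[X in _ - X = _]h0 -sumrB; apply: eq_bigr => i _; rewrite scalerBr.
  apply: eq_bigr => i _; rewrite -scalerAr; congr (_ *: _).
  case: i => -[|i] hi /=; first by rewrite big_ord0 mulr0 subrr.
  by rewrite (subrXX_comm _ comTX).
have chm := char_poly_monic X.
have := congr1 determinant fTQ; rewrite det_scalar det_mulmx.
have -> : \det (T - Xc) = char_poly X by [].
move=> fE.
have Qm : \det Q \is monic.
  by rewrite -(monicMl _ chm) -fE monic_exp // monic_map.
have [e he] := gauss_monic (f := f ^+ r.+1) Qm (etrans (esym fE) (esym (rmorphXn _ _ _))) r.
by exists (- e); rewrite rmorphN /= -he -[r]/(r.+1.-1) char_poly_trace // opprK.
Qed.

End IntegralTrace.

(** * Finite subrings and torsion-free coordinates *)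

Section ModuleSpan.
Variables (E V : comNzRingType) (s : {rmorphism E -> V}).
Implicit Types (l : seq V) (v x y : V).

Definition mspan l : set V :=
  [set x | exists c : nat -> E, x = \sum_(i < size l) s (c i) * l`_i].

Lemma mspan0 l : mspan l 0.
Proof. by exists (fun=> 0); rewrite big1 // => i _; rewrite rmorph0 mul0r. Qed.
Lemma mspanD l x y : mspan l x -> mspan l y -> mspan l (x + y).
Proof.
move=> [c ->] [d ->]; exists (fun i => c i + d i); rewrite -big_split.
by apply: eq_bigr => i _; rewrite rmorphD mulrDl.
Qed.
Lemma mspanZ l e x : mspan l x -> mspan l (s e * x).
Proof.
move=> [c ->]; exists (fun i => e * c i); rewrite mulr_sumr.
by apply: eq_bigr => i _; rewrite rmorphM mulrA.
Qed.
Lemma mspanN l x : mspan l x -> mspan l (- x).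
Proof. by move=> /(mspanZ (-1)); rewrite rmorphN1 mulN1r. Qed.
Lemma mem_mspan l x : x \in l -> mspan l x.
Proof.
move=> xl; exists (fun i => (i == index x l)%:R).
have hi : (index x l < size l)%N by rewrite index_mem.
rewrite (bigD1 (Ordinal hi)) //= eqxx rmorph1 mul1r nth_index // big1 ?addr0 // => i.
by rewrite -val_eqE /= => /negPf ->; rewrite rmorph0 mul0r.
Qed.
Lemma mspan_ind l (K : set V) : K 0 -> (forall x y, K x -> K y -> K (x + y)) ->
  (forall e x, K x -> K (s e * x)) -> (forall x, x \in l -> K x) ->
  forall x, mspan l x -> K x.
Proof.
move=> K0 KD KZ Kl x [c ->]; apply: big_ind => // i _.
by apply: KZ; apply: Kl; apply: mem_nth.
Qed.
Lemma mspan_sum l (T : Type) (r : seq T) (P : pred T) (G : T -> V) :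
  (forall i, P i -> mspan l (G i)) -> mspan l (\sum_(i <- r | P i) G i).
Proof.
move=> h; apply: big_ind => //; first exact: mspan0.
exact: mspanD.
Qed.

Definition fg_subring l := [/\ mspan l 1,
  (forall x y, mspan l x -> mspan l y -> mspan l (x * y))
  & (forall e, mspan l (s e))].

(** Integral elements are adjoined one at a time: the generators are multiplied by the powers of z
    below the degree of a monic equation, to which division by that equation reduces all others. *)
Lemma fg_subringE (zs : seq V) : (forall z, z \in zs -> integralOver s z) ->
  exists l, fg_subring l /\ forall z, z \in zs -> mspan l z.
Proof.
elim: zs => [|z zs IH] hz.
  exists [:: 1]; split=> //; have h1 : mspan [:: 1] 1 by apply: mem_mspan; rewrite mem_head.
  split=> [//|x y [c ->] [d ->]|e]; last by rewrite -[s e]mulr1; apply: mspanZ.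
  by rewrite !big_ord1 /= !mulr1 -rmorphM -[s _]mulr1; apply: mspanZ.
have [l [[l1 lM lE] lz]] := IH (fun x hx => hz x (@mem_behead _ (z :: zs) _ hx)).
have [p pm pz] := hz z (mem_head _ _).
pose r := (size p).-1.
have zn n : exists c : nat -> E, z ^+ n = \sum_(i < r) s (c i) * z ^+ i.
  pose q := Pdiv.Ring.rmodp 'X^n p.
  have qE : 'X^n = Pdiv.Ring.rdivp 'X^n p * p + q by apply: Pdiv.RingMonic.rdivp_eq.
  have sq : (size q <= r)%N.
    by rewrite -ltnS /r prednK ?size_poly_gt0 ?monic_neq0 // Pdiv.Ring.ltn_rmodpN0 ?monic_neq0.
  exists (fun i => q`_i).
  have := congr1 (fun u => (map_poly s u).[z]) qE.
  rewrite /= rmorphD rmorphM /= hornerD hornerM (eqP pz) mulr0 add0r map_polyXn hornerXn => ->.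
  rewrite (horner_coef_wide _ (leq_trans (size_poly _ _) sq)).
  by apply: eq_bigr => i _; rewrite coef_map.
pose l' := [seq a * z ^+ i | a <- l, i <- iota 0 r].
have Qz q n : mspan l q -> mspan l' (q * z ^+ n).
  move: q; apply: mspan_ind => [|x y|e x|a al].
  - by rewrite mul0r; apply: mspan0.
  - by rewrite mulrDl; apply: mspanD.
  - by rewrite -mulrA; apply: mspanZ.
  have [c ->] := zn n; rewrite mulr_sumr; apply: mspan_sum => i _.
  rewrite mulrCA; apply: mspanZ; apply: mem_mspan; apply/allpairsPdep.
  by exists a, (val i); rewrite mem_iota /= add0n ltn_ord.
have lsub q : mspan l q -> mspan l' q by move/(Qz q 0%N); rewrite expr0 mulr1.
exists l'; split; last first.
  move=> x; rewrite inE => /orP[/eqP ->|/lz/lsub //].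
  by rewrite -[z]mul1r -[z]expr1; apply: Qz.
split=> [|x y|e]; [exact: lsub| |exact/lsub/lE].
move=> hx hy; move: x hx; apply: mspan_ind => [|x x'|e x|x].
- by rewrite mul0r; apply: mspan0.
- by rewrite mulrDl; apply: mspanD.
- by rewrite -mulrA; apply: mspanZ.
move=> /allpairsPdep[a [i [al _ ->]]]; move: y hy.
apply: mspan_ind => [|x' y'|e x'|y].
- by rewrite mulr0; apply: mspan0.
- by rewrite mulrDr; apply: mspanD.
- by rewrite mulrCA; apply: mspanZ.
move=> /allpairsPdep[b [j [bl _ ->]]]; rewrite mulrACA -exprD.
by apply/Qz/lM; apply: mem_mspan.
Qed.

End ModuleSpan.

Section TorsionFreeModule.
Variables (E D V : comNzRingType) (h : {rmorphism E -> D}) (s : {rmorphism E -> V}).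
Hypothesis domD : forall x y : D, x * y = 0 -> x = 0 \/ y = 0.
Hypothesis h0 : forall e, h e = 0 -> s e = 0.

Let indep (l : seq V) := forall c : nat -> E,
  \sum_(i < size l) s (c i) * l`_i = 0 -> forall i, (i < size l)%N -> h (c i) = 0.

Lemma torsion_free_coord (l0 : seq V) : exists (l : seq V) (co : nat -> V -> D) (d : E),
  [/\ h d <> 0, (forall x, x \in l -> mspan s l0 x),
   (forall v, mspan s l0 v -> exists c : nat -> E,
      s d * v = \sum_(i < size l) s (c i) * l`_i /\
      forall j, (j < size l)%N -> co j v = h (c j)),
   (forall j v w, (j < size l)%N -> mspan s l0 v -> mspan s l0 w ->
      co j (v + w) = co j v + co j w)
   & (forall j e v, (j < size l)%N -> mspan s l0 v -> co j (s e * v) = h e * co j v)].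
Proof.
have [l [il [d hd [ll0 hl]]]] : exists l, indep l /\ exists2 d, h d <> 0 &
    (forall x, x \in l -> mspan s l0 x) /\
    (forall y, y \in l0 -> mspan s l (s d * y)).
  elim: l0 => [|y l0 [l [il [d hd [ll0 hl]]]]].
    exists [::]; split=> //; exists 1 => //; rewrite rmorph1; exact/eqP/oner_neq0.
  have sub x : mspan s l0 x -> mspan s (y :: l0) x.
    move: x; apply: mspan_ind; [exact: mspan0|exact: mspanD|exact: mspanZ|].
    by move=> x xl; apply: mem_mspan; rewrite inE xl orbT.
  case: (pselect (exists2 e, h e <> 0 & mspan s l (s e * y))) => [[e he hy]|nh].
    exists l; split=> //; exists (d * e).
      by rewrite rmorphM => /domD[].
    split=> [x /ll0/sub //|x].
    rewrite inE => /orP[/eqP ->|/hl hx]; first by rewrite rmorphM -mulrA; apply: mspanZ.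
    by rewrite [d * e]mulrC rmorphM -mulrA; apply: mspanZ.
  exists (y :: l); split.
    move=> c /=; rewrite big_ord_recl /= => hc.
    have hc0 : h (c 0%N) = 0.
      apply: contrapT => hn; apply: nh; exists (c 0%N) => //.
      move/eqP: hc; rewrite addr_eq0 => /eqP ->; apply: mspanN.
      by exists (fun i => c i.+1).
    move: hc; rewrite (h0 hc0) mul0r add0r => hc [|i] //= hi.
    exact: (il (fun i => c i.+1)).
  exists d => //; split=> [x|x]; rewrite inE => /orP[/eqP ->|].
  - by apply: mem_mspan; rewrite mem_head.
  - by move=> /ll0/sub.
  - by apply: mspanZ; apply: mem_mspan; rewrite mem_head.
  - move=> /hl [c ->]; apply: mspan_sum => i _; apply: mspanZ; apply: mem_mspan.
    by rewrite inE mem_nth ?orbT.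
have hs v : mspan s l0 v -> mspan s l (s d * v).
  move: v; apply: mspan_ind => [|x y|e x|//].
  - by rewrite mulr0; apply: mspan0.
  - by rewrite mulrDr; apply: mspanD.
  - by rewrite mulrCA; apply: mspanZ.
have /choice[cf hcf] : forall v, exists c : nat -> E, mspan s l0 v ->
    s d * v = \sum_(i < size l) s (c i) * l`_i.
  move=> v; case: (pselect (mspan s l0 v)) => [/hs[c hc]|nv]; first by exists c.
  by exists (fun=> 0).
have uniq_co (c c' : nat -> E) : \sum_(i < size l) s (c i) * l`_i = \sum_(i < size l) s (c' i) * l`_i ->
    forall j, (j < size l)%N -> h (c j) = h (c' j).
  move=> /eqP; rewrite -subr_eq0 -sumrB => /eqP hc j jl.
  have := il (fun i => c i - c' i) _ j jl; rewrite rmorphB => hj.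
  apply/eqP; rewrite -subr_eq0 hj // -[RHS]hc; apply: eq_bigr => i _.
  by rewrite rmorphB mulrBl.
exists l, (fun j v => h (cf v j)), d; split=> //.
- by move=> v hv; exists (cf v); split=> //; apply: hcf.
- move=> j v w jl hv hw; rewrite -rmorphD.
  apply: (uniq_co (cf (v + w)) (fun i => cf v i + cf w i)) => //.
  rewrite -hcf; last exact: mspanD.
  rewrite mulrDr hcf // hcf // -big_split; apply: eq_bigr => i _.
  by rewrite rmorphD mulrDl.
- move=> j e v jl hv; rewrite -rmorphM.
  apply: (uniq_co (cf (s e * v)) (fun i => e * cf v i)) => //.
  rewrite -hcf; last exact: mspanZ.
  rewrite mulrCA hcf // mulr_sumr; apply: eq_bigr => i _.
  by rewrite rmorphM mulrA.
Qed.

End TorsionFreeModule.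

(** * The Lipman-Sathaye multiplier *)

Lemma fg_subring_integral (E V : comNzRingType) (s : {rmorphism E -> V}) l v :
  fg_subring s l -> mspan s l v -> integralOver s v.
Proof.
move=> [l1 lM _] hv.
have /choice[c hc] : forall i : 'I_(size l), exists c : nat -> E,
    v * l`_i = \sum_(j < size l) s (c j) * l`_j.
  by move=> i; apply: lM => //; apply: mem_mspan; apply: mem_nth.
pose A : 'M[E]_(size l) := \matrix_(i, j) c i j; exists (char_poly A); first exact: char_poly_monic.
pose B := v%:M - map_mx s A; pose Y : 'cV[V]_(size l) := \col_j l`_(nat_of_ord j).
have BY : B *m Y = 0.
  apply/colP=> i; rewrite mulmxBl mul_scalar_mx !mxE hc.
  by apply/eqP; rewrite subr_eq0; apply/eqP/eq_bigr => j _; rewrite !mxE.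
have dY (i : 'I_(size l)) : \det B * l`_(nat_of_ord i) = 0 :> V.
  have : (\det B *: Y) i 0 = 0.
    by rewrite -mul_scalar_mx -mul_adj_mx -mulmxA BY mulmx0 mxE.
  by rewrite !mxE.
have -> : root (map_poly s (char_poly A)) v = (\det B == 0).
  rewrite rootE -horner_evalE -2!det_map_mx; congr (\det _ == 0).
  apply/matrixP=> i j; rewrite !mxE /= /horner_eval.
  by rewrite rmorphB rmorphMn /= map_polyX map_polyC !hornerE hornerMn hornerX; case: eqP.
have [d hd] := l1; rewrite -[\det B]mulr1 hd mulr_sumr big1 // => i _.
by rewrite mulrCA dY mulr0.
Qed.

Lemma mmap1D n (V : comNzRingType) (z : 'I_n -> V) m1 m2 :
  mmap1 z (m1 + m2)%MM = mmap1 z m1 * mmap1 z m2.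
Proof. by rewrite /mmap1 -big_split; apply: eq_bigr => i _; rewrite mnmDE exprD. Qed.

Section LipmanSathaye.
Variables (k : fieldType) (E : idomainType) (V : comNzRingType).
Variables (s : {rmorphism E -> V}) (a : {rmorphism k -> V}) (l0 : seq V).
Hypothesis aE : forall c, exists e, a c = s e.
Hypotheses (hE : cic E) (sreg : forall e, e <> 0 -> forall v, s e * v = 0 -> v = 0).
Hypothesis hQ : fg_subring s l0.
Local Notation Q := (mspan s l0).
Variables (n : nat) (z : 'I_n -> V).
Hypothesis zQ : forall i, Q (z i).
Local Notation ev := (mmap a z).
Let P := [set x | exists p : {mpoly k[n]}, x = ev p].
Hypothesis sP : forall e, P (s e).
Hypothesis denP : forall v, Q v -> exists p, P (ev p * v) /\ forall w, ev p * w = 0 -> w = 0.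

Local Notation cmap := (map_mpoly a).
Local Notation VZ := {mpoly V[n]}.

Definition kdiff (p : {mpoly k[n]}) : VZ := cmap p - (ev p)%:MP.
(** The ideal generated by p(Z) - p(z) for all p with p(z) in E, as an intersection of ideals.
    Modulo it, V[Z] is the tensor product of V and k[z] over E; an element that multiplies every Z_i
    - z_i into it represents a member of the Noether different. *)
Definition killed : set VZ := [set q | forall I : set VZ, is_ideal I ->
  (forall p e, ev p = s e -> I (kdiff p)) -> I q].

Lemma killed_ideal : is_ideal killed.
Proof.
split=> [I hI _|x y hx hy I hI hg|c x hx I hI hg].
- exact: ideal0.
- by apply: idealD => //; [apply: hx|apply: hy].
- by apply: idealM => //; apply: hx.
Qed.

Lemma killed_kdiff p e : ev p = s e -> killed (kdiff p).
Proof. by move=> h I hI; apply; exact: h. Qed.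

Let QM x y : Q x -> Q y -> Q (x * y). Proof. by case: hQ => _ + _; apply. Qed.
Let Q1 : Q 1. Proof. by case: hQ. Qed.
Let Qs e : Q (s e). Proof. by case: hQ. Qed.
Let Qa c : Q (a c). Proof. by have [e ->] := aE c; apply: Qs. Qed.
Let zmQ m : Q (mmap1 z m).
Proof.
rewrite /mmap1; apply: big_ind => // i _; elim: (m i) => // j IH.
by rewrite exprS; apply: QM.
Qed.
Let evQ p : Q (ev p).
Proof. by rewrite /mmap; apply: mspan_sum => m _; apply: QM; [exact: Qa|exact: zmQ]. Qed.

Definition good (mu : V -> V) := (forall x y, Q x -> Q y -> mu (x + y) = mu x + mu y) /\
  (forall e x, Q x -> mu (s e * x) = s e * mu x).

(** Contraction of the tensor product with [mu]: coefficients stay in V, and monomials are evaluated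
    at z and sent through mu. *)
Definition pairing (mu : V -> V) (q : VZ) := \sum_(m <- msupp q) q@_m * mu (mmap1 z m).

Lemma pairing_sup mu q r : uniq r -> {subset msupp q <= r} ->
  pairing mu q = \sum_(m <- r) q@_m * mu (mmap1 z m).
Proof.
move=> ur sub; rewrite (bigID (mem (msupp q))) /= [X in _ + X]big1 ?addr0; last first.
  by move=> m; rewrite -mcoeff_eq0 => /eqP ->; rewrite mul0r.
rewrite -big_filter; apply: perm_big; apply: uniq_perm; [exact: msupp_uniq|exact: filter_uniq|].
by move=> m; rewrite mem_filter /=; case: (boolP (m \in msupp q)) => //= /sub ->.
Qed.

Lemma pairingD mu p q : pairing mu (p + q) = pairing mu p + pairing mu q.
Proof.
pose r := undup (msupp p ++ msupp q ++ msupp (p + q)).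
have ur : uniq r by exact: undup_uniq.
rewrite !(pairing_sup mu ur); try by move=> m mp; rewrite mem_undup !mem_cat mp ?orbT.
by rewrite -big_split; apply: eq_bigr => m _; rewrite mcoeffD mulrDl.
Qed.

Lemma pairingC mu c q : pairing mu (c%:MP * q) = c * pairing mu q.
Proof.
pose r := undup (msupp q ++ msupp (c%:MP * q)).
have ur : uniq r by exact: undup_uniq.
rewrite !(pairing_sup mu ur); try by move=> m mp; rewrite mem_undup !mem_cat mp ?orbT.
by rewrite mulr_sumr; apply: eq_bigr => m _; rewrite mcoeffCM mulrA.
Qed.

Lemma pairingN mu q : pairing mu (- q) = - pairing mu q.
Proof. by rewrite -mulN1r -(rmorphN1 (@mpolyC n V)) pairingC mulN1r. Qed.
Lemma pairingB mu p q : pairing mu (p - q) = pairing mu p - pairing mu q.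
Proof. by rewrite pairingD pairingN. Qed.

Lemma pairingX mu m : pairing mu 'X_[m] = mu (mmap1 z m).
Proof. by rewrite /pairing msuppX big_seq1 mcoeffX eqxx mul1r. Qed.

Lemma pairing_ext mu nu q : (forall x, Q x -> mu x = nu x) -> pairing mu q = pairing nu q.
Proof. by move=> h; apply: eq_bigr => m _; rewrite h. Qed.

Lemma good_mul mu x : good mu -> Q x -> good (fun y => mu (y * x)).
Proof.
move=> [mD mZ] hx; split=> [y w hy hw|e y hy]; first by rewrite mulrDl mD //; apply: QM.
by rewrite -mulrA mZ //; apply: QM.
Qed.

Lemma good0 mu : good mu -> mu 0 = 0.
Proof. by move=> [_ h]; have := h 0 0 (mspan0 _ _); rewrite rmorph0 !mul0r. Qed.

Lemma pairing_ev mu q p : good mu ->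
  pairing mu (q * cmap p) = pairing (fun y => mu (y * ev p)) q.
Proof.
move=> hmu; have [mD mZ] := hmu.
elim/mpolyind: p => [|c m p _ _ IH].
  rewrite !rmorph0 mulr0 /pairing msupp0 big_nil big1 // => m _.
  by rewrite mulr0 good0 // mulr0.
rewrite [cmap _]rmorphD /= mulrDr pairingD IH.
have -> : pairing (fun y => mu (y * ev (c *: 'X_[m] + p))) q =
    pairing (fun y => mu (y * (a c * mmap1 z m))) q + pairing (fun y => mu (y * ev p)) q.
  rewrite /pairing -big_split; apply: eq_bigr => m' _.
  rewrite rmorphD /= mmapZ mmapX mulrDr mD ?mulrDr //.
    by apply: QM => //; apply: QM => //; exact: Qa.
  exact: QM.
congr (_ + _); clear IH.
elim/mpolyind: q => [|b m' q _ _ IHq].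
  by rewrite mul0r /pairing msupp0 !big_nil.
rewrite mulrDl !pairingD IHq; congr (_ + _).
have -> : cmap (c *: 'X_[m]) = (a c)%:MP * 'X_[m].
  by rewrite map_mpolyZ map_mpolyX -mul_mpolyC.
rewrite -[b *: _]mul_mpolyC -mulrA !pairingC; congr (_ * _).
have [e ae] := aE c; rewrite mulrCA pairingC -mpolyXD !pairingX mmap1D mulrCA ae mZ //.
by apply: QM; exact: zmQ.
Qed.

(** Linearity of mu over E is what lets the contraction descend to the tensor product over E. *)
Lemma pairing_killed mu q : good mu -> killed q -> pairing mu q = 0.
Proof.
move=> hmu hq; suff h : forall c, pairing mu (c * q) = 0 by rewrite -[q]mul1r.
pose I := [set q | forall c, pairing mu (c * q) = 0].
have hI : is_ideal I.
  split=> [c|x y hx hy c|b x hx c]; last by rewrite mulrA.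
    by rewrite mulr0 /pairing msupp0 big_nil.
  by rewrite mulrDr pairingD hx hy addr0.
apply: (hq I) => // p e pe c; rewrite mulrBr pairingB pairing_ev // [c * _]mulrC pairingC pe.
apply/eqP; rewrite subr_eq0; apply/eqP.
rewrite /pairing mulr_sumr; apply: eq_bigr => m _.
by rewrite mulrCA [_ * s e]mulrC hmu.2.
Qed.

Variable Dl : VZ.
Hypothesis DlP : forall m, P Dl@_m.
Hypothesis Dlk : forall i, killed (Dl * kdiff 'X_i).

(** Modulo [killed], multiplying [Dl] by p(Z) or by p(z) gives the same: this holds for the
    variables by assumption and is stable under sums and products. *)
Lemma pairing_P mu p : good mu -> pairing (fun y => mu (y * ev p)) Dl = ev p * pairing mu Dl.
Proof.
move=> hmu; rewrite -pairing_ev //.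
apply/eqP; rewrite -pairingC mulrC -subr_eq0 -pairingB -mulrBl; apply/eqP.
apply: pairing_killed => //; rewrite mulrC -/(kdiff p).
have kd := killed_ideal.
elim/mpolyind: p => [|c m p _ _ IH].
  by rewrite /kdiff !rmorph0 subrr mulr0; exact: (ideal0 kd).
have -> : kdiff (c *: 'X_[m] + p) = kdiff (c *: 'X_[m]) + kdiff p.
  by rewrite /kdiff !rmorphD /= opprD addrACA.
rewrite mulrDr; apply: (idealD kd) => //.
have -> : kdiff (c *: 'X_[m]) = (a c)%:MP * kdiff 'X_[m].
  rewrite /kdiff mulrBr map_mpolyZ -mul_mpolyC; congr (_ - _).
  by rewrite mmapZ rmorphM.
rewrite mulrCA; apply: (idealM _ kd) => //.
have H (S : {mpoly k[n]} -> Prop) : S 1 -> (forall i, S 'X_i) -> (forall x y, S x -> S y -> S (x * y)) ->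
    forall m, S 'X_[m].
  move=> S1 SX SM m'; rewrite mpolyXE_id; apply: big_ind => // i _.
  by elim: (m' i) => [|j IHj]; rewrite ?expr0 // exprS; apply: SM.
move: m; apply: (H (fun p => killed (Dl * kdiff p))) => //.
  by rewrite /kdiff !rmorph1 subrr mulr0; exact: (ideal0 kd).
move=> x y hx hy; have -> : kdiff (x * y) = cmap x * kdiff y + (ev y)%:MP * kdiff x.
  by rewrite /kdiff !rmorphM /=; ring.
by rewrite mulrDr !(mulrCA Dl); apply: (idealD kd) => //; apply: (idealM _ kd).
Qed.

Lemma pairing_Q mu v : good mu -> Q v -> pairing (fun y => mu (y * v)) Dl = v * pairing mu Dl.
Proof.
move=> hmu hv; have [p [[r hr] reg]] := denP hv.
apply/eqP; rewrite -subr_eq0; apply/eqP; apply: reg.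
rewrite mulrBr -pairing_P; last exact: good_mul.
rewrite mulrA hr -pairing_P // -hr; apply/eqP; rewrite subr_eq0; apply/eqP.
by apply: pairing_ext => x _; rewrite mulrA.
Qed.

(* Lagrange interpolation at the conjugates of z, expressed by traces. *)
Theorem lipman_sathaye_core v : Q v -> P (mmap idfun z Dl * v).
Proof.
move=> hv.
have domE : forall x y : E, x * y = 0 -> x = 0 \/ y = 0.
  by move=> x y /eqP; rewrite mulf_eq0 => /orP[/eqP|/eqP]; [left|right].
have [l [co [d [d0 lQ hco coD coZ]]]] := @torsion_free_coord E E V idfun s domE
  (fun e h => etrans (congr1 s h) (rmorph0 s)) l0.
have lQ' (j : 'I_(size l)) : Q l`_j by apply/lQ/mem_nth.
pose mu (j : nat) x := s (co j x).
have gmu (j : 'I_(size l)) : good (mu j).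
  split=> [x y hx hy|e x hx]; first by rewrite /mu coD // rmorphD.
  by rewrite /mu coZ // rmorphM.
have exp x : Q x -> s d * x = \sum_(j < size l) s (co j x) * l`_j.
  by move=> hx; have [c [-> hc]] := hco x hx; apply: eq_bigr => j _; rewrite hc.
(* [tr] is d times the trace of multiplication by x in the basis [l]; [dtr] divides by d because the
   trace of an integral element lies in E. *)
pose tr x := \sum_(j < size l) co j (x * l`_j).
have dtr x : Q x -> exists t, tr x = d * t.
  move=> hx; have [p pm px] := fg_subring_integral hQ hx.
  pose M y : 'M[E]_(size l) := \matrix_(i, j) co j (y * l`_i).
  have coS (j : 'I_(size l)) (T : Type) (r : seq T) (G : T -> V) : (forall i, Q (G i)) ->
      co j (\sum_(i <- r) G i) = \sum_(i <- r) co j (G i).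
    move=> hG; elim: r => [|x0 r IHr].
      by rewrite !big_nil; have := coZ j 0 0 (ltn_ord j) (mspan0 _ _); rewrite rmorph0 !mul0r.
    by rewrite !big_cons coD ?IHr //; apply: mspan_sum.
  have MM y w : Q y -> Q w -> d *: M (y * w) = M w *m M y.
    move=> hy hw; apply/matrixP => i j; rewrite !mxE.
    have h1 : Q (w * l`_i) by apply: QM.
    rewrite -mulrA -[LHS]coZ //; last exact: QM.
    rewrite mulrCA exp // mulr_sumr.
    rewrite coS => [|m]; last by apply: QM => //; apply: QM => //; exact: Qs.
    by apply: eq_bigr => m _; rewrite !mxE mulrCA coZ //; apply: QM.
  pose X : 'M[{fraction E}]_(size l) := (tofrac d)^-1 *: map_mx (@tofrac E) (M x).
  have d0' : tofrac d != 0 by rewrite tofrac_eq0; apply/eqP.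
  have xi i : Q (x ^+ i) by elim: i => // i IH; rewrite exprS; apply: QM.
  have XE i : X ^+ i.+1 = (tofrac d)^-1 *: map_mx (@tofrac E) (M (x ^+ i.+1)).
    elim: i => [|i IH]; first by rewrite !expr1.
    rewrite exprSr IH /X -!mulmxE -scalemxAl -scalemxAr -map_mxM.
    by rewrite -MM // -exprS map_mxZ !scalerA ?mulfVK ?mulVf ?mulr1 // -?mulrA ?mulVf ?mulr1.
  (* The extra factor removes the constant term, so that only the positive powers of [X] described
     by [XE] occur. *)
  pose g := 'X * p.
  have MS : M (\sum_(i < size g) s g`_i * x ^+ i) = \sum_(i < size g) g`_i *: M (x ^+ i).
    apply/matrixP=> i j; rewrite summxE !mxE mulr_suml coS => [|m]; last first.
      by apply: QM => //; apply: QM => //; exact: Qs.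
    by apply: eq_bigr => m _; rewrite !mxE -mulrA coZ //; apply: QM.
  have gx : \sum_(i < size g) s g`_i * x ^+ i = 0.
    transitivity (map_poly s g).[x]; last first.
      by rewrite rmorphM hornerM (eqP px) mulr0.
    rewrite (horner_coef_wide _ (size_poly _ _)).
    by apply: eq_bigr => i _; rewrite coef_map.
  have [||e he] := @trace_integral E hE _ X g.
  - by rewrite monicMl ?monicX.
  - transitivity ((tofrac d)^-1 *: map_mx (@tofrac E) (M (\sum_(i < size g) s g`_i * x ^+ i))).
      rewrite MS raddf_sum scaler_sumr; apply: eq_bigr => -[[|i] hi] _ /=.
        by rewrite coefXM /= rmorph0 !scale0r map_mx0 scaler0.
      by rewrite XE map_mxZ !scalerA mulrC.
    rewrite gx; apply/matrixP => i j; rewrite !mxE mul0r.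
    have -> : co j 0 = 0 by have := coZ j 0 0 (ltn_ord j) (mspan0 _ _); rewrite rmorph0 !mul0r.
    by rewrite rmorph0 mulr0.
  exists e; apply/eqP; rewrite -tofrac_eq rmorphM /= -he /X mxtraceZ mulrA mulfV // mul1r.
  rewrite trace_map_mx; apply/eqP; congr tofrac; apply: eq_bigr => i _; by rewrite mxE.
have l0n x : Q x -> s d * x = \sum_(j < size l) l`_j * s (co j x).
  by move=> /exp ->; apply: eq_bigr => j _; rewrite mulrC.
have step1 : s d * mmap idfun z Dl = \sum_(j < size l) l`_j * pairing (mu j) Dl.
  rewrite /mmap mulr_sumr; under [RHS]eq_bigr do rewrite /pairing mulr_sumr.
  rewrite exchange_big /=; apply: eq_bigr => m _.
  rewrite mulrCA l0n // mulr_sumr; apply: eq_bigr => j _; by rewrite mulrCA.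
have /choice[t ht] : forall m, exists t, tr (mmap1 z m * v) = d * t.
  by move=> m; apply: dtr; apply: QM.
have step2 : s d * (mmap idfun z Dl * v) = s d * \sum_(m <- msupp Dl) Dl@_m * s (t m).
  rewrite mulrA step1 mulr_suml.
  have -> : \sum_(j < size l) l`_j * pairing (mu j) Dl * v =
      \sum_(j < size l) pairing (fun y => mu j (y * (v * l`_j))) Dl.
    apply: eq_bigr => j _; rewrite pairing_Q //; last exact: QM.
    by rewrite mulrAC [l`_j * v]mulrC.
  rewrite /pairing exchange_big mulr_sumr; apply: eq_bigr => m _.
  rewrite -mulr_sumr mulrCA -rmorphM -ht /tr rmorph_sum; congr (_ * _).
  by apply: eq_bigr => j _; rewrite mulrA.
have -> : mmap idfun z Dl * v = \sum_(m <- msupp Dl) Dl@_m * s (t m).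
  apply/eqP; rewrite -subr_eq0; apply/eqP; apply: (sreg d0).
  by rewrite mulrBr step2 subrr.
apply: big_ind => [|x y [p ->] [q ->]|m _].
- by exists 0; rewrite rmorph0.
- by exists (p + q); rewrite rmorphD.
- by have [p ->] := DlP m; have [q ->] := sP (t m); exists (p * q); rewrite rmorphM.
Qed.

End LipmanSathaye.

(** * Hefer decompositions of the relations between the variables *)

Section HeferRows.
Variables (k : fieldType) (V : comNzRingType) (a : {rmorphism k -> V}).
Variables (n : nat) (z : 'I_n -> V).
Local Notation ev := (mmap a z).
Local Notation VZ := {mpoly V[n]}.
Local Notation cmap := (map_mpoly a).
Local Notation kd := (kdiff a z).
Local Notation at_z := (mmap idfun z).

Definition pol : set V := [set x | exists p : {mpoly k[n]}, x = ev p].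

Lemma polD x y : pol x -> pol y -> pol (x + y).
Proof. by move=> [p ->] [q ->]; exists (p + q); rewrite rmorphD. Qed.
Lemma polM x y : pol x -> pol y -> pol (x * y).
Proof. by move=> [p ->] [q ->]; exists (p * q); rewrite rmorphM. Qed.
Lemma polC c : pol (a c). Proof. by exists c%:MP; rewrite mmapC. Qed.
Lemma pol0 : pol 0. Proof. by exists 0; rewrite rmorph0. Qed.
Lemma pol1 : pol 1. Proof. by exists 1; rewrite rmorph1. Qed.
Lemma polz i : pol (z i). Proof. by exists 'X_i; rewrite mmapX mmap1U. Qed.
Lemma polX x j : pol x -> pol (x ^+ j).
Proof. by move=> [p ->]; exists (p ^+ j); rewrite rmorphXn. Qed.
Lemma pol_sum (T : Type) (r : seq T) (Pr : pred T) (G : T -> V) :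
  (forall i, Pr i -> pol (G i)) -> pol (\sum_(i <- r | Pr i) G i).
Proof. by move=> h; apply: big_ind => //; [exact: pol0|exact: polD]. Qed.
Lemma pol_subalg : subalgebra a pol.
Proof. by split; [exact: polC|exact: polD|exact: polM]. Qed.

Definition coefP : set VZ := [set q | forall m, pol q@_m].

Lemma coefPD p q : coefP p -> coefP q -> coefP (p + q).
Proof. by move=> hp hq m; rewrite mcoeffD; apply: polD. Qed.
Lemma coefP0 : coefP 0. Proof. by move=> m; rewrite mcoeff0; apply: pol0. Qed.
Lemma coefPC x : pol x -> coefP x%:MP.
Proof.
by move=> hx m; rewrite mcoeffC; case: eqP => _; rewrite ?mulr1 ?mulr0 //; apply: pol0.
Qed.
Lemma coefPM p q : coefP p -> coefP q -> coefP (p * q).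
Proof.
move=> hp hq m; rewrite mcoeffM; apply: pol_sum => i _; exact: polM.
Qed.
Lemma coefPmap p : coefP (cmap p).
Proof. by move=> m; rewrite mcoeff_map_mpoly; apply: polC. Qed.
Lemma coefP_sum (T : Type) (r : seq T) (Pr : pred T) (G : T -> VZ) :
  (forall i, Pr i -> coefP (G i)) -> coefP (\sum_(i <- r | Pr i) G i).
Proof. by move=> h; apply: big_ind => //; [exact: coefP0|exact: coefPD]. Qed.
Lemma coefP_prod (T : Type) (r : seq T) (Pr : pred T) (G : T -> VZ) :
  (forall i, Pr i -> coefP (G i)) -> coefP (\prod_(i <- r | Pr i) G i).
Proof.
by move=> h; apply: big_ind => //; [rewrite -mpolyC1; apply: coefPC; exact: pol1|exact: coefPM].
Qed.
Lemma coefPX p j : coefP p -> coefP (p ^+ j).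
Proof.
move=> hp; elim: j => [|j IH]; last by rewrite exprS; apply: coefPM.
by rewrite expr0 -mpolyC1; apply: coefPC; exact: pol1.
Qed.

Definition algn (A : pred 'I_n) : set V :=
  [set x | forall S : set V, subalgebra a S -> (forall i, A i -> S (z i)) -> S x].

Definition hefer (A : pred 'I_n) (p : {mpoly k[n]}) := exists h : 'I_n -> VZ,
  [/\ kd p = \sum_i h i * kd 'X_i, forall i, coefP (h i) & forall i, ~~ A i -> h i = 0].

Lemma algn_hefer A x : algn A x -> exists p, ev p = x /\ hefer A p.
Proof.
move=> hx; apply: (hx [set x | exists p, ev p = x /\ hefer A p]); last first.
  move=> i Ai; exists 'X_i; rewrite mmapX mmap1U; split=> //.
  exists (fun j => (i == j)%:R); split=> [|j|j nA].
  - rewrite (bigD1 i) //= eqxx mul1r big1 ?addr0 // => j.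
    by rewrite eq_sym => /negPf ->; rewrite mul0r.
  - by case: eqP => _; [rewrite -mpolyC1; apply: coefPC; exact: pol1|exact: coefP0].
  - by case: eqP nA => // <-; rewrite Ai.
split=> [c|x' y' [p [<- [h [hE hC h0]]]] [q [<- [g [gE gC g0]]]]|
    x' y' [p [<- [h [hE hC h0]]]] [q [<- [g [gE gC g0]]]]].
- exists c%:MP; rewrite mmapC; split=> //; exists (fun=> 0); split=> // [|i]; last exact: coefP0.
  by rewrite big1 => [|i _]; rewrite ?mul0r // /kdiff map_mpolyC mmapC subrr.
- exists (p + q); rewrite rmorphD; split=> //; exists (fun i => h i + g i); split=> [|i|i nA].
  + have -> : kd (p + q) = kd p + kd q by rewrite /kdiff !rmorphD /= opprD addrACA.
    by rewrite hE gE -big_split; apply: eq_bigr => i _; rewrite mulrDl.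
  + exact: coefPD.
  + by rewrite h0 // g0 // addr0.
- exists (p * q); rewrite rmorphM; split=> //.
  exists (fun i => (ev q)%:MP * h i + cmap p * g i); split=> [|i|i nA].
  + have -> : kd (p * q) = (ev q)%:MP * kd p + cmap p * kd q.
      by rewrite /kdiff !rmorphM /=; ring.
    rewrite hE gE !mulr_sumr -big_split; apply: eq_bigr => i _.
    by rewrite mulrDl !mulrA.
  + apply: coefPD; apply: coefPM => //; last exact: coefPmap.
    by apply: coefPC; exists q.
  + by rewrite h0 // g0 // !mulr0 addr0.
Qed.

(** The coefficients of G contribute their own decompositions, supported on A; the powers of the new
    variable contribute the divided differences of Z_j^l at z_j, whose values l z_j^(l-1) add up to
    the derivative. The support condition makes the matrix of all rows triangular. *)
Lemma bound_row (A : pred 'I_n) (j : 'I_n) (G : {poly V}) :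
  ~~ A j -> (forall l, algn A G`_l) -> G.[z j] = 0 ->
  exists (F : {mpoly k[n]}) (h : 'I_n -> VZ), [/\ ev F = 0,
    kd F = \sum_i h i * kd 'X_i, forall i, coefP (h i),
    forall i, ~~ A i -> i != j -> h i = 0 & at_z (h j) = G^`().[z j]].
Proof.
move=> nAj hG Gz.
have /choice[p hp] : forall l, exists p, ev p = G`_l /\ hefer A p by move=> l; apply: algn_hefer.
have /choice[h hh] : forall l, exists h : 'I_n -> VZ, [/\ kd (p l) = \sum_i h i * kd 'X_i,
    forall i, coefP (h i) & forall i, ~~ A i -> h i = 0] by move=> l; exact: (hp l).2.
pose dq l : VZ := \sum_(t < l) 'X_j ^+ (l.-1 - t) * (z j ^+ t)%:MP.
exists (\sum_(l < size G) p l * 'X_j ^+ l).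
exists (fun i => \sum_(l < size G) ((z j ^+ l)%:MP * h l i + (i == j)%:R * (cmap (p l) * dq l))).
have zX : ev 'X_j = z j by rewrite mmapX mmap1U.
have cX : cmap 'X_j = 'X_j by rewrite map_mpolyX.
have dqC l : coefP (dq l).
  apply: coefP_sum => t _; apply: coefPM; last by apply: coefPC; apply: polX; apply: polz.
  by rewrite -cX -rmorphXn; apply: coefPmap.
split.
- rewrite -Gz horner_coef rmorph_sum; apply: eq_bigr => l _.
  by rewrite rmorphM rmorphXn /= zX (hp l).1.
- have kdS (T : Type) (r : seq T) (f : T -> {mpoly k[n]}) :
    kd (\sum_(l <- r) f l) = \sum_(l <- r) kd (f l).
    elim: r => [|x0 r IHr]; first by rewrite !big_nil /kdiff !rmorph0 subrr.
    by rewrite !big_cons -IHr /kdiff !rmorphD /= opprD addrACA.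
  rewrite kdS; under [RHS]eq_bigr do rewrite mulr_suml.
  rewrite exchange_big; apply: eq_bigr => l _ /=.
  have -> : kd (p l * 'X_j ^+ l) = (z j ^+ l)%:MP * kd (p l) + cmap (p l) * dq l * kd 'X_j.
    rewrite /kdiff !rmorphM !rmorphXn /= cX zX.
    have E : 'X_j ^+ l - (z j ^+ l)%:MP = dq l * ('X_j - (z j)%:MP) :> VZ.
      rewrite /dq; case: (val l) => [|l']; first by rewrite big_ord0 mul0r !expr0 mpolyC1 subrr.
      rewrite [RHS]mulrC rmorphXn subrXX; congr (_ * _); apply: eq_bigr => t _.
      by rewrite rmorphXn.
    rewrite -mulrA -E rmorphXn; ring.
  have [-> _ _] := hh l; rewrite mulr_sumr [in LHS](bigD1 j) //= [in RHS](bigD1 j) //=.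
  rewrite eqxx mul1r mulrDl -!mulrA -!addrA; congr (_ + _); rewrite addrC; congr (_ + _).
  apply: eq_bigr => i ij; by rewrite (negPf ij) mul0r addr0 mulrA.
- move=> i; apply: coefP_sum => l _; have [_ hC _] := hh l; apply: coefPD.
    by apply: coefPM => //; apply: coefPC; apply: polX; apply: polz.
  case: eqP => _; last by rewrite mul0r; exact: coefP0.
  by rewrite mul1r; apply: coefPM => //; apply: coefPmap.
- move=> i nA ij; rewrite big1 // => l _; have [_ _ h0] := hh l.
  by rewrite h0 // (negPf ij) mulr0 mul0r addr0.
- rewrite rmorph_sum (horner_coef_wide _ (size_poly _ _)).
  have cz q : at_z (cmap q) = ev q.
    elim/mpolyind: q => [|c m q _ _ IH]; first by rewrite !rmorph0.
    by rewrite !rmorphD /= IH map_mpolyZ map_mpolyX !mmapZ !mmapX.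
  have E (l : 'I_(size G)) : at_z ((z j ^+ l)%:MP * h l j + (j == j)%:R * (cmap (p l) * dq l)) =
      G`_l * (z j ^+ l.-1 *+ l).
    have [_ _ h0] := hh l; rewrite h0 // mulr0 add0r eqxx mul1r rmorphM /= cz (hp l).1.
    congr (_ * _); rewrite rmorph_sum /=.
    transitivity (\sum_(t < l) z j ^+ l.-1); last by rewrite sumr_const card_ord.
    apply: eq_bigr => t _; rewrite rmorphM rmorphXn /= mmapX mmap1U mmapC /= -exprD subnK //.
    by rewrite -ltnS (ltn_predK (ltn_ord t)).
  rewrite (eq_bigr _ (fun l _ => E l)); case: (size G) => [|N] /=.
    by rewrite !big_ord0.
  rewrite big_ord_recl /= mulr0n mulr0 add0r.
  by apply: eq_bigr => l _; rewrite coef_poly ltn_ord mulrnAr mulrnAl.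
Qed.

End HeferRows.

(** * The determinantal multiplier *)

Section LipmanSathayeDet.
Variables (k : fieldType) (V : comNzRingType) (a : {rmorphism k -> V}).
Variables (m r : nat) (z : 'I_(m + r) -> V) (G : 'I_r -> {poly V}).
Hypothesis hG : forall (b : 'I_r) (l : nat), algn a z (fun i => (i < m + b)%N) (G b)`_l.
Hypothesis Gz : forall b : 'I_r, (G b).[z (rshift m b)] = 0.
Local Notation ev := (mmap a z).
Local Notation VZ := {mpoly V[m + r]}.
Local Notation kd := (kdiff a z).
Local Notation at_z := (mmap idfun z).

Lemma coefP_det N (M : 'M[VZ]_N) : (forall i j, coefP a z (M i j)) -> coefP a z (\det M).
Proof.
move=> hM; apply: coefP_sum => s _; apply: coefPM; last exact: coefP_prod.
apply: coefPX; have -> : -1 = (a (-1))%:MP :> VZ by rewrite !rmorphN1.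
by apply: coefPC; apply: polC.
Qed.

(** Each bound variable gives the row of its Hefer decomposition, and each z_i minus its combination
    of bound variables, being in E, gives a row of (1 | -C). Every row applied to the vector of Z_j
    - z_j lands in [killed]; by the adjugate so does the determinant times each Z_j - z_j, so it can
    serve as [Dl]. [B] and [T] are fixed before [E] and [C], which keeps the determinant polynomial
    in C. *)
Theorem ls_det : exists (B : 'M[V]_(r, m)) (T : 'M[V]_r),
  \det T = \prod_b ((G b)^`()).[z (rshift m b)] /\
  forall (E : idomainType) (s : {rmorphism E -> V}) (l0 : seq V) (C : 'M[k]_(m, r)),
  (forall c, exists e, a c = s e) -> cic E -> (forall e, e <> 0 -> forall v, s e * v = 0 -> v = 0) ->
  fg_subring s l0 -> (forall i, mspan s l0 (z i)) -> (forall e, pol a z (s e)) ->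
  (forall v, mspan s l0 v -> exists p, pol a z (ev p * v) /\ forall w, ev p * w = 0 -> w = 0) ->
  (forall i, exists e, z (lshift r i) - \sum_b a (C i b) * z (rshift m b) = s e) ->
  forall v, mspan s l0 v -> pol a z (\det (block_mx 1%:M (- map_mx a C) B T) * v).
Proof.
have /choice[F hF] : forall b : 'I_r, exists F : {mpoly k[m + r]}, exists h : 'I_(m + r) -> VZ, [/\ ev F = 0,
    kd F = \sum_i h i * kd 'X_i, forall i, coefP a z (h i),
    forall i : 'I_(m + r), ~~ (i < m + b)%N -> i != rshift m b -> h i = 0
    & at_z (h (rshift m b)) = (G b)^`().[z (rshift m b)]].
  by move=> b; apply: (bound_row (A := fun i => (i < m + b)%N)); rewrite ?ltnn.
have /choice[h hh] := hF.
pose Bz : 'M[VZ]_(r, m) := \matrix_(b, i) h b (lshift r i).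
pose Tz : 'M[VZ]_r := \matrix_(b, c) h b (rshift m c).
exists (map_mx at_z Bz), (map_mx at_z Tz); split.
  rewrite det_trig; first by apply: eq_bigr => b _; rewrite !mxE; have [_ _ _ _ ->] := hh b.
  apply/is_trig_mxP => b c bc; rewrite !mxE; have [_ _ _ h0 _] := hh b; rewrite h0 ?rmorph0 //=.
    by rewrite -leqNgt leq_add2l; exact: ltnW bc.
  by rewrite eq_rshift; apply/eqP => cb; move: bc; rewrite cb ltnn.
move=> E s l0 C aE hE sreg hQ zQ sP denP hC v hv.
pose H : 'M[VZ]_(m + r) := block_mx 1%:M (- map_mx (@mpolyC _ _ \o a) C) Bz Tz.
have -> : block_mx 1%:M (- map_mx a C) (map_mx at_z Bz) (map_mx at_z Tz) = map_mx at_z H.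
  rewrite /H map_block_mx map_mx1 map_mxN; congr (block_mx _ (- _) _ _).
  by apply/matrixP => i j; rewrite !mxE /= mmapC.
rewrite det_map_mx; apply: (@lipman_sathaye_core k E V s a l0 aE hE sreg hQ _ z zQ sP denP) => //.
  apply: coefP_det => i j.
  case: (split_ordP i) => i' ->; case: (split_ordP j) => j' ->.
  - rewrite block_mxEul mxE; case: eqP => _ /=; [rewrite -mpolyC1; apply: coefPC; exact: pol1|exact: coefP0].
  - rewrite block_mxEur !mxE /= -rmorphN; apply: coefPC; rewrite -rmorphN; exact: polC.
  - by rewrite block_mxEdl mxE; have [] := hh i'.
  - by rewrite block_mxEdr mxE; have [] := hh i'.
have kd0 : is_ideal (killed s a z) by exact: killed_ideal.
pose X : 'cV[VZ]_(m + r) := \col_j kd 'X_j.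
have HX i : killed s a z ((H *m X) i 0).
  case: (split_ordP i) => i' ->; last first.
    have [F0 FE _ _ _] := hh i'.
    have -> : (H *m X) (rshift m i') 0 = kd (F i').
      rewrite FE mxE; apply: eq_bigr => j _; rewrite [X j 0]mxE; congr (_ * _).
      by case: (split_ordP j) => j' ->; rewrite ?block_mxEdl ?block_mxEdr mxE.
    by apply: (@killed_kdiff _ _ _ _ _ _ _ _ 0); rewrite rmorph0.
  have [e he] := hC i'.
  pose p : {mpoly k[m + r]} := 'X_(lshift r i') - \sum_b (C i' b)%:MP * 'X_(rshift m b).
  have -> : (H *m X) (lshift r i') 0 = kd p.
    rewrite mxE big_split_ord /= (bigD1 i') //= block_mxEul !mxE eqxx mul1r big1 ?addr0; last first.
      by move=> j /negPf ji; rewrite block_mxEul !mxE eq_sym ji mul0r.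
    have kdB p' q : kd (p' - q) = kd p' - kd q by rewrite /kdiff !rmorphB /=; ring.
    rewrite kdB; congr (_ + _).
    have kdS (T : Type) (rr : seq T) (f : T -> {mpoly k[m + r]}) :
      kd (\sum_(l <- rr) f l) = \sum_(l <- rr) kd (f l).
      elim: rr => [|x0 rr IHr]; first by rewrite !big_nil /kdiff !rmorph0 subrr.
      by rewrite !big_cons -IHr /kdiff !rmorphD /= opprD addrACA.
    rewrite kdS -sumrN; apply: eq_bigr => b _.
    rewrite block_mxEur !mxE /= mulNr; congr (- _).
    by rewrite /kdiff !rmorphM /= map_mpolyC mmapC; ring.
  apply: (@killed_kdiff _ _ _ _ _ _ _ _ e); rewrite -he /p rmorphB rmorph_sum /= mmapX mmap1U.
  by congr (_ - _); apply: eq_bigr => b _; rewrite rmorphM /= mmapC mmapX mmap1U.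
move=> i.
have -> : \det H * kd 'X_i = \sum_j (\adj H) i j * (H *m X) j 0.
  transitivity ((\adj H *m (H *m X)) i 0); last by rewrite mxE.
  by rewrite mulmxA mul_adj_mx mul_scalar_mx !mxE.
by apply: ideal_sum => // j _; apply: (idealM _ kd0).
Qed.

End LipmanSathayeDet.

(** * Noether normalization *)

Lemma mmap_rmorph n (R : nzRingType) (V W : comNzRingType) (psi : {rmorphism V -> W})
    (f : R -> V) (h : 'I_n -> V) p : psi (mmap f h p) = mmap (psi \o f) (psi \o h) p.
Proof.
rewrite /mmap rmorph_sum; apply: eq_bigr => m _; rewrite rmorphM /mmap1 rmorph_prod.
by congr (_ * _); apply: eq_bigr => i _; rewrite rmorphXn.
Qed.

Lemma eq_mmap n (R V : nzRingType) (f g : R -> V) (h1 h2 : 'I_n -> V) p :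
  f =1 g -> h1 =1 h2 -> mmap f h1 p = mmap g h2 p.
Proof.
move=> fg h12; apply: eq_bigr => m _; rewrite fg; congr (_ * _).
by apply: eq_bigr => i _; rewrite h12.
Qed.

Lemma base_inj N n (f g : 'I_n -> nat) : (forall i, f i < N)%N -> (forall i, g i < N)%N ->
  (\sum_i f i * N ^ i = \sum_i g i * N ^ i)%N -> f =1 g.
Proof.
elim: n f g => [|n IH] f g fN gN; first by move=> _ [].
rewrite !big_ord_recl /= !muln1.
have E (u : 'I_n.+1 -> nat) : (\sum_(i < n) u (lift ord0 i) * N ^ bump 0 i =
    (\sum_(i < n) u (lift ord0 i) * N ^ i) * N)%N.
  by rewrite big_distrl; apply: eq_bigr => i _; rewrite /bump /= expnS; lia.
rewrite !E => e.
have N0 : (0 < N)%N by apply: leq_ltn_trans (fN ord0).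
have e0 : f ord0 = g ord0.
  by have := congr1 (modn^~ N) e; rewrite /= addnC modnMDl [(g _ + _)%N]addnC modnMDl !modn_small.
have e1 : (\sum_(i < n) f (lift ord0 i) * N ^ i = \sum_(i < n) g (lift ord0 i) * N ^ i)%N.
  by apply/eqP; rewrite -(eqn_pmul2r N0); apply/eqP; move: e; rewrite e0 => /addnI.
have h := IH (fun i => f (lift ord0 i)) (fun i => g (lift ord0 i)) (fun i => fN _) (fun i => gN _) e1.
by move=> i; case: (unliftP ord0 i) => [j ->|->].
Qed.

Definition kronecker N n (m : 'X_{1..n}) := (\sum_(i < n) m i * N ^ i)%N.

Lemma kronecker_inj N n (m1 m2 : 'X_{1..n}) : (mdeg m1 < N)%N -> (mdeg m2 < N)%N ->
  kronecker N m1 = kronecker N m2 -> m1 = m2.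
Proof.
move=> h1 h2 e; apply/mnmP; apply: (base_inj (N := N)) e => i.
  by apply: leq_ltn_trans h1; rewrite mdegE (bigD1 i) //= leq_addr.
by apply: leq_ltn_trans h2; rewrite mdegE (bigD1 i) //= leq_addr.
Qed.

Definition infinite_field (k : fieldType) := forall s : seq k, exists x, x \notin s.

Lemma infinite_poly_point (k : fieldType) (p : {poly k}) (s : seq k) : infinite_field k ->
  p != 0 -> exists2 x, x \notin s & p.[x] != 0.
Proof.
move=> hk p0.
have hn n : exists t : seq k, [/\ uniq t, size t = n & forall x, x \in t -> x \notin s].
  elim: n => [|n [t [ut st hs]]]; first by exists [::].
  have [x] := hk (t ++ s); rewrite mem_cat negb_or => /andP[xt xs]; exists (x :: t).
  by split; rewrite /= ?xt ?st // => y; rewrite inE => /orP[/eqP ->|/hs].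
have [t [ut st hs]] := hn (size p).
apply: contrapT => h; suff rt : all (root p) t by have := max_poly_roots p0 rt ut; rewrite st ltnn.
apply/allP => x xt; apply/negPn/negP => rx; apply: h; exists x; first exact: hs.
exact: rx.
Qed.

(** Kronecker substitution X_i -> X^(N^i) keeps distinct monomials distinct for N above the degree,
    which reduces the claim to one variable. *)
Lemma infinite_mpoly_point (k : fieldType) n (p : {mpoly k[n]}) : infinite_field k ->
  p != 0 -> exists c : 'I_n -> k, mmap idfun c p != 0.
Proof.
move=> hk p0; pose N := msize p.
pose q := mmap polyC (fun i : 'I_n => 'X^(N ^ i)) p.
have qE : q = \sum_(m <- msupp p) p@_m *: 'X^(kronecker N m).
  apply: eq_bigr => m _; rewrite mul_polyC; congr (_ *: _).
  by rewrite /mmap1 /kronecker expr_sum; apply: eq_bigr => i _; rewrite -exprM mulnC.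
have q0 : q != 0.
  apply/eqP => /(congr1 (fun q : {poly k} => q`_(kronecker N (mlead p)))).
  rewrite qE coef0 coef_sum (bigD1_seq (mlead p)) ?msupp_uniq ?mlead_supp //=.
  rewrite coefZ coefXn eqxx mulr1 big_seq_cond big1 ?addr0; last first.
    move=> m /andP[mp mn]; rewrite coefZ coefXn; case: eqP => [e|]; last by rewrite mulr0.
    case/eqP: mn; apply: (kronecker_inj (N := N)) (esym e); exact: msize_mdeg_lt (mlead_supp p0) || exact: msize_mdeg_lt mp.
  by apply/eqP; rewrite mleadc_eq0.
have [x _ qx] := infinite_poly_point [::] hk q0.
exists (fun i => x ^+ (N ^ i)); apply: contraNneq qx => <-.
rewrite -horner_evalE /q mmap_rmorph; apply/eqP/eq_mmap => i /=; rewrite /horner_eval ?hornerC ?hornerXn //.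
Qed.

Definition ext (T : Type) n (w : 'I_n -> T) (g : T) : 'I_n.+1 -> T :=
  fun i => oapp w g (unlift ord_max i).

Lemma ext_lift T n (w : 'I_n -> T) g j : ext w g (lift ord_max j) = w j.
Proof. by rewrite /ext liftK. Qed.
Lemma ext_max T n (w : 'I_n -> T) g : ext w g ord_max = g.
Proof. by rewrite /ext unlift_none. Qed.

Lemma coefM_top (R : comNzRingType) (p q : {poly R}) i j : (size p <= i.+1)%N ->
  (size q <= j.+1)%N -> (size (p * q)%R <= (i + j).+1)%N /\ (p * q)`_(i + j) = p`_i * q`_j.
Proof.
move=> hp hq; split; first by apply: leq_trans (size_polyMleq _ _) _; lia.
have hi : (i < (i + j).+1)%N by rewrite ltnS leq_addr.
rewrite coefM (bigD1 (Ordinal hi)) //= addKn big1 ?addr0 // => l /eqP li.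
have : nat_of_ord l <> i by move=> e; apply: li; apply: val_inj.
move=> {}li; case: (ltnP l i) => lt; last by rewrite (nth_default 0 (leq_trans hp _)) ?mul0r //; lia.
by rewrite [q`__](nth_default 0 (leq_trans hq _)) ?mulr0 //; lia.
Qed.

Lemma mmap1_top (R : comNzRingType) n (q : 'I_n -> {poly R}) (m : 'X_{1..n}) :
  (forall i, size (q i) <= 2)%N ->
  (size (mmap1 q m) <= (mdeg m).+1)%N /\
  (mmap1 q m)`_(mdeg m) = mmap1 (fun i => (q i)`_1) m.
Proof.
move=> hq.
have hX i j : (size (q i ^+ j) <= j.+1)%N /\ (q i ^+ j)`_j = (q i)`_1 ^+ j.
  elim: j => [|j [IH1 IH2]]; first by rewrite !expr0 size_poly1 coef1.
  by rewrite !exprS -IH2 -[j.+1]add1n; apply: coefM_top.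
rewrite mdegE /mmap1; elim/big_rec3: _ => [|i x d y _ [IH1 IH2]]; first by rewrite size_poly1 coef1.
have [h1 h2] := hX i (m i); rewrite -IH2 -h2; exact: coefM_top.
Qed.

(** The leading form of Phi is nonzero at some point, scaled to have last coordinate 1 and other
    coordinates c; [theta] is the leading form at (lam c, 1), so theta(1) is nonzero. A whole line
    of substitutions is kept because interpolation later returns to lam = 0, and c and theta are
    chosen before the ring in which the relation holds. *)
Lemma noether_step (k : fieldType) n (Phi : {mpoly k[n.+1]}) : infinite_field k -> Phi != 0 ->
  exists (c : 'I_n -> k) (theta : {poly k}), theta != 0 /\
    forall (V : comNzRingType) (a : {rmorphism k -> V}) (w : 'I_n -> V) g lam,
    theta.[lam] != 0 -> mmap a (ext w g) Phi = 0 ->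
    integralOver (mmap a (fun i => w i - a (lam * c i) * g)) g.
Proof.
move=> hk P0; pose D := (msize Phi).-1.
pose PD := \sum_(m <- msupp Phi | mdeg m == D) Phi@_m *: 'X_[m].
have sz : (mdeg (mlead Phi)).+1 = msize Phi by apply: mlead_deg.
have PD0 : PD != 0.
  apply/eqP => /(congr1 (mcoeff (mlead Phi))); rewrite mcoeff0 raddf_sum /=.
  rewrite big_mkcond (bigD1_seq (mlead Phi)) ?msupp_uniq ?mlead_supp //=.
  rewrite {1}/D -sz eqxx mcoeffZ mcoeffX eqxx mulr1 big1 ?addr0.
    by apply/eqP; rewrite mleadc_eq0.
  by move=> m /negPf mn; case: ifP => // _; rewrite mcoeffZ mcoeffX mn mulr0.
(* The additional factor forces the last coordinate of the point to be nonzero. *)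
have X0 : PD * 'X_ord_max != 0.
  rewrite mulf_neq0 //; apply/eqP => /(congr1 (mcoeff U_(ord_max)%MM)).
  by rewrite mcoeffX eqxx mcoeff0 => /eqP; rewrite oner_eq0.
have [e he] := infinite_mpoly_point hk X0.
have eM : mmap idfun e (PD * 'X_ord_max) = mmap idfun e PD * e ord_max.
  by rewrite (rmorphM (mmap (@idfun k) e)) /= mmapX mmap1U.
rewrite eM mulf_eq0 negb_or in he; have /andP[ePD eM0] := he.
pose c i := e (lift ord_max i) / e ord_max.
pose L : 'I_n.+1 -> {poly k} := ext (fun i => c i *: 'X) 1.
pose theta := mmap polyC L PD; exists c, theta.
have PDE (W : comNzRingType) (f : {rmorphism k -> W}) (h : 'I_n.+1 -> W) : mmap f h PD =
    \sum_(m <- msupp Phi | mdeg m == D) f Phi@_m * mmap1 h m.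
  rewrite (raddf_sum (mmap f h)) /=; apply: eq_bigr => m _; by rewrite mmapZ mmapX.
have th lam : theta.[lam] = mmap idfun (ext (fun i => lam * c i) 1) PD.
  rewrite -horner_evalE /theta mmap_rmorph; apply: eq_mmap => i /=; rewrite /horner_eval ?hornerC //.
  case: (unliftP ord_max i) => [j|] ->; rewrite /L ?ext_lift ?ext_max; [by rewrite hornerZ hornerX mulrC|by rewrite hornerC].
split.
  suff : e ord_max ^+ D * theta.[1] != 0 by apply: contraNneq => ->; rewrite horner0 mulr0.
  apply: contraNneq ePD => h0; rewrite -h0 th !PDE mulr_sumr; apply/eqP/eq_bigr => m /eqP <-.
  rewrite /= mulrCA; congr (_ * _); rewrite mdegE -prodrXr -big_split; apply: eq_bigr => i _ /=.
  rewrite -exprMn; congr (_ ^+ _); case: (unliftP ord_max i) => [j|] ->.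
    by rewrite ext_lift mul1r /c mulrCA mulfV ?mulr1.
  by rewrite ext_max mulr1.
move=> V a w g lam tl Pz; pose w' i := w i - a (lam * c i) * g.
pose lin : 'I_n.+1 -> {poly {mpoly k[n]}} :=
  ext (fun i => ('X_i)%:P + ((lam * c i)%:MP)%:P * 'X) 'X.
pose F := mmap (polyC \o @mpolyC n k) lin Phi.
have lin2 i : (size (lin i) <= 2)%N.
  rewrite /lin; case: (unliftP ord_max i) => [j|] ->; rewrite ?ext_lift ?ext_max ?size_polyX //.
  rewrite addrC mul_polyC; apply: leq_trans (size_polyD _ _) _; rewrite geq_max.
  rewrite (leq_trans (size_scale_leq _ _)) ?size_polyX //; exact: leq_trans (size_polyC_leq1 _) _.
have lin1 i : (lin i)`_1 = (ext (fun i => lam * c i) 1 i)%:MP.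
  rewrite /lin; case: (unliftP ord_max i) => [j|] ->; rewrite ?ext_lift ?ext_max ?coefX //.
  by rewrite coefD coefC add0r mul_polyC coefZ coefX mulr1.
have Ftop : (size F <= D.+1)%N /\ F`_D = (theta.[lam])%:MP.
  split.
    rewrite /F /mmap big_seq; apply: leq_trans (size_sum _ _ _) _; apply/bigmax_leqP_seq => m mP _ /=.
    rewrite mul_polyC; apply: leq_trans (size_scale_leq _ _) _.
    apply: leq_trans (mmap1_top m lin2).1 _; rewrite ltnS /D -ltnS prednK ?msize_mdeg_lt //.
    by rewrite -sz.
  rewrite /F /mmap coef_sum th PDE rmorph_sum [RHS]big_mkcond !big_seq; apply: eq_bigr => m mP /=.
  rewrite mul_polyC coefZ; case: eqP => mD.
    rewrite -mD (mmap1_top m lin2).2 rmorphM /mmap1 rmorph_prod; congr (_ * _).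
    by apply: eq_bigr => i _; rewrite lin1 rmorphXn.
  rewrite nth_default ?mulr0 //; apply: leq_trans (mmap1_top m lin2).1 _.
  have := msize_mdeg_lt mP; rewrite -sz ltnS /D -sz /= => h.
  by rewrite ltn_neqAle h andbT; apply/eqP => e'; apply: mD; rewrite e' /D -sz.
pose F1 := ((theta.[lam])^-1)%:MP *: F.
exists F1.
  have F1D : F1`_D = 1 by rewrite coefZ Ftop.2 -mpolyCM mulVf // mpolyC1.
  have sF : size F1 = D.+1.
    apply/eqP; rewrite eqn_leq (leq_trans (size_scale_leq _ _) Ftop.1) /=.
    by rewrite ltnNge; apply/negP => /(nth_default 0); rewrite F1D => /eqP; rewrite oner_eq0.
  by rewrite monicE lead_coefE sF F1D.
rewrite /F1 -mul_polyC rmorphM /root hornerM; apply/eqP.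
suff -> : (map_poly (mmap a w') F).[g] = 0 by rewrite mulr0.
pose psi : {rmorphism _ -> V} := horner_eval g \o map_poly (mmap a w').
rewrite -[LHS]/(psi F) /F mmap_rmorph.
rewrite -Pz; apply: eq_mmap => i /=; first by rewrite map_polyC /horner_eval hornerC /= mmapC.
rewrite /lin /horner_eval; case: (unliftP ord_max i) => [j|] ->; rewrite ?ext_lift ?ext_max.
  rewrite rmorphD rmorphM /= !map_polyC map_polyX !hornerE /= mmapC mmapX mmap1U.
  by rewrite /w' /c mulrA subrK.
by rewrite map_polyX hornerX.
Qed.

(** * Algebraic relations by counting monomials *)

Section Counting.
Variables (k : fieldType) (V : comNzRingType) (a : {rmorphism k -> V}).
Variables (M : nat) (U : 'I_M -> V).
Local Notation s := (mmap a U).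

Definition box d (p : {mpoly k[M]}) := forall m, m \in msupp p -> forall i, (m i <= d)%N.

Lemma box_le d d' p : (d <= d')%N -> box d p -> box d' p.
Proof. by move=> dd h m mp i; apply: leq_trans (h m mp i) dd. Qed.
Lemma box_msize p : box (msize p) p.
Proof.
move=> m mp i; apply: leq_trans (ltnW (msize_mdeg_lt mp)).
by rewrite mdegE (bigD1 i) //= leq_addr.
Qed.
Lemma boxM d d' p q : box d p -> box d' q -> box (d + d') (p * q).
Proof.
move=> hp hq m /msuppM_le /allpairsP[[m1 m2] /= [h1 h2 ->]] i.
by rewrite mnmDE leq_add ?hp ?hq.
Qed.
Lemma box_sum d (T : Type) (r : seq T) (P : pred T) (F : T -> {mpoly k[M]}) :
  (forall i, P i -> box d (F i)) -> box d (\sum_(i <- r | P i) F i).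
Proof.
move=> h; apply: big_ind => // [m|p q hp hq m /msuppD_le]; first by rewrite msupp0.
by rewrite mem_cat => /orP[/hp|/hq].
Qed.

Variable l : seq V.
Definition boxspan d v := exists p : nat -> {mpoly k[M]}, (forall j, box d (p j)) /\
  v = \sum_(j < size l) s (p j) * l`_j.

Lemma boxspan_mul x : (forall v, v \in l -> mspan s l (x * v)) ->
  exists D, forall d v, boxspan d v -> boxspan (d + D) (x * v).
Proof.
move=> hx; have /choice[t ht] : forall j : 'I_(size l), exists t : nat -> {mpoly k[M]},
    x * l`_j = \sum_(i < size l) s (t i) * l`_i by move=> j; apply: hx; apply: mem_nth.
exists (\sum_(j < size l) \sum_(i < size l) msize (t j i))%N => d v [p [pd ->]].
exists (fun i => \sum_(j < size l) if (i < size l)%N then p j * t j i else 0); split.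
  move=> i; apply: box_sum => j _; case: ltnP => il; last by move=> m; rewrite msupp0.
  apply: box_le (boxM (pd j) (@box_msize _)); rewrite leq_add2l.
  by rewrite (bigD1 j) //= (bigD1 (Ordinal il)) //= -addnA leq_addr.
rewrite mulr_sumr; under eq_bigr => j _ do rewrite mulrCA ht mulr_sumr.
rewrite exchange_big; apply: eq_bigr => i _; rewrite rmorph_sum mulr_suml.
by apply: eq_bigr => j _; rewrite ltn_ord rmorphM mulrA.
Qed.

Lemma boxspan_le d d' v : (d <= d')%N -> boxspan d v -> boxspan d' v.
Proof. by move=> dd [p [hp ->]]; exists p; split=> // j; apply: box_le dd _. Qed.

End Counting.

(** V may have zero divisors, so a count replaces transcendence degree. The products of rho^(n N)
    with the N^n monomials in z of exponents below N lie in the k-span of size l times (d+1)^M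
    elements, where d is linear in N. As M < n, a large N gives a linear dependence, from which rho
    is cancelled. *)
Theorem algebraic_relation (k : fieldType) (V : comNzRingType) (a : {rmorphism k -> V})
    M (U : 'I_M -> V) n (z : 'I_n -> V) rho :
  (M < n)%N -> (forall v, rho * v = 0 -> v = 0) -> integralOver (mmap a U) rho ->
  (forall i, integralOver (mmap a U) (rho * z i)) ->
  exists2 Phi : {mpoly k[n]}, Phi != 0 & mmap a z Phi = 0.
Proof.
move=> Mn rreg ri zi.
have [|l [[l1 lM ls] hl]] := @fg_subringE _ _ (mmap a U) (rho :: [seq rho * z i | i <- enum 'I_n]).
  by move=> x; rewrite inE => /orP[/eqP ->|/mapP[i _ ->]].
have lr : mspan (mmap a U) l rho by apply: hl; rewrite mem_head.
have lz i : mspan (mmap a U) l (rho * z i).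
  by apply: hl; rewrite inE; apply/orP; right; apply: map_f; rewrite mem_enum.
have [D1 hD1] : exists D, forall d v, boxspan a U l d v -> boxspan a U l (d + D) (rho * v).
  by apply: boxspan_mul => v vl; apply: lM => //; apply: mem_mspan.
have /choice[D2 hD2] : forall i, exists D, forall d v, boxspan a U l d v ->
    boxspan a U l (d + D) (rho * z i * v).
  by move=> i; apply: boxspan_mul => v vl; apply: lM => //; apply: mem_mspan.
pose D := (D1 + \sum_i D2 i)%N.
have hr d v : boxspan a U l d v -> boxspan a U l (d + D) (rho * v).
  by move=> /hD1; apply: boxspan_le; rewrite leq_add2l leq_addr.
have hz i d v : boxspan a U l d v -> boxspan a U l (d + D) (rho * z i * v).
  by move=> /(hD2 i); apply: boxspan_le; rewrite leq_add2l /D (bigD1 i) //=; lia.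
have [D0 h1] : exists D0, boxspan a U l D0 1.
  have [c ->] := l1; exists (\sum_(j < size l) msize (c j))%N.
  exists (fun j => if (j < size l)%N then c j else 0); split=> [j|].
    case: ltnP => jl; last by move=> m; rewrite msupp0.
    by apply: box_le (@box_msize _ _ _); rewrite (bigD1 (Ordinal jl)) //= leq_addr.
  by apply: eq_bigr => j _; rewrite ltn_ord.
(* Since d + 1 is at most N (D0 + n D + 1), this choice makes size l times (d+1)^M smaller than
   N^(M+1), hence than N^n. *)
pose N := (size l * (D0 + n * D + 1) ^ M).+1.
pose d := (D0 + n * (N * D))%N.
pose S := {ffun 'I_n -> 'I_N}; pose T := ('I_(size l) * {ffun 'I_M -> 'I_d.+1})%type.
have cardST : (#|{: T}| < #|{: S}|)%N.
  rewrite card_prod !card_ffun !card_ord.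
  have expn_mono x y e : (x <= y)%N -> (x ^ e <= y ^ e)%N.
    by case: e => // e xy; rewrite leq_exp2r.
  have h2 : ((d.+1) ^ M <= (N * (D0 + n * D + 1)) ^ M)%N.
    by apply: expn_mono; rewrite /d; have : (1 <= N)%N by []; nia.
  have h3 : (N ^ M.+1 <= N ^ n)%N by rewrite leq_pexp2l.
  apply: leq_trans h3; apply: leq_ltn_trans (leq_mul (leqnn _) h2) _.
  rewrite expnMn expnSr mulnCA ltn_pmul2l ?expn_gt0 //; exact: ltnSn.
have /choice[P hP] : forall al : S, exists p : nat -> {mpoly k[M]}, (forall j, box d (p j)) /\
    rho ^+ (n * N) * \prod_i z i ^+ al i = \sum_(j < size l) mmap a U (p j) * l`_j.
  move=> al; suff : boxspan a U l d (rho ^+ (n * N) * \prod_i z i ^+ al i) by [].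
  have -> : rho ^+ (n * N) * \prod_i z i ^+ al i = \prod_i (rho ^+ N * z i ^+ al i).
    by rewrite big_split prodr_const card_ord /= -exprM mulnC.
  have hzN i e v d0 : boxspan a U l d0 v -> boxspan a U l (d0 + e * D) ((rho * z i) ^+ e * v).
    elim: e => [|e IHe] hv; first by rewrite mul1r addn0.
    by rewrite exprS -mulrA mulSn [(D + _)%N]addnC addnA; apply/hz/IHe.
  have hrN e v d0 : boxspan a U l d0 v -> boxspan a U l (d0 + e * D) (rho ^+ e * v).
    elim: e => [|e IHe] hv; first by rewrite mul1r addn0.
    by rewrite exprS -mulrA mulSn [(D + _)%N]addnC addnA; apply/hr/IHe.
  have hI (r : seq 'I_n) : boxspan a U l (D0 + size r * (N * D)) (\prod_(i <- r) (rho ^+ N * z i ^+ al i)).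
    elim: r => [|i r IH]; first by rewrite big_nil addn0.
    rewrite big_cons; set x := \prod_(_ <- r) _.
    have -> : rho ^+ N * z i ^+ al i * x = rho ^+ (N - al i) * ((rho * z i) ^+ al i * x).
      by rewrite exprMn -{1}(subnK (ltnW (ltn_ord (al i)))) exprD; ring.
    have -> : (D0 + (size r).+1 * (N * D) = (D0 + size r * (N * D)) + al i * D + (N - al i) * D)%N.
      by rewrite -addnA -mulnDl subnKC ?mulSn; [lia|exact: ltnW].
    exact/hrN/hzN.
  have := hI (index_enum 'I_n); rewrite /d.
  by have -> : size (index_enum 'I_n) = n by rewrite /index_enum -enumT size_enum_ord.
pose eS (i : 'I_#|{: S}|) : S := enum_val i; pose eT (t : 'I_#|{: T}|) : T := enum_val t.
pose A : 'M[k]_(#|{: S}|, #|{: T}|) := \matrix_(i, t)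
  (P (eS i) (eT t).1)@_[multinom ((eT t).2 j : nat) | j < M].
have : kermx A != 0.
  rewrite kermx_eq0 /row_free; apply/eqP => e.
  by have := rank_leq_col A; rewrite e leqNgt cardST.
case/rowV0Pn => u /sub_kermxP uA /rV0Pn[i0 ui0].
pose mon (al : S) := [multinom (al j : nat) | j < n].
have mon_inj : injective mon.
  by move=> x y /mnmP h; apply/ffunP => j; apply: val_inj; have := h j; rewrite !mnmE.
exists (\sum_i u 0 i *: 'X_[mon (eS i)]).
  apply/eqP => /(congr1 (mcoeff (mon (eS i0)))); rewrite mcoeff0 raddf_sum /=.
  rewrite (bigD1 i0) //= mcoeffZ mcoeffX eqxx mulr1 big1 ?addr0; first exact/eqP.
  move=> i ii0; rewrite mcoeffZ mcoeffX; case: eqP => [/mon_inj/enum_val_inj e|]; last by rewrite mulr0.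
  by rewrite e eqxx in ii0.
have rregN e v : rho ^+ e * v = 0 -> v = 0.
  by elim: e => [|e IH]; rewrite ?mul1r // exprS -mulrA => /rreg/IH.
apply: (rregN (n * N)%N); rewrite rmorph_sum mulr_sumr.
transitivity (\sum_i \sum_(j < size l) mmap a U (u 0 i *: P (eS i) j) * l`_j).
  apply: eq_bigr => i _; rewrite /= mmapZ mmapX mulrCA.
  have -> : mmap1 z (mon (eS i)) = \prod_j z j ^+ (eS i) j.
    by apply: eq_bigr => j _; rewrite mnmE.
  by rewrite (hP _).2 mulr_sumr; apply: eq_bigr => j _; rewrite mmapZ mulrA.
rewrite exchange_big big1 // => j _; rewrite -mulr_suml -rmorph_sum /=.
suff -> : \sum_i u 0 i *: P (eS i) j = 0 by rewrite rmorph0 mul0r.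
apply/mpolyP => m; rewrite mcoeff0 raddf_sum /=.
have [md|] := pselect (forall i, (m i <= d)%N).
  pose t : T := (j, [ffun i => inord (m i)]).
  have /rowP/(_ (enum_rank t)) := uA; rewrite !mxE; apply: etrans; apply: eq_bigr => i _.
  rewrite mcoeffZ !mxE /eT enum_rankK /=; congr (_ * _@_ _); apply/mnmP => i'.
  by rewrite mnmE ffunE inordK // ltnS.
move=> hm; apply: big1 => i _; rewrite mcoeffZ memN_msupp_eq0 ?mulr0 //.
apply/negP => mP; apply: hm => i'; exact: (hP _).1 mP i'.
Qed.

Lemma int_eqn (E V : comNzRingType) (s : {rmorphism E -> V}) n (c : nat -> V) y : (0 < n)%N ->
  (forall i, (1 <= i <= n)%N -> integralOver s (c i)) ->
  y ^+ n + \sum_(1 <= i < n.+1) c i * y ^+ (n - i) = 0 -> integralOver s y.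
Proof.
move=> n0 hc hy; pose q := \sum_(1 <= i < n.+1) (c i)%:P * 'X^(n - i).
have sq : (size q <= n)%N.
  rewrite /q big_nat; apply: leq_trans (size_sum _ _ _) _; apply/bigmax_leqP_seq => i _ /andP[i1 i2].
  rewrite mul_polyC; apply: leq_trans (size_scale_leq _ _) _; rewrite size_polyXn; lia.
have mp : 'X^n + q \is monic by rewrite monicE lead_coefDl ?lead_coefXn // size_polyXn.
apply: (integral_root_monic mp).
  rewrite /root hornerD hornerXn horner_sum -[X in _ == X]hy; apply/eqP; congr (_ + _).
  by apply: eq_bigr => i _; rewrite hornerM hornerC hornerXn.
apply/integral_poly => j; rewrite coefD coefXn coef_sum; apply: integral_add; first exact: integral_nat.
rewrite big_nat; apply: big_ind => [|x z|i hi]; [exact: integral0|exact: integral_add|].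
by rewrite coefCM coefXn; apply: integral_mul; [apply: hc|exact: integral_nat].
Qed.

Lemma int_push (A B C E : comNzRingType) (s : {rmorphism A -> B}) (psi : {rmorphism B -> C})
    (s' : {rmorphism E -> C}) x :
  integralOver s x -> (forall e, integralOver s' (psi (s e))) -> integralOver s' (psi x).
Proof.
move=> [p mp px] h; apply: (@integral_root_monic _ _ _ _ (map_poly psi (map_poly s p))).
- by rewrite !monic_map.
- by rewrite rmorph_root.
- by apply/integral_poly => i; rewrite !coef_map; apply: h.
Qed.

Lemma int_mmap (k E V : comNzRingType) (s : {rmorphism E -> V}) (f : {rmorphism k -> V}) n
    (h : 'I_n -> V) p : (forall c, integralOver s (f c)) -> (forall i, integralOver s (h i)) ->
  integralOver s (mmap f h p).
Proof.
move=> hf hh; apply: big_ind => [|x y|m _]; [exact: integral0|exact: integral_add|].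
apply: integral_mul => //; apply: big_ind => [|x y|i _]; [exact: integral1|exact: integral_mul|].
by elim: (m i) => [|j IH]; [exact: integral1|rewrite exprS; apply: integral_mul].
Qed.

Lemma int_trans (k E V : comNzRingType) (s : {rmorphism E -> V}) (f : {rmorphism k -> V}) n
    (h : 'I_n -> V) x : integralOver (mmap f h) x ->
  (forall c, integralOver s (f c)) -> (forall i, integralOver s (h i)) -> integralOver s x.
Proof.
move=> hx hf hh; apply: (int_push (psi := idfun) hx) => e; exact: int_mmap.
Qed.

Lemma int_var (k V : comNzRingType) (f : {rmorphism k -> V}) n (h : 'I_n -> V) i :
  integralOver (mmap f h) (h i).
Proof. by have := integral_id (mmap f h) 'X_i; rewrite /= mmapX mmap1U. Qed.
Lemma int_const (k V : comNzRingType) (f : {rmorphism k -> V}) n (h : 'I_n -> V) c :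
  integralOver (mmap f h) (f c).
Proof. by have := integral_id (mmap f h) c%:MP; rewrite /= mmapC. Qed.

(** * Torsion-freeness over polynomial rings and generic linear combinations *)

Definition tf_over (k : fieldType) (V : comNzRingType) (a : {rmorphism k -> V}) M (U : 'I_M -> V) :=
  forall Phi : {mpoly k[M]}, Phi != 0 -> forall y, mmap a U Phi * y = 0 -> y = 0.

Lemma tf_poly (k : fieldType) (R : comNzRingType) (a : {rmorphism k -> R}) M (U : 'I_M -> R) :
  tf_over a U -> tf_over (polyC \o a) (ext (fun i => (U i)%:P) 'X).
Proof.
move=> tf Phi P0 y.
pose F := mmap (polyC \o @mpolyC M k) (ext (fun i => ('X_i)%:P) 'X) Phi.
have F0 : F != 0.
  apply: contraNneq P0 => F0.
  pose u : {rmorphism {mpoly k[M]} -> {mpoly k[M.+1]}} :=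
    mmap (@mpolyC M.+1 k) (fun i => 'X_(lift ord_max i)).
  pose g : {rmorphism {mpoly k[M.+1]} -> {mpoly k[M.+1]}} :=
    (horner_eval 'X_ord_max \o map_poly u) \o mmap (polyC \o @mpolyC M k) (ext (fun i => ('X_i)%:P) 'X).
  have gi : g =1 idfun.
    apply: (mpoly_hom_ext (g := idfun)) => [c|i] /=.
      by rewrite mmapC /= map_polyC /horner_eval hornerC /= mmapC.
    rewrite mmapX mmap1U /horner_eval; case: (unliftP ord_max i) => [j|] ->.
      by rewrite ext_lift map_polyC hornerC /= mmapX mmap1U.
    by rewrite ext_max map_polyX hornerX.
  by rewrite -[Phi]gi /g /= -/F F0 !rmorph0.
have -> : mmap (polyC \o a) (ext (fun i => (U i)%:P) 'X) Phi = map_poly (mmap a U) F.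
  rewrite /F (mmap_rmorph (map_poly (mmap a U))); apply: eq_mmap => i /=.
    by rewrite map_polyC /= mmapC.
  case: (unliftP ord_max i) => [j|] ->; rewrite ?ext_lift ?ext_max ?map_polyX //.
  by rewrite map_polyC /= mmapX mmap1U.
have lr : GRing.lreg (mmap a U (lead_coef F)).
  by apply: mulrI0_lreg => z; apply: tf; rewrite lead_coef_eq0.
have ln : mmap a U (lead_coef F) != 0 by apply: lreg_neq0.
move/eqP; rewrite mulrI_eq0; first by move/eqP.
by apply: lreg_lead; rewrite lead_coef_map_eq.
Qed.

Lemma ext_of T n (z : 'I_n.+1 -> T) : ext (fun i => z (lift ord_max i)) (z ord_max) =1 z.
Proof. by move=> i; case: (unliftP ord_max i) => [j|] ->; rewrite ?ext_lift ?ext_max. Qed.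

(** If Psi(w) kills y, then w satisfies a relation in V modulo the annihilator of y. There
    [noether_step] makes the M+1 elements U integral over only M elements, so they satisfy a
    relation too, and this relation kills y in V. *)
Lemma tf_exchange (k : fieldType) (V : comNzRingType) (a : {rmorphism k -> V}) M
    (U w : 'I_M.+1 -> V) : infinite_field k -> tf_over a U ->
  (forall i, integralOver (mmap a w) (U i)) -> tf_over a w.
Proof.
move=> hk tf hU Psi P0 y Py; apply: contrapT => y0.
pose I := [set r : V | r * y = 0].
have hI : is_ideal I.
  split; rewrite /I /=; [by rewrite mul0r|by move=> r1 r2 h1 h2; rewrite mulrDl h1 h2 addr0|].
  by move=> b r h; rewrite -mulrA h mulr0.
have [W [p [sp pI]]] := quot_ex hI (fun h : I 1 => y0 (etrans (esym (mul1r y)) h)).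
have [c [th [th0 hN]]] := noether_step hk P0.
have [lam _ hl] := infinite_poly_point [::] hk th0.
pose a' : {rmorphism k -> W} := p \o a.
pose g := p (w ord_max); pose w0 i := p (w (lift ord_max i)).
pose w2 i := w0 i - a' (lam * c i) * g.
have ig : integralOver (mmap a' w2) g.
  apply: hN => //; transitivity (p (mmap a w Psi)); last by apply/pI.
  rewrite mmap_rmorph; apply: eq_mmap => // i /=.
  by rewrite -[w i in RHS](ext_of w); case: (unliftP ord_max i) => [j|] ->; rewrite ?ext_lift ?ext_max.
have ia := int_const a' w2.
have iw i : integralOver (mmap a' w2) (p (w i)).
  case: (unliftP ord_max i) => [j|] -> //.
  rewrite -/(w0 j) -[w0 j](subrK (a' (lam * c j) * g)); apply: integral_add; first exact: int_var.
  by apply: integral_mul => //.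
have iU i : integralOver (mmap a' w2) (p (U i)).
  apply: (int_push (hU i)) => e; rewrite mmap_rmorph; exact: int_mmap.
have [||||Phi Phi0 hPhi] := @algebraic_relation k W a' _ w2 M.+1 (fun i => p (U i)) 1 => //.
- by move=> v; rewrite mul1r.
- exact: integral1.
- by move=> i; rewrite mul1r.
apply: y0; apply: (tf _ Phi0); apply/pI; rewrite mmap_rmorph -hPhi; exact: eq_mmap.
Qed.

(** More than M elements satisfy a relation, so that the last one becomes integral over the others
    once these are modified by multiples of it; induct on their number. For generators of J divided
    by tau this produces a reduction of J with as many generators as [W] has entries. *)
Lemma few_generators (k : fieldType) (V : comNzRingType) (a : {rmorphism k -> V}) M
    (W : 'I_M -> V) rho : infinite_field k -> (forall v, rho * v = 0 -> v = 0) ->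
  integralOver (mmap a W) rho ->
  forall N (b : 'I_N -> V), (forall i, integralOver (mmap a W) (rho * b i)) ->
  exists C : 'I_M -> 'I_N -> k,
    forall i, integralOver (mmap a (fun i => \sum_j a (C i j) * b j)) (b i).
Proof.
move=> hk hr ir; elim=> [|N IH] b hb; first by exists (fun _ _ => 0) => -[].
have [NM|MN] := leqP N.+1 M.
  exists (fun (i : 'I_M) (j : 'I_N.+1) => (nat_of_ord i == nat_of_ord j)%:R) => i.
  set h := (X in mmap a X); have -> : b i = h (widen_ord NM i).
    rewrite /h (bigD1 i) //= eqxx rmorph1 mul1r big1 ?addr0 // => j.
    by rewrite eq_sym -val_eqE /= => /negPf ->; rewrite rmorph0 mul0r.
  exact: int_var.
have [Phi P0 hPhi] := algebraic_relation MN hr ir hb.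
have [c [th [th0 hN]]] := noether_step hk P0.
have [lam _ hl] := infinite_poly_point [::] hk th0.
pose w0 i := b (lift ord_max i); pose g := b ord_max.
pose w2 i := w0 i - a (lam * c i) * g.
have ig : integralOver (mmap a w2) g.
  by apply: hN => //; rewrite -hPhi; apply: eq_mmap => //; apply: ext_of.
have [|C hC] := IH w2.
  move=> i; rewrite mulrBr mulrCA; apply: integral_sub; first exact: hb.
  by apply: integral_mul; [exact: int_const|exact: hb].
exists (fun i => ext (C i) (- \sum_j C i j * (lam * c j))).
set h := (X in mmap a X).
have hE : h =1 (fun i => \sum_j a (C i j) * w2 j).
  move=> i; rewrite /h big_ord_recr /= ext_max rmorphN rmorph_sum mulNr mulr_suml -sumrB.
  apply: eq_bigr => j _; rewrite rmorphM /w2 mulrBr mulrA; congr (_ * _ - _).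
    congr (a _); rewrite -[RHS](ext_lift (C i) (- \sum_j C i j * (lam * c j))); congr (ext _ _ _).
    by apply: val_inj; rewrite /= /bump leqNgt ltn_ord.
  by rewrite /w0; congr b; apply: val_inj; rewrite /= /bump leqNgt ltn_ord.
have {}hC i : integralOver (mmap a h) (w2 i).
  apply: (int_trans (hC i)) => [c'|i']; first exact: int_const.
  by rewrite -hE; apply: int_var.
have ig' : integralOver (mmap a h) g by apply: (int_trans ig) => // c'; exact: int_const.
move=> i; case: (unliftP ord_max i) => [j|] -> //.
rewrite -/(w0 j) -[w0 j](subrK (a (lam * c j) * g)); apply: integral_add; first exact: hC.
by apply: integral_mul; [exact: int_const|exact: ig'].
Qed.

(** * Briancon-Skoda for Lipman-Sathaye presentations *)

Definition alg_gen (k : fieldType) (R : comNzRingType) (a : {rmorphism k -> R}) (A : set R) : set R :=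
  [set x | forall S, subalgebra a S -> A `<=` S -> S x].

(* R is generated by free variables U and bound variables v_b, where v_b is a root of a
   polynomial with coefficients in the subalgebra generated by the preceding variables;
   Delta is the product of the derivatives of these polynomials. *)
Definition ls_presentation (k : fieldType) (R : comNzRingType) (a : {rmorphism k -> R}) M (Delta : R) :=
  exists (U : 'I_M -> R) (s : nat) (v : 'I_s -> R) (G : 'I_s -> {poly R}),
  [/\ tf_over a U, (forall x, integralOver (mmap a U) x),
      (forall x, alg_gen a (range U `|` range v) x),
      (forall (b : 'I_s) (l : nat), alg_gen a (range U `|` v @` [set b' : 'I_s | (b' < b)%N]) (G b)`_l)
    & (forall b, (G b).[v b] = 0) /\ Delta = \prod_b ((G b)^`()).[v b]].

Definition briancon_skoda (R : comPzRingType) (Delta : R) c :=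
  forall J, is_ideal J -> forall m x,
  integral_closure (ideal_pow J (m + c)) x -> ideal_pow J m (Delta * x).

(** With q1 the divided difference of q at a good point mu, q(0) = q(mu) - mu q1(0). The degree of
    q1 is smaller, and its values at the other good points are again in [P]. *)
Lemma infinite_value (k : fieldType) (V : comNzRingType) (a : {rmorphism k -> V}) (P : set V)
    (theta : {poly k}) (q : {poly V}) : infinite_field k -> subalgebra a P -> theta != 0 ->
  (forall lam, theta.[lam] != 0 -> P q.[a lam]) -> P q.[0].
Proof.
move=> hk [Pc PD PM] t0 h; have [d] := ubnP (size q); elim: d => // d IH in q theta t0 h *.
rewrite ltnS => sq; have [mu _ hmu] := infinite_poly_point [::] hk t0.
have [q1 qE] : exists q1, q - (q.[a mu])%:P = q1 * ('X - (a mu)%:P).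
  by apply/factor_theorem; rewrite /root hornerD hornerN hornerC subrr.
have qv x : q.[x] = q.[a mu] + q1.[x] * (x - a mu).
  by rewrite -hornerXsubC -hornerM -qE hornerD hornerN hornerC addrC subrK.
have [q10|q10] := eqVneq q1 0; first by rewrite qv q10 horner0 mul0r addr0; apply: h.
have sq1 : (size q1 < d)%N.
  have sq0 : (1 < size q)%N.
    rewrite ltnNge; apply/negP => s1; move: qE; rewrite (size1_polyC s1) hornerC subrr => /esym e.
    have := congr1 (size \o polyseq) e; rewrite /= size_Mmonic ?monicXsubC // size_XsubC size_poly0 addn2 /=.
    by have := q10; rewrite -size_poly_gt0; case: (size q1).
  have := congr1 (size \o polyseq) qE; rewrite /= size_Mmonic ?monicXsubC // size_XsubC addn2 /= => e.
  apply: leq_trans sq; rewrite -e; apply: leq_trans (size_polyD _ _) _.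
  by rewrite geq_max leqnn size_polyN (leq_trans (size_polyC_leq1 _)) // ltnW.
have P0 : P 0 by rewrite -(rmorph0 a).
have PN x : P x -> P (- x) by move=> Px; rewrite -mulN1r -(rmorphN1 a); apply: (PM).
rewrite qv sub0r mulrN; apply: (PD); first exact: h.
apply: (PN); apply: (PM); last exact: Pc.
apply: (IH _ (theta * ('X - mu%:P))) => //; first by rewrite mulf_neq0 // polyXsubC_eq0.
move=> lam; rewrite hornerM hornerXsubC mulf_eq0 negb_or => /andP[tl lm].
have -> : q1.[a lam] = a ((lam - mu)^-1) * (q.[a lam] - q.[a mu]).
  rewrite (qv (a lam)) [q.[a mu] + _]addrC addrK mulrCA -rmorphB -rmorphM mulVf //.
  by rewrite rmorph1 mulr1.
by apply: (PM) => //; apply: (PD); [apply: h|apply/PN/h].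
Qed.

Section RationalPowers.
Variables (R V : comNzRingType) (io : {rmorphism R -> V}) (t : V) (J : set R).
Variables (E : comNzRingType) (s' : {rmorphism E -> V}) (bs : seq R).
Hypothesis hio : forall r, integralOver s' (io r).
Hypothesis hbs : forall i, (i < size bs)%N -> integralOver s' (io bs`_i * t).
Hypothesis hJ : J = span bs.

Lemma int_pow_rees i y : ideal_pow J i y -> integralOver s' (io y * t ^+ i).
Proof.
have hJt x : J x -> integralOver s' (io x * t).
  rewrite hJ => -[c ->]; rewrite rmorph_sum mulr_suml.
  apply: big_ind => [|u v|j _]; [exact: integral0|exact: integral_add|].
  by rewrite rmorphM -mulrA; apply: integral_mul => //; apply: hbs.
move: y; apply: pow_ind => [|u v hu hv|b ys <- hys].
- by rewrite rmorph0 mul0r; exact: integral0.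
- by rewrite rmorphD mulrDl; apply: integral_add.
rewrite rmorphM -mulrA; apply: integral_mul => //; elim: ys hys => [|y ys IH] hys.
  by rewrite big_nil rmorph1 mulr1; apply: integral1.
rewrite big_cons rmorphM /= exprS mulrACA; apply: integral_mul.
  by apply/hJt/hys/mem_head.
by apply: IH => z zs; apply: hys; rewrite inE zs orbT.
Qed.

(** Multiplying an equation of degree n for x by t^(m n) turns it into one for x t^m with
    coefficients c_i t^(m i), which are integral because J t is. *)
Lemma int_closure_rees m x : integral_closure (ideal_pow J m) x -> integralOver s' (io x * t ^+ m).
Proof.
move=> [n [c [n0 hc hx]]].
apply: (@int_eqn _ _ s' n (fun i => io (c i) * t ^+ (m * i))) => // [i hi|].
  by apply: int_pow_rees; apply: powM; apply: hc.
transitivity (io (x ^+ n + \sum_(1 <= i < n.+1) c i * x ^+ (n - i)) * t ^+ (m * n)); last first.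
  by rewrite hx rmorph0 mul0r.
rewrite rmorphD rmorph_sum mulrDl mulr_suml.
rewrite rmorphXn exprMn -exprM; congr (_ + _). apply: eq_big_nat => i /andP[_ hi].
rewrite rmorphM rmorphXn exprMn -exprM mulrACA -exprD -mulnDr; congr (_ * t ^+ (_ * _)).
by rewrite subnKC.
Qed.
End RationalPowers.

Lemma horner_lin (A B : comNzRingType) (h : {rmorphism A -> B}) x y r :
  ((h x)%:P + (h y)%:P * 'X).[h r] = h (x + r * y).
Proof. by rewrite hornerD hornerM !hornerC hornerX mulrC -rmorphM -rmorphD. Qed.

Lemma preim_subalg (k : fieldType) (R V : comNzRingType) (a : {rmorphism k -> R})
    (psi : {rmorphism R -> V}) S : subalgebra (psi \o a) S -> subalgebra a (psi @^-1` S).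
Proof.
move=> [Sc SD SM]; split=> [c|u w hu hw|u w hu hw]; rewrite /preimage /=; first exact: Sc.
  by rewrite rmorphD; apply: SD.
by rewrite rmorphM; apply: SM.
Qed.

Lemma pol_sub (k : fieldType) (V : comNzRingType) (a : {rmorphism k -> V}) n (z : 'I_n -> V) (S : set V) :
  subalgebra a S -> (forall i, S (z i)) -> pol a z `<=` S.
Proof.
move=> [Sc SD SM] hz _ [p ->].
apply: big_ind => [|x y|mm _]; [by rewrite -(rmorph0 a)|exact: SD|].
apply: (SM) => //; apply: big_ind => [|x y|i _]; [by rewrite -(rmorph1 a)|exact: SM|].
by elim: (mm i) => [|j IH]; [rewrite expr0 -(rmorph1 a)|rewrite exprS; apply: (SM)].
Qed.

(** Work in V = R[X, 1/X] with tau = X and t = 1/X. The point [z] consists of the free variables U,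
    tau and the bound variables v_b and g_c = b_c t, where M+1 linear combinations b_c of generators
    of J are chosen so that J t is integral over k[g]. As tau g_c - b_c = 0 has derivative tau, the
    determinant at C = 0 is Delta tau^(M+1). It carries x t^(m+M+1) to Delta x t^m, which therefore
    lies in R[tau, J t]; comparing degrees gives the claim. *)
Theorem lipman_sathaye (k : fieldType) (R : comNzRingType) (a : {rmorphism k -> R}) M (Delta : R) :
  infinite_field k -> noetherian R -> ls_presentation a M Delta -> briancon_skoda Delta M.+1.
Proof.
move=> hk nR [U [s [v [G [tf inR gen genG [Gv ->]]]]]] J hJ m x hx.
have [bs JE] := nR J hJ.
pose W : set {poly R} := [set p | exists n, p = 'X^n].
have hW : mul_closed W.
  by split; [exists 0%N; rewrite expr0|move=> _ _ [i ->] [j ->]; exists (i + j)%N; rewrite exprD].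
have hW0 : ~ W 0 by move=> [n e]; have := monic_neq0 (monicXn R n); rewrite -e eqxx.
have [V [f [fu fd fk]]] := loc_ex hW hW0.
have Xreg n (p : {poly R}) : 'X^n * p = 0 -> p = 0.
  move/eqP; rewrite mulrI_eq0; first by move/eqP.
  by apply: lreg_lead; rewrite lead_coefXn; apply: lreg1.
have finj p : f p = 0 -> p = 0 by move=> /fk[_ [[n ->]]]; apply: Xreg.
pose tau : V := f 'X.
have [t tt] : exists t, t * tau = 1 by apply: fu; exists 1%N; rewrite expr1.
have tauN n : t ^+ n * tau ^+ n = 1 by rewrite -exprMn tt expr1n.
have fXn n : f 'X^n = tau ^+ n by rewrite rmorphXn.
have tauregN n (y : V) : tau ^+ n * y = 0 -> y = 0.
  by move=> e; rewrite -[y]mul1r -(tauN n) -mulrA e mulr0.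
have taureg (y : V) : tau * y = 0 -> y = 0 by apply: (tauregN 1%N).
pose io : {rmorphism R -> V} := f \o polyC.
pose a' : {rmorphism k -> V} := io \o a.
pose U' := ext (fun i => io (U i)) tau.
have tf' : tf_over a' U'.
  move=> Phi P0 y hy; have [p [_ [[n ->] yp]]] := fd y.
  have p0 : p = 0.
    apply: (tf_poly tf P0); apply: finj; rewrite rmorphM -yp mulrA.
    suff -> : f (mmap (polyC \o a) (ext (fun i => (U i)%:P) 'X) Phi) = mmap a' U' Phi by rewrite hy mul0r.
    rewrite mmap_rmorph; apply: eq_mmap => // i /=.
    by case: (unliftP ord_max i) => [j|] ->; rewrite /U' ?ext_lift ?ext_max.
  by apply: (tauregN n); rewrite mulrC -fXn yp p0 rmorph0.
have inV r : integralOver (mmap a' U') (io r).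
  apply: (int_push (inR r)) => e; rewrite mmap_rmorph; apply: int_mmap => [c|i].
    exact: (int_const a').
  by have := int_var a' U' (lift ord_max i); rewrite {2}/U' ext_lift.
have inTau : integralOver (mmap a' U') tau.
  by have := int_var a' U' ord_max; rewrite {2}/U' ext_max.
have [|C0 hC0] := few_generators hk taureg inTau (b := fun i : 'I_(size bs) => io bs`_i * t).
  by move=> i; rewrite mulrCA [tau * t]mulrC tt mulr1.
pose b2 (c : 'I_M.+1) := \sum_j a (C0 c j) * bs`_(nat_of_ord j).
have Jb2 c : J (b2 c).
  by apply: ideal_sum => // j _; apply: (idealM _ hJ); rewrite JE; apply: mem_span; apply: mem_nth.
pose g c := io (b2 c) * t.
have hg (i : 'I_(size bs)) : integralOver (mmap a' g) (io bs`_(nat_of_ord i) * t).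
  apply: (int_trans (hC0 i)) => [c|c]; first exact: int_const.
  have -> : \sum_j a' (C0 c j) * (io bs`_(nat_of_ord j) * t) = g c.
    by rewrite /g /b2 rmorph_sum mulr_suml; apply: eq_bigr => j _; rewrite rmorphM mulrA.
  exact: int_var.
pose zr (b : 'I_(s + M.+1)) := match split b with inl b => io (v b) | inr c => g c end.
pose z (i : 'I_(M.+1 + (s + M.+1))) := match split i with inl i => U' i | inr b => zr b end.
have zU i : z (lshift _ i) = U' i by rewrite /z (unsplitK (inl _ i)).
have zR b : z (rshift _ b) = zr b by rewrite /z (unsplitK (inr _ b)).
have zv b : zr (lshift _ b) = io (v b) by rewrite /zr (unsplitK (inl _ b)).
have zg c : zr (rshift _ c) = g c by rewrite /zr (unsplitK (inr _ c)).
pose G' (b : 'I_(s + M.+1)) : {poly V} := match split b with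
  inl b => map_poly io (G b) | inr c => tau%:P * 'X - (io (b2 c))%:P end.
have Gl b : G' (lshift _ b) = map_poly io (G b) by rewrite /G' (unsplitK (inl _ b)).
have Gr c : G' (rshift _ c) = tau%:P * 'X - (io (b2 c))%:P by rewrite /G' (unsplitK (inr _ c)).
have preS S : subalgebra a' S -> subalgebra a (io @^-1` S).
  exact: preim_subalg.
have gen_io S : subalgebra a' S -> (forall i, S (io (U i))) -> (forall b, S (io (v b))) ->
    forall r, S (io r).
  move=> hS hU hv r; apply: (gen r _ (preS S hS)) => y [[i _ <-]|[b _ <-]].
    exact: hU.
  exact: hv.
have SN S x0 : subalgebra a' S -> S x0 -> S (- x0).
  by move=> [Sc _ SM] h; rewrite -mulN1r -(rmorphN1 a'); apply: SM.
have hG' : forall (b : 'I_(s + M.+1)) (l : nat), algn a' z (fun i => (i < M.+1 + b)%N) (G' b)`_l.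
  move=> b l S hS hz.
  have hU i : S (U' i) by rewrite -zU; apply: hz => /=; rewrite ltn_addr.
  have hU1 i : S (io (U i)) by have := hU (lift ord_max i); rewrite /U' ext_lift.
  have htau : S tau by have := hU ord_max; rewrite /U' ext_max.
  case: (split_ordP b) hz => b' -> hz.
    rewrite Gl coef_map; apply: (genG b' l _ (preS S hS)) => y [[i _ <-]|[b3 lt <-]]; first exact: hU1.
    by change (S (io (v b3))); rewrite -zv -zR; apply: hz; rewrite /= ltn_add2l.
  have hio r : S (io r).
    apply: gen_io => // b3; rewrite -zv -zR; apply: hz; rewrite /= ltn_add2l.
    by rewrite ltn_addr.
  have [Sc SD SM] := hS.
  have S0 : S 0 by rewrite -(rmorph0 a').
  rewrite Gr coefB coefCM coefX coefC; case: l => [|[|l]] /=.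
  - by rewrite mulr0 sub0r; apply: (SN S) => //; exact: hio.
  - by rewrite mulr1 subr0.
  - by rewrite mulr0 subr0.
have Gz' b : (G' b).[z (rshift M.+1 b)] = 0.
  rewrite zR; case: (split_ordP b) => b' ->; first by rewrite Gl zv horner_map Gv rmorph0.
  by rewrite Gr zg hornerD hornerN hornerCM hornerX hornerC /g mulrCA [tau * t]mulrC tt mulr1 subrr.
have [B [T [dT hls]]] := ls_det hG' Gz'.
pose Jd (C : 'M[k]_(M.+1, s + M.+1)) := \det (block_mx 1%:M (- map_mx a' C) B T).
pose w (C : 'M[k]_(M.+1, s + M.+1)) i := U' i - \sum_b a' (C i b) * z (rshift M.+1 b).
(* Finiteness over k[w C] is reached one g_c at a time: after n stages the first n of them are
   integral over it, and C is supported on their columns. *)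
pose Ok n C := (forall c : 'I_M.+1, (c < n)%N -> integralOver (mmap a' (w C)) (g c)) /\
  (forall i b, C i b <> 0 -> exists2 c : 'I_M.+1, (c < n)%N & b = rshift s c).
pose xv := io x * t ^+ (m + M.+1).
have polio r : pol a' z (io r).
  apply: gen_io => [|i|b]; first exact: pol_subalg.
    have -> : io (U i) = z (lshift _ (lift ord_max i)) by rewrite zU /U' ext_lift.
    exact: polz.
  by rewrite -zv -zR; apply: polz.
have poltau : pol a' z tau.
  by have := polz a' z (lshift _ ord_max); rewrite zU /U' ext_max.
(* When all g_c are integral over k[w C], so are the variables U', then R, and then x t^(m+M+1). By
   [tf_exchange] the polynomial ring mapping to k[w C] acts without torsion, so it can serve as
   [E]. *)
have step_final C : Ok M.+1 C -> pol a' z (Jd C * xv).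
  move=> [Ok1 Ok2]; pose s0 : {rmorphism {mpoly k[M.+1]} -> V} := mmap a' (w C).
  have gint c : integralOver s0 (g c) by apply: Ok1.
  have cint c : integralOver s0 (a' c) by apply: int_const.
  have Uint i : integralOver s0 (U' i).
    rewrite -[U' i](subrK (\sum_b a' (C i b) * z (rshift M.+1 b))).
    apply: integral_add; first exact: int_var.
    apply: big_ind => [|u1 u2|b _]; [exact: integral0|exact: integral_add|].
    have [->|/eqP/Ok2[c _ ->]] := eqVneq (C i b) 0; first by rewrite rmorph0 mul0r; apply: integral0.
    by apply: integral_mul => //; rewrite zR zg.
  have rint r : integralOver s0 (io r) by apply: (int_trans (inV r)).
  have zint i : integralOver s0 (z i).
    case: (split_ordP i) => i' ->; first by rewrite zU.
    by rewrite zR; case: (split_ordP i') => b ->; rewrite ?zv ?zg.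
  have xint : integralOver s0 xv.
    apply: (int_closure_rees (bs := bs) rint _ JE hx) => i hi.
    apply: (int_trans (hg (Ordinal hi))) => // c.
  have [|l0 [fgl hl0]] := @fg_subringE _ _ s0 (xv :: [seq z i | i <- enum 'I_(M.+1 + (s + M.+1))]).
    by move=> y; rewrite inE => /orP[/eqP ->|/mapP[i _ ->]].
  apply: (hls _ s0 l0 C) => //.
  - by move=> c; exists c%:MP; rewrite /s0 /= mmapC.
  - exact: cic_mpoly.
  - move=> e e0; apply: (tf_exchange hk tf' Uint); exact/eqP.
  - by move=> i; apply: hl0; rewrite inE; apply/orP; right; apply: map_f; rewrite mem_enum.
  - move=> e; have : pol a' (w C) (s0 e) by exists e.
    apply: pol_sub; first exact: pol_subalg.
    move=> i; apply: polD; first by rewrite -zU; apply: polz.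
    apply: (SN (pol a' z)); first exact: pol_subalg.
    by apply: pol_sum => b _; apply: polM; [apply: polC|apply: polz].
  - move=> y _; have [p [_ [[n ->] yp]]] := fd y.
    have evX : mmap a' z ('X_(lshift _ ord_max) ^+ n) = tau ^+ n.
      by rewrite rmorphXn /= mmapX mmap1U zU /U' ext_max.
    exists ('X_(lshift _ ord_max) ^+ n); rewrite evX; split; last exact: tauregN.
    rewrite mulrC -fXn yp; elim/poly_ind: (p) => [|q c IH]; first by rewrite rmorph0; exact: pol0.
    by rewrite rmorphD rmorphM; apply: polD; [apply: polM|exact: polio].
  - by move=> i; exists 'X_i; rewrite /s0 /= mmapX mmap1U /w zU.
  - by apply: hl0; rewrite mem_head.
(* The column of [g cn] receives lam c; by [noether_step] this makes [g cn] integral unless lam is a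
   root of a fixed nonzero polynomial. *)
pose up (C : 'M[k]_(M.+1, s + M.+1)) (c : 'I_M.+1 -> k) cn lam : 'M[k]_(M.+1, s + M.+1) :=
  \matrix_(i, b) (C i b + lam * c i * (b == rshift s cn)%:R).
have step C (cn : 'I_M.+1) : Ok cn C -> exists (c : 'I_M.+1 -> k) th, th != 0 /\
    forall lam, th.[lam] != 0 -> Ok cn.+1 (up C c cn lam).
  move=> [Ok1 Ok2].
  have zrint b : integralOver (mmap a' U') (tau * zr b).
    case: (split_ordP b) => b' ->; rewrite ?zv ?zg; first exact: integral_mul.
    by rewrite /g mulrCA [tau * t]mulrC tt mulr1.
  have [|Phi P0 hPhi] := algebraic_relation (ltnSn M.+1) taureg inTau (z := ext (w C) (g cn)).
    move=> i; case: (unliftP ord_max i) => [j|] ->; rewrite ?ext_lift ?ext_max; last by rewrite -zg.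
    rewrite mulrBr; apply: integral_sub; first by apply: integral_mul => //; apply: int_var.
    rewrite mulr_sumr; apply: big_ind => [|u1 u2|b _]; [exact: integral0|exact: integral_add|].
    by rewrite mulrCA zR; apply: integral_mul => //; apply: int_const.
  have [c [th [th0 hN]]] := noether_step hk P0; exists c, th; split=> // lam hlam.
  have wE i : w (up C c cn lam) i = w C i - a' (lam * c i) * g cn.
    rewrite /w -addrA; congr (_ + _); rewrite -opprD; congr (- _).
    have -> : a' (lam * c i) * g cn = \sum_b a' (lam * c i * (b == rshift s cn)%:R) * z (rshift M.+1 b).
      rewrite (bigD1 (rshift s cn)) //= eqxx mulr1 zR zg big1 ?addr0 // => b /negPf ->.
      by rewrite mulr0 !rmorph0 mul0r.
    by rewrite -big_split; apply: eq_bigr => b _; rewrite mxE rmorphD mulrDl.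
  have ig : integralOver (mmap a' (w (up C c cn lam))) (g cn).
    have [p mp rp] := hN V a' (w C) (g cn) lam hlam hPhi; exists p => //.
    move: rp; rewrite /root; congr (_.[_] == 0); apply: eq_map_poly => e /=.
    by apply: eq_mmap => // i; rewrite wE.
  split=> [c' hc'|i b].
    have [e|cc] := eqVneq c' cn; first by rewrite e.
    have lt : (c' < cn)%N by rewrite ltn_neqAle cc -ltnS.
    apply: (int_trans (Ok1 _ lt)) => [e|i]; first exact: int_const.
    rewrite -[w C i](subrK (a' (lam * c i) * g cn)) -wE; apply: integral_add; first exact: int_var.
    by apply: integral_mul => //; apply: int_const.
  rewrite mxE; have [-> _|bc] := eqVneq b (rshift s cn); first by exists cn.
  by rewrite mulr0 addr0 => /Ok2[c' lt ->]; exists c' => //; apply: ltnW.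
(* d counts the stages still to come. The element for C is the value at lam = 0 of a polynomial in
   lam whose values at generic lam are known from the next stage; this descends to stage 0, where C
   = 0. *)
have main d : forall n C, (n + d)%N = M.+1 -> Ok n C -> pol a' z (Jd C * xv).
  elim: d => [|d IH] n C nd hC; first by apply: step_final; rewrite -nd addn0.
  have hn : (n < M.+1)%N by rewrite -nd addnS ltnS leq_addr.
  have [c [th [th0 hth]]] := step C (Ordinal hn) hC.
  pose Mp : 'M[{poly V}]_(M.+1, s + M.+1) := \matrix_(i, b) ((a' (C i b))%:P +
    (a' (c i * (b == rshift s (Ordinal hn))%:R))%:P * 'X).
  pose q := \det (block_mx 1%:M (- Mp) (map_mx polyC B) (map_mx polyC T)) * xv%:P.
  have qE r : q.[a' r] = Jd (up C c (Ordinal hn) r) * xv.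
    rewrite /q hornerM hornerC -horner_evalE -det_map_mx map_block_mx map_mx1 map_mxN; congr (\det _ * _).
    congr (block_mx _ (- _) _ _); apply/matrixP => i j; last by rewrite !mxE; exact: hornerC.
      by rewrite !mxE; apply: (etrans (horner_lin _ _ _ _)); rewrite mulrA.
    by rewrite !mxE; exact: hornerC.
  have -> : Jd C * xv = q.[0].
    rewrite -(rmorph0 a') qE; congr (Jd _ * _); apply/matrixP => i j.
    rewrite [in RHS]mxE. by rewrite !mul0r addr0.
  apply: (infinite_value hk (pol_subalg a' z) th0) => lam hlam.
  by rewrite qE; apply: (IH n.+1); [rewrite addSnnS|apply: hth].
have := main M.+1 0%N 0 erefl; case.
  by split=> [c|i b]; rewrite // mxE.
move=> p0 hp0; have {p0 hp0} : pol a' z (Jd 0 * xv) by exists p0.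
have -> : Jd 0 * xv = io (\prod_b ((G b)^`()).[v b] * x) * t ^+ m.
  rewrite /Jd map_mx0 oppr0 det_lblock det1 mul1r dT (rmorphM io) (rmorph_prod io) /xv exprD big_split_ord.
  have -> : \prod_(i < s) ((G' (lshift M.+1 i))^`()).[z (rshift M.+1 (lshift M.+1 i))] =
      \prod_i io ((G i)^`()).[v i].
    by apply: eq_bigr => b _; rewrite Gl zR zv deriv_map horner_map.
  have -> : \prod_(i < M.+1) ((G' (rshift s i))^`()).[z (rshift M.+1 (rshift s i))] = tau ^+ M.+1.
    rewrite -[X in _ ^+ X]card_ord -prodr_const; apply: eq_bigr => c _.
    by rewrite Gr derivB derivC subr0 mul_polyC derivZ derivX hornerZ hornerC mulr1.
  rewrite -!mulrA; congr (_ * _); rewrite mulrCA; congr (_ * _).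
  by rewrite mulrCA [tau ^+ _ * _]mulrC tauN mulr1.
move: (_ * x) => y.
(* The extended Rees algebra R[tau, J t]: the coefficient of tau^(i-K) must lie in J^(K-i), with no
   condition for i at least K. *)
pose S := [set u : V | exists K p, tau ^+ K * u = f p /\ forall i, ideal_pow J (K - i) p`_i].
have hS : subalgebra a' S.
  split=> [c|u1 u2 [K1 [p1 [e1 h1]]] [K2 [p2 [e2 h2]]]|u1 u2 [K1 [p1 [e1 h1]]] [K2 [p2 [e2 h2]]]].
  - by exists 0%N, (a c)%:P; rewrite expr0 mul1r; split=> // i; rewrite sub0n.
  - exists (K1 + K2)%N, ('X^K2 * p1 + 'X^K1 * p2); split.
      by rewrite rmorphD !rmorphM !fXn -e1 -e2 exprD; ring.
    move=> i; rewrite coefD !coefXnM; apply: powDr; case: ltnP => hi; try exact: pow0r.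
      by apply: pow_le (h1 _); lia.
    by apply: pow_le (h2 _); lia.
  exists (K1 + K2)%N, (p1 * p2); split; first by rewrite rmorphM -e1 -e2 exprD; ring.
  move=> i; rewrite coefM; apply: ideal_sum => [|j _]; first exact: pow_ideal.
  by apply: pow_le (powD (h1 _) (h2 _)); have := ltn_ord j; lia.
have Sio r : S (io r).
  by exists 0%N, r%:P; rewrite expr0 mul1r; split=> // i; rewrite sub0n.
move=> /(pol_sub hS) [|K [p [e h]]].
  move=> i; case: (split_ordP i) => i' ->.
    rewrite zU; case: (unliftP ord_max i') => [j|] ->; rewrite /U' ?ext_lift ?ext_max //.
    by exists 0%N, 'X; rewrite expr0 mul1r; split=> // l; rewrite sub0n.
  rewrite zR; case: (split_ordP i') => b ->; rewrite ?zv ?zg //.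
  exists 1%N, (b2 b)%:P; split=> [|l]; first by rewrite expr1 mulrCA [tau * t]mulrC tt mulr1.
  by rewrite coefC; case: eqP => [->|_]; [apply: pow1|apply: pow0r].
have : f (y%:P * 'X^K) = f (p * 'X^m).
  by rewrite (rmorphM f y%:P) (rmorphM f p) !fXn -e -(mulrA (tau ^+ K)) -(mulrA (io y)) tauN mulr1 mulrC.
move/eqP; rewrite -subr_eq0 -rmorphB => /eqP/finj/eqP; rewrite subr_eq0 => /eqP.
move=> /(congr1 (fun q : {poly R} => q`_K)); rewrite !coefMXn ltnn subnn coefC eqxx => ->.
case: ltnP => Km; first exact: pow0r.
by apply: pow_le (h _); lia.
Qed.

(** * Towers of separable monic extensions *)

Lemma noeth_mpoly (k : fieldType) n : noetherian {mpoly k[n]}.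
Proof.
elim: n => [|n IH].
  apply: (noeth_surj (f := @mpolyC 0 k)); last exact: noeth_field.
  by move=> p; exists p@_0%MM; exact: mpolyKC.
pose u : {rmorphism {mpoly k[n]} -> {mpoly k[n.+1]}} :=
  mmap (@mpolyC n.+1 k) (fun i => 'X_(lift ord_max i)).
pose F : {rmorphism {poly {mpoly k[n]}} -> {mpoly k[n.+1]}} := horner_eval 'X_ord_max \o map_poly u.
apply: (noeth_surj (f := F)); last exact: noeth_poly.
move=> p; exists (mmap (polyC \o @mpolyC n k) (ext (fun i => ('X_i)%:P) 'X) p).
rewrite (mmap_rmorph F); transitivity (mmap (@mpolyC n.+1 k) (fun i => 'X_i) p).
  apply: eq_mmap => i; rewrite /F /= /horner_eval.
    by rewrite map_polyC hornerC /u /= mmapC.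
  case: (unliftP ord_max i) => [j|] ->; rewrite ?ext_lift ?ext_max ?map_polyX ?hornerX //.
  by rewrite map_polyC hornerC /u /= mmapX mmap1U.
apply: (mpoly_hom_ext (f := mmap (@mpolyC n.+1 k) (fun i => 'X_i)) (g := idfun)) => [c|i] /=.
  by rewrite mmapC.
by rewrite mmapX mmap1U.
Qed.

Lemma alg_gen_map (k : fieldType) (R V : comNzRingType) (a : {rmorphism k -> R})
    (psi : {rmorphism R -> V}) (A : set R) (B : set V) x :
  (forall y, A y -> B (psi y)) -> alg_gen a A x -> alg_gen (psi \o a) B (psi x).
Proof.
move=> AB hx S hS BS; apply: (hx (psi @^-1` S)); first exact: preim_subalg.
by move=> y /AB/BS.
Qed.

(* Q = H[Y]/(G) with the projection p *)
Definition adjoins (H Q : comNzRingType) (p : {rmorphism {poly H} -> Q}) (G : {poly H}) :=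
  [/\ G \is monic, (forall q, exists f, p f = q) & (forall f, p f = 0 <-> exists g, f = g * G)].

Lemma adjoins_rem (H Q : comNzRingType) (p : {rmorphism {poly H} -> Q}) G (f : {poly H}) : adjoins p G ->
  exists f', p f' = p f /\ (size f' < size G)%N.
Proof.
move=> [mG _ kp]; exists (Pdiv.Ring.rmodp f G); split; last first.
  by apply: Pdiv.Ring.ltn_rmodpN0; apply: monic_neq0.
apply/eqP; rewrite eq_sym -subr_eq0 -rmorphB; apply/eqP/kp.
by exists (Pdiv.Ring.rdivp f G); rewrite {1}(Pdiv.RingMonic.rdivp_eq mG f) addrK.
Qed.

Lemma adjoins_small (H Q : comNzRingType) (p : {rmorphism {poly H} -> Q}) G (f : {poly H}) : adjoins p G ->
  (size f < size G)%N -> p f = 0 -> f = 0.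
Proof.
move=> [mG _ kp] sf /kp[g fE]; apply: contrapT => f0.
have g0 : g != 0 by apply: contra_notN f0 => /eqP g0; rewrite fE g0 mul0r.
by move: sf; rewrite fE size_Mmonic // ltnNge -subn1; move: g0; rewrite -size_poly_gt0; lia.
Qed.

Lemma adjoins_size (H Q : comNzRingType) (p : {rmorphism {poly H} -> Q}) G : adjoins p G ->
  (1 < size G)%N.
Proof.
move=> hp; have [mG _ kp] := hp; rewrite ltnNge; apply/negP => s1.
have s0 : (0 < size G)%N by rewrite size_poly_gt0 monic_neq0.
have G1 : G = 1.
  by move: mG; rewrite (size1_polyC s1) monicE lead_coefC => /eqP ->.
have : p 1 = 0 by apply/kp; exists 1; rewrite G1 mulr1.
by rewrite rmorph1 => /eqP; rewrite oner_eq0.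
Qed.

Lemma adjoins_ex (H : comNzRingType) (G : {poly H}) : G \is monic -> (1 < size G)%N ->
  exists (Q : comNzRingType) (p : {rmorphism {poly H} -> Q}), adjoins p G.
Proof.
move=> mG sG; pose I := [set f : {poly H} | exists g, f = g * G].
have hI : is_ideal I.
  split; first by exists 0; rewrite mul0r.
    by move=> _ _ [g ->] [h ->]; exists (g + h); rewrite mulrDl.
  by move=> b _ [g ->]; exists (b * g); rewrite mulrA.
have hI1 : ~ I 1.
  move=> [g e]; have g0 : g != 0 by apply/eqP => g0; move/eqP: e; rewrite g0 mul0r oner_eq0.
  have := congr1 (size \o polyseq) e; rewrite /= size_Mmonic // size_poly1.
  by move: g0; rewrite -size_poly_gt0; lia.
by have [Q [p [sp kp]]] := quot_ex hI hI1; exists Q, p.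
Qed.

Lemma ls_base (k : fieldType) M : ls_presentation (@mpolyC M k) M 1.
Proof.
have idE : mmap (@mpolyC M k) (fun i => 'X_i) =1 idfun.
  apply: (mpoly_hom_ext (f := mmap (@mpolyC M k) (fun i => 'X_i)) (g := idfun)) => [c|i] /=.
    by rewrite mmapC.
  by rewrite mmapX mmap1U.
exists (fun i => 'X_i), 0%N, (fun=> 0), (fun=> 0); split.
- by move=> Phi P0 y; rewrite idE => /eqP; rewrite mulf_eq0 (negPf P0) => /eqP.
- by move=> x; have := integral_id (mmap (@mpolyC M k) (fun i => 'X_i)) x; rewrite /= idE.
- move=> x S hS AS; rewrite -[x]idE; apply: (pol_sub hS (z := fun i => 'X_i)); last by exists x.
  by move=> i; apply: AS; left; exists i.
- by case.
- by split; [case|rewrite big_ord0].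
Qed.

(** As G is monic, an element of Q has a representative of degree below that of G, on whose
    coefficients torsion-freeness can be checked. The class of 'X becomes the last bound
    variable. *)
Lemma ls_step (k : fieldType) (H Q : comNzRingType) (a : {rmorphism k -> H}) M Delta
    (p : {rmorphism {poly H} -> Q}) G : adjoins p G -> ls_presentation a M Delta ->
  ls_presentation (p \o (polyC \o a)) M (p (Delta%:P * G^`())).
Proof.
move=> hp [U [s [v [Gs [tf inR gen genG [Gv DE]]]]]]; have [mG sp kp] := hp.
pose io : {rmorphism H -> Q} := p \o polyC.
pose a' : {rmorphism k -> Q} := io \o a.
have evE e : mmap a' (io \o U) e = io (mmap a U e) by rewrite [RHS]mmap_rmorph.
have inio x : integralOver (mmap a' (io \o U)) (io x).
  by apply: (int_push (inR x)) => e; rewrite -evE; apply: integral_id.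
have pE f : p f = (map_poly io f).[p 'X].
  rewrite -[f in LHS]coefK poly_def rmorph_sum (horner_coef_wide _ (size_poly _ _)).
  apply: eq_bigr => i _; rewrite coef_map -mul_polyC rmorphM rmorphXn; congr (_ * _).
have GX : (map_poly io G).[p 'X] = 0 by rewrite -pE; apply/kp; exists 1; rewrite mul1r.
have liftE (j : 'I_s) : lift ord_max j = j :> nat by rewrite /= /bump leqNgt ltn_ord.
exists (io \o U), s.+1, (ext (io \o v) (p 'X)), (ext (fun b => map_poly io (Gs b)) (map_poly io G)); split.
- move=> Phi P0 y; have [f0 <-] := sp y; have [f [<- sf]] := adjoins_rem f0 hp.
  move=> e; have e' : p ((mmap a U Phi)%:P * f) = 0 by rewrite rmorphM -e; congr (_ * _); exact: esym (evE _).
  have f0' : (mmap a U Phi)%:P * f = 0.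
    apply: (adjoins_small hp) e'; apply: leq_ltn_trans sf.
    by rewrite mul_polyC size_scale_leq.
  suff -> : f = 0 by rewrite rmorph0.
  apply/polyP => i; rewrite coef0; apply: (tf _ P0); by rewrite -coefCM f0' coef0.
- move=> y; have [f <-] := sp y; rewrite pE; apply: integral_horner.
    by apply/integral_poly => i; rewrite coef_map; exact: inio.
  apply: (integral_root_monic (monic_map io mG)); first exact/eqP.
  by apply/integral_poly => i; rewrite coef_map; exact: inio.
- move=> y S hS AS; have [f <-] := sp y.
  have Sio x : S (io x).
    apply: (alg_gen_map (psi := io) _ (gen x)) hS AS => u [[i _ <-]|[b _ <-]]; first by left; exists i.
    by right; exists (lift ord_max b); rewrite // ext_lift.
  have SX : S (p 'X) by apply: AS; right; exists ord_max; rewrite // ext_max.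
  have [Sc SD SM] := hS.
  elim/poly_ind: f => [|f c IH]; first by rewrite rmorph0 -(rmorph0 a'); apply: Sc.
  by rewrite rmorphD rmorphM; apply: (SD); [apply: SM|apply: Sio].
- move=> b l; case: (unliftP ord_max b) => [j|] ->; rewrite ?ext_lift ?ext_max coef_map.
    apply: (alg_gen_map (psi := io) _ (genG j l)) => u [[i _ <-]|[b' lt <-]]; first by left; exists i.
    right; exists (lift ord_max b'); last by rewrite ext_lift.
    by change (lift ord_max b' < lift ord_max j)%N; rewrite !liftE.
  apply: (alg_gen_map (psi := io) _ (gen G`_l)) => u [[i _ <-]|[b' _ <-]]; first by left; exists i.
  right; exists (lift ord_max b'); last by rewrite ext_lift.
  by change (lift ord_max b' < s)%N; rewrite liftE.
split=> [b|].
  case: (unliftP ord_max b) => [j|] ->; rewrite ?ext_lift ?ext_max //.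
  by rewrite /= horner_map Gv rmorph0.
rewrite big_ord_recr /= !ext_max rmorphM; congr (_ * _); last by rewrite pE deriv_map.
transitivity (io Delta) => //; rewrite DE (rmorph_prod io); apply: eq_bigr => b _.
have -> : widen_ord (leqnSn s) b = lift ord_max b by apply: val_inj; rewrite /= /bump leqNgt ltn_ord.
by rewrite !ext_lift deriv_map horner_map.
Qed.

(** The new variable is a free one, so no derivative is added to Delta. *)
Lemma ls_poly (k : fieldType) (H : comNzRingType) (a : {rmorphism k -> H}) M Delta :
  ls_presentation a M Delta -> ls_presentation (polyC \o a) M.+1 Delta%:P.
Proof.
move=> [U [s [v [Gs [tf inR gen genG [Gv DE]]]]]].
pose a' : {rmorphism k -> {poly H}} := polyC \o a.
pose U' := ext (fun i => (U i)%:P) 'X.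
have inC x : integralOver (mmap a' U') x%:P.
  apply: (int_push (psi := polyC) (inR x)) => e; rewrite mmap_rmorph; apply: int_mmap => [c|i].
    exact: int_const.
  by have := int_var a' U' (lift ord_max i); rewrite {2}/U' ext_lift.
have inX : integralOver (mmap a' U') 'X by have := int_var a' U' ord_max; rewrite {2}/U' ext_max.
exists U', s, (fun b => (v b)%:P), (fun b => map_poly polyC (Gs b)); split.
- exact: tf_poly.
- elim/poly_ind => [|f c IH]; first exact: integral0.
  by apply: integral_add => //; apply: integral_mul.
- move=> y S hS AS.
  have Sio x : S x%:P.
    apply: (alg_gen_map (psi := polyC) _ (gen x)) hS AS => u [[i _ <-]|[b _ <-]]; last by right; exists b.
    by left; exists (lift ord_max i); rewrite // /U' ext_lift.
  have SX : S 'X by apply: AS; left; exists ord_max; rewrite // /U' ext_max.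
  have [Sc SD SM] := hS.
  elim/poly_ind: y => [|f c IH]; first by rewrite -(rmorph0 a'); apply: Sc.
  by apply: (SD); [apply: SM|apply: Sio].
- move=> b l; rewrite coef_map.
  apply: (alg_gen_map (psi := polyC) _ (genG b l)) => u [[i _ <-]|[b' lt <-]]; last by right; exists b'.
  by left; exists (lift ord_max i); rewrite // /U' ext_lift.
split=> [b|]; first by rewrite horner_map Gv rmorph0.
by rewrite DE rmorph_prod; apply: eq_bigr => b _; rewrite deriv_map horner_map.
Qed.

(* A split extension: r is an A-linear left inverse of e. *)
Definition retract (A B : comNzRingType) (e : {rmorphism A -> B}) (r : B -> A) :=
  [/\ (forall x y, r (x + y) = r x + r y), (forall x y, r (e x * y) = x * r y) & r 1 = 1].

(** * Descent along split extensions *)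

Section Retract.
Variables (A B : comNzRingType) (e : {rmorphism A -> B}) (r : B -> A).
Hypothesis hr : retract e r.

Lemma retractD x y : r (x + y) = r x + r y. Proof. by case: hr. Qed.
Lemma retractM x y : r (e x * y) = x * r y. Proof. by case: hr. Qed.
Lemma retractK x : r (e x) = x.
Proof. by rewrite -[e x]mulr1 retractM; case: hr => _ _ ->; rewrite mulr1. Qed.
Lemma retract0 : r 0 = 0. Proof. by rewrite -(rmorph0 e) retractK. Qed.
Lemma retract_sum (T : Type) (s : seq T) (P : pred T) (F : T -> B) :
  r (\sum_(i <- s | P i) F i) = \sum_(i <- s | P i) r (F i).
Proof. exact: (big_morph r retractD retract0). Qed.

Lemma retract_pow (J : set A) (J' : set B) n y : is_ideal J ->
  (forall y, J' y -> ideal_mul setT (e @` J) y) -> ideal_pow J' n y -> ideal_pow J n (r y).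
Proof.
move=> hJ hJ'; suff h m z : ideal_pow J' m z -> ideal_mul setT (e @` ideal_pow J m) z.
  move=> /h; apply: (mul_ind (K := [set y | ideal_pow J n (r y)])).
  - by rewrite /= retract0; exact: pow0r.
  - by move=> u v /=; rewrite retractD; apply: powDr.
  move=> u _ _ [x Jx <-] /=; rewrite mulrC retractM mulrC.
  by apply: idealM => //; exact: pow_ideal.
elim: m z => [|m IH] z /=; first by move=> _; rewrite -[z]mulr1; apply: mem_mul => //; exists 1; rewrite ?rmorph1.
apply: mul_ind => [|u v|u v /hJ' hu /IH]; [exact: mul0|exact: mulD|].
move: u hu; apply: (mul_ind (K := [set u | ideal_mul setT (e @` ideal_pow J m) v ->
    ideal_mul setT (e @` ideal_pow J m.+1) (u * v)])).
- by rewrite /= mul0r => _; exact: mul0.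
- by move=> u u' /= h h' hv; rewrite mulrDl; apply: mulD; [apply: h|apply: h'].
move=> u _ _ [x Jx <-] /=; move: v; apply: mul_ind => [|v v'|v _ _ [y' Jy <-]].
- by rewrite mulr0; exact: mul0.
- by rewrite mulrDr; apply: mulD.
rewrite mulrACA -rmorphM; apply: mem_mul => //; exists (x * y') => //.
exact: mem_mul.
Qed.

(** Extend J to B, use the property there, and return by [r], which maps the powers of the extended
    ideal into those of J. *)
Lemma bs_retract Delta c : briancon_skoda (e Delta) c -> briancon_skoda Delta c.
Proof.
move=> bs J hJ m x [n [a [n0 ha hx]]].
pose J' := ideal_mul setT (e @` J).
have hJ' : is_ideal J'.
  split; [exact: mul0|exact: mulD|]; move=> b.
  apply: mul_ind => [|u v|u v _ Jv]; first by rewrite mulr0; exact: mul0.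
    by rewrite mulrDr; apply: mulD.
  by rewrite mulrA; apply: mem_mul.
have Je y : J y -> J' (e y) by move=> Jy; rewrite -[e y]mul1r; apply: mem_mul => //; exists y.
rewrite -[Delta * x]retractK rmorphM; apply: (retract_pow (J' := J')) => //.
apply: bs => //; exists n, (fun i => e (a i)); split=> // [i hi|].
  by apply: (morph_pow (I := ideal_pow J (m + c))) (ha _ hi) => y; apply: morph_pow.
apply: etrans (etrans (congr1 e hx) (rmorph0 e)).
rewrite rmorphD rmorph_sum rmorphXn; congr (_ + _).
by apply: eq_bigr => i _; rewrite rmorphM rmorphXn.
Qed.

Lemma coef_map_retract (p : {poly B}) i : (map_poly r p)`_i = r p`_i.
Proof. by rewrite coef_map_id0 // retract0. Qed.

Lemma retract_mapM (p : {poly A}) (q : {poly B}) :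
  map_poly r (map_poly e p * q) = p * map_poly r q.
Proof.
apply/polyP => i; rewrite coef_map_retract !coefM retract_sum; apply: eq_bigr => j _.
by rewrite coef_map retractM coef_map_retract.
Qed.

Lemma retract_mapD (p q : {poly B}) : map_poly r (p + q) = map_poly r p + map_poly r q.
Proof. by apply/polyP => i; rewrite coefD !coef_map_retract coefD retractD. Qed.
End Retract.

(** Delta accumulates the derivatives of the adjoined equations at their roots. Each quotient is
    given by a projection with its properties, so that any model of it fits. *)
Inductive tower (k : fieldType) (M : nat) : forall H : comNzRingType, {rmorphism k -> H} -> H -> Prop :=
| tower0 : tower M (@mpolyC M _ : {rmorphism k -> {mpoly k[M]}}) 1
| towerS (H Q : comNzRingType) (a : {rmorphism k -> H}) (Delta : H)
    (p : {rmorphism {poly H} -> Q}) (G : {poly H}) :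
    tower M a Delta -> adjoins p G -> tower M (p \o (polyC \o a)) (p (Delta%:P * G^`())).

Lemma tower_ls (k : fieldType) M (H : comNzRingType) (a : {rmorphism k -> H}) Delta :
  tower M a Delta -> ls_presentation a M Delta.
Proof.
elim=> [|H' Q a' D p G _ IH hp]; first exact: ls_base.
exact: ls_step.
Qed.

Lemma tower_noeth (k : fieldType) M (H : comNzRingType) (a : {rmorphism k -> H}) Delta :
  tower M a Delta -> noetherian H.
Proof.
elim=> [|H' Q a' D p G _ IH [_ sp _]]; first exact: noeth_mpoly.
by apply: (noeth_surj sp); apply: noeth_poly.
Qed.

Lemma retract_mpoly (k K : fieldType) (e : {rmorphism k -> K}) r n : retract e r ->
  exists r', @retract {mpoly k[n]} {mpoly K[n]} (map_mpoly e) r'.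
Proof.
move=> hr; pose r' (p : {mpoly K[n]}) : {mpoly k[n]} := \sum_(m <- msupp p) r p@_m *: 'X_[m].
have cr p m : (r' p)@_m = r p@_m.
  rewrite raddf_sum /=; have [mp|mp] := boolP (m \in msupp p).
    rewrite (bigD1_seq m) ?msupp_uniq //= mcoeffZ mcoeffX eqxx mulr1 big1 ?addr0 // => m' /negPf mm.
    by rewrite mcoeffZ mcoeffX mm mulr0.
  rewrite memN_msupp_eq0 // (retract0 hr) big_seq big1 // => m' mp'; rewrite mcoeffZ mcoeffX.
  by case: eqP => [mm|]; [rewrite -mm mp' in mp|rewrite mulr0].
exists r'; split=> [x y|x y|]; apply/mpolyP => m.
- by rewrite mcoeffD !cr mcoeffD (retractD hr).
- rewrite cr !mcoeffM (retract_sum hr); apply: eq_bigr => i _.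
  by rewrite mcoeff_map_mpoly (retractM hr) cr.
by rewrite cr !mcoeff1; case: eqP => _; [case: hr|rewrite (retract0 hr)].
Qed.

(** The equations of the tower, mapped to the larger ring, define a tower over K. The retraction
    acts on coefficients and respects multiples of G because G has coefficients in the smaller
    ring. *)
Lemma tower_base_change (k : fieldType) M (H : comNzRingType) (a : {rmorphism k -> H}) Delta
    (K : fieldType) (e : {rmorphism k -> K}) r : tower M a Delta -> retract e r ->
  exists (HK : comNzRingType) (aK : {rmorphism K -> HK}) (eH : {rmorphism H -> HK}) rH,
    tower M aK (eH Delta) /\ retract eH rH.
Proof.
move=> tw hr; elim: tw => [|H' Q a' D p G _ [HK [aK [eH [rH [IH hrH]]]]] hp].
  have [r' hr'] := retract_mpoly M hr.
  exists {mpoly K[M]}, (@mpolyC M _ : {rmorphism K -> {mpoly K[M]}}), (map_mpoly e : {rmorphism {mpoly k[M]} -> {mpoly K[M]}}), r'; split=> //.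
  by rewrite rmorph1; exact: tower0.
have [mG sp kp] := hp.
have [|QK [pK hpK]] := adjoins_ex (monic_map eH mG).
  by rewrite size_map_poly_id0 ?(adjoins_size hp) // (monicP mG) rmorph1 oner_neq0.
have [mGK spK kpK] := hpK.
have [eQ heQ] : exists eQ : {rmorphism Q -> QK}, forall f, eQ (p f) = pK (map_poly eH f).
  apply: (factor_surj (f := pK \o map_poly eH) sp) => f /kp[g ->] /=; apply/kpK.
  by exists (map_poly eH g); rewrite rmorphM.
have /choice[sK hsK] := spK.
have rw f g : pK f = pK g -> p (map_poly rH f) = p (map_poly rH g).
  move/eqP; rewrite -subr_eq0 -rmorphB => /eqP/kpK[h fE]; rewrite -[f](subrK g) fE.
  rewrite (retract_mapD hrH) mulrC (retract_mapM hrH) rmorphD.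
  suff -> : p (G * map_poly rH h) = 0 by rewrite add0r.
  by apply/kp; exists (map_poly rH h); rewrite mulrC.
exists QK, (pK \o (polyC \o aK)), eQ, (fun q => p (map_poly rH (sK q))); split.
  have -> : eQ (p (D%:P * G^`())) = pK ((eH D)%:P * (map_poly eH G)^`()).
    by rewrite heQ rmorphM /= map_polyC deriv_map.
  exact: towerS.
split=> [x y|x y|].
- rewrite -rmorphD -(retract_mapD hrH); apply: rw.
  by rewrite hsK rmorphD !hsK.
- have [f <-] := sp x; rewrite -rmorphM -(retract_mapM hrH); apply: rw.
  by rewrite hsK heQ rmorphM hsK.
rewrite -(rmorph1 p); have -> : 1 = map_poly rH 1 :> {poly H'}.
  have [_ _ r1] := hrH; apply/polyP => i; rewrite (coef_map_retract hrH) !coef1.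
  by case: (i == 0)%N; rewrite ?r1 ?(retract0 hrH).
by apply: rw; rewrite hsK rmorph1.
Qed.

(** A subspace that is maximal among those avoiding 1 is a complement of the line spanned by 1; the
    retraction is the projection along it. *)
Lemma field_retract (k K : fieldType) (e : {rmorphism k -> K}) : exists r, retract e r.
Proof.
pose P (W : set K) := [/\ (forall x y, W x -> W y -> W (x + y)), (forall c x, W x -> W (e c * x)) & ~ W 1].
have [|A [[AD AZ A1] Amax]] := @Zorn_bigcup K P.
  move=> F FP tF; split=> [x y [X FX Xx] [Y FY Yy]|c x [X FX Xx]|[X FX X1]].
  - have [XY|YX] := tF _ _ FX FY.
      by exists Y => //; have [h _ _] := FP _ FY; apply: h => //; apply: XY.
    by exists X => //; have [h _ _] := FP _ FX; apply: h => //; apply: YX.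
  - by exists X => //; have [_ h _] := FP _ FX; apply: h.
  - by have [_ _] := FP _ FX; apply.
(* The sets given to Zorn's lemma may be empty; [B] adds zero to the maximal one. *)
pose B x := A x \/ x = 0.
have BD x y : B x -> B y -> B (x + y).
  move=> [Ax|->] [Ay|->]; rewrite ?addr0 ?add0r; [by left; apply: AD|by left|by left|by right].
have BZ c x : B x -> B (e c * x) by move=> [Ax|->]; [left; apply: AZ|right; rewrite mulr0].
have B1 : ~ B 1 by move=> [//|/eqP]; rewrite oner_eq0.
have dec x : exists c, B (x - e c).
  have [Ax|nAx] := pselect (A x); first by exists 0; rewrite rmorph0 subr0; left.
  pose C := [set y | exists w c, B w /\ y = w + e c * x].
  have AC : A `<` C.
    split=> [y Ay|CA]; first by exists y, 0; rewrite rmorph0 mul0r addr0; split=> //; left.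
    by apply: nAx; apply: CA; exists 0, 1; rewrite rmorph1 mul1r add0r; split=> //; right.
  have : C 1.
    apply: contrapT => C1; apply: (Amax _ AC); split=> // [y z [w [c [Bw ->]]] [w' [c' [Bw' ->]]]|c y [w [c' [Bw ->]]]].
      by exists (w + w'), (c + c'); split; [exact: BD|rewrite rmorphD mulrDl addrACA].
    by exists (e c * w), (c * c'); split; [exact: BZ|rewrite rmorphM mulrDr mulrA].
  move=> [w [c [Bw e1]]]; have c0 : c != 0.
    by apply/eqP => c0; apply: B1; rewrite e1 c0 rmorph0 mul0r addr0.
  exists c^-1; have -> : x - e c^-1 = e (- c^-1) * w.
    have -> : x = e c^-1 * (e c * x) by rewrite mulrA -rmorphM mulVf // rmorph1 mul1r.
    have -> : e c * x = 1 - w by rewrite e1 addrC addKr.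
    by rewrite rmorphN; ring.
  exact: BZ.
have [r hr] := choice dec.
have uniq x c : B (x - e c) -> r x = c.
  move=> hc; apply: contrapT => nc; apply: B1.
  have d0 : r x - c != 0 by rewrite subr_eq0; apply/eqP.
  have -> : 1 = e (r x - c)^-1 * ((x - e c) + e (-1) * (x - e (r x))).
    transitivity (e ((r x - c)^-1 * (r x - c))); first by rewrite mulVf // rmorph1.
    rewrite rmorphM; congr (_ * _).
    by rewrite rmorphB rmorphN1; ring.
  by apply: (BZ); apply: (BD) => //; apply: BZ.
exists r; split=> [x y|c x|]; apply: uniq.
- by rewrite rmorphD opprD addrACA; apply: BD.
- by rewrite rmorphM -mulrBr; apply: BZ.
- by rewrite rmorph1 subrr; right.
Qed.

(** * Infinite perfect extensions *)

Definition perfect_field (K : fieldType) := forall p, p \in [pchar K] -> forall x : K, exists y, y ^+ p = x.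

Lemma comring_field (Q : comNzRingType) : (forall x : Q, x <> 0 -> exists y, y * x = 1) ->
  exists (K : fieldType) (f : {rmorphism Q -> K}), bijective f.
Proof.
move=> h; have /choice[inv0 hinv] : forall x : Q, exists y, x <> 0 -> y * x = 1.
  by move=> x; have [->|/h[y hy]] := pselect (x = 0); [exists 0|exists y].
pose inv x := if `[< x = 0 >] then 0 else inv0 x.
have mulVf : forall x : Q, x != 0 -> inv x * x = 1.
  by move=> x /eqP x0; rewrite /inv asboolF //; apply: hinv.
have inv00 : inv 0 = 0 by rewrite /inv asboolT.
pose K : fieldType := HB.pack (GRing.ComNzRing.sort Q) (GRing.ComNzRing_isField.Build Q mulVf inv00).
by exists K, (idfun : {rmorphism Q -> Q}), id.
Qed.

Section PerfectClosure.
Import functions.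
Variables (F : fieldType) (p : nat) (hp : p \in [pchar F]).

Let frobD (x y : F) : (x + y) ^+ p = x ^+ p + y ^+ p.
Proof. by rewrite -!(pFrobenius_autE hp) rmorphD. Qed.
Let frobN (x : F) : (- x) ^+ p = - x ^+ p.
Proof. by rewrite -!(pFrobenius_autE hp) rmorphN. Qed.
Let p0 : (0 < p)%N. Proof. by apply: prime_gt0; apply: pcharf_prime hp. Qed.

(* The perfect closure is realized by sequences that are eventually of the
   form x, x^p, x^(p^2), ... up to eventual equality. *)
Definition frob_seq of p \in [pchar F] : pred (nat -> F) :=
  fun f => `[< exists N, forall n, (N <= n)%N -> f n.+1 = f n ^+ p >].

Fact frob_seq_subring : subring_closed (frob_seq hp).
Proof.
split; first by apply/asboolP; exists 0%N => n _; change (1 = 1 ^+ p :> F); rewrite expr1n.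
  move=> f g /asboolP[N hN] /asboolP[N' hN']; apply/asboolP; exists (maxn N N') => n.
  by rewrite geq_max => /andP[h h']; change (f n.+1 - g n.+1 = (f n - g n) ^+ p); rewrite frobD frobN hN ?hN'.
move=> f g /asboolP[N hN] /asboolP[N' hN']; apply/asboolP; exists (maxn N N') => n.
by rewrite geq_max => /andP[h h']; change (f n.+1 * g n.+1 = (f n * g n) ^+ p); rewrite exprMn hN ?hN'.
Qed.
HB.instance Definition _ := GRing.isSubringClosed.Build (nat -> F) (frob_seq hp) frob_seq_subring.

Record fseq := FSeq { fseq_val : nat -> F; _ : fseq_val \in frob_seq hp }.
HB.instance Definition _ := [isSub for fseq_val].
HB.instance Definition _ := [Choice of fseq by <:].
HB.instance Definition _ := [SubChoice_isSubComNzRing of fseq by <:].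

(** Modulo eventually zero sequences, a nonzero element is nonzero at all late indices and is
    inverted termwise. Shifting a sequence by one index extracts its p-th root, and x in F goes to
    the sequence of x^(p^n). *)
Lemma perfect_closure_ex : exists (K : fieldType) (e : {rmorphism F -> K}), perfect_field K.
Proof.
pose ev (f : fseq) n : F := fseq_val f n.
have evD f g n : ev (f + g) n = ev f n + ev g n by [].
have evM f g n : ev (f * g) n = ev f n * ev g n by [].
have evB f g n : ev (f - g) n = ev f n - ev g n by [].
have evX f n j : ev (f ^+ j) n = ev f n ^+ j.
  by elim: j => [|j IH]; [rewrite !expr0|rewrite !exprS evM IH].
have evP f : exists N, forall n, (N <= n)%N -> ev f n.+1 = ev f n ^+ p by apply/asboolP; case: f.
pose I := [set f : fseq | exists N, forall n, (N <= n)%N -> ev f n = 0].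
have hI : is_ideal I.
  split; first by exists 0%N.
    move=> f g [N hN] [N' hN']; exists (maxn N N') => n; rewrite geq_max => /andP[h h'].
    by rewrite evD hN ?hN' ?addr0.
  by move=> f g [N hN]; exists N => n h; rewrite evM hN ?mulr0.
have hI1 : ~ I 1 by move=> [N /(_ N (leqnn N)) /eqP]; rewrite (_ : ev 1 N = 1) // oner_eq0.
have [Q [pi [spi kpi]]] := quot_ex hI hI1.
have mk (f : nat -> F) : (exists N, forall n, (N <= n)%N -> f n.+1 = f n ^+ p) ->
    exists g : fseq, forall n, ev g n = f n.
  by move=> hf; have hf' : f \in frob_seq hp by [apply/asboolP]; exists (FSeq hf').
have pi_eq f g N : (forall n, (N <= n)%N -> ev f n = ev g n) -> pi f = pi g.
  move=> h; apply/eqP; rewrite -subr_eq0 -rmorphB; apply/eqP/kpi; exists N => n hn.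
  by rewrite evB h ?subrr.
have [|K [f bf]] := @comring_field Q.
  move=> x x0; have [g gx] := spi x; have [N hN] := evP g.
  have nz n : (N <= n)%N -> ev g n <> 0.
    move=> hn g0; apply: x0; rewrite -gx; apply/kpi; exists n => m; elim: m => [|m IH].
      by rewrite leqn0 => /eqP n0; rewrite -n0.
    rewrite leq_eqVlt => /orP[/eqP <- //|]; rewrite ltnS => nm.
    by rewrite hN ?IH ?expr0n ?(gtn_eqF p0) // (leq_trans hn).
  have [|h hh] := mk (fun n => (ev g n)^-1); first by exists N => n hn; rewrite hN // exprVn.
  exists (pi h); rewrite -gx -rmorphM -(rmorph1 pi); apply: (pi_eq _ _ N) => n hn.
  by rewrite evM hh mulVf //; apply/eqP/nz.
have /choice[e0 he0] : forall c : F, exists g, forall n, ev g n = c ^+ (p ^ n).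
  by move=> c; apply: mk; exists 0%N => n _; rewrite -exprM expnSr.
have frobN' n (x y : F) : (x - y) ^+ (p ^ n) = x ^+ (p ^ n) - y ^+ (p ^ n).
  by elim: n => [|n IH]; rewrite ?expn0 ?expr1 // expnSr !exprM IH frobD frobN.
pose e1 c := pi (e0 c).
have e1B : zmod_morphism e1.
  by move=> x y; rewrite -rmorphB; apply: (pi_eq _ _ 0%N) => n _; rewrite evB !he0 frobN'.
have e1M : monoid_morphism e1.
  split=> [|x y]; first by rewrite /e1 -(rmorph1 pi); apply: (pi_eq _ _ 0%N) => n _; rewrite he0 expr1n.
  by rewrite -rmorphM; apply: (pi_eq _ _ 0%N) => n _; rewrite evM !he0 exprMn.
pose e : {rmorphism F -> Q} :=
  HB.pack e1 (GRing.isZmodMorphism.Build _ _ e1 e1B) (GRing.isMonoidMorphism.Build _ _ e1 e1M).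
exists K, (f \o e) => q hq x.
have qp : q = p.
  have : p \in [pchar K] by apply: (rmorph_pchar (f \o e)).
  by have := pcharf_eq hq; move=> hpe; rewrite hpe => /eqP ->.
have [f' fK fK'] := bf; have [g gx] := spi (f' x); have [N hN] := evP g.
have [|h hh] := mk (fun n => ev g n.-1); first by exists N.+1 => -[|n] //= hn; rewrite hN.
exists (f (pi h)); rewrite -[x]fK' -rmorphXn -gx; congr (f _); rewrite -rmorphXn qp.
by apply: (pi_eq _ _ N.+1) => -[|n] // hn; rewrite evX hh /= hN.
Qed.
End PerfectClosure.

(** In characteristic zero k itself serves; in characteristic p the perfect closure of k(X) does,
    being infinite by the powers of X. *)
Lemma infinite_perfect_ext (k : fieldType) : exists (K : fieldType) (e : {rmorphism k -> K}) (r : K -> k),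
  [/\ retract e r, infinite_field K & perfect_field K].
Proof.
have infI (K : fieldType) (z : nat -> K) : injective z -> infinite_field K.
  move=> zi s; apply: contrapT => h.
  have sub : {subset [seq z i | i <- iota 0 (size s).+1] <= s}.
    by move=> x _; apply: contrapT => xs; apply: h; exists x; apply/negP.
  have u : uniq [seq z i | i <- iota 0 (size s).+1] by rewrite map_inj_uniq ?iota_uniq.
  by have := uniq_leq_size u sub; rewrite size_map size_iota ltnn.
have [[p hp]|nop] := pselect (exists p, p \in [pchar k]); last first.
  have ch0 : [pchar k] =i pred0 by move=> p; apply/negP => hp; apply: nop; exists p.
  exists k, (idfun : {rmorphism k -> k}), id; split.
  - by split.
  - have le m n : (m <= n)%N -> m%:R = n%:R :> k -> m = n.
      move=> mn e; have := (pcharf0P k).1 ch0 (n - m)%N; rewrite natrB // e subrr eqxx => /esym/eqP.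
      by lia.
    apply: (infI _ (fun n => n%:R)) => m n e; have [mn|/ltnW mn] := leqP m n; first exact: le.
    by apply/esym/le.
  - by move=> p; rewrite ch0.
pose F := {fraction {poly k}}.
pose e1 : {rmorphism k -> F} := @tofrac {poly k} \o polyC.
have hpF : p \in [pchar F] by apply: rmorph_pchar hp.
have [K [e hK]] := perfect_closure_ex hpF.
have [r hr] := field_retract (e \o e1); exists K, (e \o e1), r; split=> //.
apply: (infI _ (fun n => e (tofrac 'X^n))) => m n /fmorph_inj/eqP; rewrite tofrac_eq => /eqP.
by move=> /(congr1 (size \o polyseq)); rewrite /= !size_polyXn => -[].
Qed.

(** * Uniform Artin-Rees *)

Lemma prod_const_seq (R : comPzRingType) (v : seq R) x : (forall y, y \in v -> y = x) ->
  \prod_(y <- v) y = x ^+ size v.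
Proof.
elim: v => [|y v IH] hv; first by rewrite big_nil.
rewrite big_cons exprS (hv y (mem_head _ _)) IH // => y' yv; apply: hv.
by rewrite inE yv orbT.
Qed.

Section GeneratedIdeals.
Variable R : comPzRingType.
Implicit Types (A C I J K : set R).

Definition gen_ideal A := ideal_mul setT A.

Lemma gen_is_ideal A : is_ideal (gen_ideal A).
Proof.
split; [exact: mul0|exact: mulD|]; move=> b.
apply: mul_ind => [|u v|u v _ Jv]; first by rewrite mulr0; exact: mul0.
  by rewrite mulrDr; apply: mulD.
by rewrite mulrA; apply: mem_mul.
Qed.

Lemma mem_gen A x : A x -> gen_ideal A x.
Proof. by move=> Ax; rewrite -[x]mul1r; apply: mem_mul. Qed.

Lemma pow_gen_ind A n K : K 0 -> (forall u v, K u -> K v -> K (u + v)) ->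
  (forall a (s : seq R), size s = n -> (forall y, y \in s -> A y) ->
     K (a * \prod_(y <- s) y)) ->
  forall x, ideal_pow (gen_ideal A) n x -> K x.
Proof.
move=> K0 KD; elim: n K K0 KD => [|n IH] K K0 KD h /=.
  by move=> x _; have := h x [::] erefl; rewrite big_nil mulr1; apply.
apply: mul_ind => // u v; move: u v.
suff : gen_ideal A `<=` [set u | forall v, ideal_pow (gen_ideal A) n v -> K (u * v)].
  by move=> H u v /H; apply.
apply: mul_ind => [v _|u u' hu hu' v hv|r y _ Ay v] /=; first by rewrite mul0r.
  by rewrite mulrDl; apply: KD; [apply: hu|apply: hu'].
apply: (IH (fun v => K (r * y * v))); first by rewrite mulr0.
  by move=> w w'; rewrite mulrDr; apply: KD.
move=> b s ss hs; have -> : r * y * (b * \prod_(z <- s) z) = (r * b) * \prod_(z <- y :: s) z.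
  by rewrite big_cons mulrACA.
by apply: h; rewrite /= ?ss // => z; rewrite inE => /orP[/eqP ->|/hs].
Qed.

Lemma pow_split I m n x : ideal_pow I (m + n) x -> ideal_mul (ideal_pow I m) (ideal_pow I n) x.
Proof.
elim: m x => [|m IH] x; first by move=> hx; rewrite -[x]mul1r; apply: mem_mul.
rewrite addSn /=; apply: mul_ind => [|u v|u v Iu /IH]; [exact: mul0|exact: mulD|].
move: v; apply: mul_ind => [|v v'|v v' hv hv']; first by rewrite mulr0; exact: mul0.
  by rewrite mulrDr; apply: mulD.
by rewrite mulrA; apply: mem_mul => //; apply: mem_mul.
Qed.

Lemma pow_mul_pow C J m n x y : ideal_pow C m x -> ideal_mul (ideal_pow C n) J y ->
  ideal_mul (ideal_pow C (m + n)) J (x * y).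
Proof.
move=> Cx; move: y; apply: mul_ind => [|v v'|v v' hv hv']; first by rewrite mulr0; exact: mul0.
  by rewrite mulrDr; apply: mulD.
by rewrite mulrA; apply: mem_mul => //; apply: powD.
Qed.

Lemma mul_span_coef N (ms : seq R) x : is_ideal N -> ideal_mul N (span ms) x ->
  exists c : nat -> R, (forall i, N (c i)) /\ x = \sum_(i < size ms) c i * ms`_i.
Proof.
move=> hN; move: x; apply: mul_ind => [|u v [c [hc ->]] [d [hd ->]]|u v Nu [d ->]].
- by exists (fun=> 0); split=> [i|]; [exact: ideal0|rewrite big1 // => i _; rewrite mul0r].
- exists (fun i => c i + d i); split=> [i|]; first exact: idealD.
  by rewrite -big_split; apply: eq_bigr => i _; rewrite mulrDl.
exists (fun i => u * d i); split=> [i|]; first exact: idealMl.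
by rewrite mulr_sumr; apply: eq_bigr => i _; rewrite mulrA.
Qed.

Lemma sub_integral_closure I x : I x -> is_ideal I -> integral_closure I x.
Proof.
move=> Ix hI; exists 1%N, (fun=> - x); split=> // [i|].
  case: i => [|[|i]] // _; apply: pow1; exact: idealN.
by rewrite big_nat1 expr1 subnn expr0 mulr1 subrr.
Qed.
End GeneratedIdeals.

Lemma pigeonhole (T : eqType) (f : T -> nat) g d (w : seq T) : (forall x, x \in w -> (f x < g)%N) ->
  (g * d < size w)%N -> exists a w1 w2, [/\ (a < g)%N, perm_eq w (w1 ++ w2), size w1 = d.+1 &
    forall x, x \in w1 -> f x = a].
Proof.
move=> hf hs; have [a [ag ha]] : exists a, (a < g)%N /\ (d < count (fun x => f x == a) w)%N.
  apply: contrapT => h; move: hs; rewrite ltnNge => /negP; apply.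
  have -> : size w = (\sum_(a < g) count (fun x => f x == a) w)%N.
    elim: w hf {h} => [|x w IH] hf; first by rewrite big1.
    rewrite /= big_split /= -IH; last by move=> y yw; apply: hf; rewrite inE yw orbT.
    rewrite (bigD1 (Ordinal (hf x (mem_head _ _)))) //= eqxx big1 ?addn0 ?add1n // => i.
    by rewrite -val_eqE eq_sym /= => /negPf ->.
  apply: leq_trans (_ : \sum_(a < g) d <= _)%N; last by rewrite sum_nat_const card_ord.
  apply: leq_sum => i _; rewrite leqNgt; apply/negP => hi; apply: h; exists i; split=> //.
pose v := filter (fun x => f x == a) w.
exists a, (take d.+1 v), (drop d.+1 v ++ filter (predC (fun x => f x == a)) w); split=> //.
- by rewrite catA cat_take_drop perm_sym perm_filterC.
- by rewrite size_takel // size_filter.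
by move=> x /mem_take; rewrite mem_filter => /andP[/eqP].
Qed.

(** The determinant trick on generators of M gives an equation for s that kills M; the
    nonzerodivisor [y0] in M lets M be cancelled. *)
Lemma det_integral (R : comNzRingType) (N M : set R) s y0 : noetherian R -> is_ideal N -> is_ideal M ->
  (forall y, M y -> ideal_mul N M (s * y)) -> M y0 -> (forall y, y * y0 = 0 -> y = 0) ->
  integral_closure N s.
Proof.
move=> nR hN hM hs My0 reg; have [ms ME] := nR M hM; pose r := size ms.
have /choice[c hc] : forall i : 'I_r, exists c : nat -> R, (forall j, N (c j)) /\
    s * ms`_i = \sum_(j < r) c j * ms`_j.
  move=> i; apply: mul_span_coef => //; rewrite -ME; apply: hs.
  by rewrite ME; apply: mem_span; apply: mem_nth.
have [|i|p [mp sp] [pN p0]] := @det_trick R R idfun N r (\matrix_(i, j) c i j)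
    (fun i => ms`_(nat_of_ord i)) s hN.
- by move=> i j; rewrite mxE; apply: (hc i).1.
- by rewrite /= (hc i).2; apply: eq_bigr => j _; rewrite mxE.
have ps : p.[s] = 0.
  apply: reg; move: My0; rewrite ME => -[d ->]; rewrite mulr_sumr big1 // => i _.
  by rewrite mulrCA; have /= -> := p0 i; rewrite mulr0.
have r0 : (0 < r)%N.
  rewrite lt0n; apply/eqP => r0; move: My0; rewrite ME => -[d]; rewrite -/r r0 big_ord0 => y00.
  by have := reg 1; rewrite y00 mulr0 => /(_ erefl)/eqP; rewrite oner_eq0.
exists r, (fun i => p`_(r - i)); split=> // [i /andP[_ ir]|].
  by have := pN (r - i)%N (leq_subr _ _); rewrite subKn.
rewrite -[RHS]ps horner_coef sp big_ord_recr /= addrC.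
have -> : p`_r = 1 by move/monicP: mp; rewrite lead_coefE sp.
rewrite mul1r; congr (_ + _).
rewrite -(big_mkord xpredT (fun i => p`_i * s ^+ i)) [RHS]big_nat_rev big_add1 /=.
by apply: eq_bigr => i _; rewrite add0n.
Qed.

(* A abstracts a polynomial ring in a variable X, G a monic polynomial of degree D in X;
   phi is the substitution X -> X + lambda b. *)
Definition transl (A : comNzRingType) (G : A) D := forall (B : comNzRingType) (io : {rmorphism A -> B}) b,
  exists phi : {rmorphism A -> {poly B}}, [/\ forall f, (phi f)`_0 = io f,
    forall f i, (0 < i)%N -> exists y, (phi f)`_i = b * y & (phi G)`_D = b ^+ D].

(** Translating by multiples of a generator b of J preserves the powers of J, so the translates of G
    and of s multiply into J^(m+D). Let C be generated by G and the coefficients of its translates,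
    among them every b^D. Dedekind-Mertens gives s C^(nn+1) inside C^nn J^(m+D). With L = C + J^D
    one has L^(g+1) inside C L^g, so s maps M = C^nn L^(g+1) into J^m M, and M contains a power of
    G. *)
Theorem transl_closure (A : comNzRingType) (G : A) D (J : set A) m s : noetherian A ->
  transl G D -> (forall y, y * G = 0 -> y = 0) -> is_ideal J ->
  ideal_pow J (m + D) (G * s) -> integral_closure (ideal_pow J m) s.
Proof.
move=> nA tG reg hJ hGs; have [bs JE] := nA J hJ; pose g := size bs.
case: D tG hGs => [|d] tG hGs.
  (* For D = 0 the definition forces G = 1. *)
  have [phi [p0 _ pD]] := tG A idfun 0; rewrite p0 expr0 /= in pD.
  by apply: sub_integral_closure; [move: hGs; rewrite pD mul1r addn0|exact: pow_ideal].
have /choice[phi hphi] : forall i : nat, exists phi : {rmorphism A -> {poly A}},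
    [/\ forall f, (phi f)`_0 = f, forall f l, (0 < l)%N -> exists y, (phi f)`_l = bs`_i * y
      & (phi G)`_d.+1 = bs`_i ^+ d.+1] by move=> i; exact: (tG A idfun bs`_i).
(* [n] bounds the degrees of the translates of s. Among nn + 1 generators of C, some n + 1 are all
   equal to G or all coefficients of the same translate of G, as Dedekind-Mertens requires. *)
pose n := (\sum_(i < g) size (phi i s))%N; pose nn := (g.+1 * n)%N.
pose gens := [set y | y = G \/ exists i l, (i < g)%N /\ y = (phi i G)`_l].
pose C := gen_ideal gens; have hC : is_ideal C by exact: gen_is_ideal.
have CG : C G by apply: mem_gen; left.
have Jb i : (i < g)%N -> J bs`_i by move=> ig; rewrite JE; apply: mem_span; apply: mem_nth.
have phiJ i N f : (i < g)%N -> ideal_pow J N f -> forall l, ideal_pow J N (phi i f)`_l.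
  move=> ig; move: f; apply: pow_ind => [l|u v hu hv l|b ys <- hys].
  - by rewrite rmorph0 coef0; apply: pow0r.
  - by rewrite rmorphD coefD; apply: powDr.
  have phiJ1 y : J y -> forall l, J (phi i y)`_l.
    have [h0 h1 _] := hphi i.
    move=> Jy [|l]; first by rewrite h0.
    by have [y' ->] := h1 y l.+1 isT; apply: idealMl => //; apply: Jb.
  rewrite rmorphM => l; rewrite coefM; apply: ideal_sum => [|j _]; first exact: pow_ideal.
  apply: idealM; first exact: pow_ideal.
  move: (l - j)%N; elim: ys hys => [|y ys IH] hys l' //=.
  rewrite big_cons rmorphM coefM; apply: ideal_sum => [|j' _]; first exact: ideal_mul_ideal (pow_ideal _ _).
  apply: mem_mul; first by apply/phiJ1/hys/mem_head.
  by apply: IH => z zs; apply: hys; rewrite inE zs orbT.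
have claim1 x : ideal_pow C nn.+1 x -> ideal_mul (ideal_pow C nn) (ideal_pow J (m + d.+1)) (s * x).
  move: x; apply: pow_gen_ind => [|u v|b w sw hw].
  - by rewrite mulr0; exact: mul0.
  - by rewrite mulrDr; apply: mulD.
  have /choice[f hf] : forall y, exists t, gens y -> (t = g /\ y = G) \/ ((t < g)%N /\ exists l, y = (phi t G)`_l).
    move=> y; have [[->|[i [l [ig ->]]]]|ny] := pselect (gens y).
    + by exists g => _; left.
    + by exists i => _; right; split=> //; exists l.
    + by exists 0%N.
  have [||t [w1 [w2 [tg pw sw1 hw1]]]] := @pigeonhole _ f g.+1 n w.
  - by move=> y /hw/hf[[-> _]|[h _]] //; apply: ltnW.
  - by rewrite sw.
  have wg y : y \in w1 ++ w2 -> gens y by rewrite -(perm_mem pw); apply: hw.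
  have sw2 : (size w2 + n)%N = nn by have := perm_size pw; rewrite sw size_cat sw1; lia.
  have w2C : ideal_pow C (size w2) (b * \prod_(y <- w2) y).
    by apply: mem_pow => y yw; apply: mem_gen; apply: wg; rewrite mem_cat yw orbT.
  rewrite (perm_big _ pw) big_cat /=.
  have -> : s * (b * (\prod_(y <- w1) y * \prod_(y <- w2) y)) =
      (b * \prod_(y <- w2) y) * (s * \prod_(y <- w1) y) by ring.
  rewrite -sw2; apply: (pow_mul_pow w2C).
  have w1g y : y \in w1 -> gens y by move=> yw; apply: wg; rewrite mem_cat yw.
  have [tg'|tg'] := eqVneq t g.
    have -> : \prod_(y <- w1) y = G ^+ size w1.
      have : forall y, y \in w1 -> y = G.
        move=> y yw; have [[_ ->] //|[]] := hf y (w1g y yw).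
        by rewrite hw1 // tg' ltnn.
      exact: prod_const_seq.
    rewrite sw1 exprS mulrCA mulrA mulrC; apply: mem_mul => //.
    by have := powE n (pow1 CG); rewrite mul1n.
  have tlt : (t < g)%N by rewrite ltn_neqAle tg' -ltnS.
  have [idx [si ->]] : exists idx : seq nat, size idx = size w1 /\
      \prod_(y <- w1) y = \prod_(l <- idx) (phi t G)`_l.
    have : forall y, y \in w1 -> exists l, y = (phi t G)`_l.
      move=> y yw; have [[e _]|[_]] := hf y (w1g y yw); last by rewrite hw1.
      by rewrite -e hw1 // eqxx in tg'.
    elim: (w1) => [|y v IH] hv; first by exists [::]; rewrite !big_nil.
    have [|idx [si e]] := IH; first by move=> y' yv; apply: hv; rewrite inE yv orbT.
    have [l ->] := hv y (mem_head _ _); exists (l :: idx); rewrite /= si; split=> //.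
    by rewrite !big_cons e.
  have s0 : s = (phi t s)`_0 by have [-> _ _] := hphi t.
  rewrite [s in s * _]s0 mulrC.
  apply: (@dedekind_mertens _ n (phi t G) (phi t s) [set x | ideal_mul (ideal_pow C n) (ideal_pow J (m + d.+1)) x]).
  - by apply: leqW; rewrite /n (bigD1 (Ordinal tlt)) //= leq_addr.
  - split; first exact: mul0.
    move=> x y hx hy; apply: mulD => //.
    by apply: idealN => //; apply: ideal_mul_ideal; exact: pow_ideal.
  - move=> idx' l' <-; apply: mem_mul; last by rewrite -rmorphM; apply: phiJ.
    elim: idx' => [//|i' v' IH].
    by rewrite big_cons /=; apply: mem_mul => //; apply: mem_gen; right; exists t, i'.
  by rewrite si sw1.
pose L := [set x | exists u v, [/\ C u, ideal_pow J d.+1 v & x = u + v]].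
have hL : is_ideal L.
  split; first by exists 0, 0; rewrite addr0; split=> //; [exact: ideal0|exact: pow0r].
    move=> _ _ [u [v [Cu Jv ->]]] [u' [v' [Cu' Jv' ->]]]; exists (u + u'), (v + v').
    by rewrite addrACA; split=> //; [apply: idealD|apply: powDr].
  move=> b _ [u [v [Cu Jv ->]]]; exists (b * u), (b * v); rewrite mulrDr; split=> //.
    exact: idealM.
  by apply: idealM => //; exact: pow_ideal.
have CL u : C u -> L u by exists u, 0; rewrite addr0; split=> //; exact: pow0r.
have JL v : ideal_pow J d.+1 v -> L v by exists 0, v; rewrite add0r; split=> //; exact: ideal0.
have hCL N : is_ideal (ideal_mul C (ideal_pow L N)) by apply: ideal_mul_ideal; exact: pow_ideal.
(* Replacing each factor by its part in J^D costs an element of C L^g. The rest lies in J^(D (g+1)),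
   where the pigeonhole principle finds some generator D times, and its D-th power is in C. *)
have claim2 x : ideal_pow L g.+1 x -> ideal_mul C (ideal_pow L g) x.
  move: x; apply: pow_ind => [|u v|b ys sy hy]; [exact: mul0|exact: mulD|].
  apply: idealM => //.
  have [vs [svs hvs hd]] : exists vs : seq A, [/\ size vs = size ys, forall v, v \in vs -> ideal_pow J d.+1 v &
      ideal_mul C (ideal_pow L (size ys).-1) (\prod_(y <- ys) y - \prod_(v <- vs) v)].
    elim: ys {sy} hy => [|y ys IH] hy; first by exists [::]; rewrite !big_nil subrr; split=> //; exact: mul0.
    have [|vs [svs hvs hd]] := IH; first by move=> z zs; apply: hy; rewrite inE zs orbT.
    have [u [v [Cu Jv ye]]] := hy y (mem_head _ _).
    exists (v :: vs); rewrite /= svs; split=> //.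
      by move=> z; rewrite inE => /orP[/eqP -> //|/hvs].
    rewrite !big_cons ye.
    have -> : (u + v) * \prod_(j <- ys) j - v * \prod_(j <- vs) j =
      u * \prod_(j <- ys) j + v * (\prod_(j <- ys) j - \prod_(j <- vs) j) by ring.
    apply: mulD.
      apply: mem_mul => //; rewrite -[\prod_(_ <- _) _]mul1r; apply: mem_pow => z zs.
      by apply: hy; rewrite inE zs orbT.
    case: (size ys) hd => [|N] /= hd; first by apply: (idealM _ (hCL 0%N)).
    move: hd; move: (_ - _) => w; move: w; apply: mul_ind => [|w w'|w w' hw hw'].
    - by rewrite mulr0; exact: mul0.
    - by rewrite mulrDr; apply: mulD.
    by rewrite mulrCA; apply: mem_mul => //; apply: mem_mul => //; apply: JL.
  rewrite -(subrK (\prod_(v <- vs) v) (\prod_(y <- ys) y)); apply: mulD; first by rewrite sy in hd.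
  have : ideal_pow (gen_ideal [set y | y \in bs]) (d.+1 * g.+1) (\prod_(v <- vs) v).
    rewrite -sy -svs; apply: powM; rewrite -[\prod_(_ <- _) _]mul1r; apply: mem_pow => v /hvs.
    apply: pow_sub => z; rewrite JE; apply: span_sub; first exact: gen_is_ideal.
    by move=> y yb; apply: mem_gen.
  apply: pow_gen_ind => [|u v|b' w sw hw]; [exact: mul0|exact: mulD|].
  have [||t [w1 [w2 [tg pw sw1 hw1]]]] := @pigeonhole _ (fun y => index y bs) g d w.
  - by move=> y /hw yb; rewrite index_mem.
  - by rewrite sw; nia.
  rewrite (perm_big _ pw) big_cat /= mulrCA; apply: mem_mul.
    have -> : \prod_(y <- w1) y = (phi t G)`_d.+1.
      have [_ _ ->] := hphi t; rewrite -sw1.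
      have : forall y, y \in w1 -> y = bs`_t.
        move=> y yw; rewrite -(hw1 y yw) nth_index //; apply: hw.
        by rewrite (perm_mem pw) mem_cat yw.
      exact: prod_const_seq.
    by apply: mem_gen; right; exists t, d.+1.
  have sw2 : size w2 = (d.+1 * g)%N by have := perm_size pw; rewrite sw size_cat sw1; lia.
  apply: (pow_sub (I := ideal_pow J d.+1)); first exact: JL.
  have : ideal_pow J (d.+1 * g) (b' * \prod_(y <- w2) y).
    rewrite -sw2; apply: mem_pow => y yw; rewrite JE; apply: mem_span; apply: hw.
    by rewrite (perm_mem pw) mem_cat yw orbT.
  elim: (g) (b' * _) => [|N IH] z //; rewrite mulnS => /pow_split.
  by apply: mul_sub => // y; exact: IH.
pose M := ideal_mul (ideal_pow C nn) (ideal_pow L g.+1).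
have hM : is_ideal M by apply: ideal_mul_ideal; exact: pow_ideal.
have claim3 u v : ideal_pow C nn.+1 u -> ideal_pow L g v -> ideal_mul (ideal_pow J m) M (s * (u * v)).
  move=> /claim1 + Lv; rewrite mulrA; move: (s * u) => w; move: w.
  apply: mul_ind => [|w w'|w w' hw /pow_split hw'].
  - by rewrite mul0r; exact: mul0.
  - by rewrite mulrDl; apply: mulD.
  move: w' hw'; apply: mul_ind => [|z z'|z z' hz hz'].
  - by rewrite mulr0 mul0r; exact: mul0.
  - by rewrite mulrDr mulrDl; apply: mulD.
  have -> : w * (z * z') * v = z * (w * (z' * v)) by ring.
  by apply: mem_mul => //; apply: mem_mul => //; apply: mem_mul => //; apply: JL.
apply: (@det_integral A (ideal_pow J m) M s (G ^+ nn * G ^+ g.+1)) => //; first exact: pow_ideal.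
- apply: mul_ind => [|u v|u v Cu /claim2].
  + by rewrite mulr0; exact: mul0.
  + by rewrite mulrDr; apply: mulD.
  move: v; apply: mul_ind => [|v v'|v v' Cv Lv'].
  + by rewrite !mulr0; exact: mul0.
  + by rewrite !mulrDr; apply: mulD.
  rewrite mulrA; apply: claim3 => //; rewrite mulrC; exact: mem_mul.
- apply: mem_mul; first by have := powE nn (pow1 CG); rewrite mul1n.
  by have := powE g.+1 (pow1 (CL _ CG)); rewrite mul1n.
move=> y; rewrite -exprD; elim: (_ + _)%N y => [|N IH] y; first by rewrite mulr1.
by rewrite exprSr mulrA => /reg/IH.
Qed.

(** * Translations in monic and iterated polynomial extensions *)

Lemma poly_hom_ext (R B : comNzRingType) (f g : {rmorphism {poly R} -> B}) :
  (forall c, f c%:P = g c%:P) -> f 'X = g 'X -> f =1 g.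
Proof.
move=> hC hX; elim/poly_ind => [|p c IH]; first by rewrite !rmorph0.
by rewrite !rmorphD !rmorphM IH hC hX.
Qed.

Lemma poly_hom_ex (A B : comNzRingType) (f : {rmorphism A -> B}) (u : B) :
  exists phi : {rmorphism {poly A} -> B}, (forall c, phi c%:P = f c) /\ phi 'X = u.
Proof.
exists (horner_eval u \o map_poly f); split=> [c|] /=.
  by rewrite map_polyC /horner_eval hornerC.
by rewrite map_polyX /horner_eval hornerX.
Qed.

Lemma transl_monic (H : comNzRingType) (G : {poly H}) : G \is monic -> transl G (size G).-1.
Proof.
move=> mG B io b; pose j : {rmorphism H -> {poly B}} := polyC \o (io \o polyC).
pose u : {poly B} := (io 'X)%:P + b%:P * 'X.
have [phi [phiC phiX]] := poly_hom_ex j u.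
have {}phiC c : phi c%:P = (io c%:P)%:P by rewrite phiC.
have key f : exists y, phi f = (io f)%:P + b%:P * 'X * y.
  elim/poly_ind: f => [|f c [y e]]; first by exists 0; rewrite !rmorph0 mulr0 addr0.
  exists (y * u + (io f)%:P); rewrite rmorphD rmorphM phiX phiC e [io (_ + _)]rmorphD [io (_ * _)]rmorphM.
  by rewrite polyCD polyCM /u; ring.
exists phi; split=> [f|f i i0|].
- have [y ->] := key f; rewrite coefD coefC eqxx -mulrA coefCM coefXM eqxx mulr0 addr0 //.
- have [y ->] := key f; exists ('X * y)`_i.
  by rewrite coefD coefC -mulrA coefCM; case: i i0 => // i _; rewrite add0r.
have su : (size u <= 2)%N.
  rewrite /u addrC mul_polyC; apply: leq_trans (size_polyD _ _) _; rewrite geq_max.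
  by rewrite (leq_trans (size_scale_leq _ _)) ?size_polyX //= (leq_trans (size_polyC_leq1 _)).
have u1 : u`_1 = b by rewrite /u coefD coefC add0r coefCM coefX mulr1.
have hX j' : (size (u ^+ j') <= j'.+1)%N /\ (u ^+ j')`_j' = b ^+ j'.
  elim: j' => [|l [IH1 IH2]]; first by rewrite !expr0 size_poly1 coef1.
  by rewrite !exprS -IH2 -{1}u1 -[l.+1]add1n; apply: coefM_top.
have sG : size G = (size G).-1.+1 by rewrite prednK // size_poly_gt0 monic_neq0.
rewrite -[G in phi G]coefK poly_def rmorph_sum coef_sum.
rewrite [in LHS]sG big_ord_recr /= big1 ?add0r => [|i _].
  have := monicP mG; rewrite lead_coefE => ->.
  by rewrite scale1r rmorphXn phiX (hX _).2.
rewrite -mul_polyC rmorphM phiC rmorphXn phiX coefCM [(u ^+ _)`__]nth_default ?mulr0 //.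
exact: leq_trans (hX i).1 (ltn_ord i).
Qed.

Lemma transl_poly (A : comNzRingType) (G : A) D : transl G D -> transl G%:P D.
Proof.
move=> tG B io b; have [phi0 [p0 pb pG]] := tG B (io \o polyC) b.
have [phi [phiC phiX]] := poly_hom_ex phi0 (io 'X)%:P.
exists phi; split=> [|f i i0|]; last by rewrite phiC.
  elim/poly_ind => [|f c IH]; first by rewrite !rmorph0 coef0.
  by rewrite rmorphD rmorphM phiX phiC coefD coefMC IH p0 rmorphD rmorphM.
elim/poly_ind: f => [|f c [y IH]]; first by exists 0; rewrite rmorph0 coef0 mulr0.
have [y' hy'] := pb c i i0; exists (y * io 'X + y').
by rewrite rmorphD rmorphM phiX phiC coefD coefMC IH hy' mulrDr mulrA.
Qed.

Definition quot_by (A B : comNzRingType) (f : {rmorphism A -> B}) (G : A) :=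
  (forall y, exists x, f x = y) /\ (forall x, f x = 0 <-> exists y, x = y * G).

Lemma quot_by_poly (A B : comNzRingType) (f : {rmorphism A -> B}) (G : A) :
  quot_by f G -> quot_by (map_poly f) G%:P.
Proof.
move=> [sf kf]; split=> [p|p].
  have [s hs] := choice sf; exists (\poly_(i < size p) s p`_i).
  apply/polyP => i; rewrite coef_map coef_poly; case: ltnP => h; first exact: hs.
  rewrite [RHS]nth_default //; exact: raddf0.
split=> [h|[q ->]]; last first.
  have fG : f G = 0 by apply/kf; exists 1; rewrite mul1r.
  apply/polyP => i; rewrite coef_map coefMC coef0; apply: etrans (rmorphM f _ _) _.
  by rewrite fG mulr0.
have /choice[s hs] : forall i, exists y, p`_i = y * G.
  by move=> i; apply/kf; rewrite -coef_map h coef0.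
exists (\poly_(i < size p) s i); apply/polyP => i; rewrite coefMC coef_poly.
by case: ltnP => hi; [exact: hs|rewrite mul0r nth_default].
Qed.

(** The newest variable is innermost: [ip {poly H} m] is [ip H m.+1] by definition, so a level H[X]
    -> Q of a tower induces a map of iterated polynomial rings with no isomorphism in between. *)
Fixpoint ip (H : comNzRingType) m : comNzRingType := if m is m'.+1 then ip {poly H} m' else H.
Fixpoint ipC m (H : comNzRingType) : {rmorphism H -> ip H m} :=
  match m return {rmorphism H -> ip H m} with
  | 0%N => idfun
  | m'.+1 => (ipC m' {poly H} \o polyC : {rmorphism H -> ip {poly H} m'})
  end.
Fixpoint ipmap m (A B : comNzRingType) (f : {rmorphism A -> B}) : {rmorphism ip A m -> ip B m} :=
  match m return {rmorphism ip A m -> ip B m} with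
  | 0%N => f
  | m'.+1 => @ipmap m' {poly A} {poly B} (map_poly f)
  end.

Lemma ipmapC m (A B : comNzRingType) (f : {rmorphism A -> B}) x : ipmap m f (ipC m A x) = ipC m B (f x).
Proof.
elim: m A B f x => [|m IH] A B f x //=.
by have := IH _ _ (map_poly f) x%:P; rewrite /= map_polyC.
Qed.

Lemma quot_by_ip m (A B : comNzRingType) (f : {rmorphism A -> B}) G : quot_by f G -> quot_by (ipmap m f) (ipC m A G).
Proof.
elim: m A B f G => [|m IH] A B f G hG //=.
exact: (IH _ _ (map_poly f) G%:P (quot_by_poly hG)).
Qed.

Lemma transl_ip m (A : comNzRingType) (G : A) D : transl G D -> transl (ipC m A G) D.
Proof. by elim: m A G => [|m IH] A G tG //=; apply: (IH _ G%:P); apply: transl_poly. Qed.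

Lemma reg_ip m (A : comNzRingType) (G : A) : (forall y, y * G = 0 -> y = 0) ->
  forall y, y * ipC m A G = 0 -> y = 0.
Proof.
elim: m A G => [|m IH] A G rG //=; apply: (IH _ G%:P) => p h; apply/polyP => i.
by rewrite coef0; apply: rG; rewrite -coefMC h coef0.
Qed.

Lemma noeth_ip m (A : comNzRingType) : noetherian A -> noetherian (ip A m).
Proof. by elim: m A => [|m IH] A nA //=; apply: IH; apply: noeth_poly. Qed.

Lemma ls_ip m (k : fieldType) (H : comNzRingType) (a : {rmorphism k -> H}) M Delta :
  ls_presentation a M Delta -> exists M', ls_presentation (ipC m H \o a) M' (ipC m H Delta).
Proof.
elim: m H a M Delta => [|m IH] H a M Delta hl /=; first by exists M.
exact: (IH _ (polyC \o a) M.+1 Delta%:P (ls_poly hl)).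
Qed.

(** * Artin-Rees up to a multiplier *)

Definition domain_like (D : comNzRingType) := forall x y : D, x * y = 0 -> x = 0 \/ y = 0.

(** Artin-Rees for the kernel of rho up to a multiplier outside it, which is all that the Noetherian
    induction asks for at a prime ideal. *)
Definition weak_ar (Q D : comNzRingType) (rho : Q -> D) := exists a c, rho a <> 0 /\
  forall J, is_ideal J -> forall n z, ideal_pow J (n + c) z -> rho z = 0 ->
    ideal_mul (ideal_pow J n) [set z | rho z = 0] (a * z).

Lemma weak_ar_ext (Q D : comNzRingType) (rho rho' : Q -> D) : rho =1 rho' -> weak_ar rho -> weak_ar rho'.
Proof. by move=> /funext ->. Qed.

Lemma image_ideal (A B : comPzRingType) (f : {rmorphism A -> B}) (J : set A) :
  (forall y, exists x, f x = y) -> is_ideal J -> is_ideal (f @` J).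
Proof.
move=> sf hJ; split.
- by exists 0; [exact: ideal0|rewrite rmorph0].
- by move=> _ _ [x Jx <-] [y Jy <-]; exists (x + y); [exact: idealD|rewrite rmorphD].
- move=> b _ [x Jx <-]; have [c <-] := sf b; exists (c * x); [exact: idealM|by rewrite rmorphM].
Qed.

(** Lift the decomposition of a1 z from the quotient by G. The error s G lies in J^(n+c0+d), so
    [transl_closure] puts s into the integral closure of J^(n+c0), and Delta s lies in J^n. As G is
    in the kernel, Delta s G is of the required form. *)
Lemma weak_ar_chain (A A1 D : comNzRingType) (G : A) d (q : {rmorphism A -> A1}) (rho : {rmorphism A1 -> D})
    Delta c0 : domain_like D -> noetherian A -> transl G d -> (forall y, y * G = 0 -> y = 0) ->
  quot_by q G -> weak_ar rho -> briancon_skoda Delta c0 -> rho (q Delta) <> 0 -> weak_ar (rho \o q).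
Proof.
move=> dD nA tG rG [sq kq] [a1 [c1 [a10 h1]]] bs D0; have [a1' a1E] := sq a1.
exists (Delta * a1'), (c0 + d + c1)%N; split.
  by rewrite /= !rmorphM a1E => /dD[].
move=> J hJ n z hz rz; pose N := (n + c0 + d)%N.
have hqz : ideal_mul (ideal_pow (q @` J) N) [set z | rho z = 0] (a1 * q z).
  apply: h1 => //; first exact: image_ideal.
  by apply: image_pow; move: hz; rewrite /N !addnA.
have kideal : is_ideal [set z | (rho \o q) z = 0].
  split=> [|x y /= hx hy|b x /= hx]; rewrite /= ?rmorph0 //.
    by rewrite !rmorphD hx hy addr0.
  by rewrite !rmorphM hx mulr0.
have [x [hx qx]] : exists x, ideal_mul (ideal_pow J N) [set z | (rho \o q) z = 0] x /\ q x = a1 * q z.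
  move: (a1 * q z) hqz; apply: mul_ind => [|u v [x [hx <-]] [y [hy <-]]|u v hu hv].
  - by exists 0; rewrite rmorph0; split=> //; exact: mul0.
  - by exists (x + y); rewrite rmorphD; split=> //; exact: mulD.
  have [x hx <-] := lift_pow sq (fun y h => h) hu; have [y yv] := sq v.
  by exists (x * y); rewrite rmorphM yv; split=> //; apply: mem_mul; rewrite //= yv.
have [s sE] : exists s, a1' * z - x = s * G by apply/kq; rewrite rmorphB rmorphM a1E qx subrr.
have Gs : ideal_pow J N (G * s).
  rewrite mulrC -sE; apply: idealB; first exact: pow_ideal.
    apply: idealM; first exact: pow_ideal.
    by apply: pow_le hz; rewrite /N; lia.
  by apply: mul_subl hx; exact: pow_ideal.
have cs := transl_closure nA tG rG hJ Gs.
have Ds := bs J hJ n s cs.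
have -> : Delta * a1' * z = Delta * x + (Delta * s) * G by rewrite -!mulrA -sE; ring.
apply: mulD.
  apply: (idealM _ (ideal_mul_ideal _ kideal)).
  by apply: mul_sub hx => // y; apply: pow_le; rewrite /N -addnA leq_addr.
apply: mem_mul => //=; have -> : q G = 0 by apply/kq; exists 1; rewrite mul1r.
by rewrite rmorph0.
Qed.

Lemma weak_ar_surj (T S D : comNzRingType) (pi : {rmorphism T -> S}) (rho : {rmorphism S -> D}) :
  (forall y, exists x, pi x = y) -> weak_ar (rho \o pi) -> weak_ar rho.
Proof.
move=> sp [a [c [a0 h]]]; exists (pi a), c; split=> // J hJ n z hz rz.
have [|z' hz' ze] := lift_pow (I := pi @^-1` J) sp _ hz.
  by move=> y Jy; have [x xy] := sp y; exists x; rewrite /preimage //= xy.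
have := h _ (preim_ideal pi hJ) n z' hz'; rewrite /= ze => /(_ rz); rewrite -ze -rmorphM.
move: (a * z'); apply: mul_ind => [|u v|u v hu hv].
- by rewrite rmorph0; exact: mul0.
- by rewrite rmorphD; exact: mulD.
by rewrite rmorphM; apply: mem_mul => //; apply: morph_pow hu.
Qed.

Lemma monic_regr (A : comNzRingType) (G : {poly A}) : G \is monic -> forall y, y * G = 0 -> y = 0.
Proof.
move=> mG y /eqP; rewrite mulrC mulrI_eq0; first by move/eqP.
by apply: lreg_lead; rewrite (monicP mG); exact: lreg1.
Qed.

(** The levels of the tower are removed from the top: each adjoined root is replaced by a polynomial
    variable, and the equation is absorbed by [weak_ar_chain], with the Briancon-Skoda multiplier of
    the level below. *)
Lemma tower_weak_ar (k : fieldType) M (H : comNzRingType) (a : {rmorphism k -> H}) Delta (D : comNzRingType)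
    (kappa : k -> D) : infinite_field k -> domain_like D -> tower M a Delta ->
  forall m (rho : {rmorphism ip H m -> D}), weak_ar rho -> rho (ipC m H Delta) <> 0 ->
  (forall c, rho (ipC m H (a c)) = kappa c) -> (forall y, exists x, rho x = y) ->
  exists m' (rho' : {rmorphism ip {mpoly k[M]} m' -> D}), [/\ weak_ar rho',
    forall c, rho' (ipC m' {mpoly k[M]} c%:MP) = kappa c & forall y, exists x, rho' x = y].
Proof.
move=> hk dD; elim=> [|H' Q a' De p G tw IH hp] m rho hw hD hc sr; first by exists m, rho.
have [mG sp kp] := hp.
pose q : {rmorphism ip H' m.+1 -> ip Q m} := ipmap m p.
have hq : quot_by q (ipC m {poly H'} G) by apply: quot_by_ip.
have DE : ipC m Q (p (De%:P * G^`())) = ipC m Q (p De%:P) * ipC m Q (p G^`()) by rewrite !rmorphM.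
have D1 : rho (q (ipC m.+1 H' De)) <> 0.
  rewrite /q /= ipmapC => e; apply: hD; rewrite DE rmorphM.
  by move: e; move: (rho _) => ? ->; rewrite mul0r.
have [M' hl] := ls_ip m.+1 (tower_ls tw).
have nA : noetherian (ip H' m.+1) by apply: noeth_ip; apply: tower_noeth tw.
apply: (IH m.+1 (rho \o q)) => //.
- exact: (@weak_ar_chain (ip H' m.+1) (ip Q m) D (ipC m {poly H'} G) (size G).-1 q rho _ _ dD nA
    (@transl_ip m {poly H'} G _ (transl_monic mG)) (@reg_ip m {poly H'} G (monic_regr mG)) hq hw
    (lipman_sathaye hk nA hl) D1).
- by move=> c; rewrite -(hc c) /= /q ipmapC.
- by move=> y; have [x <-] := sr y; have [x' <-] := hq.1 x; exists x'.
Qed.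

Lemma ip_lift m (A S D : comNzRingType) (rhoS : {rmorphism S -> D}) (rho : {rmorphism ip A m -> D})
    (pi0 : {rmorphism A -> S}) : (forall y, exists x, rhoS x = y) ->
  (forall x, rhoS (pi0 x) = rho (ipC m A x)) ->
  exists pi : {rmorphism ip A m -> S}, (forall x, rhoS (pi x) = rho x) /\
    forall x, pi (ipC m A x) = pi0 x.
Proof.
move=> sS; elim: m A rho pi0 => [|m IH] A rho pi0 h /=; first by exists pi0.
have [s hs] := sS (rho (ipC m.+1 A 1 * ipC m {poly A} 'X)).
have [pi1 [pi1C pi1X]] := poly_hom_ex pi0 s.
have [|pi [h1 h2]] := IH _ rho pi1; last first.
  by exists pi; split=> // x; rewrite h2 pi1C.
move=> x; apply: (poly_hom_ext (f := rhoS \o pi1) (g := rho \o ipC m {poly A})) => [c|] /=.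
  by rewrite pi1C h.
by rewrite pi1X hs rmorph1 mul1r.
Qed.

(** For each x a variable is added that maps to x in S. In D this x agrees with the image of some t
    in T, so T[X] -> D factors through X -> t, with the monic X - t as relation, and [weak_ar_chain]
    applies with Delta = 1. *)
Lemma weak_ar_cover (k : fieldType) (S D : comNzRingType) (rhoS : {rmorphism S -> D}) (xs : seq S) :
  infinite_field k -> domain_like D ->
  forall (T : comNzRingType) (aT : {rmorphism k -> T}) MT (pi : {rmorphism T -> S}),
  noetherian T -> ls_presentation aT MT 1 -> weak_ar (rhoS \o pi) ->
  (forall y, exists x, rhoS (pi x) = y) ->
  exists (T' : comNzRingType) (pi' : {rmorphism T' -> S}), [/\ weak_ar (rhoS \o pi'),
    (forall t, exists t', pi' t' = pi t) & forall x, x \in xs -> exists t, pi' t = x].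
Proof.
move=> hk dD; elim: xs => [|x xs IH] T aT MT pi nT lT hw sp.
  by exists T, pi; split=> // t; exists t.
have [t ht] := sp (rhoS x).
pose q : {rmorphism {poly T} -> T} := horner_eval t.
have [pi1 [pi1C pi1X]] := poly_hom_ex pi x.
have rE : (rhoS \o pi) \o q =1 rhoS \o pi1.
  apply: (poly_hom_ext (f := (rhoS \o pi) \o q) (g := rhoS \o pi1)) => [c|] /=.
    by rewrite /horner_eval hornerC pi1C.
  by rewrite /horner_eval hornerX ht pi1X.
have hq : quot_by q ('X - t%:P).
  split=> [y|p]; first by exists y%:P; rewrite /q /= /horner_eval hornerC.
  split=> [h|[y ->]]; last by rewrite /q /= /horner_eval hornerM hornerXsubC subrr mulr0.
  by apply/factor_theorem; rewrite /root; apply/eqP.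
have nT1 := noeth_poly nT.
have lT1 := ls_poly lT; rewrite polyC1 in lT1.
have hw1 : weak_ar (rhoS \o pi1).
  apply: weak_ar_ext rE _.
  apply: (weak_ar_chain (rho := rhoS \o pi) (q := q) dD nT1 _ _ hq hw (lipman_sathaye hk nT1 lT1)).
  - exact: transl_monic (monicXsubC t).
  - exact: monic_regr (monicXsubC t).
  - by rewrite !rmorph1 => /eqP; rewrite oner_eq0.
have [|T' [pi' [hw' h1 h2]]] := IH {poly T} _ _ pi1 nT1 lT1 hw1.
  by move=> y; have [z <-] := sp y; exists z%:P; rewrite pi1C.
exists T', pi'; split=> // [t'|y]; first by rewrite -pi1C; apply: h1.
by rewrite inE => /orP[/eqP ->|/h2 //]; rewrite -pi1X; apply: h1.
Qed.

(** * Uniform Artin-Rees by Noetherian induction *)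

Definition uniform_ar (S : comPzRingType) (b : set S) := exists c, forall J, is_ideal J -> forall n z,
  ideal_pow J (n + c) z -> b z -> ideal_mul (ideal_pow J n) b z.

(** Decompose z by the property of b + (x). After the part already in J^n b is removed, a single
    product x v in b remains, with v in a high power of J. *)
Lemma uniform_ar_step (S : comPzRingType) (b : set S) x c2 : is_ideal b ->
  uniform_ar [set z | exists u v, b u /\ z = u + x * v] ->
  (forall J, is_ideal J -> forall n v, ideal_pow J (n + c2) v -> b (x * v) ->
     ideal_mul (ideal_pow J n) b (x * v)) -> uniform_ar b.
Proof.
move=> hb [c1 h1] h2; exists (c2 + c1)%N => J hJ n z hz bz.
have hm N : is_ideal (ideal_mul (ideal_pow J N) b) by apply: ideal_mul_ideal.
have : ideal_mul (ideal_pow J (n + c2)) [set z | exists u v, b u /\ z = u + x * v] z.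
  by apply: h1; rewrite -?addnA //; exists z, 0; rewrite mulr0 addr0.
have key : forall w, ideal_mul (ideal_pow J (n + c2)) [set z | exists u v, b u /\ z = u + x * v] w ->
    exists u v, [/\ ideal_mul (ideal_pow J (n + c2)) b u, ideal_pow J (n + c2) v & w = u + x * v].
  apply: mul_ind => [|_ _ [u [v [hu hv ->]]] [u' [v' [hu' hv' ->]]]|j _ hj [u [v [bu ->]]]].
  - by exists 0, 0; rewrite mulr0 addr0; split=> //; [exact: mul0|exact: pow0r].
  - by exists (u + u'), (v + v'); split; [exact: mulD|exact: powDr|rewrite mulrDr addrACA].
  exists (j * u), (j * v); split; [exact: mem_mul| |by rewrite mulrDr mulrCA].
  by apply: idealMl => //; exact: pow_ideal.
move=> /key[u [v [hu hv zE]]].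
have bu : b u by apply: mul_subr hu.
have bxv : b (x * v).
  have e : x * v = z - u by rewrite zE addrC addKr.
  by rewrite e; apply: idealB.
rewrite zE; apply: mulD; last exact: h2.
by apply: mul_sub hu => // y; apply: pow_le; rewrite leq_addr.
Qed.

(** Both cases reduce to [uniform_ar_step]. For b prime take x = a outside b, so that a v in b
    forces v in b. Otherwise x y lies in b with x and y outside b; the ideal of v with x v in b is
    larger than b, and its decomposition is multiplied by x. *)
Theorem uniform_artin_rees (S : comPzRingType) : noetherian S ->
  (forall P : set S, is_prime_ideal P -> exists a c, ~ P a /\ forall J, is_ideal J -> forall n z,
     ideal_pow J (n + c) z -> P z -> ideal_mul (ideal_pow J n) P (a * z)) ->
  forall b : set S, is_ideal b -> uniform_ar b.
Proof.
move=> nS hP; apply: noeth_ind => // b hb IH.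
have [b1|nb1] := pselect (b 1).
  exists 0%N => J hJ n z; rewrite addn0 => hz _; rewrite -[z]mulr1; exact: mem_mul.
have bigger x : ~ b x -> uniform_ar [set z | exists u v, b u /\ z = u + x * v].
  move=> nbx; apply: IH.
  - split; first by exists 0, 0; rewrite mulr0 addr0; split=> //; exact: ideal0.
      move=> _ _ [u [v [bu ->]]] [u' [v' [bu' ->]]]; exists (u + u'), (v + v').
      by rewrite mulrDr addrACA; split=> //; exact: idealD.
    move=> r _ [u [v [bu ->]]]; exists (r * u), (r * v); rewrite mulrDr mulrCA; split=> //.
    exact: idealM.
  - by move=> u bu; exists u, 0; rewrite mulr0 addr0.
  by move=> e; apply: nbx; rewrite e; exists 0, 1; rewrite mulr1 add0r; split=> //; exact: ideal0.
have [pb|npb] := pselect (forall x y, b (x * y) -> b x \/ b y).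
  have [|a [c [na h]]] := hP b; first by split.
  apply: (uniform_ar_step (x := a) (c2 := c) hb (bigger a na)) => J hJ n v hv bav.
  by apply: h => //; case: (pb _ _ bav).
have [x [y [bxy nbx nby]]] : exists x y, [/\ b (x * y), ~ b x & ~ b y].
  apply: contrapT => h; apply: npb => x y bxy; apply: contrapT => h'; apply: h; exists x, y.
  by split=> // ?; apply: h'; [left|right].
have [|||c2 h2] := IH [set v | b (x * v)].
- split=> [|u v|r u] /=; first by rewrite mulr0; exact: ideal0.
    by rewrite mulrDr; apply: idealD.
  by rewrite mulrCA; apply: idealM.
- by move=> u bu; apply: idealM.
- by move=> e; apply: nby; rewrite e.
apply: (uniform_ar_step (x := x) (c2 := c2) hb (bigger x nbx)) => J hJ n v hv bxv.
have := h2 J hJ n v hv bxv; move: v {hv bxv}; apply: mul_ind => [|u v|u v hu /= hv].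
- by rewrite mulr0; exact: mul0.
- by rewrite mulrDr; exact: mulD.
by rewrite mulrCA; apply: mem_mul.
Qed.

(** * Generic separable towers over the prime quotients *)

Lemma pseudo_division (A : comNzRingType) (m : {poly A}) n (f : {poly A}) : (0 < size m)%N ->
  (size f < n + size m)%N ->
  exists u r : {poly A}, (lead_coef m ^+ n)%:P * f = u * m + r /\ (size r < size m)%N.
Proof.
move=> sm; elim: n f => [|n IH] f sf; first by exists 0, f; rewrite mul0r add0r expr0 mul1r.
pose t := (n + size m).-1; pose f' := (lead_coef m)%:P * f - (f`_t)%:P * ('X^n * m).
have [|u [r [e sr]]] := IH f'.
  have -> : (n + size m = t.+1)%N by rewrite prednK // addn_gt0 sm orbT.
  rewrite ltnS; apply/leq_sizeP => j hj.
  rewrite /f' coefB !coefCM coefXnM.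
  have nj : (j < n)%N = false by apply/negbTE; rewrite -leqNgt; move: hj; rewrite /t; lia.
  rewrite nj; have [jt|jt] := eqVneq j t.
    by rewrite jt lead_coefE; have -> : (t - n = (size m).-1)%N by [rewrite /t; lia]; rewrite mulrC subrr.
  have jt' : (n + size m <= j)%N by move: hj jt; rewrite /t; lia.
  have -> : f`_j = 0 by rewrite nth_default // -ltnS; apply: leq_trans sf _; rewrite addSn ltnS.
  have -> : m`_(j - n) = 0 by rewrite nth_default // leq_subRL // (leq_trans (leq_addr _ _) jt').
  by rewrite !mulr0 subrr.
exists (u + (lead_coef m ^+ n * f`_t)%:P * 'X^n), r; split=> //.
rewrite exprS mulrDl [RHS]addrAC -e /f' !polyCM; ring.
Qed.

Lemma lead_top (A : comNzRingType) (f : {poly A}) d : (size f <= d.+1)%N -> f`_d = 1 -> f \is monic.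
Proof.
move=> sf fd; have s : size f = d.+1.
  apply/eqP; rewrite eqn_leq sf ltnNge /=; apply/negP => /(nth_default 0).
  by rewrite fd => /eqP; rewrite oner_eq0.
by rewrite monicE lead_coefE s fd.
Qed.

(** [m] has least degree among polynomials vanishing at y but not zero in D[Y]. Up to [a0] and
    powers of its leading coefficient it divides every polynomial vanishing at y; in particular G
    becomes w m. As y is a simple root of G, w is nonzero at y, and a multiple of w kills the kernel
    of Q -> D, even when G is far from the minimal equation of y. *)
Lemma tri_step (k : fieldType) M (H : comNzRingType) (a : {rmorphism k -> H}) Delta (D : comNzRingType)
    (h : {rmorphism H -> D}) (a0 : H) (G : {poly H}) y : domain_like D -> tower M a Delta ->
  h Delta <> 0 -> h a0 <> 0 -> (forall z, h z = 0 -> a0 * z = 0) -> G \is monic ->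
  (map_poly h G).[y] = 0 -> (map_poly h G)^`().[y] <> 0 ->
  exists (Q : comNzRingType) (aQ : {rmorphism k -> Q}) DQ (hQ : {rmorphism Q -> D}) (a1 : Q),
    [/\ tower M aQ DQ, hQ DQ <> 0 & hQ a1 <> 0] /\
    [/\ (forall z, hQ z = 0 -> a1 * z = 0), (forall c, hQ (aQ c) = h (a c)),
      (forall z, exists w, hQ w = h z) & exists w, hQ w = y].
Proof.
move=> dD tw hD ha0 ka0 mG Gy G'y.
have sG : (1 < size G)%N.
  rewrite ltnNge; apply/negP => s1; have G1 : G = 1.
    by move: mG; rewrite (size1_polyC s1) monicE lead_coefC => /eqP ->.
  by move: Gy; rewrite G1 rmorph1 hornerC => /eqP; rewrite oner_eq0.
have [Q [p hp]] := adjoins_ex mG sG; have [_ sp kp] := hp.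
have [e0 [e0C e0X]] := poly_hom_ex h y.
have e0E f : e0 f = (map_poly h f).[y].
  apply: (poly_hom_ext (f := e0) (g := horner_eval y \o map_poly h)) => [c|] /=.
    by rewrite e0C map_polyC /horner_eval hornerC.
  by rewrite e0X map_polyX /horner_eval hornerX.
have [hQ hQE] : exists hQ : {rmorphism Q -> D}, forall f, hQ (p f) = e0 f.
  by apply: (factor_surj (f := e0) sp) => f /kp[g ->]; rewrite rmorphM (e0E G) Gy mulr0.
pose R (n : nat) := `[< exists f : {poly H}, [/\ e0 f = 0, map_poly h f <> 0 & size (map_poly h f) = n] >].
have exR : exists n, R n.
  exists (size (map_poly h G)); apply/asboolP; exists G; rewrite e0E; split=> //.
  by apply/eqP; apply: monic_neq0; apply: monic_map.
case: (ex_minnP exR) => n0 /asboolP[m0 [m0y m0n0 m0s]] nmin.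
pose m := \poly_(i < n0) m0`_i.
have hm : map_poly h m = map_poly h m0.
  apply/polyP => i; rewrite !coef_map coef_poly; case: ltnP => // ni.
  apply: etrans (rmorph0 h) _; apply: etrans _ (coef_map h m0 i).
  by rewrite nth_default // m0s.
have sm : size m = n0.
  apply/eqP; rewrite eqn_leq size_poly -m0s -hm.
  exact: size_poly.
have n00 : (0 < n0)%N by rewrite -m0s size_poly_gt0; apply/eqP.
have my : e0 m = 0 by rewrite e0E hm -e0E.
pose L := lead_coef m.
have hL : h L <> 0.
  have -> : h L = lead_coef (map_poly h m0) by rewrite /L !lead_coefE sm m0s -hm coef_map.
  by apply/eqP; rewrite lead_coef_eq0; apply/eqP.
have small r : e0 r = 0 -> (size r < n0)%N -> a0%:P * r = 0.
  move=> ry sr; have r0 : map_poly h r = 0.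
    apply: contrapT => r0; have Rr : R (size (map_poly h r)) by apply/asboolP; exists r.
    by have := nmin _ Rr; rewrite leqNgt (leq_ltn_trans (size_poly _ _) sr).
  by apply/polyP => i; rewrite coefCM coef0; apply: ka0; rewrite -coef_map r0 coef0.
have divide n (f : {poly H}) : e0 f = 0 -> (size f <= n)%N ->
    exists u, (a0 * L ^+ n)%:P * f = a0%:P * (u * m).
  move=> fy sf; have [||u [r [e sr]]] := @pseudo_division _ m n f; rewrite ?sm //.
    by apply: leq_ltn_trans sf _; rewrite -{1}[n]addn0 ltn_add2l.
  exists u; rewrite polyCM -mulrA e mulrDr [X in _ + X]small ?addr0 //; last by rewrite -sm.
  by move: (congr1 e0 e); rewrite rmorphD !rmorphM fy my !mulr0 add0r => <-.
have Gy0 : e0 G = 0 by rewrite e0E.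
have [w hw] := divide (size G) G Gy0 (leqnn _).
have hne x z : h x <> 0 -> h z <> 0 -> h (x * z) <> 0 by move=> hx hz; rewrite rmorphM => /dD[].
have hpow n : h (L ^+ n) <> 0.
  elim: n => [|n IH]; first by rewrite rmorph1; apply/eqP; exact: oner_neq0.
  by rewrite exprS; apply: hne.
have dmap f : (map_poly h f)^`() = map_poly h f^`() by rewrite deriv_map.
have wy : e0 w <> 0.
  move=> w0; have := congr1 (fun f => e0 f^`()) hw.
  rewrite !derivM !derivC !mul0r !add0r ![e0 (_ * _)]rmorphM [e0 (_ + _)]rmorphD ![e0 (_ * _)]rmorphM.
  rewrite my w0 mulr0 mul0r addr0 mulr0 e0C (e0E G^`()) -dmap => /dD[]; first exact: hne.
  exact: G'y.
exists Q, (p \o (polyC \o a)), (p (Delta%:P * G^`())), hQ, (p ((a0 * a0 * L ^+ size G)%:P * w)).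
split; split.
- exact: towerS.
- rewrite hQE rmorphM e0C e0E -dmap => /dD[]; [exact: hD|exact: G'y].
- rewrite hQE rmorphM e0C => /dD[] //; apply: (hne) => //; exact: (hne).
- move=> z; have [f0 <-] := sp z; have [f [<- sf]] := adjoins_rem f0 hp.
  rewrite hQE => fy; have [u hu] := divide (size G) f fy (ltnW sf).
  rewrite -rmorphM; apply/kp; exists (a0%:P * u * (a0 * L ^+ size G)%:P).
  transitivity (a0%:P * w * ((a0 * L ^+ size G)%:P * f)); first by rewrite !polyCM; ring.
  by rewrite hu -[RHS]mulrA hw; ring.
- by move=> c; rewrite /= hQE e0C.
- by move=> z; exists (p z%:P); rewrite hQE e0C.
- by exists (p 'X); rewrite hQE.
Qed.

(** Powers of the characteristic exponent; characteristic zero is covered by e = 0. *)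
Definition pexp (k : fieldType) q := exists p e, (p \in [pchar k] \/ e = 0%N) /\ q = (p ^ e)%N.

Lemma pexp1 (k : fieldType) : pexp k 1.
Proof. by exists 1%N, 0%N; split; [right|]. Qed.

Lemma pexpM (k : fieldType) p q : p \in [pchar k] -> pexp k q -> pexp k (p * q).
Proof.
move=> hp [p' [[|e] [he ->]]]; first by exists p, 1%N; rewrite expn0 muln1 expn1; split=> //; left.
have [hp'|//] := he; have := pcharf_eq hp p'; rewrite hp' => /esym/eqP ->.
by exists p, e.+2; split; [left|rewrite -expnS].
Qed.

Lemma pexpMM (k : fieldType) q q' : pexp k q -> pexp k q' -> pexp k (q * q').
Proof.
move=> [p [e [he ->]]] hq'; elim: e he => [|e IH] he; first by rewrite mul1n.
have [hp|//] := he; rewrite expnS -mulnA; apply: pexpM => //; apply: IH; by left.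
Qed.

Lemma pexp_gt0 (k : fieldType) q : pexp k q -> (0 < q)%N.
Proof.
by move=> [p [e [[hp|->] ->]]] //; rewrite expn_gt0 prime_gt0 //; exact: pcharf_prime hp.
Qed.

Lemma pexp_hom (k : fieldType) (D : comNzRingType) (kappa : {rmorphism k -> D}) q : pexp k q ->
  exists phi : {rmorphism D -> D}, forall x, phi x = x ^+ q.
Proof.
move=> [p [e [he ->]]]; elim: e he => [|e IH] he; first by exists idfun => x; rewrite expr1.
have [hp|//] := he; have [|phi hphi] := IH; first by left.
exists (pFrobenius_aut (rmorph_pchar kappa hp) \o phi) => x /=.
by rewrite pFrobenius_autE hphi -exprM expnSr.
Qed.

Lemma mpoly_subalg (k : fieldType) n (S : set {mpoly k[n]}) : subalgebra (@mpolyC n k) S ->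
  (forall i, S 'X_i) -> forall p, S p.
Proof.
move=> hS hX p; apply: (pol_sub (a := @mpolyC n k) (z := fun i => 'X_i) hS hX); exists p.
apply: (mpoly_hom_ext (f := idfun) (g := mmap (@mpolyC n k) (fun i => 'X_i))) => [c|i] /=.
  by rewrite mmapC.
by rewrite mmapX mmap1U.
Qed.

Lemma msize_bound (k : fieldType) n (p : {mpoly k[n]}) b :
  (forall m, m \in msupp p -> (mdeg m < b)%N) -> (msize p <= b)%N.
Proof. by move=> h; rewrite msizeE; apply/bigmax_leqP_seq => m mp _; apply: h. Qed.

(** Induction on the degree of Phi. A nonzero partial derivative that still vanishes at z is a
    relation of smaller degree. If all derivatives are zero, every exponent is divisible by p: over
    a perfect field a p-th root of Phi is a relation for z, as D has no nilpotents, and otherwise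
    Phi is read as a relation between the p-th powers. *)
Lemma separable_relation (k : fieldType) (D : comNzRingType) (kappa : {rmorphism k -> D}) : domain_like D ->
  forall s n (z : 'I_n -> D) (Phi : {mpoly k[n]}), (msize Phi <= s)%N -> Phi != 0 -> mmap kappa z Phi = 0 ->
  exists q (Psi : {mpoly k[n]}), [/\ pexp k q, perfect_field k -> q = 1%N, Psi != 0,
    mmap kappa (fun i => z i ^+ q) Psi = 0 &
    exists i, mmap kappa (fun i => z i ^+ q) Psi^`M(i) <> 0].
Proof.
move=> dD; elim=> [|s IH] n z Phi.
  by rewrite leqn0 mmeasure_poly_eq0 => /eqP ->; rewrite eqxx.
move=> sP P0 Pz; have [hi|hi] := pselect (exists i, mmap kappa z Phi^`M(i) <> 0).
  by exists 1%N, Phi; split=> //; exact: pexp1.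
have dz i : mmap kappa z Phi^`M(i) = 0 by apply: contrapT => h; apply: hi; exists i.
have [[i di]|d0] := pselect (exists i, Phi^`M(i) != 0).
  apply: (IH _ z Phi^`M(i)) => //; apply: msize_bound => m.
  rewrite mcoeff_msupp mcoeff_deriv => h.
  have mP : (m + U_(i))%MM \in msupp Phi.
    by rewrite mcoeff_msupp; apply: contraNneq h => ->; rewrite mul0rn.
  by have := msize_mdeg_lt mP; rewrite mdegD mdeg1 addn1 => /leq_trans/(_ sP).
have ex0 m i : m \in msupp Phi -> (m i)%:R = 0 :> k.
  move=> mP; case mi : (m i) => [//|l].
  have di : Phi^`M(i) = 0 by apply/eqP/negPn/negP => h; apply: d0; exists i.
  have := congr1 (mcoeff (m - U_(i))%MM) di; rewrite mcoeff0 mcoeff_deriv.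
  have -> : (m - U_(i) + U_(i))%MM = m by apply: submK; apply/mnm_lepP => j; rewrite mnm1E; case: eqP => // <-; rewrite mi.
  rewrite mnmBE mnm1E eqxx mi subn1 /= => /eqP; rewrite -[_ *+ _]mulr_natr mulf_eq0.
  by rewrite mcoeff_eq0 mP => /eqP.
have [m1 [m1P m1n]] : exists m1, m1 \in msupp Phi /\ m1 != 0%MM.
  apply: contrapT => h; have PC : Phi = (Phi@_0%MM)%:MP.
    apply/mpolyP => m; rewrite mcoeffC; case: eqP => [<-|m0]; first by rewrite mulr1.
    rewrite mulr0 memN_msupp_eq0 //; apply/negP => mP; apply: h; exists m; split=> //.
    by apply/eqP => e; apply: m0.
  move: Pz; rewrite PC mmapC => c0; move: P0; rewrite PC mpolyC_eq0 => cn.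
  have := congr1 (fun x => x * kappa (Phi@_0%MM)^-1) c0; rewrite mul0r -rmorphM mulfV // rmorph1.
  by move/eqP; rewrite oner_eq0.
have [i1 hi1] : exists i, m1 i != 0%N.
  apply: contrapT => h; move/eqP: m1n; apply; apply/mnmP => i; rewrite mnm0E.
  by apply/eqP/negPn/negP => hi'; apply: h; exists i.
have [p hp] : exists p, p \in [pchar k].
  by apply: (natf0_pchar (n := m1 i1)); [rewrite lt0n|rewrite ex0].
have p2 : (1 < p)%N by apply: prime_gt1; exact: pcharf_prime hp.
have dv m i : m \in msupp Phi -> m i = (m i %/ p * p)%N.
  by move=> mP; rewrite divnK // (dvdn_pcharf hp) ex0.
pose dm (m : 'X_{1..n}) := [multinom (m i %/ p)%N | i < n].
have [g [g0 hg]] : exists g : k -> k, (forall c, g c = 0 -> c = 0) /\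
    if `[< perfect_field k >] then forall c, g c ^+ p = c else g = id.
  case: asboolP => pk; last by exists id.
  have /choice[g hg] := pk p hp; exists g; split=> // c gc; rewrite -[c]hg gc expr0n.
  by rewrite gtn_eqF // ltnW.
pose Psi := \sum_(m <- msupp Phi) g Phi@_m *: 'X_[dm m].
have dminj m m' : m \in msupp Phi -> m' \in msupp Phi -> dm m = dm m' -> m = m'.
  move=> mP mP' /mnmP e; apply/mnmP => i; rewrite (dv m i mP) (dv m' i mP').
  by have := e i; rewrite !mnmE => ->.
have cPsi m : m \in msupp Phi -> Psi@_(dm m) = g Phi@_m.
  move=> mP; rewrite raddf_sum (bigD1_seq m) ?msupp_uniq //= mcoeffZ mcoeffX eqxx mulr1.
  rewrite big_seq_cond big1 ?addr0 // => m' /andP[mP' mm]; rewrite mcoeffZ mcoeffX.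
  by case: eqP => [e|]; [rewrite (dminj _ _ mP' mP e) eqxx in mm|rewrite mulr0].
have Psi0 : Psi != 0.
  apply/eqP => e; have := cPsi m1 m1P; rewrite e mcoeff0 => /esym/g0/eqP.
  by rewrite mcoeff_eq0 m1P.
have deg m : m \in msupp Phi -> mdeg m = (mdeg (dm m) * p)%N.
  by move=> mP; rewrite !mdegE big_distrl; apply: eq_bigr => i _; rewrite mnmE; apply: dv.
have szPsi : (msize Psi <= s)%N.
  apply: msize_bound => m; rewrite mcoeff_msupp raddf_sum /= => h.
  have [m' [mP' ->]] : exists m', m' \in msupp Phi /\ m = dm m'.
    apply: contrapT => h'; move/eqP: h; apply; rewrite big_seq big1 // => m' mP'.
    rewrite mcoeffZ mcoeffX; case: eqP => [e|]; last by rewrite mulr0.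
    by case: h'; exists m'.
  have h1 := leq_trans (msize_mdeg_lt m1P) sP; have h2 := leq_trans (msize_mdeg_lt mP') sP.
  have h3 : (0 < mdeg m1)%N by rewrite lt0n mdeg_eq0.
  move: h1 h2 h3; rewrite (deg _ m1P) (deg _ mP'); nia.
have evPsi z' : mmap kappa z' Psi = \sum_(m <- msupp Phi) kappa (g Phi@_m) * mmap1 z' (dm m).
  by rewrite (rmorph_sum (mmap kappa z')) /=; apply: eq_bigr => m _; rewrite mmapZ mmapX.
have [pk|npk] := pselect (perfect_field k).
  rewrite asboolT // in hg; apply: (IH _ z Psi) => //.
  have [|phi hphi] := @pexp_hom k D kappa p; first by exists p, 1%N; rewrite expn1; split=> //; left.
  have : mmap kappa z Psi ^+ p = 0.
    rewrite -hphi evPsi rmorph_sum; apply: etrans Pz; rewrite [RHS]/mmap [LHS]big_seq [RHS]big_seq.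
    apply: eq_bigr => m mP.
    rewrite rmorphM hphi -rmorphXn hg /mmap1 rmorph_prod; congr (_ * _).
    by apply: eq_bigr => i _; rewrite hphi mnmE -exprM -dv.
  elim: (p) => [|p' IHp]; first by move/eqP; rewrite oner_eq0.
  by rewrite exprS => /dD[].
rewrite asboolF // in hg; have [|q [Psi' [hq pq P'0 P'z hd]]] := IH n (fun i => z i ^+ p) Psi szPsi Psi0.
  rewrite evPsi; apply: etrans Pz; rewrite [RHS]/mmap [LHS]big_seq [RHS]big_seq; apply: eq_bigr => m mP.
  rewrite hg; congr (_ * _); apply: eq_bigr => i _.
  by rewrite mnmE -exprM mulnC -dv.
have E (P : {mpoly k[n]}) : mmap kappa (fun i => (z i ^+ p) ^+ q) P = mmap kappa (fun i => z i ^+ (p * q)) P.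
  by apply: eq_mmap => // i; rewrite exprM.
exists (p * q)%N, Psi'; split=> //; [exact: pexpM|by rewrite -E|].
by have [i hdi] := hd; exists i; rewrite -E.
Qed.

Lemma mmap1_top_deg (R : comNzRingType) n (q : 'I_n -> {poly R}) (d : 'I_n -> nat) (m : 'X_{1..n}) :
  (forall i, size (q i) <= (d i).+1)%N ->
  (size (mmap1 q m) <= (\sum_i m i * d i).+1)%N /\
  (mmap1 q m)`_(\sum_i m i * d i)%N = mmap1 (fun i => (q i)`_(d i)) m.
Proof.
move=> hq.
have hX i j : (size (q i ^+ j) <= (j * d i).+1)%N /\ (q i ^+ j)`_(j * d i) = (q i)`_(d i) ^+ j.
  elim: j => [|j [IH1 IH2]]; first by rewrite !expr0 size_poly1 coef1.
  by rewrite !exprS -IH2 mulSn; apply: coefM_top.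
rewrite /mmap1; elim/big_rec3: _ => [|i x e y _ [IH1 IH2]]; first by rewrite size_poly1 coef1.
have [h1 h2] := hX i (m i); rewrite -IH2 -h2; exact: coefM_top.
Qed.

Lemma seq_argmax (T : eqType) (f : T -> nat) (s : seq T) x0 : x0 \in s ->
  exists2 x, x \in s & forall y, y \in s -> (f y <= f x)%N.
Proof.
elim: s x0 => // x s IH x0 _; case: s IH => [_|y s IH].
  by exists x; rewrite ?mem_head // => y; rewrite inE => /eqP ->.
have [z zs hz] := IH y (mem_head _ _); have [xz|zx] := leqP (f x) (f z).
    exists z; first by rewrite inE zs orbT.
    by move=> t; rewrite inE => /orP[/eqP -> //|/hz].
exists x; rewrite ?mem_head // => t; rewrite inE => /orP[/eqP -> //|/hz h].
by apply: leq_trans h _; apply: ltnW.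
Qed.

Lemma poly_mpoly_chain (k : fieldType) n (B : comNzRingType) (psi : {rmorphism {mpoly k[n]} -> {poly B}})
    (P : {mpoly k[n]}) : (forall c, (psi c%:MP)^`() = 0) ->
  (psi P)^`() = \sum_l psi P^`M(l) * (psi 'X_l)^`().
Proof.
move=> hC; move: P; apply: (mpoly_subalg (S := [set P | (psi P)^`() = \sum_l psi P^`M(l) * (psi 'X_l)^`()])).
  split=> [c|P Q|P Q] /=.
  - by rewrite hC big1 // => l _; rewrite mderivC rmorph0 mul0r.
  - move=> hP hQ; rewrite rmorphD derivD hP hQ -big_split; apply: eq_bigr => l _.
    by rewrite mderivD rmorphD mulrDl.
  - move=> hP hQ; rewrite rmorphM derivM hP hQ mulr_suml mulr_sumr -big_split; apply: eq_bigr => l _.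
    by rewrite mderivM rmorphD !rmorphM /= mulrDl; congr (_ + _); rewrite ?mulrA // mulrAC.
move=> i /=; rewrite (bigD1 i) //= big1 ?addr0 => [|l li].
  rewrite mderivX mnm1E eqxx scale1r; have -> : (U_(i) - U_(i) = 0 :> 'X_{1..n})%MM by apply/mnmP => j; rewrite mnmBE mnm0E subnn.
  by rewrite mpolyX0 rmorph1 mul1r.
by rewrite mderivX mnm1E eq_sym (negPf li) scale0r rmorph0 mul0r.
Qed.

(** Nagata's change of variables by powers works over finite fields as well, and the tower is to be
    built over k itself. The weights of the monomials are distinct, so one of them gives the top
    power of y with constant coefficient; c is adjusted so that the root stays simple. *)
Lemma nagata (k : fieldType) (D : comNzRingType) (kappa : {rmorphism k -> D}) n (z : 'I_n.+1 -> D) i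
    (Phi : {mpoly k[n.+1]}) : domain_like D -> Phi != 0 -> mmap kappa z Phi = 0 ->
  mmap kappa z Phi^`M(i) <> 0 ->
  exists (c : k) (e : 'I_n -> nat) (F : {poly {mpoly k[n]}}),
    let x' := fun j => z (lift i j) - kappa c * z i ^+ e j in
    [/\ F \is monic, (map_poly (mmap kappa x') F).[z i] = 0 &
      (map_poly (mmap kappa x') F)^`().[z i] <> 0].
Proof.
move=> dD P0 Pz dP; set y := z i.
(* [r] exceeds all exponents, so that weights in base r separate monomials; it is even, so that [B]
   is divisible by 2. *)
pose r := (msize Phi).*2; pose e (j : 'I_n) := (r ^ j.+1)%N.
pose B := \sum_(j < n) mmap kappa z Phi^`M(lift i j) * (y ^+ (e j).-1 *+ e j).
pose A := mmap kappa z Phi^`M(i).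
have r0 : (0 < r)%N by rewrite double_gt0 lt0n mmeasure_poly_eq0.
have B2 : exists B', B = B' *+ 2.
  exists (\sum_(j < n) mmap kappa z Phi^`M(lift i j) * (y ^+ (e j).-1 *+ (msize Phi * r ^ j))).
  rewrite /B -sumrMnl; apply: eq_bigr => j _; rewrite -mulrnAr -mulrnA.
  by congr (_ * (_ *+ _)); rewrite /e expnS /r -muln2; lia.
(* By the chain rule the derivative at y is A + c B up to a unit. If c = 1 fails, then B = -A and c
   = 2 gives -A, nonzero; and 2 is nonzero in k, since otherwise B, a multiple of 2, would
   vanish. *)
have [c [c0 hc]] : exists c, c != 0 /\ A + kappa c * B <> 0.
  have [AB|AB] := pselect (A + B = 0); last by exists 1; rewrite oner_neq0 rmorph1 mul1r.
  have BA : B = - A by rewrite -[LHS](addKr A) AB addr0.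
  exists 2%:R; split.
    apply/eqP => k2; have [B' hB'] := B2; apply: dP; rewrite -/A -[A]opprK -BA hB'.
    by rewrite -mulr_natr -(rmorph_nat kappa) k2 rmorph0 mulr0 oppr0.
  by rewrite rmorph_nat BA => h; apply: dP; rewrite -/A -[A]opprK; apply/eqP; rewrite oppr_eq0 -h; apply/eqP; ring.
pose E := {mpoly k[n]}.
pose lin (l : 'I_n.+1) : {poly E} := if unlift i l is Some j
  then ('X_j : E)%:P + (c%:MP : E)%:P * 'X^(e j) else 'X.
have lini : lin i = 'X by rewrite /lin unlift_none.
have linl j : lin (lift i j) = ('X_j : E)%:P + (c%:MP : E)%:P * 'X^(e j) by rewrite /lin liftK.
pose psi : {rmorphism {mpoly k[n.+1]} -> {poly E}} := mmap (polyC \o @mpolyC n k) lin.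
have psiC c' : psi c'%:MP = c'%:MP%:P by rewrite /psi /= mmapC.
have psiX l : psi 'X_l = lin l by rewrite /psi /= mmapX mmap1U.
pose dl (l : 'I_n.+1) := (if unlift i l is Some j then e j else 1)%N.
have dli : dl i = 1%N by rewrite /dl unlift_none.
have dll j : dl (lift i j) = e j by rewrite /dl liftK.
have e0 j : (0 < e j)%N by rewrite expn_gt0 r0.
have lins l : (size (lin l) <= (dl l).+1)%N.
  case: (unliftP i l) => [j|] ->; rewrite ?lini ?dli ?size_polyX // linl dll addrC mul_polyC.
  apply: leq_trans (size_polyD _ _) _; rewrite geq_max (leq_trans (size_polyC_leq1 _)) ?andbT //.
  by rewrite (leq_trans (size_scale_leq _ _)) ?size_polyXn.
have lint l : exists2 u : k, u != 0 & (lin l)`_(dl l) = u%:MP.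
  case: (unliftP i l) => [j|] ->; rewrite ?lini ?dli ?coefX.
    exists c => //; rewrite linl dll coefD coefC gtn_eqF ?e0 // add0r coefCM coefXn eqxx.
    by rewrite mulr1.
  by exists 1; rewrite ?oner_neq0 ?mpolyC1.
pose w (m : 'X_{1..n.+1}) := (\sum_l m l * dl l)%N.
have w_inj m m' : m \in msupp Phi -> m' \in msupp Phi -> w m = w m' -> m = m'.
  have wE m0 : w m0 = (\sum_(t < n.+1) (if unlift ord0 t is Some j then m0 (lift i j) else m0 i) * r ^ t)%N.
    rewrite /w (bigD1_ord i) //= dli muln1 big_ord_recl unlift_none expn0 muln1; congr (_ + _)%N.
    by apply: eq_bigr => j _; rewrite dll liftK.
  have lt m0 l : m0 \in msupp Phi -> (m0 l < r)%N.
    move=> mP; have := msize_mdeg_lt mP; rewrite mdegE (bigD1 l) //= /r; lia.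
  have ltu m0 (t : 'I_n.+1) : m0 \in msupp Phi ->
      ((if unlift ord0 t is Some j then m0 (lift i j) else m0 i) < r)%N.
    by move=> mP; case: unliftP => [j|] _; exact: lt.
  move=> mP mP'; rewrite !wE => ew.
  have h := base_inj (fun t => ltu m t mP) (fun t => ltu m' t mP') ew.
  apply/mnmP => l; case: (unliftP i l) => [j|] ->.
    by have := h (@lift n.+1 ord0 j); rewrite liftK.
  by have := h ord0; rewrite unlift_none.
have [ms msP msmax] := @seq_argmax _ w (msupp Phi) (mlead Phi) (mlead_supp P0).
have psiE P : psi P = \sum_(m <- msupp P) (P@_m)%:MP%:P * mmap1 lin m by [].
have topu m : exists2 u : k, u != 0 & (mmap1 lin m)`_(w m) = u%:MP.
  rewrite (mmap1_top_deg m lins).2 /mmap1; elim/big_rec: _ => [|l x _ [u u0 ->]].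
    by exists 1; rewrite ?oner_neq0 ?mpolyC1.
  have [v v0 ->] := lint l; exists (v ^+ m l * u); first by rewrite mulf_neq0 ?expf_neq0.
  by rewrite rmorphM rmorphXn.
have [u u0 hu] := topu ms.
have topF : (psi Phi)`_(w ms) = (Phi@_ms * u)%:MP.
  rewrite psiE coef_sum (bigD1_seq ms) ?msupp_uniq //= coefCM hu -rmorphM.
  rewrite big_seq_cond big1 ?addr0 // => m /andP[mP mm]; rewrite coefCM nth_default ?mulr0 //.
  apply: leq_trans (mmap1_top_deg m lins).1 _; rewrite ltn_neqAle msmax // andbT.
  by apply: contraNneq mm => h; apply/eqP; apply: w_inj.
have sF : (size (psi Phi) <= (w ms).+1)%N.
  rewrite psiE big_seq; apply: leq_trans (size_sum _ _ _) _; apply/bigmax_leqP_seq => m _ mP.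
  rewrite mul_polyC; apply: leq_trans (size_scale_leq _ _) _.
  by apply: leq_trans (mmap1_top_deg m lins).1 _; rewrite ltnS; apply: msmax.
have Pu0 : Phi@_ms * u != 0 by rewrite mulf_neq0 // -mcoeff_msupp.
pose v : E := ((Phi@_ms * u)^-1)%:MP.
exists c, e, (v%:P * psi Phi) => x'.
pose ev : {rmorphism E -> D} := mmap kappa x'.
have evC a' : ev a'%:MP = kappa a' by rewrite /ev /= mmapC.
have evX j : ev 'X_j = x' j by rewrite /ev /= mmapX mmap1U.
pose ey : {rmorphism {poly E} -> D} := horner_eval y \o map_poly ev.
have eyE f : (map_poly ev f).[y] = ey f by [].
have eyC f : ey f%:P = ev f by rewrite -eyE map_polyC hornerC.
have eyX : ey 'X = y by rewrite -eyE map_polyX hornerX.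
have eypsi P : ey (psi P) = mmap kappa z P.
  apply: (mpoly_hom_ext (f := ey \o psi) (g := mmap kappa z)) => [a'|l].
    by change (ey (psi a'%:MP) = mmap kappa z a'%:MP); rewrite psiC eyC evC mmapC.
  change (ey (psi 'X_l) = mmap kappa z 'X_l); rewrite psiX mmapX mmap1U.
  case: (unliftP i l) => [j|] ->; last by rewrite lini eyX.
  by rewrite linl rmorphD rmorphM rmorphXn !eyC evC evX eyX /x' subrK.
have ev_v : ev v <> 0.
  rewrite evC => h; have := congr1 (fun t => t * kappa (Phi@_ms * u)) h.
  by rewrite mul0r -rmorphM mulVf // rmorph1 => /eqP; rewrite oner_eq0.
split.
- apply: (@lead_top _ _ (w ms)); last by rewrite coefCM topF -rmorphM mulVf // mpolyC1.
  by rewrite mul_polyC (leq_trans (size_scale_leq _ _)).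
- by rewrite -/ev eyE rmorphM eypsi Pz mulr0.
rewrite -/ev deriv_map eyE derivM derivC mul0r add0r rmorphM eyC => /dD[] //.
rewrite poly_mpoly_chain => [|c']; last by rewrite psiC derivC.
rewrite rmorph_sum (bigD1_ord i) //= => h; apply: hc; rewrite -[RHS]h.
have eypsi' P : horner_eval y (map_poly ev (psi P)) = mmap kappa z P by exact: eypsi.
congr (_ + _); first by rewrite -[RHS]/(ey _) rmorphM eypsi psiX lini derivX rmorph1 mulr1.
rewrite mulr_sumr; apply: eq_bigr => j _; rewrite -[RHS]/(ey _) rmorphM eypsi psiX linl.
rewrite derivD derivC add0r derivM derivC mul0r add0r derivXn rmorphM eyC evC rmorphMn rmorphXn eyX.
by rewrite mulrCA.
Qed.

(** Induction on the number of elements. A separable relation between the q1-th powers becomes, by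
    [nagata], a monic equation for one of them, y, over modified others. The Frobenius power q of
    the induction hypothesis moves its coefficients into the image of H, and [tri_step] adjoins y^q.
    If there is no relation, the polynomial ring itself is the tower. *)
Theorem tower_cover (k : fieldType) (D : comNzRingType) (kappa : {rmorphism k -> D}) : domain_like D ->
  forall n (x : 'I_n -> D), exists q M (H : comNzRingType) (a : {rmorphism k -> H}) Delta (h : {rmorphism H -> D}) a0,
  [/\ pexp k q, perfect_field k -> q = 1%N, tower M a Delta & h Delta <> 0] /\
  [/\ (forall c, exists w, h w = kappa c), (forall i, exists w, h w = x i ^+ q),
     h a0 <> 0, (forall z, h z = 0 -> a0 * z = 0) & forall c, h (a c) = kappa c].
Proof.
move=> dD; elim=> [|n IH] x; last first.
  have [[Phi P0 Px]|free] := pselect (exists2 Phi : {mpoly k[n.+1]}, Phi != 0 & mmap kappa x Phi = 0); last first.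
    exists 1%N, n.+1, {mpoly k[n.+1]}, (@mpolyC _ _ : {rmorphism k -> {mpoly k[n.+1]}}), 1,
      (mmap kappa x : {rmorphism {mpoly k[n.+1]} -> D}), 1.
    have one : (mmap kappa x : {rmorphism {mpoly k[n.+1]} -> D}) 1 <> 0.
      by rewrite rmorph1; apply/eqP; exact: oner_neq0.
    split; split=> //; [exact: pexp1|exact: tower0| | | |].
    - by move=> c; exists c%:MP; rewrite /= mmapC.
    - by move=> i; exists 'X_i; rewrite /= mmapX mmap1U.
    - by move=> z hz; rewrite mul1r; apply: contrapT => /eqP z0; apply: free; exists z.
    - by move=> c; rewrite /= mmapC.
  have [q1 [Psi [hq1 pq1 Psi0 Psiz [i di]]]] := separable_relation dD (leqnn _) P0 Px.
  have [c [e [F /= [mF Fz dF]]]] := nagata dD Psi0 Psiz di.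
  set x' := fun j : 'I_n => _ in Fz dF; set y := x i ^+ q1 in Fz dF.
  have [q [M [H [a [De [h [a0 [[hq pq tw hD] [imc imx ha0 ka0 hc]]]]]]]]] := IH x'.
  have [phi hphi] := pexp_hom kappa hq.
  have imD u v : (exists w, h w = u) -> (exists w, h w = v) -> exists w, h w = u + v.
    by move=> [w <-] [w' <-]; exists (w + w'); rewrite rmorphD.
  have imM u v : (exists w, h w = u) -> (exists w, h w = v) -> exists w, h w = u * v.
    by move=> [w <-] [w' <-]; exists (w * w'); rewrite rmorphM.
  have im (P : {mpoly k[n]}) : exists w, h w = phi (mmap kappa x' P).
    move: P; apply: (mpoly_subalg (S := [set P | exists w, h w = phi (mmap kappa x' P)])).
      split=> [c'|P Q|P Q] /=.
      - by rewrite mmapC hphi -rmorphXn; apply: imc.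
      - by move=> hP hQ; rewrite !rmorphD; apply: imD.
      - by move=> hP hQ; rewrite !rmorphM; apply: imM.
    by move=> j /=; rewrite mmapX mmap1U hphi; apply: imx.
  have /choice[g hg] : forall l, exists w, h w = phi (mmap kappa x' F`_l) by move=> l; apply: im.
  pose d := (size F).-1; have sF : size F = d.+1 by rewrite prednK // size_poly_gt0 monic_neq0.
  pose G := \poly_(l < d.+1) (if l == d then 1 else g l).
  have Gtop : G`_d = 1 by rewrite coef_poly ltnSn eqxx.
  have mG : G \is monic by exact: (lead_top (size_poly _ _) Gtop).
  have hG : map_poly h G = map_poly phi (map_poly (mmap kappa x') F).
    apply/polyP => l; rewrite !coef_map coef_poly; case: ltnP => ld.
      case: eqP => [->|_]; last exact: hg.
      have := monicP mF; rewrite lead_coefE -/d => ->.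
      exact: etrans (rmorph1 h) (esym (etrans (congr1 phi (rmorph1 (mmap kappa x'))) (rmorph1 phi))).
    rewrite [F`_l]nth_default ?sF //; exact: etrans (rmorph0 h) (esym (etrans (congr1 phi (rmorph0 (mmap kappa x'))) (rmorph0 phi))).
  have hGy : (map_poly h G).[phi y] = 0 by rewrite hG horner_map Fz rmorph0.
  have hGdy : (map_poly h G)^`().[phi y] <> 0.
    rewrite hG deriv_map horner_map hphi; move: dF; move: (_.[_]) => u u0.
    by elim: (q) => [|q' IHq]; [apply/eqP; exact: oner_neq0|rewrite exprS => /dD[]].
  have [Q [aQ [DQ [hQ [a1 [[twQ hDQ ha1] [ka1 hcQ imQ imy]]]]]]] := tri_step dD tw hD ha0 ka0 mG hGy hGdy.
  have imQc c' : exists w, hQ w = kappa c' by exists (aQ c'); rewrite hcQ hc.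
  have imQM u v : (exists w, hQ w = u) -> (exists w, hQ w = v) -> exists w, hQ w = u * v.
    by move=> [w <-] [w' <-]; exists (w * w'); rewrite rmorphM.
  have imQX u l : (exists w, hQ w = u) -> exists w, hQ w = u ^+ l.
    by move=> [w <-]; exists (w ^+ l); rewrite rmorphXn.
  exists (q1 * q)%N, M, Q, aQ, DQ, hQ, a1; split; split=> //.
  - exact: pexpMM.
  - by move=> pk; rewrite pq1 ?pq.
  - move=> l; rewrite exprM -hphi; case: (unliftP i l) => [j|] -> //.
    have -> : phi (x (lift i j) ^+ q1) = x' j ^+ q + phi (kappa c) * phi y ^+ e j.
      by rewrite -[x _ ^+ q1](subrK (kappa c * y ^+ e j)) rmorphD rmorphM rmorphXn -hphi.
    have [w1 hw1] := imx j; have [w2 hw2] := imQ w1.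
    have [w3 hw3] : exists w, hQ w = phi (kappa c) * phi y ^+ e j.
      by apply: imQM; [rewrite hphi -rmorphXn; apply: imQc|apply: imQX].
    by exists (w2 + w3); rewrite rmorphD hw2 hw1 hw3.
  - by move=> c'; rewrite hcQ hc.
exists 1%N, 0%N, {mpoly k[0]}, (@mpolyC _ _ : {rmorphism k -> {mpoly k[0]}}), 1,
  (mmap kappa x : {rmorphism {mpoly k[0]} -> D}), 1.
have one : (mmap kappa x : {rmorphism {mpoly k[0]} -> D}) 1 <> 0.
  by rewrite rmorph1; apply/eqP; exact: oner_neq0.
split; split=> //; [exact: pexp1|exact: tower0| | | |].
- by move=> c; exists c%:MP; rewrite /= mmapC.
- by case.
- move=> z; rewrite [z]nvar0_mpolyC /= mmapC mul1r => h; apply/eqP; rewrite mpolyC_eq0.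
  apply/negPn/negP => z0; have := congr1 (fun x => x * kappa (z@_0%MM)^-1) h.
  by rewrite mul0r -rmorphM mulfV // rmorph1 => /eqP; rewrite oner_eq0.
- by move=> c; rewrite /= mmapC.
Qed.

(** * Uniform Artin-Rees in polynomial rings *)

Lemma quot_domain (S D : comNzRingType) (P : set S) (pi : {rmorphism S -> D}) : is_prime_ideal P ->
  (forall q, exists r, pi r = q) -> (forall r, pi r = 0 <-> P r) -> domain_like D.
Proof.
move=> [_ _ hP] sp kp x y; have [r <-] := sp x; have [t <-] := sp y.
by rewrite -rmorphM => /kp/hP[h|h]; [left|right]; apply/kp.
Qed.

(** Perfectness gives q = 1, so a tower maps onto the quotient by P. At its top the claim is
    trivial, as [a0] kills the kernel. Unrolling the tower gives a polynomial ring over D, whose map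
    to D is lifted to the given ring, completed to a surjection by [weak_ar_cover], and used to push
    the property forward. *)
Lemma ar_perfect (K : fieldType) n (b : set {mpoly K[n]}) : infinite_field K -> perfect_field K ->
  is_ideal b -> uniform_ar b.
Proof.
move=> hK pK; apply: uniform_artin_rees; first exact: noeth_mpoly.
move=> P hP; have [iP P1 _] := hP; have [D [pi [sp kp]]] := quot_ex iP P1.
have dD := quot_domain hP sp kp.
pose kappa : {rmorphism K -> D} := pi \o @mpolyC n K.
have [q [M [H [a [De [h [a0 [[_ /(_ pK) q1 tw hD] [imc imx ha0 ka0 hc]]]]]]]]] :=
  tower_cover kappa dD (fun i => pi 'X_i).
have imp (Q : {mpoly K[n]}) : exists w, h w = pi Q.
  move: Q; apply: (mpoly_subalg (S := [set Q | exists w, h w = pi Q])).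
    split=> [c|Q R [w e] [w' e']|Q R [w e] [w' e']]; first exact: imc.
      by exists (w + w'); rewrite !rmorphD e e'.
    by exists (w * w'); rewrite !rmorphM e e'.
  by move=> i; have [w e] := imx i; exists w; rewrite e q1 expr1.
have wh : weak_ar h.
  exists a0, 0%N; split=> // J _ m z _ /ka0 ->; exact: mul0.
have sh y : exists x, h x = y by have [Q <-] := sp y; apply: imp.
have [m' [rho [wr rc sr]]] := tower_weak_ar (kappa := kappa) hK dD tw (m := 0%N) (rho := h) wh hD hc sh.
have /choice[s hs] : forall i : 'I_M, exists t, pi t = rho (ipC m' {mpoly K[M]} 'X_i) by move=> i; apply: sp.
pose pi0 : {rmorphism {mpoly K[M]} -> {mpoly K[n]}} := mmap (@mpolyC n K) s.
have [|pi1 [pi1r pi1C]] := @ip_lift m' {mpoly K[M]} {mpoly K[n]} D pi rho pi0 sp.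
  apply: (mpoly_hom_ext (f := pi \o pi0) (g := rho \o ipC m' {mpoly K[M]})) => [c|i] /=.
    by rewrite mmapC rc.
  by rewrite mmapX mmap1U hs.
have [MT lT] := ls_ip m' (ls_base K M); rewrite rmorph1 in lT.
have nT : noetherian (ip {mpoly K[M]} m') by apply: noeth_ip; apply: noeth_mpoly.
have wpi1 : weak_ar (pi \o pi1) by apply: weak_ar_ext wr => x; rewrite /= pi1r.
have spi1 y : exists x, pi (pi1 x) = y by have [x <-] := sr y; exists x.
have [T' [pi' [wp' im1 im2]]] := weak_ar_cover [seq 'X_i | i <- enum 'I_n] hK dD nT lT wpi1 spi1.
have [|a1 [c [pa1 hw]]] := weak_ar_surj _ wp'.
  apply: (mpoly_subalg (S := [set Q | exists t, pi' t = Q])).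
    split=> [c|Q R [w <-] [w' <-]|Q R [w <-] [w' <-]].
    - have [t ht] := im1 (ipC m' {mpoly K[M]} c%:MP); exists t.
      by rewrite ht pi1C /pi0 /= mmapC.
    - by exists (w + w'); rewrite rmorphD.
    - by exists (w * w'); rewrite rmorphM.
  by move=> i; apply: im2; apply: map_f; rewrite mem_enum.
exists a1, c; split; first by move/kp.
move=> J hJ m z hz Pz; have := hw J hJ m z hz ((kp z).2 Pz).
by apply: mul_sub => // y /kp.
Qed.

(** J and b are extended to the infinite perfect field; the linear retraction sends the product of
    the extended ideals back into J^m b. *)
Lemma ar_mpoly (k : fieldType) n (b : set {mpoly k[n]}) : is_ideal b -> uniform_ar b.
Proof.
move=> hb; have [K [e [r [hr iK pK]]]] := infinite_perfect_ext k.
have [r' hr'] := retract_mpoly n hr.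
set e' : {rmorphism {mpoly k[n]} -> {mpoly K[n]}} := map_mpoly e in hr'.
have [c hc] := ar_perfect iK pK (gen_is_ideal (e' @` b)).
exists c => J hJ m z hz bz.
have /hc : ideal_pow (gen_ideal (e' @` J)) (m + c) (e' z).
  by apply: morph_pow hz => y Jy; apply: mem_gen; exists y.
move=> /(_ (gen_is_ideal _)) h; rewrite -[z](retractK hr').
have {}h : ideal_mul (ideal_pow (gen_ideal (e' @` J)) m) (gen_ideal (e' @` b)) (e' z).
  by apply: h; apply: mem_gen; exists z.
move: (e' z) h; apply: (mul_ind (K := [set y | ideal_mul (ideal_pow J m) b (r' y)])).
- by rewrite /= (retract0 hr'); exact: mul0.
- by move=> u v /=; rewrite (retractD hr'); exact: mulD.
have hmb := ideal_mul_ideal (ideal_pow J m) hb.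
move=> u v hu hv; move: u hu; apply: (pow_gen_ind (K := [set u | ideal_mul (ideal_pow J m) b (r' (u * v))])).
- by rewrite /= mul0r (retract0 hr'); exact: mul0.
- by move=> u u' /=; rewrite mulrDl (retractD hr'); exact: mulD.
move=> x s ss hs /=; have [t [st ht te]] : exists t : seq {mpoly k[n]}, [/\ size t = size s,
    forall y, y \in t -> J y & \prod_(y <- s) y = e' (\prod_(y <- t) y)].
  elim: s {ss} hs => [|y s IH] hs; first by exists [::]; rewrite !big_nil rmorph1.
  have [|t [st ht te]] := IH; first by move=> y' ys; apply: hs; rewrite inE ys orbT.
  have [y0 Jy0 y0E] := hs y (mem_head _ _); exists (y0 :: t); rewrite /= st; split=> //.
    by move=> y'; rewrite inE => /orP[/eqP ->|/ht].
  by rewrite !big_cons rmorphM y0E te.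
rewrite te; move: v hv; apply: (mul_ind (K := [set v | ideal_mul (ideal_pow J m) b (r' (x * e' (\prod_(y <- t) y) * v))])).
- by rewrite /= mulr0 (retract0 hr'); exact: mul0.
- by move=> v v' /=; rewrite mulrDr (retractD hr'); exact: mulD.
move=> v _ _ [y by_ <-] /=.
have -> : x * e' (\prod_(j <- t) j) * (v * e' y) = e' (\prod_(j <- t) j * y) * (x * v) by rewrite rmorphM; ring.
rewrite (retractM hr') mulrC; apply: idealM => //; apply: mem_mul => //.
by rewrite -ss -st -[\prod_(_ <- _) _]mul1r; apply: mem_pow.
Qed.

(** * Cancelling a nonzerodivisor uniformly *)

Section Localized.
Variables (k : fieldType) (n : nat) (R : comNzRingType) (th : {rmorphism {mpoly k[n]} -> R}).
Hypothesis frac : forall y, exists (s t : {mpoly k[n]}) (u : R), u * th t = 1 /\ th t * y = th s.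

Lemma frac_pow (J : set R) N (y : R) : is_ideal J -> ideal_pow J N y ->
  exists (t : {mpoly k[n]}) (u : R) (j : {mpoly k[n]}), [/\ u * th t = 1, ideal_pow (th @^-1` J) N j & th t * y = th j].
Proof.
move=> hJ; have hJS := preim_ideal th hJ; move: y; apply: pow_ind.
- by exists 1, 1, 0; rewrite !rmorph0 rmorph1 !mulr1 mulr0; split=> //; exact: pow0r.
- move=> y y' [t [u [j [ut Jj e]]]] [t' [u' [j' [ut' Jj' e']]]].
  exists (t * t'), (u * u'), (t' * j + t * j'); split.
  + by rewrite rmorphM mulrACA ut ut' mulr1.
  + by apply: powDr; apply: idealM => //; exact: pow_ideal.
  + by rewrite rmorphD !rmorphM -e -e'; ring.
move=> a s <- hs; have [x [t [u [ut xe]]]] := frac a.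
have [t' [u' [j [ut' Jj e]]]] : exists (t : {mpoly k[n]}) (u : R) (j : {mpoly k[n]}), [/\ u * th t = 1, ideal_pow (th @^-1` J) (size s) j &
    th t * \prod_(y <- s) y = th j].
  elim: s hs => [|y s IH] hs; first by exists 1, 1, 1; rewrite big_nil !rmorph1 mulr1; split.
  have [|t' [u' [j [ut' Jj e]]]] := IH; first by move=> y' ys; apply: hs; rewrite inE ys orbT.
  have [x' [t2 [u2 [ut2 xe2]]]] := frac y.
  exists (t2 * t'), (u2 * u'), (x' * j); split.
  + by rewrite rmorphM mulrACA ut2 ut' mulr1.
  + apply: mem_mul => //; rewrite /preimage /= -xe2; apply: idealM => //; apply: hs.
    exact: mem_head.
  + by rewrite big_cons !rmorphM -e -xe2; ring.
exists (t * t'), (u * u'), (x * j); split.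
- by rewrite rmorphM mulrACA ut ut' mulr1.
- by apply: idealM => //; exact: pow_ideal.
- by rewrite !rmorphM -e -xe; ring.
Qed.

(** Up to a unit, a is the image of s0. Uniform Artin-Rees for the ideal generated by s0 and the
    kernel of [th] writes a representative of a y, up to denominators, as u + s0 v with u in the
    kernel and v in the m-th power; s0 is then cancelled in R. *)
Theorem uniform_colon (a : R) : (forall y, a * y = 0 -> y = 0) ->
  exists c, forall J : set R, is_ideal J -> forall m y, ideal_pow J (m + c) (a * y) -> ideal_pow J m y.
Proof.
move=> areg; have [s0 [t0 [u0 [ut0 ae]]]] := frac a.
pose b := [set z | th z = 0].
have hb : is_ideal b.
  split; rewrite /b /=.
  - by rewrite rmorph0.
  - by move=> x y hx hy; rewrite rmorphD hx hy addr0.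
  - by move=> x y hy; rewrite rmorphM hy mulr0.
pose b' := [set z | exists u v, b u /\ z = u + s0 * v].
have hb' : is_ideal b'.
  split; first by exists 0, 0; rewrite mulr0 addr0; split=> //; exact: ideal0.
    move=> _ _ [u [v [bu ->]]] [u' [v' [bu' ->]]]; exists (u + u'), (v + v').
    by rewrite mulrDr addrACA; split=> //; exact: idealD.
  move=> r _ [u [v [bu ->]]]; exists (r * u), (r * v); rewrite mulrDr mulrCA; split=> //.
  exact: idealM.
have s0reg y : th s0 * y = 0 -> y = 0.
  rewrite -ae -mulrA => h; apply: areg.
  by rewrite -[LHS]mul1r -ut0 -mulrA h mulr0.
have [c hc] := ar_mpoly hb'; exists c => J hJ m y hay.
have [t [u [j [ut Jj je]]]] := frac_pow hJ hay.
have [s [t' [u' [ut' se]]]] := frac y.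
have hJS := preim_ideal th hJ.
have Jj' : ideal_pow (th @^-1` J) (m + c) (j * t0 * t').
  by rewrite -mulrA; apply: idealMl => //; exact: pow_ideal.
have thE : th (j * t0 * t') = th s0 * th (t * s).
  by rewrite !rmorphM -je -ae -se; ring.
have bj : b' (j * t0 * t').
  exists (j * t0 * t' - s0 * (t * s)), (t * s); rewrite subrK; split=> //.
  by rewrite /b /= rmorphB thE [th (s0 * _)]rmorphM subrr.
have key : forall w, ideal_mul (ideal_pow (th @^-1` J) m) b' w ->
    exists u v, [/\ b u, ideal_pow (th @^-1` J) m v & w = u + s0 * v].
  apply: mul_ind => [|_ _ [u1 [v1 [hu hv ->]]] [u2 [v2 [hu' hv' ->]]]|i _ hi [u1 [v1 [bu ->]]]].
  - by exists 0, 0; rewrite mulr0 addr0; split=> //; [exact: ideal0|exact: pow0r].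
  - by exists (u1 + u2), (v1 + v2); split; [exact: idealD|exact: powDr|rewrite mulrDr addrACA].
  exists (i * u1), (i * v1); split; [exact: idealM| |by rewrite mulrDr mulrCA].
  by apply: idealMl => //; exact: pow_ideal.
have [w1 [v [bw Jv e]]] := key _ (hc _ hJS m _ Jj' bj).
have tsv : th (t * s) = th v.
  apply/eqP; rewrite -subr_eq0; apply/eqP; apply: s0reg.
  by rewrite mulrBr -thE e rmorphD [th (s0 * v)]rmorphM bw add0r subrr.
have -> : y = (u * u') * th v.
  rewrite -tsv rmorphM -se; transitivity ((u * th t) * (u' * th t') * y).
    by rewrite ut ut' !mul1r.
  by ring.
apply: idealM; first exact: pow_ideal.
by apply: morph_pow Jv.
Qed.
End Localized.

(** * Associated primes *)

Lemma noeth_max (R : comPzRingType) (P : set R -> Prop) : noetherian R -> (forall I, P I -> is_ideal I) ->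
  (exists I, P I) -> exists I, P I /\ forall J, P J -> I `<=` J -> J = I.
Proof.
move=> nR PI [I0 PI0]; apply: contrapT => h.
suff H : forall I, is_ideal I -> ~ P I by exact: H I0 (PI _ PI0) PI0.
apply: noeth_ind => // I hI IH hPI; apply: h; exists I; split=> // J PJ IJ.
apply: contrapT => ne; apply: (IH J (PI _ PJ) IJ _ PJ) => e; exact: ne (esym e).
Qed.

Section AssociatedPrimes.
Variable R : comNzRingType.
Hypothesis nR : noetherian R.

Lemma ann_ideal (x : R) : is_ideal (annihilator x).
Proof.
split; rewrite /annihilator /=; first by rewrite mul0r.
  by move=> u v hu hv; rewrite mulrDl hu hv addr0.
by move=> u v hv; rewrite -mulrA hv mulr0.
Qed.

Lemma assoc_exists (x0 : R) : x0 <> 0 -> exists y, associated_prime (annihilator (y * x0)).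
Proof.
move=> x00; pose P I := exists y, y * x0 <> 0 /\ I = annihilator (y * x0).
have [|| I [[y [yx0 ->]] mx]] := @noeth_max R P nR.
- by move=> _ [y [_ ->]]; exact: ann_ideal.
- by exists (annihilator (1 * x0)), 1; rewrite mul1r.
exists y; split; last by exists (y * x0).
split; [exact: ann_ideal|by rewrite /annihilator /= mul1r|].
move=> a b ab; have [|ax] := pselect (annihilator (y * x0) a); first by left.
right; have <- : annihilator (a * y * x0) = annihilator (y * x0).
  apply: mx; first by exists (a * y); split=> //; rewrite -mulrA.
  by move=> z; rewrite /annihilator /= -mulrA => hz; rewrite mulrCA hz mulr0.
by move: ab; rewrite /annihilator /= -!mulrA mulrCA => ->.
Qed.

Lemma torsion_killer (T : set R) : mul_closed T ->
  exists2 t0, T t0 & forall y, (exists2 t, T t & t * y = 0) -> t0 * y = 0.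
Proof.
move=> [T1 TM]; pose Z := [set y : R | exists2 t, T t & t * y = 0].
have hZ : is_ideal Z.
  split; first by exists 1; rewrite ?mulr0.
    move=> x y [t Tt tx] [t' Tt' ty]; exists (t * t'); first exact: TM.
    by rewrite mulrDr mulrAC tx mul0r add0r -mulrA ty mulr0.
  by move=> a x [t Tt tx]; exists t => //; rewrite mulrCA tx mulr0.
have kill (l : seq R) : (forall y, y \in l -> Z y) -> exists2 t0, T t0 & forall y, span l y -> t0 * y = 0.
  elim: l => [_|x l IH hl].
    by exists 1 => // y [c ->]; rewrite big_ord0 mulr0.
  have [|t1 Tt1 h1] := IH; first by move=> y yl; apply: hl; rewrite inE yl orbT.
  have [t2 Tt2 h2] := hl x (mem_head _ _); exists (t1 * t2); first exact: TM.
  move=> y [c ->]; rewrite big_ord_recl /= mulrDr mulrCA -[t1 * t2 * x]mulrA h2 !mulr0 add0r.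
  by rewrite mulrAC [t1 * _]h1 ?mul0r //; exists (fun i => c i.+1).
have [l Zl] := nR hZ.
have [|t0 Tt0 ht0] := kill l; first by move=> y yl; rewrite Zl; apply: mem_span.
by exists t0 => // y Zy; apply: ht0; rewrite -Zl.
Qed.

(** Take an associated prime annihilating some y t0, where t0 in T kills all T-torsion. If some t in
    T killed y t0, then y would be T-torsion and y t0 = 0. *)
Lemma assoc_avoid (T : set R) : mul_closed T -> ~ T 0 ->
  exists Q, associated_prime Q /\ forall t, T t -> ~ Q t.
Proof.
move=> hT T0; have [T1 TM] := hT; have [t0 Tt0 ht0] := torsion_killer hT.
have [|y hy] := @assoc_exists t0; first by move=> e; apply: T0; rewrite -e.
exists (annihilator (y * t0)); split=> // t Tt; rewrite /annihilator /= => h.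
have yt0 : y * t0 = 0.
  by rewrite mulrC; apply: ht0; exists (t * t0); [exact: TM|rewrite -mulrA [t0 * y]mulrC].
by have [[_ + _] _] := hy; apply; rewrite /annihilator /= mul1r.
Qed.

Lemma assoc_nzd (a : R) : (forall Q : set R, associated_prime Q -> ~ Q a) -> forall y, a * y = 0 -> y = 0.
Proof.
move=> h y ay; apply: contrapT => /assoc_exists[z hz]; apply: (h _ hz).
by rewrite /annihilator /= mulrCA ay mulr0.
Qed.

Lemma assoc_nilp (z : R) : (forall Q : set R, associated_prime Q -> Q z) -> exists n, z ^+ n = 0.
Proof.
move=> h; apply: contrapT => nz.
have [||Q [aQ hQ]] := @assoc_avoid [set t | exists n, t = z ^+ n].
- split; first by exists 0%N; rewrite expr0.
  by move=> _ _ [i ->] [j ->]; exists (i + j)%N; rewrite exprD.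
- by move=> [n e]; apply: nz; exists n.
by apply: (hQ z); [exists 1%N; rewrite expr1|exact: h].
Qed.

(** Otherwise [assoc_avoid] yields an associated prime avoiding all t z^n with t outside P: it lies
    inside P and misses z, so P would be embedded. *)
Lemma assoc_local_nilp (P : set R) (z : R) : no_embedded_primes R -> associated_prime P -> P z ->
  exists n t, ~ P t /\ t * z ^+ n = 0.
Proof.
move=> ne aP Pz; have [[iP P1 hP] _] := aP; apply: contrapT => nz.
have [||Q [aQ hQ]] := @assoc_avoid [set y | exists n t, ~ P t /\ y = t * z ^+ n].
- split; first by exists 0%N, 1; rewrite expr0 mulr1.
  move=> _ _ [i [t [Pt ->]]] [j [t' [Pt' ->]]]; exists (i + j)%N, (t * t').
  by split; [move=> /hP[]|rewrite exprD mulrACA].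
- by move=> [n [t [Pt e]]]; apply: nz; exists n, t.
apply: (ne P); split=> //; exists Q; split=> //; split=> [y Qy|PQ].
  by apply: contrapT => Py; apply: (hQ y) Qy; exists 0%N, y; rewrite expr0 mulr1.
by apply: (hQ z); [exists 1%N, 1; rewrite mul1r expr1|exact: PQ].
Qed.

(** If x y lies in I but x and y do not, the lists for I + (x) and I + (y) are concatenated. *)
Lemma prime_list (I : set R) : is_ideal I -> exists r (P : 'I_r -> set R),
  (forall i, is_prime_ideal (P i)) /\
  forall x : 'I_r -> R, (forall i, P i (x i)) -> I (\prod_i x i).
Proof.
move: I; apply: noeth_ind => // I hI IH.
have [I1|nI1] := pselect (I 1).
  by exists 0%N, (fun=> setT); split=> [[]|x _] //; rewrite big_ord0.
have [pI|npI] := pselect (forall x y, I (x * y) -> I x \/ I y).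
  by exists 1%N, (fun=> I); split=> [i|x hx]; [split|rewrite big_ord1].
have [x [y [Ixy nIx nIy]]] : exists x y, [/\ I (x * y), ~ I x & ~ I y].
  apply: contrapT => h; apply: npI => x y Ixy; apply: contrapT => h'; apply: h; exists x, y.
  by split=> // ?; apply: h'; [left|right].
have addI w : ~ I w -> exists r (P : 'I_r -> set R), (forall i, is_prime_ideal (P i)) /\
    forall x : 'I_r -> R, (forall i, P i (x i)) -> exists u v, I u /\ \prod_i x i = u + w * v.
  move=> nIw; apply: (IH [set z | exists u v, I u /\ z = u + w * v]).
  - split; first by exists 0, 0; rewrite mulr0 addr0; split=> //; exact: ideal0.
      move=> _ _ [u [v [Iu ->]]] [u' [v' [Iu' ->]]]; exists (u + u'), (v + v').
      by rewrite mulrDr addrACA; split=> //; exact: idealD.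
    move=> a _ [u [v [Iu ->]]]; exists (a * u), (a * v); rewrite mulrDr mulrCA; split=> //.
    exact: idealM.
  - by move=> u Iu; exists u, 0; rewrite mulr0 addr0.
  - by move=> e; apply: nIw; rewrite e; exists 0, 1; rewrite mulr1 add0r; split=> //; exact: ideal0.
have [r [P [pP hP]]] := addI x nIx; have [r' [P' [pP' hP']]] := addI y nIy.
exists (r + r')%N, (fun i => match split i with inl j => P j | inr j => P' j end); split.
  by move=> i; case: split.
move=> z hz; rewrite big_split_ord /=.
have [|u [v [Iu ->]]] := hP (fun i => z (lshift r' i)).
  by move=> i; have := hz (lshift r' i); rewrite (unsplitK (inl _ i)).
have [|u' [v' [Iu' ->]]] := hP' (fun i => z (rshift r i)).
  by move=> i; have := hz (rshift r i); rewrite (unsplitK (inr _ i)).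
have -> : (u + x * v) * (u' + y * v') = u * (u' + y * v') + ((x * v) * u' + (v * v') * (x * y)) by ring.
by apply: idealD => //; [exact: idealMl|apply: idealD => //; exact: idealM].
Qed.

(** An associated prime Q contains some prime of a list whose product is zero, and equals it because
    the elements of Q are nilpotent locally at Q. The [e i] are products of elements separating the
    primes, which exist because no associated prime contains another. *)
Lemma assoc_list : no_embedded_primes R -> exists r (P : 'I_r -> set R) (e : 'I_r -> R),
  [/\ forall i, associated_prime (P i), forall Q : set R, associated_prime Q -> exists i, Q = P i,
    forall i, ~ P i (e i) & forall i j, i != j -> P j (e i)].
Proof.
move=> ne; have [r [P [pP hP]]] := prime_list (@ideal_set0 R).
have inP Q : associated_prime Q -> exists i, Q = P i.
  move=> aQ; have [[iQ Q1 hQ] _] := aQ.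
  have [i PQ] : exists i, P i `<=` Q.
    apply: contrapT => h; have /choice[x hx] : forall i, exists x, P i x /\ ~ Q x.
      move=> i; apply: contrapT => h'; apply: h; exists i => x Px; apply: contrapT => Qx.
      by apply: h'; exists x.
    have /hP e : forall i, P i (x i) by move=> i; apply: (hx i).1.
    suff : ~ Q (\prod_i x i) by rewrite [\prod_i _]e; apply; exact: ideal0.
    by apply: (big_ind (fun v => ~ Q v)) => [//|u v hu hv /hQ[]//|i _]; exact: (hx i).2.
  exists i; apply: subset_eq => // z Qz.
  have [n [t [Qt tz]]] := assoc_local_nilp ne aQ Qz.
  have [iPi P1 hPi] := pP i; have : P i (t * z ^+ n) by rewrite tz; exact: ideal0.
  move=> /hPi[/PQ//|]; elim: n {tz} => [//|n IH]; rewrite exprS => /hPi[//|]; exact: IH.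
(* Repetitions are removed by keeping the smallest index of each prime. *)
pose good (i : 'I_r) := `[< associated_prime (P i) /\ forall j : 'I_r, (j < i)%N -> P j <> P i >].
pose s := [seq i <- enum 'I_r | good i].
pose P' (i : 'I_(size s)) := P (tnth (in_tuple s) i).
have goodi (i : 'I_(size s)) : good (tnth (in_tuple s) i).
  by have := mem_tnth i (in_tuple s); rewrite /= mem_filter => /andP[].
have ass i : associated_prime (P' i) by have /asboolP[] := goodi i.
have inj i j : P' i = P' j -> i = j.
  have us : uniq s by rewrite filter_uniq ?enum_uniq.
  move=> e.
  have := goodi i; have := goodi j => /asboolP[_ hj] /asboolP[_ hi].
  have vij : val (tnth (in_tuple s) i) = val (tnth (in_tuple s) j).
    case: (ltngtP (tnth (in_tuple s) i) (tnth (in_tuple s) j)) => //.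
      by move=> /hj; rewrite /P' in e.
    by move=> /hi h; case: h; rewrite /P' in e.
  have x0 : 'I_r := tnth (in_tuple s) i; move: (val_inj vij); rewrite !(tnth_nth x0) /= => /eqP.
  by rewrite nth_uniq // => /eqP/val_inj.
have sub i j : i != j -> exists x, P' j x /\ ~ P' i x.
  move=> ij; apply: contrapT => h; apply: (ne (P' i)); split=> //; exists (P' j); split=> //.
  split=> [x Px|PP]; first by apply: contrapT => nPx; apply: h; exists x.
  move/eqP: ij; apply; apply: inj; apply: subset_eq => // x Px.
  by apply: contrapT => nPx; apply: h; exists x.
have /choice[x hx] : forall ij : 'I_(size s) * 'I_(size s), exists x, ij.1 != ij.2 -> P' ij.2 x /\ ~ P' ij.1 x.
  by move=> [i j]; have [->|ij] := eqVneq i j; [by exists 0 => /eqP []|have [x hx] := sub i j ij; exists x].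
exists (size s), P', (fun i => \prod_(j | i != j) x (i, j)); split=> //.
- move=> Q aQ; have [i0 Qi0] := inP Q aQ.
  have ex : exists n, `[< exists i : 'I_r, i = n :> nat /\ P i = Q >].
    by exists i0; apply/asboolP; exists i0.
  case: (ex_minnP ex) => n /asboolP[i [iN PiQ]] mn.
  have gi : good i.
    apply/asboolP; rewrite PiQ; split=> // j ji Pj.
    have : (n <= j)%N by apply: mn; apply/asboolP; exists j.
    by rewrite -iN leqNgt ji.
  have /tnthP[l hl] : i \in in_tuple s by rewrite /= mem_filter gi mem_enum.
  by exists l; rewrite /P' -hl PiQ.
- move=> i; have [[_ P1 hPi] _] := ass i.
  by apply: (big_ind (fun v => ~ P' i v)) => [//|u v hu hv /hPi[]//|j ij]; exact: (hx (i, j) ij).2.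
- move=> i j ij; rewrite (bigD1 j) //=; have [[iPj _ _] _] := ass j.
  by apply: idealMl => //; exact: (hx (i, j) ij).1.
Qed.
End AssociatedPrimes.

Lemma noeth_frac (k : fieldType) n (R : comNzRingType) (th : {rmorphism {mpoly k[n]} -> R}) :
  (forall y, exists (s t : {mpoly k[n]}) (u : R), u * th t = 1 /\ th t * y = th s) -> noetherian R.
Proof.
move=> frac I hI; have [l lE] := noeth_mpoly (preim_ideal th hI); exists [seq th x | x <- l].
apply: subset_eq.
  move=> y Iy; have [s [t [u [ut e]]]] := frac y.
  have : span l s by rewrite -lE /preimage /= -e; apply: idealM.
  move=> [c sE]; exists (fun i => u * th (c i)); rewrite size_map.
  rewrite -[LHS]mul1r -ut -mulrA e sE rmorph_sum mulr_sumr; apply: eq_bigr => i _.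
  by rewrite (nth_map 0) // rmorphM mulrA.
apply: span_sub => // _ /mapP[x xl ->]; have : (th @^-1` I) x by rewrite lE; apply: mem_span.
by [].
Qed.

(** * Hensel lifting to the local rings at the associated primes *)

Lemma powM_inv (R : comPzRingType) (I : set R) m n x :
  ideal_pow I (m * n) x -> ideal_pow (ideal_pow I m) n x.
Proof.
elim: n x => [|n IH] x //; rewrite mulnS => /pow_split.
by apply: mul_sub => // y; exact: IH.
Qed.

Lemma loc_factor (A B C : comNzRingType) (W : set A) (f : {rmorphism A -> B}) (g : {rmorphism A -> C}) :
  mul_closed W -> is_localization W f -> (forall w, W w -> exists u, u * g w = 1) ->
  exists g' : {rmorphism B -> C}, forall x, g' (f x) = g x.
Proof.
move=> [W1 WM] [fu fd fk] gu.
have cancel w x y : W w -> x * g w = y * g w -> x = y.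
  move=> Ww e; have [u uw] := gu w Ww.
  by rewrite -[x]mulr1 -uw mulrCA e mulrCA uw mulr1.
have /choice[g' hg'] : forall b, exists c, forall a w, W w -> b * f w = f a -> c * g w = g a.
  move=> b; have [a [w [Ww e]]] := fd b; have [u uw] := gu w Ww.
  exists (u * g a) => a' w' Ww' e'; have /fk[t [Wt te]] : f (a * w' - a' * w) = 0.
    by rewrite rmorphB !rmorphM -e -e'; ring.
  apply: (cancel (t * w)); first exact: WM.
  have : g t * (g a * g w') = g t * (g a' * g w).
    by apply/eqP; rewrite -subr_eq0 -mulrBr -!rmorphM -rmorphB -rmorphM te rmorph0.
  rewrite rmorphM => h; transitivity ((u * g w) * (g t * (g a * g w'))); first by ring.
  by rewrite uw mul1r h; ring.
have g'B : zmod_morphism g'.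
  move=> x y; have [a [w [Ww ex]]] := fd x; have [b [v [Wv ey]]] := fd y.
  apply: (cancel (w * v)); first exact: WM.
  have e : (x - y) * f (w * v) = f (a * v - b * w) by rewrite rmorphB !rmorphM -ex -ey; ring.
  rewrite (hg' _ _ _ (WM _ _ Ww Wv) e) rmorphB !rmorphM.
  by rewrite -(hg' x a w Ww ex) -(hg' y b v Wv ey); ring.
have g'M : monoid_morphism g'.
  split; first by have := hg' 1 1 1 W1; rewrite !rmorph1 mulr1 => /(_ erefl); rewrite mulr1.
  move=> x y; have [a [w [Ww ex]]] := fd x; have [b [v [Wv ey]]] := fd y.
  apply: (cancel (w * v)); first exact: WM.
  have e : (x * y) * f (w * v) = f (a * b) by rewrite !rmorphM -ex -ey; ring.
  rewrite (hg' _ _ _ (WM _ _ Ww Wv) e) !rmorphM.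
  by rewrite -(hg' x a w Ww ex) -(hg' y b v Wv ey); ring.
pose gr : {rmorphism B -> C} :=
  HB.pack g' (GRing.isZmodMorphism.Build _ _ g' g'B) (GRing.isMonoidMorphism.Build _ _ g' g'M).
exists gr => x; have := hg' (f x) x 1 W1; rewrite !rmorph1 mulr1 => /(_ erefl).
by rewrite mulr1.
Qed.

Lemma pow_contract (A B : comNzRingType) (W : set A) (f : {rmorphism A -> B}) (J : set B) N y :
  mul_closed W -> is_localization W f -> is_ideal J -> ideal_pow J N y ->
  exists w j, [/\ W w, ideal_pow (f @^-1` J) N j & y * f w = f j].
Proof.
move=> [W1 WM] [fu fd fk] hJ; have hJS := preim_ideal f hJ; move: y; apply: pow_ind.
- by exists 1, 0; rewrite !rmorph0 mul0r; split=> //; exact: pow0r.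
- move=> y y' [t [j [Wt Jj e]]] [t' [j' [Wt' Jj' e']]].
  exists (t * t'), (t' * j + t * j'); split; [exact: WM| |].
  + by apply: powDr; apply: idealM => //; exact: pow_ideal.
  + by rewrite rmorphD !rmorphM -e -e'; ring.
move=> a s <- hs; have [x [t [Wt xe]]] := fd a.
have [t' [j [Wt' Jj e]]] : exists t j, [/\ W t, ideal_pow (f @^-1` J) (size s) j &
    (\prod_(y <- s) y) * f t = f j].
  elim: s hs => [|y s IH] hs; first by exists 1, 1; rewrite big_nil !rmorph1 mulr1; split.
  have [|t' [j [Wt' Jj e]]] := IH; first by move=> y' ys; apply: hs; rewrite inE ys orbT.
  have [x' [t2 [Wt2 xe2]]] := fd y.
  exists (t2 * t'), (x' * j); split; [exact: WM| |].
  + apply: mem_mul => //; rewrite /preimage /= -xe2; apply: idealMl => //; apply: hs.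
    exact: mem_head.
  + by rewrite big_cons !rmorphM -e -xe2; ring.
exists (t * t'), (x * j); split; [exact: WM| |].
- by apply: idealM => //; exact: pow_ideal.
- by rewrite !rmorphM -e -xe; ring.
Qed.

(** The integral equation of x is cleared by a common denominator w; a further t in W makes it hold
    in A. Then t X, with X the numerator of x over w, is in the integral closure of the contracted
    power. *)
Lemma bs_loc (A B : comNzRingType) (W : set A) (f : {rmorphism A -> B}) Delta c :
  mul_closed W -> is_localization W f -> briancon_skoda Delta c -> briancon_skoda (f Delta) c.
Proof.
move=> hW hf bs J hJ m x [n [a [n0 ha hx]]]; have [W1 WM] := hW; have [fu fd fk] := hf.
have hJS := preim_ideal f hJ; pose JA := f @^-1` J.
have /choice[wA hwA] : forall i : 'I_n.+1, exists wA : A * A, [/\ W wA.1,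
    (0 < i)%N -> ideal_pow (ideal_pow JA (m + c)) i wA.2 & (0 < i)%N -> a i * f wA.1 = f wA.2].
  move=> i; have [i0|i0] := posnP i; first by exists (1, 0); split; rewrite ?i0.
  have [|w [j [Ww Jj e]]] := pow_contract hW hf hJ (powM (ha i _)).
    by rewrite i0 -ltnS ltn_ord.
  by exists (w, j); split=> // _; apply: powM_inv.
have [X0 [w0 [Ww0 x0E]]] := fd x.
pose w := w0 * \prod_i (wA i).1.
have Ww : W w by apply: (WM) => //; apply: (big_ind W) => // i _; have [] := hwA i.
pose X := X0 * \prod_i (wA i).1.
have XE : x * f w = f X by rewrite /w /X !rmorphM mulrA x0E.
have /choice[A' hA'] : forall i : 'I_n.+1, exists A', (0 < i)%N ->
    ideal_pow (ideal_pow JA (m + c)) i A' /\ a i * f w = f A'.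
  move=> i; have [_ h1 h2] := hwA i.
  exists ((w0 * \prod_(j | j != i) (wA j).1) * (wA i).2) => i0; split.
    by apply: idealM; [exact: pow_ideal|exact: h1].
  by rewrite /w (bigD1 i) //= !rmorphM -(h2 i0); ring.
pose A2 i := if (insub i : option 'I_n.+1) is Some i' then A' i' else 0.
have A2E i : (1 <= i <= n)%N -> ideal_pow (ideal_pow JA (m + c)) i (A2 i) /\ a i * f w = f (A2 i).
  move=> /andP[i1 i2]; rewrite /A2 insubT; exact: hA'.
have /fk[t [Wt te]] : f (X ^+ n + \sum_(1 <= i < n.+1) A2 i * w ^+ i.-1 * X ^+ (n - i)) = 0.
  transitivity (f w ^+ n * (x ^+ n + \sum_(1 <= i < n.+1) a i * x ^+ (n - i))); last by rewrite hx mulr0.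
  rewrite rmorphD rmorph_sum mulrDr mulr_sumr rmorphXn -XE exprMn mulrC; congr (_ + _).
  apply: eq_big_nat => i hi; rewrite 2!rmorphM !rmorphXn -(A2E i hi).2 -XE exprMn.
  have -> : f w ^+ n = f w * f w ^+ i.-1 * f w ^+ (n - i).
    by rewrite -exprS -exprD; congr (_ ^+ _); move: hi; lia.
  by ring.
have cl : integral_closure (ideal_pow JA (m + c)) (t * X).
  exists n, (fun i => t ^+ i * w ^+ i.-1 * A2 i); split=> // [i hi|].
    by apply: idealM; [exact: pow_ideal|exact: (A2E i hi).1].
  transitivity (t ^+ n.-1 * (t * (X ^+ n + \sum_(1 <= i < n.+1) A2 i * w ^+ i.-1 * X ^+ (n - i)))); last by rewrite te mulr0.
  rewrite mulrA -exprSr prednK // mulrDr mulr_sumr exprMn; congr (_ + _).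
  apply: eq_big_nat => i hi; rewrite [(t * X) ^+ _]exprMn.
  have -> : t ^+ n = t ^+ i * t ^+ (n - i) by rewrite -exprD subnKC //; move: hi; lia.
  by ring.
have := bs JA hJS m _ cl; move/(morph_pow (f := f) (J := J)) => /(_ (fun y h => h)).
have [u1 h1] := fu _ Wt; have [u2 h2] := fu _ Ww.
move=> h; have -> : f Delta * x = (u1 * u2) * f (Delta * (t * X)).
  transitivity ((u1 * f t) * (u2 * f w) * (f Delta * x)); first by rewrite h1 h2 !mul1r.
  by rewrite (rmorphM f Delta) (rmorphM f t) -XE; ring.
by apply: idealM => //; exact: pow_ideal.
Qed.

(** [lipman_sathaye] needs an infinite field, so the tower is extended to one and the property is
    retracted. *)
Lemma bs_tower (k : fieldType) M (H : comNzRingType) (a : {rmorphism k -> H}) Delta : tower M a Delta ->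
  briancon_skoda Delta M.+1.
Proof.
move=> tw; have [K [e [r [hr iK _]]]] := infinite_perfect_ext k.
have [HK [aK [eH [rH [twK hrH]]]]] := tower_base_change tw hr.
exact: (bs_retract hrH (lipman_sathaye iK (tower_noeth twK) (tower_ls twK))).
Qed.

Lemma taylor1 (A : comNzRingType) (F : {poly A}) x d : exists c, F.[x + d] = F.[x] + d * c.
Proof.
elim/poly_ind: F => [|F b [c e]]; first by exists 0; rewrite !horner0 mulr0 addr0.
by exists (c * (x + d) + F.[x]); rewrite !hornerMXaddC e; ring.
Qed.

Lemma taylor2 (A : comNzRingType) (F : {poly A}) x d :
  exists c, F.[x + d] = F.[x] + F^`().[x] * d + c * d ^+ 2.
Proof.
elim/poly_ind: F => [|F b [c e]]; first by exists 0; rewrite deriv0 !horner0 !mul0r !addr0.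
exists (c * (x + d) + F^`().[x]).
by rewrite derivD derivM derivX derivC addr0 mulr1 !(hornerD, hornerMX, hornerC) e; ring.
Qed.

(** Newton's iteration gains one power of m per step, which suffices since a power of m is zero. *)
Lemma hensel (A : comNzRingType) (m : set A) N (F : {poly A}) y0 : is_ideal m ->
  (forall y, ~ m y -> exists u, u * y = 1) -> (forall y, ideal_pow m N y -> y = 0) ->
  m F.[y0] -> ~ m F^`().[y0] -> exists y, m (y - y0) /\ F.[y] = 0.
Proof.
move=> hm un nilm Fy dF; suff [y [hy /nilm Fy0]] : exists y, m (y - y0) /\ ideal_pow m N F.[y] by exists y.
suff [y [hy Fy0]] : exists y, m (y - y0) /\ ideal_pow m N.+1 F.[y] by exists y; split=> //; exact: powS.
elim: (N) => [|i [y [hy Fi]]]; first by exists y0; rewrite subrr; split; [exact: ideal0|exact: pow1].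
have dFy : ~ m F^`().[y].
  move=> h; apply: dF; have [c e] := taylor1 F^`() y0 (y - y0); move: h; rewrite -[y](subrK y0) addrC e.
  move=> h; have -> : F^`().[y0] = F^`().[y0] + (y - y0) * c - (y - y0) * c by rewrite addrK.
  by apply: idealB => //; apply: idealMl.
have [u hu] := un _ dFy; pose d := - (u * F.[y]).
have di : ideal_pow m i.+1 d by apply: idealN; [exact: pow_ideal|apply: idealM => //; exact: pow_ideal].
have md : m d by apply: mul_subl hm _ di.
exists (y + d); split; first by rewrite addrAC; exact: idealD.
have [c ->] := taylor2 F y d.
have -> : F.[y] + F^`().[y] * d = 0 by rewrite /d mulrN mulrA [_ * u]mulrC hu mul1r subrr.
rewrite add0r expr2 mulrCA; apply: mem_mul => //.
exact: (idealM _ (pow_ideal m i.+1)).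
Qed.

(** * Lifting towers into the local ring *)

Section LocalRing.
Variables (k : fieldType) (R : comNzRingType) (alg : {rmorphism k -> R}) (P : set R).
Variables (D : comNzRingType) (p : {rmorphism R -> D}) (L : comNzRingType) (lam : {rmorphism R -> L}).
Hypotheses (nR : noetherian R) (pP : is_prime_ideal P).
Hypothesis (lnil : forall z, P z -> exists n t, ~ P t /\ t * z ^+ n = 0).
Hypotheses (sp : forall q, exists r, p r = q) (kp : forall r, p r = 0 <-> P r).
Local Notation W := [set w | ~ P w].
Hypothesis hlam : is_localization W lam.

Let iP : is_ideal P. Proof. by case: pP. Qed.
Lemma compl_mul : mul_closed W.
Proof. by have [_ P1 hP] := pP; split=> //= x y Px Py /hP[]. Qed.

(** The maximal ideal of the local ring, described by fractions with numerator in P. *)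
Definition maxid : set L := [set y | exists w r, [/\ ~ P w, P r & y * lam w = lam r]].

Lemma maxid_ideal : is_ideal maxid.
Proof.
have [P1 WM] := compl_mul; split.
- by exists 1, 0; rewrite mul0r rmorph0; split=> //; exact: ideal0.
- move=> _x y [w [r [Pw Pr e]]] [w' [r' [Pw' Pr' e']]]; exists (w * w'), (r * w' + r' * w); split.
  + exact: WM.
  + by apply: idealD => //; apply: idealMl.
  + by rewrite rmorphD !rmorphM -e -e'; ring.
move=> b y [w [r [Pw Pr e]]]; have [_ fd _] := hlam; have [a [v [Pv ev]]] := fd b.
exists (v * w), (a * r); split; [exact: WM|exact: idealM|by rewrite !rmorphM -ev -e; ring].
Qed.

Lemma maxid_lam r : maxid (lam r) <-> P r.
Proof.
have [P1 WM] := compl_mul; have [_ _ hP] := pP; split=> [[w [r' [Pw Pr e]]]|Pr]; last first.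
  by exists 1, r; rewrite rmorph1 mulr1.
have [_ _ fk] := hlam; have /fk[t [Wt te]] : lam (r * w - r') = 0 by rewrite rmorphB rmorphM e subrr.
have : P (t * (r * w)).
  have -> : t * (r * w) = t * r' by apply/eqP; rewrite -subr_eq0 -mulrBr te.
  exact: idealM.
by move=> /hP[//|/hP[]].
Qed.

Lemma maxid_unit y : ~ maxid y -> exists u, u * y = 1.
Proof.
have [fu fd _] := hlam; have [r [w [Pw e]]] := fd y => ny.
have Pr : ~ P r by move=> Pr; apply: ny; exists w, r.
by have [u hu] := fu r Pr; exists (u * lam w); rewrite -hu -e -!mulrA [lam w * _]mulrC.
Qed.

Lemma maxid_nilp : exists N, forall y, ideal_pow maxid N y -> y = 0.
Proof.
have [fu fd _] := hlam; have [l Pl] := nR iP.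
have [n hn] : exists n, forall x, x \in l -> lam x ^+ n = 0.
  apply: (@seq_max_index _ l (fun n x => lam x ^+ n = 0)) => [x xl|i j x ij e]; last first.
    by rewrite -(subnK ij) exprD e mulr0.
  have [|n [t [Pt e]]] := lnil (z := x); first by rewrite Pl; apply: mem_span.
  have [u hu] := fu t Pt; exists n; rewrite -rmorphXn -[LHS]mul1r -hu -mulrA -rmorphM e.
  by rewrite rmorph0 mulr0.
pose A := [set y | exists2 x, x \in l & y = lam x].
have mA : maxid `<=` gen_ideal A.
  move=> y [w [r [Pw Pr e]]]; have [u hu] := fu w Pw.
  have -> : y = u * lam r by rewrite -e mulrCA hu mulr1.
  apply: idealM; first exact: gen_is_ideal.
  move: Pr; rewrite Pl => -[c ->]; rewrite rmorph_sum; apply: ideal_sum => [|i _]; first exact: gen_is_ideal.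
  rewrite rmorphM; apply: idealM; first exact: gen_is_ideal.
  by apply: mem_gen; exists l`_i => //; apply: mem_nth.
exists (size l * n).+1 => y /(pow_sub mA); move: y; apply: pow_gen_ind => [//|u v -> ->|a w sw hw].
  by rewrite addr0.
have [||t [w1 [w2 [tg pw sw1 hw1]]]] := @pigeonhole _ (fun y => index y [seq lam x | x <- l]) (size l) n w.
- by move=> y /hw[x xl ->]; rewrite -(size_map lam) index_mem; apply: map_f.
- by rewrite sw.
rewrite (perm_big _ pw) big_cat /=.
have [x xl xE] : exists2 x, x \in l & forall y, y \in w1 -> y = lam x.
  exists l`_t; first exact: mem_nth.
  move=> y yw; rewrite -(nth_map 0 0) // -(hw1 y yw) nth_index //.
  by have /hw[x xl ->] : y \in w by [rewrite (perm_mem pw) mem_cat yw]; apply: map_f.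
by rewrite (prod_const_seq xE) sw1 exprS hn // mulr0 mul0r mulr0.
Qed.

Lemma local_common_den (l : seq L) : exists2 t, ~ P t & forall y, y \in l -> exists r, lam t * y = lam r.
Proof.
have [P1 WM] := compl_mul; have [_ fd _] := hlam.
elim: l => [|y l [t Pt ht]]; first by exists 1.
have [a [w [Pw e]]] := fd y; exists (t * w); first exact: WM.
move=> z; rewrite inE => /orP[/eqP ->|/ht[r hr]].
  by exists (t * a); rewrite !rmorphM -e; ring.
by exists (w * r); rewrite !rmorphM -hr; ring.
Qed.

(** Besides agreeing with [h] modulo the maximal ideal, the lift has one denominator t for its whole
    image; the final estimate returns from the local ring to R with it. *)
Definition lifts (H : comNzRingType) (h : {rmorphism H -> D}) (S : {rmorphism H -> L}) :=
  (forall z r, h z = p r -> maxid (S z - lam r)) /\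
  exists2 t, ~ P t & forall z, exists r, lam t * S z = lam r.

(** The free variables are lifted arbitrarily to R. At each level the derivative of G is nonzero in
    D because it divides Delta, so Hensel lifts the root. Remainders have bounded degree, so
    finitely many powers of the root determine the new denominator. *)
Lemma hensel_tower M (H : comNzRingType) (a : {rmorphism k -> H}) Delta : tower M a Delta ->
  forall h : {rmorphism H -> D}, (forall c, h (a c) = p (alg c)) -> h Delta <> 0 ->
  exists S : {rmorphism H -> L}, (forall c, S (a c) = lam (alg c)) /\ lifts h S.
Proof.
have dD : domain_like D := quot_domain pP sp kp.
have hm := maxid_ideal; have [P1 WM] := compl_mul; have [N nilm] := maxid_nilp.
have lamP r r' : p r = p r' -> maxid (lam r - lam r').
  by move=> e; rewrite -rmorphB; apply/maxid_lam/kp; rewrite rmorphB e subrr.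
elim=> [|H' Q a' De q G tw IH hq] h ha hD.
  have /choice[x hx] : forall i : 'I_M, exists r, p r = h 'X_i by move=> i; apply: sp.
  pose th : {rmorphism {mpoly k[M]} -> R} := mmap alg x.
  have hE : h =1 p \o th.
    apply: (mpoly_hom_ext (f := h) (g := p \o th)) => [c|i] /=; first by rewrite ha mmapC.
    by rewrite mmapX mmap1U hx.
  exists (lam \o th); split=> [c|]; first by rewrite /= mmapC.
  split=> // [z r e|]; first by apply: lamP; rewrite -e hE.
  by exists 1 => // z; exists (th z); rewrite rmorph1 mul1r.
have [mG sq kq] := hq; pose j : {rmorphism H' -> Q} := q \o polyC.
have [||S' [SC [Sl [t Pt ht]]]] := IH (h \o j).
- by move=> c; rewrite /= -ha.
- by move=> e; apply: hD; rewrite !rmorphM; move: e; rewrite /= => ->; rewrite mul0r.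
have [r0 hr0] := sp (h (q 'X)).
have liftpoly (f : {poly H'}) r : h (q f) = p r -> maxid ((map_poly S' f).[lam r0] - lam r).
  elim/poly_ind: f r => [|f c IHf] r e.
    rewrite rmorph0 horner0 -(rmorph0 lam); apply: lamP; rewrite -e; by rewrite !rmorph0.
  have [rf hrf] := sp (h (q f)); have [rc hrc] := sp (h (j c)).
  have -> : (map_poly S' (f * 'X + c%:P)).[lam r0] - lam r =
      lam r0 * ((map_poly S' f).[lam r0] - lam rf) + (S' c - lam rc) + (lam (rf * r0 + rc) - lam r).
    by rewrite rmorphD rmorphM /= map_polyX map_polyC hornerMXaddC rmorphD rmorphM; ring.
  apply: (idealD hm); first apply: (idealD hm).
  - by apply: (idealM _ hm); apply: IHf.
  - exact: Sl.
  - by apply: lamP; rewrite -e !rmorphD !rmorphM hrf hr0 hrc.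
pose F := map_poly S' G.
have Fy : maxid F.[lam r0].
  have := liftpoly G 0; rewrite (rmorph0 lam) subr0; apply; rewrite (kq G).2 ?rmorph0 //.
  by exists 1; rewrite mul1r.
have dF : ~ maxid F^`().[lam r0].
  rewrite /F deriv_map => hdF; have [r' hr'] := sp (h (q G^`())).
  have /maxid_lam Pr' : maxid (lam r').
    have -> : lam r' = (map_poly S' G^`()).[lam r0] - ((map_poly S' G^`()).[lam r0] - lam r') by rewrite subKr.
    by apply: (idealB hm) => //; apply: liftpoly.
  by apply: hD; rewrite !rmorphM -hr' (kp r').2 // mulr0.
have [y [my Fy0]] := hensel hm maxid_unit nilm Fy dF.
have [S hS] : exists S : {rmorphism Q -> L}, forall f, S (q f) = (map_poly S' f).[y].
  apply: (factor_surj (f := horner_eval y \o map_poly S') sq) => f /kq[g ->] /=.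
  by rewrite /horner_eval rmorphM hornerM -/F Fy0 mulr0.
exists S; split=> [c|]; first by rewrite /= hS map_polyC hornerC; exact: SC.
split=> // [z r|].
  have [f <-] := sq z => e; rewrite hS; have [c e'] := taylor1 (map_poly S' f) (lam r0) (y - lam r0).
  have -> : (map_poly S' f).[y] = (map_poly S' f).[lam r0] + (y - lam r0) * c.
    by rewrite -e' addrC subrK.
  rewrite addrAC; apply: (idealD hm); first exact: liftpoly.
  exact: (idealMl _ hm).
have [t' Pt' ht'] := local_common_den [seq y ^+ i | i <- iota 0 (size G)].
exists (t * t'); first exact: WM.
move=> z; have [f0 <-] := sq z; have [f [<- sf]] := adjoins_rem f0 hq.
have /choice[u hu] := ht.
have /choice[v hv] : forall i, exists r, (i < size G)%N -> lam t' * y ^+ i = lam r.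
  move=> i; have [ig|ig] := ltnP i (size G); last by exists 0.
  by have [|r hr] := ht' (y ^+ i); [apply: map_f; rewrite mem_iota|exists r].
exists (\sum_(i < size G) u f`_i * v i).
rewrite hS (horner_coef_wide (n := size G)); last by apply: leq_trans (size_poly _ _) (ltnW sf).
rewrite mulr_sumr rmorph_sum; apply: eq_bigr => i _; rewrite coef_map !rmorphM -hu -hv //; ring.
Qed.

(** D may require denominators that the tower H lacks, so H is localized at the elements whose
    images are units of D; then all q-th powers of D are reached. The lift extends, since such
    elements go to units of the local ring. *)
Lemma local_cover n (th : {rmorphism {mpoly k[n]} -> R}) : (forall c, th c%:MP = alg c) ->
  (forall y, exists s t u, u * th t = 1 /\ th t * y = th s) ->
  exists q (E : comNzRingType) (hE : {rmorphism E -> D}) (sE : {rmorphism E -> L}) DE a0 c1,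
  [/\ pexp k q, briancon_skoda DE c1, hE DE <> 0, hE a0 <> 0 & forall e, hE e = 0 -> a0 * e = 0] /\
  [/\ forall x, exists e, hE e = x ^+ q, forall e y, y * hE e = 1 -> exists u, u * e = 1,
      lifts hE sE & forall c, exists e, hE e = p (alg c) /\ sE e = lam (alg c)].
Proof.
move=> thC frac; have dD : domain_like D := quot_domain pP sp kp.
have hm := maxid_ideal; have [P1 WM] := compl_mul; have [N nilm] := maxid_nilp.
have lamP r r' : p r = p r' -> maxid (lam r - lam r').
  by move=> e; rewrite -rmorphB; apply/maxid_lam/kp; rewrite rmorphB e subrr.
have [q [M [H [a [Delta [h [a0 [[pq _ tw hD] [hk hx ha0 ka0 ha]]]]]]]]] :=
  tower_cover (p \o alg) dD (fun i : 'I_n => p (th 'X_i)).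
have [S [SC [Sl [t Pt ht]]]] := hensel_tower tw ha hD.
pose Z := [set z : H | exists y, y * h z = 1].
have hZ : mul_closed Z.
  split; first by exists 1; rewrite mul1r rmorph1.
  by move=> x y [u hu] [v hv]; exists (u * v); rewrite rmorphM mulrACA hu hv mul1r.
have h_n0 z : Z z -> h z <> 0 by move=> [y e] z0; move: e; rewrite z0 mulr0 => /esym/eqP; rewrite oner_eq0.
have Su z : Z z -> exists u, u * S z = 1.
  move=> Zz; apply: maxid_unit => mz; have [r hr] := sp (h z).
  apply: (h_n0 z Zz); rewrite -hr; apply/kp/maxid_lam.
  by rewrite -[lam r](subKr (S z)); apply: (idealB hm) => //; apply: Sl.
have Z0 : ~ Z 0 by move=> /h_n0; apply; rewrite rmorph0.
have [E [f fl]] := loc_ex hZ Z0; have [fu fd fk] := fl.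
have [hE hEf] := loc_factor hZ fl (fun w (Zw : Z w) => Zw).
have [sE sEf] := loc_factor hZ fl Su.
exists q, E, hE, sE, (f Delta), (f a0), M.+1; split.
  split; rewrite ?hEf //; first exact: (bs_loc hZ fl (bs_tower tw)).
  move=> e e0; have [z [w [Zw ew]]] := fd e; have [u hu] := fu w Zw.
  have -> : f a0 * e = u * f (a0 * z) by rewrite rmorphM -ew -[LHS]mul1r -hu; ring.
  by rewrite ka0 ?rmorph0 ?mulr0 // -hEf -ew rmorphM e0 mul0r.
have [phi hphi] := pexp_hom (p \o alg) pq.
have pth g : exists w, h w = p (th g) ^+ q.
  elim/mpolyind: g => [|c m g _ _ [w hw]].
    by exists 0; rewrite !rmorph0 expr0n; case: (q) (pexp_gt0 pq).
  have [wc hwc] := hk (c ^+ q).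
  have /choice[wx hwx] := hx.
  exists (wc * \prod_i wx i ^+ m i + w); rewrite [LHS]rmorphD [h (wc * _)]rmorphM hw hwc.
  rewrite [th (_ + _)]rmorphD [p (_ + _)]rmorphD -[RHS]hphi rmorphD !hphi; congr (_ + _).
  have -> : th (c *: 'X_[m]) = alg c * \prod_i th 'X_i ^+ m i.
    rewrite -mul_mpolyC [LHS]rmorphM thC mpolyXE_id rmorph_prod; congr (_ * _).
    by apply: eq_bigr => i _; rewrite rmorphXn.
  rewrite [p (alg c * _)]rmorphM exprMn [h (\prod_i _)]rmorph_prod [p (\prod_i _)]rmorph_prod -prodrXl.
  congr (_ * _); first by rewrite -[RHS](rmorphXn p) -rmorphXn.
  by apply: eq_bigr => i _; rewrite rmorphXn hwx rmorphXn -!exprM mulnC.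
have lE : forall e r, hE e = p r -> maxid (sE e - lam r).
  move=> e r er; have [z [w [Zw ew]]] := fd e; have [u hu] := Su w Zw.
  have [r' hr'] := sp (h w).
  have -> : sE e - lam r = u * ((S z - lam (r * r')) - lam r * (S w - lam r')).
    by rewrite -sEf -ew !rmorphM sEf -[LHS]mul1r -hu; ring.
  apply: (idealM _ hm); apply: (idealB hm).
  - by apply: Sl; rewrite rmorphM hr' -er -hEf -ew rmorphM hEf.
  - by apply: (idealM _ hm); apply: Sl.
split=> [x|e y|| c].
- have [r <-] := sp x; have [s [t' [u [hu e]]]] := frac r.
  have [ws hws] := pth s; have [wt hwt] := pth t'.
  have Zwt : Z wt by exists (p u ^+ q); rewrite hwt -exprMn -rmorphM hu rmorph1 expr1n.
  have [v hv] := fu wt Zwt; exists (v * f ws).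
  by rewrite rmorphM hEf hws -e rmorphM exprMn -hwt -hEf mulrA -rmorphM hv rmorph1 mul1r.
- move=> hy; have [z [w [Zw ew]]] := fd e.
  have [yw hyw] : Z w := Zw.
  have Zz : Z z by exists (y * yw); rewrite -hEf -ew rmorphM hEf mulrACA hy hyw mul1r.
  by have [u hu] := fu z Zz; exists (u * f w); rewrite -hu -ew; ring.
- split=> //; exists t => // e; have [z [w [Zw ew]]] := fd e.
  have [y hy] : Z w := Zw; have [r' hr'] := sp y; have [r2 hr2] := sp (h w).
  (* The inverse of [S w] is r' times a finite geometric series in the nilpotent [nu]. Expanding
     [nu] leaves combinations of values of S with coefficients from R, so the denominator t still
     suffices. *)
  pose nu := 1 - S w * lam r'.
  have mnu : maxid nu.
    have -> : nu = (lam 1 - lam (r2 * r')) - lam r' * (S w - lam r2) by rewrite /nu rmorph1 rmorphM; ring.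
    apply: (idealB hm); first by apply: lamP; rewrite rmorph1 rmorphM hr2 hr' mulrC.
    by apply: (idealM _ hm); apply: Sl.
  have nu0 : nu ^+ N = 0 by apply: nilm; elim: (N) => // i IH; rewrite exprS; exact: mem_mul.
  pose T y := exists r, lam t * y = lam r.
  have TD x1 x2 : T x1 -> T x2 -> T (x1 + x2).
    by move=> [r h1] [s h2]; exists (r + s); rewrite mulrDr h1 h2 rmorphD.
  have TM r x1 : T x1 -> T (lam r * x1) by move=> [s h1]; exists (r * s); rewrite mulrCA h1 rmorphM.
  have Bnu j : forall z, T (S z * nu ^+ j).
    elim: j => [|j IH] z1; first by rewrite mulr1; apply: ht.
    have -> : S z1 * nu ^+ j.+1 = S z1 * nu ^+ j + lam (- r') * (S (z1 * w) * nu ^+ j).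
      by rewrite exprS {1}/nu rmorphN rmorphM; ring.
    by apply: TD => //; apply: TM.
  have -> : sE e = \sum_(j < N) lam r' * (S z * nu ^+ j).
    have [u hu] := Su w Zw.
    have e1 : sE e * S w = S z by rewrite -!sEf -ew rmorphM.
    have e2 : S w * lam r' * \sum_(j < N) nu ^+ j = 1.
      have := subrX1 nu N; rewrite nu0 sub0r => /(congr1 -%R); rewrite opprK => ->.
      by rewrite -mulNr opprB subKr.
    rewrite -[LHS]mulr1 -e2 -mulr_sumr -mulr_sumr -e1; ring.
  have Tsum (F : 'I_N -> L) : (forall j, T (F j)) -> T (\sum_j F j).
    by move=> hF; apply: (big_ind T) => //; exists 0; rewrite mulr0 rmorph0.
  by apply: Tsum => j; apply: TM.
- by exists (f (a c)); rewrite hEf sEf ha SC.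
Qed.
End LocalRing.

(** * Differential operators by commutators *)

Section AlgebraicOrder.
Variables (R D : comNzRingType) (p : {rmorphism R -> D}).

Definition ad f (mu : R -> D) : R -> D := fun g => mu (f * g) - p f * mu g.

(** Shifted by one against the usual order: at index 0 only the zero map remains. *)
Fixpoint dord n (mu : R -> D) : Prop :=
  if n is n'.+1 then forall f, dord n' (ad f mu) else forall g, mu g = 0.

Lemma dord0 n : dord n (fun=> 0).
Proof.
elim: n => [|n IH] //= f; have -> // : ad f (fun=> 0) = (fun=> 0).
by apply/funext => g; rewrite /ad mulr0 subr0.
Qed.

Lemma dordD n mu nu : dord n mu -> dord n nu -> dord n (fun g => mu g + nu g).
Proof.
elim: n mu nu => [|n IH] mu nu /= hm hn => [g|f]; first by rewrite hm hn addr0.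
have -> : ad f (fun g => mu g + nu g) = (fun g => ad f mu g + ad f nu g).
  by apply/funext => g; rewrite /ad; ring.
exact: IH.
Qed.

Lemma dordZ n d mu : dord n mu -> dord n (fun g => d * mu g).
Proof.
elim: n mu => [|n IH] mu /= hm => [g|f]; first by rewrite hm mulr0.
have -> : ad f (fun g => d * mu g) = (fun g => d * ad f mu g).
  by apply/funext => g; rewrite /ad; ring.
exact: IH.
Qed.

Lemma dord_pre n a mu : dord n mu -> dord n (fun g => mu (a * g)).
Proof.
elim: n mu => [|n IH] mu /= hm => [g|f]; first by rewrite hm.
have -> : ad f (fun g => mu (a * g)) = (fun g => ad f mu (a * g)).
  by apply/funext => g; rewrite /ad mulrCA.
exact: IH.
Qed.

(** Precomposition with f and multiplication by [p f] commute, so their difference expands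
    binomially. *)
Lemma ad_iter mu f n g :
  iter n (ad f) mu g = \sum_(i < n.+1) (('X - (p f)%:P) ^+ n)`_i * mu (f ^+ i * g).
Proof.
elim: n g => [|n IH] g; first by rewrite big_ord1 expr0 coef1 mul1r mul1r.
rewrite iterS {1}/ad !IH; set F := _ ^+ n.
have sF : (size F <= n.+1)%N by rewrite size_exp_XsubC.
rewrite exprSr -/F mulrBr.
under [RHS]eq_bigr => i _ do rewrite coefB coefMX coefMC mulrBl.
rewrite sumrB [X in _ = X - _]big_ord_recl /= mul0r add0r; congr (_ - _).
  by apply: eq_bigr => i _; rewrite exprSr mulrA.
rewrite [RHS]big_ord_recr /= [F`_n.+1]nth_default // !mul0r addr0 mulr_sumr.
by apply: eq_bigr => i _; ring.
Qed.

Lemma ad_comm f g mu : ad f (ad g mu) = ad g (ad f mu).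
Proof. by apply/funext => x; rewrite /ad [f * (g * x)]mulrCA; ring. Qed.

Lemma iter_ad_comm f g n mu : iter n (ad f) (ad g mu) = ad g (iter n (ad f) mu).
Proof. by elim: n => [|n IH] //=; rewrite IH ad_comm. Qed.

(** The f for which [ad f mu] has the smaller order form a subalgebra closed under inverses, so
    generators suffice. For a generator, passing to [ad] lowers its entry of [al] by one and keeps
    the other conditions, because these operations commute; induct on the sum. *)
Lemma dord_gens (k : fieldType) (alg : {rmorphism k -> R}) n (th : {rmorphism {mpoly k[n]} -> R}) :
  (forall c, th c%:MP = alg c) ->
  (forall y, exists s t u, u * th t = 1 /\ th t * y = th s) ->
  forall mu, (forall x y, mu (x + y) = mu x + mu y) ->
  (forall c x, mu (alg c * x) = p (alg c) * mu x) ->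
  forall al : 'I_n -> nat, (forall i, iter (al i) (ad (th 'X_i)) mu = (fun=> 0)) ->
  dord (\sum_i al i).+1 mu.
Proof.
move=> thC frac mu + + al; move sM : (\sum_i al i)%N => M.
elim/ltn_ind: M mu al sM => M IH mu al sM muD muC hal.
pose K := [set f | dord M (ad f mu)].
have KD f g : K f -> K g -> K (f + g).
  move=> hf hg; rewrite /K /=; have -> : ad (f + g) mu = (fun x => ad f mu x + ad g mu x); last exact: dordD.
  by apply/funext => x; rewrite /ad mulrDl muD rmorphD; ring.
have KM f g : K f -> K g -> K (f * g).
  move=> hf hg; rewrite /K /=.
  have -> : ad (f * g) mu = (fun x => ad f mu (g * x) + p f * ad g mu x).
    by apply/funext => x; rewrite /ad -mulrA rmorphM; ring.
  by apply: dordD; [apply: (dord_pre g)|apply: dordZ].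
have KV u t : u * t = 1 -> K t -> K u.
  move=> ut ht; rewrite /K /=.
  have -> : ad u mu = (fun x => - p u * ad t mu (u * x)).
    apply/funext => x; rewrite /ad [t * _]mulrA [t * u]mulrC ut mul1r mulrBr.
    rewrite mulNr mulNr -opprB opprK mulrA -rmorphM ut rmorph1 mul1r; ring.
  exact: (dordZ (- p u) (dord_pre u ht)).
have KC c : K (alg c).
  rewrite /K /=; have -> : ad (alg c) mu = (fun=> 0); last exact: dord0.
  by apply/funext => x; rewrite /ad muC subrr.
have KX i : K (th 'X_i).
  rewrite /K /=; case ai : (al i) (hal i) => [|a] e.
    have -> : ad (th 'X_i) mu = (fun=> 0); last exact: dord0.
    by rewrite /= in e; apply/funext => x; rewrite /ad e mulr0 subr0.
  pose al' j := if j == i then a else al j.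
  have sM' : M = (\sum_j al' j).+1.
    rewrite -sM (bigD1 i) //= [in RHS](bigD1 i) //= /al' eqxx ai addSn; congr (_ + _).+1.
    by apply: eq_bigr => j /negPf ->.
  rewrite sM'; apply: (IH _ _ _ al') => // [|x y|c x|j]; rewrite ?sM' //.
  - by rewrite /ad mulrDr !muD; ring.
  - by rewrite /ad mulrCA !muC; ring.
  rewrite /al'; case: eqP => [->|_]; first by rewrite -iterSr.
  by rewrite iter_ad_comm hal; apply/funext => x; rewrite /ad mulr0 subr0.
have Kth P : K (th P).
  apply: (mpoly_subalg (S := [set P | K (th P)])) => //; split=> [c|x y|x y] /=.
  - by rewrite thC.
  - by rewrite rmorphD; apply: KD.
  - by rewrite rmorphM; apply: KM.
move=> f; have [s [t [u [ut e]]]] := frac f; have -> : f = u * th s by rewrite -e mulrA ut mul1r.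
by apply: KM => //; apply: KV ut _.
Qed.

End AlgebraicOrder.

(** * Integral closures through q-th powers *)

Section Transfer.
Variables (E D : comNzRingType) (hE : {rmorphism E -> D}) (q : nat) (phi : {rmorphism D -> D}).
Hypotheses (q0 : (0 < q)%N) (hphi : forall x, phi x = x ^+ q) (hx : forall x, exists e, hE e = x ^+ q).

Lemma sum_multiples (V : nmodType) (F : nat -> V) n :
  \sum_(1 <= t < (q * n).+1) (if (q %| t)%N then F (t %/ q)%N else 0) = \sum_(1 <= i < n.+1) F i.
Proof.
elim: n => [|n IH]; first by rewrite muln0 !big_geq.
rewrite (@big_cat_nat _ _ _ (q * n).+1) //=; last by rewrite ltnS leq_mul2l leqnSn orbT.
rewrite IH [RHS]big_nat_recr //=; congr (_ + _).
rewrite mulnS addnC big_nat_recr /=; last by rewrite -[X in (X < _)%N]addn0 ltn_add2l.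
rewrite -mulnSr dvdn_mulr // mulKn // big_nat_cond big1 ?add0r // => t /andP[/andP[t1 t2] _].
case: dvdnP => // -[j jt]; move: t1 t2; rewrite jt [(j * q)%N]mulnC mulnSr ltn_pmul2l // => j1.
by rewrite -mulnSr ltn_pmul2l // ltnS leqNgt j1.
Qed.

Lemma closure_qpow (A : comNzRingType) (I : set A) m n x (b : nat -> A) : (0 < n)%N ->
  (forall i, (1 <= i <= n)%N -> ideal_pow I (m * (q * i)) (b i)) ->
  x ^+ (q * n) + \sum_(1 <= i < n.+1) b i * x ^+ (q * (n - i)) = 0 ->
  integral_closure (ideal_pow I m) x.
Proof.
move=> n0 hb e; exists (q * n)%N, (fun t => if (q %| t)%N then b (t %/ q)%N else 0).
split=> [|t /andP[t1 t2]|]; first by rewrite muln_gt0 q0.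
  case: ifP => [/dvdnP[j jt]|_]; last exact: pow0r.
  move: t1 t2; rewrite jt mulnK // => t1 t2; apply: powM_inv; rewrite [(j * q)%N]mulnC; apply: hb.
  by move: t1 t2; rewrite mulnC muln_gt0 leq_pmul2l // => /andP[_ ->] ->.
rewrite -[RHS]e; congr (_ + _); rewrite -[in RHS]sum_multiples.
apply: eq_big_nat => t ht; case: ifP => [/dvdnP[j jt]|_]; last by rewrite mul0r.
by rewrite jt mulnK // mulnBr [(j * q)%N]mulnC.
Qed.

(** Only q-th powers of elements of D are known to lift to E, so J is represented by the lifts of
    its q-th powers. *)
Definition frob_ideal (J : set D) := gen_ideal [set z | exists2 y, J y & hE z = y ^+ q].

Lemma frob_lift J K a : ideal_pow J K a -> exists2 A, ideal_pow (frob_ideal J) K A & hE A = a ^+ q.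
Proof.
move: a; apply: pow_ind => [|u v [A hA eA] [B hB eB]|a s ss hs].
- by exists 0; [exact: pow0r|rewrite rmorph0 expr0n; case: (q) q0].
- by exists (A + B); [exact: powDr|rewrite rmorphD eA eB -!hphi -rmorphD].
have [A eA] := hx a; have {ss} <- := ss.
suff [B hB eB] : exists2 B, ideal_pow (frob_ideal J) (size s) B & hE B = (\prod_(y <- s) y) ^+ q.
  by exists (A * B); [apply: idealM => //; exact: pow_ideal|rewrite rmorphM eA eB exprMn].
elim: s hs => [|y s IH] hs; first by exists 1; rewrite // big_nil rmorph1 expr1n.
have [|B hB eB] := IH; first by move=> z zs; apply: hs; rewrite inE zs orbT.
have [Y eY] := hx y; exists (Y * B); last by rewrite rmorphM big_cons eY eB exprMn.
by apply: mem_mul => //; apply: mem_gen; exists y => //; apply: hs; exact: mem_head.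
Qed.

Variables (DE a0 : E) (c1 : nat).
Hypotheses (bs : briancon_skoda DE c1) (ka0 : forall e, hE e = 0 -> a0 * e = 0).

(** The q-th power of the integral equation of s y has coefficients that lift to E; evaluated at e1
    it holds up to the kernel of hE, hence exactly after multiplication by [a0]. This is an equation
    of degree q n, so a0 e1 is integral over a power M / q of the lifted ideal, which explains the
    bound on M. *)
Lemma bs_transfer (J : set D) M m y s e1 : (q * (m + c1) <= M)%N -> hE e1 = s * y ->
  integral_closure (ideal_pow J M) y -> ideal_pow (frob_ideal J) m (DE * (a0 * e1)).
Proof.
move=> mM e1y [n [a [n0 ha ey]]]; apply: bs; first exact: gen_is_ideal.
have /choice[A hA] : forall i, exists A, (1 <= i <= n)%N ->
    ideal_pow (frob_ideal J) ((m + c1) * (q * i)) A /\ hE A = (s ^+ i * a i) ^+ q.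
  move=> i; case hi : (1 <= i <= n)%N; last by exists 0.
  have [|A hA eA] := frob_lift (J := J) (K := M * i) (a := s ^+ i * a i).
    by apply: idealM; [exact: pow_ideal|apply: powM; apply: ha].
  exists A => _; split=> //; apply: pow_le hA.
  by rewrite mulnA leq_mul2r [((m + c1) * q)%N]mulnC mM orbT.
apply: (@closure_qpow _ _ _ n _ (fun i => a0 ^+ (q * i) * A i)) => // [i hi|].
  by apply: idealM; [exact: pow_ideal|case: (hA i hi)].
pose X := e1 ^+ (q * n) + \sum_(1 <= i < n.+1) A i * e1 ^+ (q * (n - i)).
have X0 : hE X = 0.
  have e0 : phi (s ^+ n * (y ^+ n + \sum_(1 <= i < n.+1) a i * y ^+ (n - i))) = 0 by rewrite ey mulr0 rmorph0.
  rewrite -[RHS]e0 mulrDr !rmorphD; congr (_ + _).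
    by rewrite rmorphXn e1y hphi -exprMn -exprM mulnC.
  rewrite !(rmorph_sum, mulr_sumr); apply: eq_big_nat => i hi.
  rewrite [hE (A i * _)]rmorphM (hA i hi).2 rmorphXn e1y hphi [(q * _)%N]mulnC exprM -exprMn; congr (_ ^+ _).
  have -> : s ^+ n = s ^+ i * s ^+ (n - i) by rewrite -exprD subnKC //; move: hi; lia.
  by rewrite exprMn; ring.
have := ka0 X0 => aX; transitivity (a0 ^+ (q * n).-1 * (a0 * X)); last by rewrite aX mulr0.
rewrite mulrA -exprSr prednK ?muln_gt0 ?q0 // mulrDr mulr_sumr exprMn; congr (_ + _).
apply: eq_big_nat => i hi; rewrite exprMn.
have -> : a0 ^+ (q * n) = a0 ^+ (q * i) * a0 ^+ (q * (n - i)).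
  by rewrite -exprD -mulnDr subnKC //; move: hi; lia.
ring.
Qed.
End Transfer.

(** * Powers of ideals up to nilpotents *)

Section NilpotentThickening.
Variables (R E L : comNzRingType) (lam : {rmorphism R -> L}) (sE : {rmorphism E -> L}).
Variables (V mx : set L) (I : set R) (q : nat).
Hypotheses (VM : forall x y, V x -> V y -> V (x * y)).

(* Elements of (I^q + mx)^K whose mx-part lies in the subring V. *)
Inductive thick K : L -> Prop :=
| thick0 : thick K 0
| thickA j a v y : (j <= K)%N -> ideal_pow I (q * (K - j)) a -> V v -> ideal_pow mx j v -> thick K y ->
    thick K (lam a * v + y).

Lemma thickD K x y : thick K x -> thick K y -> thick K (x + y).
Proof.
elim=> [|j a v z jK Ia Vv mv _ IH] hy; first by rewrite add0r.
by rewrite -addrA; apply: (thickA jK) => //; exact: IH.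
Qed.

Lemma thickM K w x : V w -> thick K x -> thick K (w * x).
Proof.
move=> Vw; elim=> [|j a v z jK Ia Vv mv _ IH]; first by rewrite mulr0; exact: thick0.
rewrite mulrDr mulrCA; apply: (thickA jK) => //; first exact: VM.
by apply: idealM => //; exact: pow_ideal.
Qed.

Lemma thickS K r nu x : I r -> V nu -> mx nu -> thick K x -> thick K.+1 ((lam r ^+ q + nu) * x).
Proof.
move=> Ir Vn mn; elim=> [|j a v z jK Ia Vv mv _ IH]; first by rewrite mulr0; exact: thick0.
have -> : (lam r ^+ q + nu) * (lam a * v + z) = lam (r ^+ q * a) * v + (lam a * (nu * v) + (lam r ^+ q + nu) * z).
  by rewrite rmorphM rmorphXn; ring.
apply: (thickA (leqW jK)) => //.
  by rewrite subSn // mulnS; apply: powD => //; rewrite -[q in ideal_pow I q]mul1n; apply: powE; exact: pow1.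
apply: (thickA (j := j.+1)) => //; [exact: VM|exact: mem_mul].
Qed.

(** Terms with j at least N vanish, so at most N of the K factors are lost to the nilpotent part; t
    clears the denominators of the others. *)
Lemma thick_den K N (t : R) y : (forall z, ideal_pow mx N z -> z = 0) ->
  (forall v, V v -> exists r, lam t * v = lam r) -> thick K y ->
  exists2 b, ideal_pow I (q * (K - N)) b & lam t * y = lam b.
Proof.
move=> nil ht; elim=> [|j a v z jK Ia Vv mv _ [b Ib e]].
  by exists 0; [exact: pow0r|rewrite mulr0 rmorph0].
have [Nj|jN] := leqP N j.
  by exists b => //; rewrite (nil v) ?mulr0 ?add0r //; apply: pow_le mv.
have [r er] := ht v Vv; exists (r * a + b); last by rewrite rmorphD rmorphM -er -e; ring.
apply: powDr => //; apply: idealM; first exact: pow_ideal.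
by apply: pow_le Ia; rewrite leq_mul2l leq_sub2l ?orbT // ltnW.
Qed.

Lemma thick_pow (Z : set E) K z : (forall e, V (sE e)) -> V 1 -> (0 < q)%N ->
  (forall e, Z e -> exists r nu, [/\ I r, V nu, mx nu & sE e = lam r ^+ q + nu]) ->
  ideal_pow (gen_ideal Z) K z -> thick K (sE z).
Proof.
move=> VE V1 q0 hZ; move: z; apply: pow_gen_ind => [|x y hx hy|a s ss hs].
- by rewrite rmorph0; exact: thick0.
- by rewrite rmorphD; exact: thickD.
rewrite rmorphM; apply: thickM => //; have {ss} <- := ss.
elim: s hs => [|e s IH] hs.
  rewrite big_nil rmorph1 -[1]addr0 -[1]mulr1 -[X in X * _](rmorph1 lam).
  by apply: (thickA (j := 0)) => //; [rewrite muln0|exact: thick0].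
have [|r [nu [Ir Vn mn eE]]] := hZ e; first by apply: hs; exact: mem_head.
rewrite big_cons rmorphM eE; apply: thickS => //.
by apply: IH => e' es; apply: hs; rewrite inE es orbT.
Qed.
End NilpotentThickening.

(** The coordinates are taken on the E-module V, which is a ring containing the image of R. The
    factor [p e] anticipates that operators with values in the reduction of R determine [mu] only up
    to this factor. *)
Lemma local_operators (k : fieldType) (R D : comNzRingType) (alg : {rmorphism k -> R}) (P : set R)
    (p : {rmorphism R -> D}) n (th : {rmorphism {mpoly k[n]} -> R}) :
  noetherian R -> is_prime_ideal P -> (forall z, P z -> exists n t, ~ P t /\ t * z ^+ n = 0) ->
  (forall y, exists r, p r = y) -> (forall r, p r = 0 <-> P r) ->
  (forall c, th c%:MP = alg c) -> (forall y, exists s t u, u * th t = 1 /\ th t * y = th s) ->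
  exists l (mu : 'I_l -> R -> D) c0,
  [/\ forall j, exists N, dord p N (mu j), forall j x y, mu j (x + y) = mu j x + mu j y,
      forall j c x, mu j (alg c * x) = p (alg c) * mu j x
    & forall e, ~ P e -> exists2 B, ~ P B & forall J, is_ideal J -> forall m f,
      (forall j, integral_closure (ideal_pow (p @` J) (m + c0)) (p e * mu j f)) ->
      ideal_pow J m (B * f)].
Proof.
move=> nR pP lnil sp kp thC frac; have dD : domain_like D := quot_domain pP sp kp.
have [P1 WM] := compl_mul pP.
have W0 : ~ [set w | ~ P w] 0 by move=> /=; apply; exact: ideal0 (let: And3 h _ _ := pP in h).
have [L [lam hlam]] := loc_ex (compl_mul pP) W0; have [fu fd fk] := hlam.
have hm := maxid_ideal pP hlam; have [N nilm] := maxid_nilp nR pP lnil hlam.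
set mx := maxid P lam in hm nilm.
have [q [E [hE [sE [DE [a0 [c1 [[pq bs hDE ha0 ka0] [hx hun [Sl [t Pt ht]] hC]]]]]]]]] :=
  local_cover nR pP lnil sp kp hlam thC frac.
have q0 : (0 < q)%N := pexp_gt0 pq.
have nilX y : mx y -> y ^+ N = 0.
  by move=> my; apply: nilm; elim: (N) => // i IH; rewrite exprS; exact: mem_mul.
have notm e : hE e <> 0 -> ~ mx (sE e).
  move=> e0 me; have [r hr] := sp (hE e); apply: e0; rewrite -hr; apply/kp/(maxid_lam pP hlam).
  by rewrite -[lam r](subKr (sE e)); apply: (idealB hm) => //; apply: Sl.
have Slq r w : hE w = p r ^+ q -> mx (sE w - lam r ^+ q).
  by move=> e; rewrite -rmorphXn; apply: Sl; rewrite e rmorphXn.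
have h0 e : hE e = 0 -> sE e = 0.
  move=> /ka0 /(congr1 sE); rewrite rmorphM rmorph0 => e0.
  by have [u hu] := maxid_unit hlam (notm _ ha0); rewrite -[LHS]mul1r -hu -mulrA e0 mulr0.
have [l0 [[l1 lM lE] lX]] : exists l, fg_subring sE l /\
    forall z, z \in [seq lam (th 'X_i) | i : 'I_n] -> mspan sE l z.
  apply: fg_subringE => _ /mapP[i _ ->]; have [w hw] := hx (p (th 'X_i)).
  exists (('X^q - w%:P) ^+ N); first by apply: monic_exp; apply: monicXnsubC.
  rewrite /root rmorphXn rmorphB /= map_polyXn map_polyC horner_exp !hornerE -opprB exprNn (nilX (sE w - _)) ?mulr0 //.
  exact: Slq.
set V := mspan sE l0 in l1 lM lE lX.
have VN x : V x -> V (- x) by exact: mspanN.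
have VX x i : V x -> V (x ^+ i) by move=> Vx; elim: i => // i IH; rewrite exprS; apply: (lM).
have Vth g : V (lam (th g)).
  apply: (mpoly_subalg (S := [set g | V (lam (th g))])) => [|i /=].
    split=> [c|x y|x y] /=; first by rewrite thC; have [e [_ <-]] := hC c.
      by rewrite !rmorphD; apply: mspanD.
    by rewrite !rmorphM; apply: (lM).
  by apply: lX; apply: map_f; rewrite mem_enum.
have Vlam r : V (lam r).
  have [s [t' [u [ut e]]]] := frac r.
  have -> : lam r = lam u * lam (th s) by rewrite -e !rmorphM mulrA -rmorphM ut rmorph1 mul1r.
  apply: (lM) => //; have [w hw] := hx (p (th t')).
  have [|v hv] := hun w (p u ^+ q); first by rewrite hw -exprMn -rmorphM ut rmorph1 expr1n.
  (* The image of t'^q is congruent to a unit from E modulo nilpotents, so the inverse of t' is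
     given by a geometric series inside V. *)
  pose nu := 1 - sE v * lam (th t') ^+ q.
  have nuE : nu = sE v * (sE w - lam (th t') ^+ q) by rewrite mulrBr -rmorphM hv rmorph1.
  have nu0 : nu ^+ N = 0 by apply: nilX; rewrite nuE; apply: (idealM _ hm); exact: Slq.
  have Vnu : V nu by apply: mspanD => //; apply: VN; apply: (lM) => //; apply: VX.
  have -> : lam u = sE v * lam (th t') ^+ q.-1 * \sum_(j < N) nu ^+ j.
    have := subrX1 nu N; rewrite nu0 sub0r => /(congr1 -%R); rewrite opprK -mulNr opprB subKr => e1.
    rewrite -[LHS]mulr1 e1 -{1}(prednK q0) exprS.
    transitivity (lam (u * th t') * (sE v * lam (th t') ^+ q.-1 * \sum_(j < N) nu ^+ j)).
      by rewrite rmorphM; ring.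
    by rewrite ut rmorph1 mul1r.
  apply: (lM); first by apply: (lM) => //; apply: VX.
  by apply: mspan_sum => j _; apply: VX.
have [l [co [d [hd lV coE coD coZ]]]] := torsion_free_coord dD h0 l0.
rewrite -/V in lV coE coD coZ.
have co0 j : (j < size l)%N -> co j 0 = 0.
  by move=> hj; have := coZ j 0 0 hj (mspan0 _ _); rewrite !rmorph0 !mul0r.
have co_sum j (M : nat) (F : nat -> L) : (j < size l)%N -> (forall i, V (F i)) ->
    co j (\sum_(i < M) F i) = \sum_(i < M) co j (F i).
  move=> hj hF; elim: M => [|M IH]; first by rewrite !big_ord0; exact: co0.
  by rewrite !big_ord_recr /= coD ?IH //; apply: mspan_sum => i _; exact: hF.
pose mu (j : 'I_(size l)) r := co j (lam r).
(* With m3 = m / q + 1 + N, rounded down, this gives q (m3 + c1) at most m + c0: the 1 repairs the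
   rounding, N covers the factors lost to nilpotents, and c1 is the Briancon-Skoda loss. *)
pose c0 := (q * (1 + N + c1))%N.
exists (size l), mu, c0; split.
- move=> j; exists (\sum_(i < n) (q * N)).+1%N; apply: (dord_gens thC frac).
  + by move=> x y; rewrite /mu rmorphD coD.
  + by move=> c x; rewrite /mu rmorphM; have [e [<- <-]] := hC c; rewrite coZ.
  move=> i; apply/funext => g; rewrite ad_iter; set x := th 'X_i.
  have [w hw] := hx (p x).
  (* (X - p x)^(q N) is the image of (X^q - w)^N, and this polynomial vanishes at lam x because lam
     x^q - sE w is in the nilpotent maximal ideal. *)
  pose G : {poly E} := ('X^q - w%:P) ^+ N.
  have GE : ('X - (p x)%:P) ^+ (q * N) = map_poly hE G.
    have [phi hphi] := pexp_hom (@polyC D \o (p \o alg)) pq.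
    rewrite exprM -[_ ^+ q]hphi rmorphB !hphi /G [RHS]rmorphXn; congr (_ ^+ _).
    by rewrite rmorphB /= map_polyXn map_polyC /= hw polyC_exp.
  rewrite GE.
  transitivity (co j (\sum_(i < (q * N).+1) sE G`_i * (lam (x ^+ i * g)))).
    rewrite (co_sum _ _ (fun i => sE G`_i * (lam (x ^+ i * g)))) //; last by move=> i'; apply: mspanZ; exact: Vlam.
    by apply: eq_bigr => i' _; rewrite coef_map coZ.
  have -> : \sum_(i < (q * N).+1) sE G`_i * (lam (x ^+ i * g)) = (map_poly sE G).[lam x] * lam g.
    rewrite (@horner_coef_wide _ (q * N).+1); last first.
      apply: leq_trans (size_poly _ _) _; apply: leq_trans (size_poly_exp_leq _ _) _.
      by rewrite size_XnsubC.
    by rewrite mulr_suml; apply: eq_bigr => i' _; rewrite coef_map rmorphM rmorphXn mulrA.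
  rewrite rmorphXn rmorphB /= map_polyXn map_polyC horner_exp !hornerE -opprB exprNn (nilX (sE w - _)) ?mulr0 ?mul0r ?co0 //.
  exact: Slq.
- by move=> j x y; rewrite /mu rmorphD coD.
- by move=> j c x; rewrite /mu rmorphM; have [e [<- <-]] := hC c; rewrite coZ.
move=> e Pe; have [ep hep] := hx (p e).
have pe0 : p e <> 0 by move/kp.
have dX x i : x <> 0 -> x ^+ i <> 0 :> D.
  move=> x0; elim: i => [/eqP|i IH]; first by rewrite oner_eq0.
  by rewrite exprS => /dD[].
(* The accumulated multipliers: [d] for the coordinates, [ep] for the q-th power of p e, [a0] for
   the kernel of hE, [DE] for Briancon-Skoda. *)
pose g := DE * a0 * ep * d.
have hg : hE g <> 0.
  by rewrite !rmorphM hep => /dD[/dD[/dD[]|/dX]|].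
have [t2 Pt2 ht2] := local_common_den pP hlam l0.
have tV v : V v -> exists r, lam (t * t2) * v = lam r.
  move=> [c ->]; have /choice[r1 hr1] := ht.
  have /choice[r2 hr2] : forall i : 'I_(size l0), exists r, lam t2 * l0`_i = lam r.
    by move=> i; apply: ht2; apply: mem_nth.
  exists (\sum_(i < size l0) r1 (c i) * r2 i); rewrite rmorph_sum mulr_sumr; apply: eq_bigr => i _.
  by rewrite !rmorphM -hr1 -hr2; ring.
have [r0 hr0] := tV _ (lE g).
have Ptt : ~ P (t * t2) := WM _ _ Pt Pt2.
have Pr0 : ~ P r0.
  move=> /(maxid_lam pP hlam); rewrite -hr0 => mr0; apply: Ptt; apply/(maxid_lam pP hlam).
  have [u hu] := maxid_unit hlam (notm _ hg).
  by rewrite -[lam _]mulr1 -hu mulrCA; apply: (idealM _ hm).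
(* [t1] kills the kernel of R -> L, so an equality in L becomes one in R after multiplication by
   it. *)
have [t1 Pt1 ht1] := torsion_killer nR (compl_mul pP).
exists (t1 * r0); first exact: WM.
move=> J hJ m f hcl; pose m3 := ((m %/ q).+1 + N)%N.
have [c [cE cco]] := coE _ (Vlam f).
have [phi hphi] := pexp_hom (p \o alg) pq.
have thk (i : 'I_(size l)) : thick lam V mx J q m3 (sE (DE * (a0 * (ep * c i)))).
  (* ep c_i maps to p(e)^q times the i-th coordinate of f, which is p(e)^(q-1) times the element
     assumed to be in the integral closure. *)
  have hz := bs_transfer q0 hphi hx bs ka0 (J := p @` J) (M := m + c0) (m := m3) (y := p e * mu i f)
    (s := p e ^+ q.-1) (e1 := ep * c i).
  apply: (thick_pow lM lE l1 q0 _ (hz _ _ (hcl i))) => [z [_ [r Jr <-] zE]||].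
  - exists r, (sE z - lam r ^+ q); split; rewrite ?subrKC //; last exact: Slq.
    by apply: mspanD; [exact: lE|apply: VN; apply: VX].
  - rewrite /m3 /c0; have := leq_trunc_div m q; nia.
  - by rewrite rmorphM hep /mu -cco // mulrA -exprSr prednK.
have gf : thick lam V mx J q m3 (sE g * lam f).
  have -> : sE g * lam f = \sum_(i < size l) l`_i * sE (DE * (a0 * (ep * c i))).
    rewrite rmorphM -mulrA cE mulr_sumr; apply: eq_bigr => i _.
    by rewrite !rmorphM; ring.
  apply: (big_ind (thick lam V mx J q m3)) => [|x y|i _]; [exact: thick0|exact: thickD|].
  by apply: thickM => //; apply: lV; apply: mem_nth.
have [b Jb bE] := thick_den nilm tV gf.
have /fk[w [Ww we]] : lam (r0 * f - b) = 0 by rewrite rmorphB rmorphM -hr0 -bE; ring.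
have := ht1 (r0 * f - b) (ex_intro2 _ _ w Ww we).
rewrite mulrBr => /eqP; rewrite subr_eq0 mulrA => /eqP ->; apply: idealM; first exact: pow_ideal.
by apply: pow_le Jb; rewrite /m3 addnK mulnC; apply: ltnW; apply: ltn_ceil.
Qed.

(** * Noetherian operators *)

Lemma ess_finite_frac (k : fieldType) (R : comNzRingType) (alg : {rmorphism k -> R}) : ess_finite_type alg ->
  exists n (th : {rmorphism {mpoly k[n]} -> R}), (forall c, th c%:MP = alg c) /\
    (forall y, exists s t u, u * th t = 1 /\ th t * y = th s).
Proof.
move=> [A [algA [f [W [[gens hg] fC hW [fu fd _]]]]]].
pose th : {rmorphism {mpoly k[size gens]} -> R} := mmap alg (fun i => f gens`_i).
have thC c : th c%:MP = alg c by rewrite /= mmapC.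
have im x : exists P, th P = f x.
  pose S := [set x | exists P, th P = f x]; suff : S = setT by move=> e; have : S x by rewrite e.
  apply: hg => [|z zg]; last first.
    have hi : (index z gens < size gens)%N by rewrite index_mem.
    by exists 'X_(Ordinal hi); rewrite /= mmapX mmap1U nth_index.
  split=> [c|a b [P hP] [Q hQ]|a b [P hP] [Q hQ]].
  - by exists c%:MP; rewrite thC fC.
  - by exists (P + Q); rewrite !rmorphD hP hQ.
  - by exists (P * Q); rewrite !rmorphM hP hQ.
exists (size gens), th; split=> // y; have [a [w [Ww e]]] := fd y; have [u hu] := fu w Ww.
have [s hs] := im a; have [t ht] := im w; exists s, t, u; rewrite ht hs; split=> //.
by rewrite -e mulrC.
Qed.

Lemma closure_morph (A B : comPzRingType) (f : {rmorphism A -> B}) (I : set A) (J : set B) m n x :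
  (forall y, I y -> J (f y)) -> (n <= m)%N ->
  integral_closure (ideal_pow I m) x -> integral_closure (ideal_pow J n) (f x).
Proof.
move=> IJ nm [d [a [d0 ha e]]]; exists d, (fun i => f (a i)); split=> // [i hi|].
  apply: (morph_pow (f := f) _ (ha i hi)) => y hy.
  by apply: (pow_le nm); apply: morph_pow hy.
rewrite -[RHS](rmorph0 f) -[in RHS]e rmorphD rmorphXn rmorph_sum; congr (_ + _).
by apply: eq_bigr => i _; rewrite rmorphM rmorphXn.
Qed.

Lemma dord_Diff (k : fieldType) (R D : comNzRingType) (alg : {rmorphism k -> R}) (p : {rmorphism R -> D})
    (emb : D -> Rred R) n (mu : R -> D) :
  (forall x y, emb (x + y) = emb x + emb y) -> (forall r x, emb (p r * x) = red r * emb x) ->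
  (forall x y, mu (x + y) = mu x + mu y) -> (forall c x, mu (alg c * x) = p (alg c) * mu x) ->
  dord p n mu -> Diff_order alg n (emb \o mu : R^o -> Rred R).
Proof.
move=> eD eZ; have e0 : emb 0 = 0 by have := eZ 0 0; rewrite !rmorph0 !mul0r.
have eB x y : emb (x - y) = emb x - emb y.
  by apply/eqP; rewrite eq_sym subr_eq -eD subrK.
elim: n mu => [|n IH] mu muD muC /= hmu.
  by move=> a u v; rewrite /= !hmu e0 scaler0 addr0.
split=> [c x y|f].
  rewrite /= muD eD; congr (_ + _).
  exact: (etrans (congr1 emb (muC c x)) (eZ (alg c) (mu x))).
have -> : commutator (emb \o mu : R^o -> Rred R) f = (emb \o ad p f mu : R^o -> Rred R).
  by apply/funext => g; rewrite /commutator /ad /= eB eZ.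
apply: IH => // [x y|c x]; first by rewrite /ad mulrDr !muD; ring.
by rewrite /ad mulrCA !muC; ring.
Qed.

(* As e lies in all the other associated primes, multiplication by e embeds R/P into R_red;
   this turns operators into R/P into operators into R_red. *)
Lemma prime_operators (k : fieldType) (R : comNzRingType) (alg : {rmorphism k -> R}) n
    (th : {rmorphism {mpoly k[n]} -> R}) (P : set R) (e : R) :
  (forall c, th c%:MP = alg c) -> (forall y, exists s t u, u * th t = 1 /\ th t * y = th s) ->
  no_embedded_primes R -> associated_prime P -> ~ P e ->
  (forall Q : set R, associated_prime Q -> Q <> P -> Q e) ->
  exists l (d : 'I_l -> R^o -> Rred R) c0, [/\ forall j, Diff alg (d j), forall j, d j 0 = 0 &
    exists2 B, ~ P B & forall J, is_ideal J -> forall m f,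
      (forall j, integral_closure (ideal_pow (@red R @` J) (m + c0)) (d j f)) -> ideal_pow J m (B * f)].
Proof.
move=> thC frac noe aP Pe Qe; have nR := noeth_frac frac; have [pP _] := aP.
have [iP P1 _] := pP; have [D [p [sp kp]]] := quot_ex iP P1.
have dD := quot_domain pP sp kp.
have lnil z : P z -> exists n t, ~ P t /\ t * z ^+ n = 0 by exact: assoc_local_nilp.
have [l [mu [c0 [muN muD muC muB]]]] := local_operators nR pP lnil sp kp thC frac.
have /choice[s hs] := sp; pose emb y := red (e * s y).
(* Two representatives differ by an element of P; times e it lies in every associated prime and is
   therefore nilpotent. *)
have embp r : emb (p r) = red (e * r).
  apply/redP/nilradicalP; rewrite -mulrBr; apply: (assoc_nilp nR) => Q aQ; have [[iQ _ _] _] := aQ.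
  have [->|QP] := pselect (Q = P); last by apply: idealMl => //; exact: Qe.
  by apply: idealM => //; apply/kp; rewrite rmorphB hs subrr.
have embD x y : emb (x + y) = emb x + emb y.
  transitivity (emb (p (s x + s y))); first by rewrite rmorphD !hs.
  by rewrite embp mulrDr; exact: raddfD.
have embZ r x : emb (p r * x) = red r * emb x.
  by rewrite -[x]hs -rmorphM !embp -rmorphM mulrCA.
(* Composed with R_red -> R/P, the embedding becomes multiplication by p e; this returns integral
   closure conditions from R_red to R/P. *)
have [pb hpb] : exists pb : {rmorphism Rred R -> D}, forall r, pb (red r) = p r.
  apply: factor_surj => [u|r]; first exact: red_surj.
  rewrite -(rmorph0 (@red R)) => /redP/nilradicalP[m]; rewrite subr0 => rm.
  have : p r ^+ m = 0 by rewrite -rmorphXn rm rmorph0.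
  elim: m {rm} => [/eqP|m IH]; first by rewrite expr0 oner_eq0.
  by rewrite exprS => /dD[].
have pbe y : pb (emb y) = p e * y by rewrite hpb rmorphM hs.
exists l, (fun j => emb \o mu j), c0; split=> [j|j|].
- by have [N hN] := muN j; exists N; apply: dord_Diff hN.
- have mu0 : mu j 0 = 0 by have := muC j 0 0; rewrite !rmorph0 !mul0r.
  change (emb (mu j 0) = 0); rewrite mu0.
  by have := embZ 0 0; rewrite !rmorph0 !mul0r.
have [B PB hB] := muB e Pe; exists B => // J hJ m f hf; apply: hB => // j; rewrite -pbe.
by apply: closure_morph (hf j) => // _ [r Jr <-]; exists r.
Qed.

Lemma corollary2_nontrivial (k : fieldType) (R : comNzRingType) (alg : {rmorphism k -> R}) :
  ess_finite_type alg -> no_embedded_primes R ->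
  exists (m : nat) (d : 'I_m -> R^o -> Rred R),
    noetherian_operators alg d /\
    exists c : nat, forall J : set R, is_ideal J -> forall n : nat,
      colon_ops (integral_closure (ideal_pow (@red R @` J) (n + c))) d `<=` ideal_pow J n.
Proof.
move=> /ess_finite_frac[n [th [thC frac]]] noe; have nR := noeth_frac frac.
have [r [P [e [aP PE Pe eP]]]] := assoc_list nR noe.
have /choice[x hx] : forall i, exists x : {l & 'I_l -> R^o -> Rred R} * (nat * R),
    [/\ forall j, Diff alg (projT2 x.1 j), forall j, projT2 x.1 j 0 = 0, ~ P i x.2.2 &
      forall J, is_ideal J -> forall m f,
      (forall j, integral_closure (ideal_pow (@red R @` J) (m + x.2.1)) (projT2 x.1 j f)) ->
      ideal_pow J m (x.2.2 * f)].
  move=> i; have [|l [d [c0 [hd d0 [B PB hB]]]]] := prime_operators thC frac noe (aP i) (Pe i).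
    move=> Q /PE[j ->] ji; apply: eP; apply/eqP => ij; by rewrite ij in ji.
  by exists (existT _ l d, (c0, B)).
pose l i := projT1 (x i).1; pose B i := (x i).2.2.
pose T := {i : 'I_r & 'I_(l i)}.
pose d (q : 'I_#|{: T}|) : R^o -> Rred R := projT2 (x (tag (enum_val q))).1 (tagged (enum_val q)).
have dE i (j : 'I_(l i)) : exists q, d q = projT2 (x i).1 j.
  by exists (enum_rank (Tagged (fun i => 'I_(l i)) j)); rewrite /d enum_rankK.
pose cm := (\max_i (x i).2.1)%N.
(* Modulo the j-th prime only e_j B_j survives, and it is nonzero there; so [a] avoids all
   associated primes and is a nonzerodivisor. *)
pose a := \sum_i e i * B i.
have [cu hcu] : exists c, forall J, is_ideal J -> forall m y, ideal_pow J (m + c) (a * y) -> ideal_pow J m y.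
  apply: (uniform_colon frac); apply: (assoc_nzd nR) => Q aQ; have [j Qj] := PE _ aQ; rewrite Qj.
  have [[iP _ hP] _] := aP j; rewrite /a (bigD1 j) //= => h.
  have /hP[] : P j (e j * B j); [|exact: Pe|by case: (hx j)].
  rewrite -[_ * _](addrK (\sum_(i | i != j) e i * B i)); apply: idealB => //.
  by apply: ideal_sum => // i ij; apply: idealMl => //; exact: eP.
have main J : is_ideal J -> forall m,
    colon_ops (integral_closure (ideal_pow (@red R @` J) (m + (cu + cm)))) d `<=` ideal_pow J m.
  move=> hJ m f hf; apply: hcu => //; rewrite mulr_suml; apply: ideal_sum => [|i _]; first exact: pow_ideal.
  rewrite -mulrA; apply: idealM; first exact: pow_ideal.
  have [_ _ _] := hx i; apply=> // j; have [q <-] := dE i j.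
  apply: (closure_morph (f := idfun)) (hf q) => //.
  by rewrite addnA leq_add2l; apply: leq_bigmax.
exists #|{: T}|, d; split; last by exists (cu + cm)%N.
split=> [q|]; first by have [h _ _ _] := hx (tag (enum_val q)); apply: h.
apply/seteqP; split=> [f hf|_ -> q /=]; last by have [_ h _ _] := hx (tag (enum_val q)); apply: h.
(* The defining property of Noetherian operators is the containment for J = 0 and n = 1. *)
apply: (pow1E (@ideal_set0 R)); apply: main => [|q]; first exact: ideal_set0.
rewrite hf; exists 1%N, (fun=> 0); split=> // [i _|]; first exact: pow0r.
by rewrite big_nat1 mul0r expr1 addr0.
Qed.

(** The argument above is carried out in nontrivial rings; an equality of structures lets its
    conclusion be transported by rewriting. *)
Lemma nonzero_nzring (R : comPzRingType) : (1 : R) != 0 -> exists R' : comNzRingType, R' = R :> comPzRingType.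
Proof.
case: R => T c R1; pose R0 := GRing.ComPzRing.Pack c.
pose R' : comNzRingType := HB.pack R0 (GRing.PzSemiRing_isNonZero.Build R0 R1).
by exists R'.
Qed.

Theorem corollary2 (k : fieldType) (R : comPzRingType)
    (alg : {rmorphism k -> R}) :
  ess_finite_type alg ->
  no_embedded_primes R ->
  exists (m : nat) (d : 'I_m -> R^o -> Rred R),
    noetherian_operators alg d /\
    exists c : nat, forall J : set R, is_ideal J -> forall n : nat,
      colon_ops (integral_closure (ideal_pow (@red R @` J) (n + c))) d
        `<=` ideal_pow J n.
Proof.
have [R0|R1] := eqVneq (1 : R) 0.
  have f0 (f : R) : f = 0 by rewrite -[f]mulr1 R0 mulr0.
  move=> _ _; exists 0%N, (fun _ _ => 0); split; last first.
    by exists 0%N => J _ n f _; rewrite (f0 f); exact: pow0r.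
  by split=> [[]//|]; apply/seteqP; split=> [f _|f _ []//]; exact: f0.
by have [R' e] := nonzero_nzring R1; move: alg; rewrite -e; exact: corollary2_nontrivial.
Qed.
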